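(* Consider the smooth family $\dot x=f(x,\lambda)$, $x\in\mathbb{R}^3$, $\lambda=(\lambda_1,\lambda_2)\in Q=J_1\times J_2$, and use the notation of the context. Assume the following. (1) $f(0,\lambda)\equiv 0$; the equilibrium $E=\{x=0\}$ is hyperbolic with $\dim W^u(E,\lambda)=1$, $\dim W^s(E,\lambda)=2$. For all $\lambda\in Q$ there is a hyperbolic periodic orbit $P$ with $\dim W^u(P,\lambda)=2$, $\dim W^s(P,\lambda)=2$ and minimal period $2\pi$. There is a maximal interval $I_2=[\underline{\lambda}_2,\overline{\lambda}_2]\subsetneq J_2$, $\underline{\lambda}_2<\overline{\lambda}_2$, such that for $\lambda\in\{0\}\times I_2$ there is a heteroclinic cycle connecting $E$ and $P$ (maximal: for $\lambda_1=0$ and $\lambda_2\in J_2\setminus I_2$ there is no such cycle). (2) The nontrivial Floquet multipliers of $P$ are negative. (3) There are an open neighbourhood $U_\Gamma$ of $\Gamma$ in $\mathbb{S}^1\times Q$, a smooth function $g:U_\Gamma\to I$ and an $\epsilon>0$ such that $$\{(\varphi,v^s,\delta)\in W^s(E,\lambda)\cap\Sigma^{out}_+: |v^s|<\epsilon,\ (\varphi,\lambda)\in U_\Gamma\}=\{(\varphi,g(\varphi,\lambda),\delta):(\varphi,\lambda)\in U_\Gamma\}$$ (read for each $\lambda$). (4) There is a constant $b>0$ such that $|g_{\lambda_2}(\varphi,\lambda)|\ge b$ for all $(\varphi,\lambda)\in U_\Gamma$, and there is a smooth function $z:\mathbb{S}^1\times J_1\to J_2$ such that $\Gamma=\mathrm{graph}\,z$,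 i.e. $\Gamma=\{(\varphi,\lambda_1,z(\varphi,\lambda_1)):(\varphi,\lambda_1)\in \mathbb{S}^1\times J_1\}$. (5) If $z_\varphi(\varphi,0)=0$, then $z_{\varphi\varphi}(\varphi,0)\neq 0$. (6) There are smooth functions $h^u:Q\to I$ and $h^c:Q\to \mathbb{S}^1$ such that $$\{(v^c,\delta,v^u)\in W^u(E,\lambda)\cap\Sigma^{in}_+,\ \lambda\in Q\}=\{(h^c(\lambda),\delta,h^u(\lambda)),\ \lambda\in Q\}$$ (read for each $\lambda$). Moreover: (i) $h^u(0,\lambda_2)\equiv 0$ and $h^u_{\lambda_1}(0,\lambda_2)>0$ for all $\lambda_2\in J_2$; (ii) there is $q<1$ such that $\left|\frac{d}{d\varphi}h^c(0,z(\varphi,0))\right|\le q$ for all $\varphi\in \mathbb{S}^1$. Then there are a constant $L_0>0$ and functions $\lambda_i^+,\lambda_i^-:(L_0,\infty)\to\mathbb{R}$, $i=1,2$, such that for each $L>L_0$ there is a one-homoclinic orbit to $E$ for $\lambda\in Q$ that spends time $2L$ between $\Sigma^{in}$ and $\Sigma^{out}$ if and only if $\lambda=(\lambda_1^+(L),\lambda_2^+(L))$ or $\lambda=(\lambda_1^-(L),\lambda_2^-(L))$. Moreover, there are an $\eta>0$, two $4\pi$-periodic functions $\varphi_0^+(\cdot),\varphi_0^-(\cdot)$ and positive bounded functions $\hat a_u^+,\hat a_u^-$ such that $$\lambda_1^\pm(L)=\frac{\pm\hat a_u^\pm(L)}{h^u_{\lambda_1}(0,z(\varphi_0^\pm(L)+2L,0))}\,e^{-2\alpha^u(0,z(\varphi_0^\pm(L)+2L,0))L}\,(1+O(e^{-\eta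 L})),$$ $$\lambda_2^\pm(L)=z(\varphi_0^\pm(L)+2L,0)+O(e^{-\eta L}).$$
   Context: $Q=J_1\times J_2\subset\mathbb{R}^2$ is a closed rectangle with $0\in\mathrm{int}\,Q$, $J_1,J_2$ closed intervals. $W^{s}(\cdot,\lambda),W^u(\cdot,\lambda)$ are stable and unstable manifolds. Subscripts on functions denote partial derivatives. $\mathbb{S}^1=\mathbb{R}/4\pi\mathbb{Z}$. Heteroclinic (EtoP) cycle: $E$, $P$, an orbit from $E$ (as $t\to-\infty$) to $P$ (as $t\to+\infty$), and an orbit from $P$ to $E$. Coordinates near $P$: $\delta>0$ is a sufficiently small constant and $I=[-\delta,\delta]$. When the nontrivial Floquet multipliers of $P$ are negative, the stable and unstable bundles of $P$ are not orientable, and one uses smooth coordinates $v=(v^c,v^s,v^u)\in\mathbb{S}^1\times I\times I$ on the double cover of a neighbourhood of $P$, in which the differential equation reads $\dot v^c=1$, $\dot v^s=\alpha^s(\lambda)v^s+\tilde F^s(v^c,v^s,v^u,\lambda)$, $\dot v^u=\alpha^u(\lambda)v^u+\tilde F^u(v^c,v^s,v^u,\lambda)$, with $\tilde F^s(v^c,0,v^u,\lambda)=\tilde F^u(v^c,v^s,0,\lambda)=0$ and $D_{v^s}\tilde F^s(v^c,0,0,\lambda)=D_{v^u}\tilde F^u(v^c,0,0,\lambda)=0$. Here $\alpha^s(\lambda)<0<\alpha^u(\lambda)$ are the (real) Floquet exponents of $P$ in this Floquet normal form, i.e. the nontrivial multipliers are $-e^{2\pi\alpha^s(\lambda)}$ and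 $-e^{2\pi\alpha^u(\lambda)}$. The points $(v^c,v^s,v^u)$ and $(v^c+2\pi,-v^s,-v^u)$ represent the same point of $\mathbb{R}^3$ and are identified. $P=\{v^s=v^u=0\}$, locally $W^s(P,\lambda)=\{v^u=0\}$, $W^u(P,\lambda)=\{v^s=0\}$; $P(\varphi,\lambda)$ is the point of $P$ with $v^c=\varphi$, and $W^{uu}(P(\varphi,\lambda),\lambda)$ is its strong unstable fibre, represented by $\{v^c=\varphi,v^s=0\}$. These coordinates are fixed. Sections: $\Sigma^{in}_+=\mathbb{S}^1\times\{v^s=\delta\}\times I$, $\Sigma^{out}_+=\mathbb{S}^1\times I\times\{v^u=\delta\}$. Under the identification they coincide with $\Sigma^{in}_-=\mathbb{S}^1\times\{v^s=-\delta\}\times I$ and $\Sigma^{out}_-=\mathbb{S}^1\times I\times\{v^u=-\delta\}$, respectively. $\Sigma^{in}$ and $\Sigma^{out}$ denote the corresponding cross-sections in phase space (represented by $\Sigma^{in}_\pm$ and $\Sigma^{out}_\pm$). $\Gamma=\{(\varphi,\lambda)\in \mathbb{S}^1\times Q: W^s(E,\lambda)\cap W^{uu}(P(\varphi,\lambda),\lambda)\cap\Sigma^{out}_+\neq\emptyset\}$. Each strong unstable fibre of $P$ meets $\Sigma^{out}$ twice; the two points are represented by $W^{uu}(P(\varphi,\lambda),\lambda)\cap\Sigma^{out}_+$ and $W^{uu}(P(\varphi+2\pi,\lambda),\lambda)\cap\Sigma^{out}_+$, where in each case the point with $v^c$-coordinate equal to the indicated argument is meant. One-homoclinic orbit to $E$: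 an orbit homoclinic to $E$ that lies in a small neighbourhood of an EtoP cycle and moves once along the cycle before returning to $E$. It consists of an orbit segment in $W^u(E,\lambda)$ from $E$ to $\Sigma^{in}$, a segment near $P$ from $\Sigma^{in}$ to $\Sigma^{out}$ (whose duration is the time spent between $\Sigma^{in}$ and $\Sigma^{out}$), and a segment in $W^s(E,\lambda)$ from $\Sigma^{out}$ to $E$. The function $z(\cdot,0)$ is regarded as a $4\pi$-periodic function on $\mathbb{R}$ when evaluated at $\varphi_0^\pm(L)+2L$. The $O$-terms are as $L\to\infty$.
   Formalization: W^s(E), W^u(E) meet the sections at their last resp. first crossing only; a one-homoclinic orbit must be near a cycle in phase and parameter space (λ near {0}×I_2); λ^±(L)∈Q is claimed only if I_2 lies in the interior of J_2. *)

(* Defs.v *)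
From HB Require Import structures.
From mathcomp Require Import all_boot all_order all_algebra.
From mathcomp Require Import all_classical all_reals all_analysis.
From mathcomp Require Import complex.

Set Implicit Arguments.
Unset Strict Implicit.
Unset Printing Implicit Defensive.

Import Order.TTheory GRing.Theory Num.Theory.
Import numFieldNormedType.Exports.

Local Open Scope classical_set_scope.
Local Open Scope ring_scope.

Section Smooth.
Context {R : realType} {V W : normedModType R}.

Fixpoint Ck (k : nat) (O : set V) (f : V -> W) : Prop :=
  match k with
  | 0 => forall x, O x -> {for x, continuous f}
  | k'.+1 => (forall x, O x -> differentiable f x) /\
             forall v : V, Ck k' O (fun x => 'D_v f x)
  end.

(* Smoothness on a set A that need not be open: the total function f is
   C^infinity on some open neighbourhood of A.  Functions given on A only are
   thus represented by a smooth extension, and their partial derivatives at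
   boundary points of A are those of the extension. *)
Definition smooth_on (A : set V) (f : V -> W) : Prop :=
  exists O : set V, [/\ open O, A `<=` O & forall k, Ck k O f].

End Smooth.

Section VectorFields.
Context {R : realType}.
Local Notation V := 'rV[R]_3.
Implicit Types (F : V -> V) (p u w x : R -> V) (S : set V).

(* For closed D the derivative at an end point is two-sided; this is no
   restriction, since a one-sided solution extends past the end point by its
   tangent line. *)
Definition solution F (D : set R) x : Prop :=
  forall t : R, D t -> is_derive t 1 x (F (x t)).

(* s lists the complex eigenvalues of A with algebraic multiplicity. *)
Definition spectrum n (A : 'M[R]_n) (s : seq R[i]) : Prop :=
  char_poly (map_mx (real_complex R) A) = \prod_(z <- s) ('X - z%:P).

Definition hyperbolic_equilibrium F (x : V) (dimWu dimWs : nat) : Prop :=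
  F x = 0 /\
  exists s : seq R[i],
    [/\ spectrum ('J F x) s,
        all (fun z => complex.Re z != 0) s,
        count (fun z => 0 < complex.Re z) s = dimWu &
        count (fun z => complex.Re z < 0) s = dimWs].

Definition periodic_orbit F p (T : R) : Prop :=
  [/\ 0 < T, solution F setT p, forall t, p (t + T) = p t &
      forall T', 0 < T' < T -> exists t, p (t + T') <> p t].

(* 'J is the Jacobian acting on row vectors from the right, so the variational
   equation along p reads Y' = Y *m 'J F (p t).  The trivial multiplier 1 of
   the monodromy matrix Y T is split off. *)
Definition nontrivial_multipliers F p (T : R) (s : seq R[i]) : Prop :=
  exists Y : R -> 'M[R]_3,
    [/\ Y 0 = 1%:M,
        forall t : R, is_derive t 1 Y (Y t *m 'J F (p t)) &
        spectrum (Y T) (1 :: s)].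

Definition hyperbolic_periodic_orbit F p (T : R) (dimWu dimWs : nat) : Prop :=
  periodic_orbit F p T /\
  exists s : seq R[i],
    [/\ nontrivial_multipliers F p T s,
        all (fun mu => `|mu| != 1) s,
        (1 + count (fun mu => (1 < `|mu|)%R) s)%N = dimWu &
        (1 + count (fun mu => (`|mu| < 1)%R) s)%N = dimWs].

(* The equilibrium E is the origin; the periodic orbit P is range p. *)
Definition EtoP_orbit F p u : Prop :=
  [/\ solution F setT u, u t @[t --> -oo] --> (0 : V) &
      forall e : R, 0 < e ->
        \forall t \near +oo, exists s, `|u t - p s| < e].

Definition PtoE_orbit F p w : Prop :=
  [/\ solution F setT w, w t @[t --> +oo] --> (0 : V) &
      forall e : R, 0 < e ->
        \forall t \near -oo, exists s, `|w t - p s| < e].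

Definition EtoP_cycle F p u w : Prop :=
  EtoP_orbit F p u /\ PtoE_orbit F p w.

Definition cycle_set p u w : set V :=
  [set 0] `|` range p `|` range u `|` range w.

(* The part of W^s(E) cut off at a section S: points of W^s(E) whose positive
   semi-orbit does not meet S again.  At parameters with a homoclinic orbit
   the whole manifold W^s(E) returns to the section; the traces of W^s(E) and
   W^u(E) in the sections are those of the last, resp. first, crossing. *)
Definition Ws_E_upto F S : set V :=
  [set x0 | exists x, [/\ solution F `[0, +oo[ x, x 0 = x0,
     x t @[t --> +oo] --> (0 : V) & forall t, 0 < t -> ~ S (x t)]].

Definition Wu_E_upto F S : set V :=
  [set x0 | exists x, [/\ solution F `]-oo, 0] x, x 0 = x0,
     x t @[t --> -oo] --> (0 : V) & forall t, t < 0 -> ~ S (x t)]].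

End VectorFields.

(* Points v = (v^c, v^s, v^u) of the double cover of a neighbourhood of P.
   The circle R/4piZ is replaced by its universal cover R: functions on it are
   4pi-periodic functions on R, subsets of it are invariant subsets of R. *)
Section Coordinates.
Context {R : realType}.
Local Notation V := 'rV[R]_3.
Local Notation coord := (R * R * R)%type.
Implicit Types (v : coord) (lam : R * R).

Definition vc v : R := v.1.1.
Definition vs v : R := v.1.2.
Definition vu v : R := v.2.

Definition box (rho : R) : set coord :=
  [set v | `|vs v| <= rho /\ `|vu v| <= rho].

(* k-fold iterate of the identification (v^c, v^s, v^u) ~ (v^c + 2pi, -v^s, -v^u) *)
Definition deck (k : int) v : coord :=
  (vc v + 2 * pi * k%:~R, (-1) ^ k * vs v, (-1) ^ k * vu v).

Definition nf_field (alps alpu : R * R -> R) (Fs Fu : coord -> R * R -> R) lam v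
    : coord :=
  (1, alps lam * vs v + Fs v lam, alpu lam * vu v + Fu v lam).

Record floquet_coordinates (Q : set (R * R)) (f : V -> R * R -> V)
    (P : R -> R * R -> V) (rho : R) (Psi : coord -> R * R -> V)
    (alps alpu : R * R -> R) (Fs Fu : coord -> R * R -> R) : Prop := {
  fc_rho : 0 < rho;
  fc_smooth_Psi : smooth_on (box rho `*` Q) (fun q => Psi q.1 q.2);
  fc_smooth_alps : smooth_on Q alps;
  fc_smooth_alpu : smooth_on Q alpu;
  fc_smooth_Fs : smooth_on (box rho `*` Q) (fun q => Fs q.1 q.2);
  fc_smooth_Fu : smooth_on (box rho `*` Q) (fun q => Fu q.1 q.2);
  fc_per_Fs : forall lam c s u, Q lam -> box rho (c, s, u) ->
    Fs (c + 4 * pi, s, u) lam = Fs (c, s, u) lam;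
  fc_per_Fu : forall lam c s u, Q lam -> box rho (c, s, u) ->
    Fu (c + 4 * pi, s, u) lam = Fu (c, s, u) lam;
  fc_fibres : forall lam v w, Q lam -> box rho v -> box rho w ->
    (Psi v lam = Psi w lam <-> exists k : int, w = deck k v);
  fc_immersion : forall lam v dv, Q lam -> box rho v -> dv != 0 ->
    'D_dv (Psi ^~ lam) v != 0;
  fc_P : forall lam c, Q lam -> Psi (c, 0, 0) lam = P c lam;
  fc_ode : forall lam v, Q lam -> box rho v ->
    'D_(nf_field alps alpu Fs Fu lam v) (Psi ^~ lam) v = f (Psi v lam) lam;
  fc_exponents : forall lam, Q lam -> alps lam < 0 < alpu lam;
  fc_multipliers : forall lam, Q lam ->
    nontrivial_multipliers (f ^~ lam) (P ^~ lam) (2 * pi)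
      [:: real_complex R (- expR (2 * pi * alps lam));
          real_complex R (- expR (2 * pi * alpu lam))];
  fc_Fs0 : forall lam c u, Q lam -> `|u| <= rho -> Fs (c, 0, u) lam = 0;
  fc_Fu0 : forall lam c s, Q lam -> `|s| <= rho -> Fu (c, s, 0) lam = 0;
  fc_DFs0 : forall lam c, Q lam -> derive1 (fun s => Fs (c, s, 0) lam) 0 = 0;
  fc_DFu0 : forall lam c, Q lam -> derive1 (fun u => Fu (c, 0, u) lam) 0 = 0
}.

Section Sections.
Variables (f : V -> R * R -> V) (Psi : coord -> R * R -> V) (delta : R).

Definition Sigma_in_plus : set coord :=
  [set v | vs v = delta /\ `|vu v| <= delta].
Definition Sigma_out_plus : set coord :=
  [set v | vu v = delta /\ `|vs v| <= delta].

(* In phase space the sections with v^s = -delta, resp. v^u = -delta, are the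
   same sets, because Psi is invariant under deck 1. *)
Definition Sigma_in lam : set V := (Psi ^~ lam) @` Sigma_in_plus.
Definition Sigma_out lam : set V := (Psi ^~ lam) @` Sigma_out_plus.

Definition WsE_out lam : set coord :=
  Sigma_out_plus `&` (Psi ^~ lam) @^-1` Ws_E_upto (f ^~ lam) (Sigma_out lam).
Definition WuE_in lam : set coord :=
  Sigma_in_plus `&` (Psi ^~ lam) @^-1` Wu_E_upto (f ^~ lam) (Sigma_in lam).

Definition strong_unstable_fibre (phi : R) : set coord :=
  [set v | vc v = phi /\ vs v = 0].

Definition Gamma (Q : set (R * R)) : set (R * (R * R)) :=
  [set q | Q q.2 /\ (WsE_out q.2 `&` strong_unstable_fibre q.1) !=set0].

(* A cycle at parameter mu whose connecting orbits cross the sections once. *)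
Definition single_cycle (P : R -> R * R -> V) mu (u w : R -> V) : Prop :=
  [/\ EtoP_cycle (f ^~ mu) (P ^~ mu) u w,
      exists! t, Sigma_in mu (u t) & exists! t, Sigma_out mu (w t)].

(* "Near a cycle" is understood in the product of phase space and parameter
   space: the orbit lies in the r-neighbourhood of a cycle which exists at a
   parameter value of {0} x I2 at distance less than r from lam.  "Once along
   the cycle" means that each section is crossed exactly once. *)
Definition one_homoclinic (P : R -> R * R -> V) (I2 : set R) (r L : R) lam
    : Prop :=
  exists x : R -> V,
    [/\ solution (f ^~ lam) setT x,
        x t @[t --> -oo] --> (0 : V) /\ x t @[t --> +oo] --> (0 : V),
        (forall t, Sigma_in lam (x t) <-> t = 0) /\
        (forall t, Sigma_out lam (x t) <-> t = 2 * L),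
        forall t, 0 <= t <= 2 * L -> ((Psi ^~ lam) @` box delta) (x t) &
        exists mu2 u w,
          [/\ I2 mu2, single_cycle P (0, mu2) u w, `|lam - (0, mu2)| < r &
              forall t, exists2 y, cycle_set (P ^~ (0, mu2)) u w y &
                                   `|x t - y| < r]].

End Sections.

Definition partial1 (h : R * R -> R) lam : R :=
  derive1 (fun t => h (t, lam.2)) lam.1.
Definition partial2 (h : R * R -> R) lam : R :=
  derive1 (fun t => h (lam.1, t)) lam.2.

Definition O_exp (eta : R) (e : R -> R) : Prop :=
  exists C : R, \forall L \near +oo, `|e L| <= C * expR (- eta * L).

(* The expansion of the branch lambda^+ (sgn = 1) or lambda^- (sgn = -1). *)
Definition branch_expansion (z : R -> R -> R) (hu alpu : R * R -> R)
    (L0 eta sgn : R) (lam : R -> R * R) : Prop :=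
  exists (phi0 a e1 e2 : R -> R),
    [/\ forall L, phi0 (L + 4 * pi) = phi0 L,
        exists M : R, forall L, L0 < L -> 0 < a L <= M,
        O_exp eta e1 /\ O_exp eta e2 &
        forall L, L0 < L ->
          let z0 := z (phi0 L + 2 * L) 0 in
          (lam L).1 = sgn * a L / partial1 hu (0, z0)
                        * expR (- 2 * alpu (0, z0) * L) * (1 + e1 L) /\
          (lam L).2 = z0 + e2 L].

End Coordinates.

(* Main.v *)
Require Import Defs.
From HB Require Import structures.
From mathcomp Require Import all_boot all_order all_algebra.
From mathcomp Require Import all_classical all_reals all_analysis.
From mathcomp Require Import complex ring lra.

Set Implicit Arguments.
Unset Strict Implicit.
Unset Printing Implicit Defensive.

Import Order.TTheory GRing.Theory Num.Theory.
Import numFieldNormedType.Exports.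

Local Open Scope classical_set_scope.
Local Open Scope ring_scope.

(** An orbit that enters a neighbourhood of P at (c, sg delta, u0) and leaves it
    at v^u = delta after time 2 L has u0 of order exp(- 2 alpu L); both u0 and
    the value of v^s at the exit depend on c and lam with an exponentially
    small Lipschitz constant ([passage_lipschitz]).  As the multipliers are
    negative, the point (hc, delta, hu) of W^u(E) in the entrance section is
    also (hc + 2 pi, - delta, - hu); the sign of hu decides which of the two
    lifts leaves at v^u = + delta.  This gives the two branches: for (sg, kap)
    equal to (1, 0) or (-1, 2 pi), the orbit of W^u(E) returns to E after the
    passage if and only if ([reach])
      sg hu(lam) = entrance value of v^u,
      g(hc(lam) + kap + 2 L, lam) = exit value of v^s.
    The right-hand sides and their Lipschitz constants are exponentially small.
    With zero right-hand sides the solution is lam0 = (0, z(phi, 0)) for the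
    phase phi = hc(lam0) + kap + 2 L, which is unique because q < 1
    ([phase_exists]).  At lam0 the derivative of the left-hand sides is
    triangular, and its diagonal is bounded away from zero along the closed
    curve of all lam0 ([newton_data_uniform]).  Newton's method therefore gives
    exactly one solution near lam0, with its expansion ([branch_point]).

    Solutions near lam0 have to be matched with homoclinic orbits near a cycle.
    Just before it leaves P, such an orbit can only follow the orbit of the
    cycle from P to E; hence the cycle exists at (0, z(phi', 0)) for some phi'
    close to the exit phase of the orbit, and lam is near lam0
    ([near_w_exit], [near_leading], [forward_uniform]).  Conversely, a solution
    gives an orbit that stays near a cycle once W^u(E) and W^s(E), between E
    and the sections, are known to stay near the connecting orbits.  For W^u(E)
    this is the persistence of the unstable branch of a saddle, obtained from
    invariant cones ([unstable_side]).  For W^s(E), points on the two sides of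
    the connecting orbit in the exit section leave the saddle in opposite
    directions, and by connectedness some point between them does not leave at
    all.  It lies on W^s(E), hence on the graph of g ([stable_side]). *)

(** * Finite-dimensional normed spaces with a supremum norm *)

(** Coordinates in which the norm is the supremum norm: scalar statements such
    as the mean value inequality extend to such spaces with their constants. *)
Class FinSup (R : realType) (V : normedModType R) := {
  fs_I : finType;
  fs_c : fs_I -> V -> R;
  fs_e : fs_I -> V;
  fs_lin : forall i a u v, fs_c i (a *: u + v) = a * fs_c i u + fs_c i v;
  fs_ce : forall i j, fs_c i (fs_e j) = (i == j)%:R;
  fs_dec : forall v, v = \sum_i fs_c i v *: fs_e i;
  fs_le : forall i v, `|fs_c i v| <= `|v|;
  fs_norm : forall v b, 0 <= b -> (forall i, `|fs_c i v| <= b) -> `|v| <= b }.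

Section FinSupTheory.
Context {R : realType} {V : normedModType R} {fV : FinSup V}.
Implicit Types (v w : V).

Lemma fs_cD i v w : fs_c i (v + w) = fs_c i v + fs_c i w.
Proof. by rewrite -[v]scale1r fs_lin mul1r scale1r. Qed.

Lemma fs_c0 i : fs_c i (0 : V) = 0.
Proof. by apply: (@addrI _ (fs_c i (0 : V))); rewrite -fs_cD !addr0. Qed.

Lemma fs_cZ i a v : fs_c i (a *: v) = a * fs_c i v.
Proof. by rewrite -[a *: v]addr0 fs_lin fs_c0 addr0. Qed.

Lemma fs_cN i v : fs_c i (- v) = - fs_c i v.
Proof. by rewrite -scaleN1r fs_cZ mulN1r. Qed.

Lemma fs_cB i v w : fs_c i (v - w) = fs_c i v - fs_c i w.
Proof. by rewrite fs_cD fs_cN. Qed.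

Lemma fs_c_sum (a : fs_I -> R) i : fs_c i (\sum_j a j *: fs_e j : V) = a i.
Proof.
have /= -> : fs_c i (\sum_j a j *: fs_e j : V) = \sum_j a j * fs_c i (fs_e j : V).
  by elim/big_rec2 : _ => [|j x v _ <-]; rewrite ?fs_c0// fs_cD fs_cZ.
rewrite (bigD1 i)//= fs_ce eqxx mulr1 big1 ?addr0// => j ji.
by rewrite fs_ce eq_sym (negbTE ji) mulr0.
Qed.

End FinSupTheory.

Local Obligation Tactic := idtac.

Section FinSupInst.
Context {R : realType}.

Lemma norm_pair {U V : normedModType R} (u : U) (v : V) :
  `|(u, v) : U * V| = Num.max `|u| `|v|.
Proof. by []. Qed.

#[global] Program Instance FinSupR : FinSup R := {|
  fs_I := unit; fs_c := fun _ x => x; fs_e := fun _ => 1 |}.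
Next Obligation. by []. Qed.
Next Obligation. by case=> -[]. Qed.
Next Obligation. by move=> v; rewrite (bigD1 tt)//= big1 ?addr0; [rewrite /GRing.scale/= mulr1|case]. Qed.
Next Obligation. by []. Qed.
Next Obligation. by move=> v b _ /(_ tt). Qed.

#[global] Program Instance FinSupProd {U V : normedModType R} {fU : FinSup U}
  {fV : FinSup V} : FinSup (U * V)%type := {|
  fs_I := (@fs_I _ _ fU + @fs_I _ _ fV)%type;
  fs_c := fun i x => match i with inl i => fs_c i x.1 | inr i => fs_c i x.2 end;
  fs_e := fun i => match i with inl i => (fs_e i, 0) | inr i => (0, fs_e i) end |}.
Next Obligation. by move=> U V fU fV [] i a [u1 u2] [v1 v2] /=; rewrite fs_lin. Qed.
Next Obligation.
by move=> U V fU fV [] i [] j /=; rewrite ?fs_ce ?fs_c0.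
Qed.
Next Obligation.
move=> U V fU fV [u v]; rewrite big_sumType/= [in LHS](fs_dec u) [in LHS](fs_dec v).
rewrite [RHS]surjective_pairing; congr pair.
- rewrite raddfD/= !raddf_sum/= [X in _ + X]big1 ?addr0//.
  by move=> i _; rewrite /= scaler0.
- rewrite raddfD/= !raddf_sum/= [X in X + _]big1 ?add0r//.
  by move=> i _; rewrite /= scaler0.
Qed.
Next Obligation.
move=> U V fU fV [] i [u v]; rewrite norm_pair le_max fs_le ?orbT//.
Qed.
Next Obligation.
move=> U V fU fV [u v] b b0 H; rewrite norm_pair ge_max; apply/andP; split.
  by apply: fs_norm => // i; exact: (H (inl i)).
by apply: fs_norm => // i; exact: (H (inr i)).
Qed.

#[global] Program Instance FinSuprV n : FinSup 'rV[R]_n := {|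
  fs_I := 'I_n; fs_c := fun i v => v 0 i; fs_e := fun i => delta_mx 0 i |}.
Next Obligation. by move=> n i a u v /=; rewrite !mxE. Qed.
Next Obligation. by move=> n i j /=; rewrite mxE eqxx. Qed.
Next Obligation. by move=> n v /=; exact: row_sum_delta. Qed.
Next Obligation.
move=> n i v; rewrite -[leRHS]/(mx_norm v) mx_normE.
exact: (@le_bigmax _ _ _ _ (fun i => `|v i.1 i.2|%:nng%R) (0, i)).
Qed.
Next Obligation.
move=> n v b b0 H; rewrite -[leLHS]/(mx_norm v) mx_normE.
have -> : b = (NngNum b0)%:num by [].
rewrite num_le; apply/bigmax_leP; split => // -[i j] _; rewrite -num_le/=.
by rewrite ord1; exact: H.
Qed.

End FinSupInst.

Lemma normD_le {R : numDomainType} {V : normedZmodType R} (x y : V) (c : R) :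
  `|x| + `|y| <= c -> `|x + y| <= c.
Proof. exact: le_trans (ler_normD x y). Qed.

Lemma normD_lt {R : numDomainType} {V : normedZmodType R} (x y : V) (c : R) :
  `|x| + `|y| < c -> `|x + y| < c.
Proof. exact: le_lt_trans (ler_normD x y). Qed.

Ltac min_le := rewrite !ge_min !lexx !orbT.

Ltac frac_lt := rewrite ltr_pdivrMr// ltr_pMr// ltr1n.

Lemma max_normBl {R : realDomainType} {V W : normedZmodType R} (x : V) (y : W) :
  Num.max `|x| `|y - y| = `|x|.
Proof. by rewrite subrr normr0 (max_idPl (normr_ge0 _)). Qed.

Lemma max_normBr {R : realDomainType} {V W : normedZmodType R} (x : V) (y : W) :
  Num.max `|x - x| `|y| = `|y|.
Proof. by rewrite subrr normr0 (max_idPr (normr_ge0 _)). Qed.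

Notation deriv_on a b y dy := (forall t, a <= t <= b -> is_derive t 1 y (dy t)).

(** * Metric formulations of continuity, differentiability and compactness *)

Section Metric.
Context {R : realType}.

Lemma ctsP {V W : normedModType R} (f : V -> W) x :
  {for x, continuous f} <->
  forall e, 0 < e -> exists2 d, 0 < d & forall y, `|y - x| < d -> `|f y - f x| < e.
Proof.
split=> [/cvgrPdist_lt H e /H|H].
  move=> /nbhs_ballP[d /= d0 B]; exists d => // y yd; rewrite distrC; apply: B.
  by rewrite -ball_normE/= distrC.
apply/cvgrPdist_lt => e /H[d d0 B]; apply/nbhs_ballP; exists d => //= y.
by rewrite -ball_normE/= distrC => /B; rewrite distrC.
Qed.

Lemma is_deriveP {W : normedModType R} (f : R -> W) (t : R) (df : W) :
  is_derive t 1 f df <->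
  forall e, 0 < e -> exists2 d, 0 < d & forall h, `|h| < d ->
    `|f (t + h) - f t - h *: df| <= e * `|h|.
Proof.
pose q h := h^-1 *: ((f \o shift t) (h *: 1) - f t).
have key h : h != 0 -> `|h| * `|df - q h| = `|f (t + h) - f t - h *: df|.
  move=> h0; rewrite -normrZ scalerBr scalerA divff// scale1r distrC /=.
  by rewrite [h *: 1]mulr1 [h + t]addrC.
have E : (forall e, 0 < e -> exists2 d, 0 < d & forall h, `|h| < d ->
    `|f (t + h) - f t - h *: df| <= e * `|h|) <-> q @ 0^' --> df.
  split=> [H|/cvgrPdist_le H e /H].
    apply/cvgrPdist_le => e /H[d d0 B]; apply/nbhs_ballP.
    exists d => //= h; rewrite -ball_normE/= sub0r normrN => hd h0.
    by rewrite -(ler_pM2l (x := `|h|)) ?normr_gt0// key// mulrC B.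
  move=> /nbhs_ballP[d /= d0 B]; exists d => // h hd.
  have [->|h0] := eqVneq h 0.
    by rewrite scale0r subr0 addr0 subrr !normr0 mulr0.
  rewrite -key// mulrC ler_pM2r ?normr_gt0//; apply: B => //.
  by rewrite -ball_normE/= sub0r normrN.
rewrite E; split=> [[der <-]//|H]; split; first by apply/cvg_ex; exists df.
by apply/cvg_lim.
Qed.

Lemma is_derive_cts {W : normedModType R} (f : R -> W) (t : R) (df : W) :
  is_derive t 1 f df -> {for t, continuous f}.
Proof.
by move=> H; apply/differentiable_continuous/derivable1_diffP; exact: ex_derive.
Qed.

Lemma chain_rule {V W : normedModType R} (f : V -> W) (y : R -> V) (t : R) (dy : V) :
  is_derive t 1 y dy -> differentiable f (y t) ->
  is_derive t 1 (f \o y) ('D_dy f (y t)).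
Proof.
move=> dyt df; have dy' : differentiable y t by apply/derivable1_diffP; exact: ex_derive.
split; first by apply/diff_derivable; exact: differentiable_comp.
have E : 'd y t 1 = dy by rewrite -deriveE//; exact: derive_val.
rewrite !deriveE//; last exact: differentiable_comp.
by rewrite diff_comp//= E.
Qed.

Lemma is_derive_shiftc {W : normedModType R} (y : R -> W) (s t : R) (dy : W) :
  is_derive (t + s) 1 y dy -> is_derive t 1 (fun t => y (t + s)) dy.
Proof.
move=> /is_deriveP H; apply/is_deriveP => e /H[d d0 B]; exists d => // h /B.
by have -> : t + s + h = t + h + s by ring.
Qed.

Lemma is_derive_rev {W : normedModType R} (y : R -> W) (t : R) (dy : W) :
  is_derive (- t) 1 y dy -> is_derive t 1 (fun t => y (- t)) (- dy).
Proof.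
move=> /is_deriveP H; apply/is_deriveP => e /H[d d0 B]; exists d => // h hd.
by have := B (- h); rewrite normrN => /(_ hd); rewrite -opprD scaleNr scalerN.
Qed.

Lemma is_derive_line {V W : normedModType R} (f : V -> W) (y w : V) (s : R) :
  differentiable f (y + s *: w) ->
  is_derive s 1 (fun s => f (y + s *: w)) ('D_w f (y + s *: w)).
Proof.
move=> df; apply: (@chain_rule _ _ f (fun s => y + s *: w) s w) => //.
apply/is_deriveP => e e0; exists 1 => // h _.
have -> : y + (s + h) *: w - (y + s *: w) - h *: w = 0.
  by rewrite scalerDl [y + (_ + _)]addrA [_ + h *: w - _]addrAC subrr add0r subrr.
by rewrite normr0 mulr_ge0// ltW.
Qed.

End Metric.

Section Compactness.
Context {R : realType}.

(** The only form in which compactness is used: a local choice of a radius can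
    be made uniformly. *)
Lemma compact_unif {V : normedModType R} (K : set V) (P : V -> R -> Prop) :
  compact K ->
  (forall x r r', P x r -> 0 < r' <= r -> P x r') ->
  (forall x, K x -> exists2 r, 0 < r & forall y, K y -> `|y - x| < r -> P y r) ->
  exists2 r, 0 < r & forall y, K y -> P y r.
Proof.
move=> cK Pmon Ploc.
have [r r0 H] : exists2 r, 0 < r & forall r', 0 < r' < r -> K `<=` P^~ r'.
  have [|d /= d0 B] :=
    (compact_near_coveringP K).1 cK R (0^'+) (fun r x => K x -> P x r) _.
    move=> x Kx; have [r r0 B] := Ploc x Kx.
    exists (ball x r, [set s | 0 < s < r]).
      split; first exact: nbhsx_ballx.
      near=> s; apply/andP; split; near: s.
        exact: nbhs_right_gt.
      exact: nbhs_right_lt.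
    move=> [y s] [/= yx /andP[s0 sr]] Ky; apply: (Pmon _ r); last by rewrite s0 ltW.
    by apply: B => //; move: yx; rewrite -ball_normE/= distrC.
  exists d => // r' /andP[r0 rd] x Kx; apply: B => //=.
  by rewrite sub0r normrN gtr0_norm.
exists (r / 2); first by rewrite divr_gt0.
by move=> y; apply: H; rewrite divr_gt0// ltr_pdivrMr// mulr_natr mulr2n ltrDl.
Unshelve. all: by end_near. Qed.

Lemma cts_bounded {V : normedModType R} (K : set V) (f : V -> R) :
  compact K -> (forall x, K x -> {for x, continuous f}) ->
  exists2 M, 0 < M & forall x, K x -> `|f x| <= M.
Proof.
move=> cK cf.
have [||r r0 H] := @compact_unif _ K (fun x r => `|f x| <= r^-1) cK.
- move=> x r r' H /andP[r0 r'r]; apply: (le_trans H).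
  by rewrite lef_pV2// posrE// (lt_le_trans r0).
- move=> x Kx; have [d d0 B] := (ctsP f x).1 (cf x Kx) 1 ltr01.
  have M0 : 0 < (`|f x| + 1)^-1 by rewrite invr_gt0 ltr_wpDl.
  exists (Num.min d (`|f x| + 1)^-1); first by rewrite lt_min d0.
  move=> y _; rewrite lt_min => /andP[/B fy _].
  have : `|f y| <= `|f x| + 1.
    by rewrite -lerBlDl (le_trans (lerB_dist _ _))// ltW.
  move/le_trans; apply.
  rewrite -[X in X <= _]invrK lef_pV2 ?posrE ?lt_min ?d0//.
  by rewrite ge_min lexx orbT.
by exists r^-1; rewrite ?invr_gt0.
Qed.

End Compactness.

Section MeanValue.
Context {R : realType}.

(** Comparing two functions, rather than bounding a derivative by a constant,
    makes integrals unnecessary in the estimates below. *)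
Lemma mvt_le_scalar (y dy B dB : R -> R) (a b : R) : a <= b ->
  deriv_on a b y dy ->
  deriv_on a b B dB ->
  (forall t, a <= t <= b -> dy t <= dB t) ->
  y b - y a <= B b - B a.
Proof.
move=> ab Hy HB Hle.
have H t : a <= t <= b -> is_derive t 1 (B - y) (dB t - dy t).
  by move=> tab; apply: is_deriveB; [exact: HB|exact: Hy].
have [c cab E] : exists2 c, c \in `[a, b] &
    (B - y) b - (B - y) a = (dB c - dy c) * (b - a).
  apply: MVT_segment => //.
    by move=> t /[!in_itv]/= /andP[/ltW at1 /ltW tb]; apply: H; rewrite at1.
  apply: continuous_in_subspaceT => t /[!inE]/= /[!in_itv]/= tab.
  exact: is_derive_cts (H t tab).
have : 0 <= (B - y) b - (B - y) a.
  rewrite E mulr_ge0// subr_ge0//; apply: Hle.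
  by move: cab; rewrite in_itv.
by rewrite !fctE; lra.
Qed.

Context {V : normedModType R} {fV : FinSup V}.

Lemma is_derive_fs_c (y : R -> V) (t : R) (dy : V) i :
  is_derive t 1 y dy -> is_derive t 1 (fs_c i \o y) (fs_c i dy).
Proof.
move=> /is_deriveP H; apply/is_deriveP => e /H[d d0 B]; exists d => // h /B.
apply: le_trans; rewrite /= -[_ *: fs_c i dy]fs_cZ -!fs_cB; exact: fs_le.
Qed.

(** The mean value inequality in the form used throughout: a curve moves at most
    as far as a scalar function whose derivative dominates its speed. *)
Lemma mvt_le (y dy : R -> V) (B dB : R -> R) (a b : R) : a <= b ->
  deriv_on a b y dy ->
  deriv_on a b B dB ->
  (forall t, a <= t <= b -> `|dy t| <= dB t) ->
  `|y b - y a| <= B b - B a.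
Proof.
move=> ab Hy HB Hle.
have H t i : a <= t <= b -> `|fs_c i (dy t)| <= dB t.
  by move=> tab; apply: le_trans (Hle t tab); exact: fs_le.
apply: fs_norm => [|i].
  rewrite -(subrr (0 : R)); apply: (@mvt_le_scalar (cst 0) (cst 0) B dB) => // t tab.
  by apply: le_trans (Hle t tab); exact: normr_ge0.
rewrite fs_cB ler_norml; apply/andP; split; last first.
  apply: (@mvt_le_scalar (fs_c i \o y) (fs_c i \o dy) B dB) => // t tab.
    exact: is_derive_fs_c (Hy t tab).
  exact: le_trans (ler_norm _) (H t i tab).
rewrite lerNl opprB (_ : _ - _ = - fs_c i (y b) - - fs_c i (y a)); last by ring.
apply: (@mvt_le_scalar (fun t => - fs_c i (y t)) (fun t => - fs_c i (dy t)) B dB) => // t tab.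
  exact: (is_deriveN (is_derive_fs_c i (Hy t tab))).
by apply: le_trans (H t i tab); rewrite -normrN ler_norm.
Qed.

Lemma mvt_le_cst (y dy : R -> V) (M : R) (a b : R) : a <= b ->
  deriv_on a b y dy ->
  (forall t, a <= t <= b -> `|dy t| <= M) ->
  `|y b - y a| <= M * (b - a).
Proof.
move=> ab Hy H; rewrite mulrBr.
apply: (@mvt_le y dy ( *%R M) (cst M)) => // t _.
rewrite -[cst M t]mulr1; exact: (@is_deriveZ R _ R id M t 1 1).
Qed.

End MeanValue.

(** * Calculus in finite dimension *)

Section Calculus.
Context {R : realType}.

Lemma fin_radius (I : finType) (P : I -> R -> Prop) :
  (forall i r r', P i r -> 0 < r' <= r -> P i r') ->
  (forall i, exists2 r, 0 < r & P i r) -> exists2 r, 0 < r & forall i, P i r.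
Proof.
move=> Pmon H.
have {}H i : exists r, 0 < r /\ P i r by have [r r0 Pr] := H i; exists r.
have [r rP] := choice H.
exists (\big[Num.min/1]_i r i).
  by apply/bigmin_gtP; split=> // i _; exact: (rP i).1.
move=> i; apply: (Pmon _ (r i)); first exact: (rP i).2.
rewrite bigmin_le_cond// andbT; apply/bigmin_gtP; split=> // j _; exact: (rP j).1.
Qed.

Lemma open_ball_sub {V : normedModType R} (O : set V) x :
  open O -> O x -> exists2 r, 0 < r & forall y, `|y - x| < r -> O y.
Proof.
move=> oO Ox; have /nbhs_ballP[r /= r0 B] : nbhs x O by apply: open_nbhs_nbhs; split.
by exists r => // y yx; apply: B; rewrite -ball_normE/= distrC.
Qed.

Section Derive.
Context {V W : normedModType R} {fV : FinSup V} {fW : FinSup W}.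
Implicit Types (f : V -> W) (O K : set V).

Lemma deriveZ_dir f x a v : differentiable f x -> 'D_(a *: v) f x = a *: 'D_v f x.
Proof. by move=> df; rewrite !deriveE// linearZ. Qed.

Lemma deriveD_dir f x u v : differentiable f x -> 'D_(u + v) f x = 'D_u f x + 'D_v f x.
Proof. by move=> df; rewrite !deriveE// linearD. Qed.

(** Continuity of the partial derivatives in finitely many directions controls
    all directional derivatives at once. *)
Lemma derive_fs f x v : differentiable f x ->
  'D_v f x = \sum_i fs_c i v *: 'D_(fs_e i) f x.
Proof.
move=> df; rewrite deriveE// {1}(fs_dec v) linear_sum; apply: eq_bigr => i _.
by rewrite linearZ deriveE.
Qed.

(** A continuously differentiable map is strictly differentiable: near a point
    its increments, between any two nearby points, are those of its
    differential up to a small relative error. *)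
Lemma C1_strict f O x0 e : open O -> Ck 1 O f -> O x0 -> 0 < e ->
  exists2 r, 0 < r & forall x y, `|x - x0| < r -> `|y - x0| < r ->
    `|f x - f y - 'D_(x - y) f x0| <= e * `|x - y|.
Proof.
move=> oO [df Cf] Ox0 e0; have [r1 r10 B1] := open_ball_sub oO Ox0.
set N : R := (#|@fs_I _ _ fV|.+1)%:R.
have N0 : 0 < N by rewrite ltr0n.
have [||r2 r20 B2] := @fin_radius (@fs_I _ _ fV) (fun i r => forall z, `|z - x0| < r ->
   `|'D_(fs_e i) f z - 'D_(fs_e i) f x0| <= e / N).
- by move=> i r r' H /andP[_ r'r] z zx; apply: H; exact: lt_le_trans r'r.
- move=> i; have /ctsP/(_ (e / N)) := Cf (fs_e i) x0 Ox0.
  by case; [rewrite divr_gt0|move=> d d0 B; exists d => // z /B/ltW].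
exists (Num.min r1 r2); first by rewrite lt_min r10.
have key z v : `|z - x0| < Num.min r1 r2 -> `|'D_v f z - 'D_v f x0| <= e * `|v|.
  rewrite lt_min => /andP[/B1 Oz /B2 zr].
  rewrite !derive_fs//; [|exact: df|exact: df].
  rewrite -sumrB; apply: le_trans (ler_norm_sum _ _ _) _.
  have : \sum_(i : fs_I) `|fs_c i v *: 'D_(fs_e i) f z - fs_c i v *: 'D_(fs_e i) f x0|
      <= \sum_(i : @fs_I _ _ fV) (e / N * `|v|).
    apply: ler_sum => i _; rewrite -scalerBr normrZ mulrC.
    by apply: ler_pM => //; exact: fs_le.
  move/le_trans; apply; rewrite sumr_const -mulr_natr.
  set n : R := (#|_|)%:R; have nN : n <= N by rewrite ler_nat.
  rewrite mulrAC ler_wpM2r// -mulrA ler_piMr ?(ltW e0)// mulrC.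
  by rewrite ler_pdivrMr// mul1r.
move=> x y xr yr.
pose w := x - y.
have seg s : 0 <= s <= 1 -> `|y + s *: w - x0| < Num.min r1 r2.
  move=> /andP[s0 s1].
  have -> : y + s *: w - x0 = (1 - s) *: (y - x0) + s *: (x - x0).
    rewrite scalerBl scale1r /w -addrA [RHS]addrC addrA addrA.
    rewrite [in RHS]addrAC [in RHS]addrC -!scalerBr.
    by rewrite opprB addrA subrK addrAC.
  apply: normD_lt; rewrite !normrZ !ger0_norm ?subr_ge0//.
  have [->|s10] := eqVneq s 1; first by rewrite subrr mul0r add0r mul1r.
  have : (1 - s) * `|y - x0| < (1 - s) * Num.min r1 r2.
    by rewrite ltr_pM2l// subr_gt0 lt_neqAle s10.
  have : s * `|x - x0| <= s * Num.min r1 r2 by rewrite ler_wpM2l// ltW.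
  by lra.
have := @mvt_le_cst _ _ fW (fun s => f (y + s *: w) - s *: 'D_w f x0)
  (fun s => 'D_w f (y + s *: w) - 'D_w f x0) (e * `|w|) 0 1 ler01.
rewrite !scale1r !scale0r subr0 addr0 [y + w]addrC subrK subr0 mulr1 addrAC; apply.
  move=> t t01; apply: is_deriveB.
    apply: is_derive_line; apply: df; apply: B1.
    by have := seg t t01; rewrite lt_min => /andP[].
  apply/is_deriveP => d d0; exists 1 => // h _.
  rewrite -!scalerBl (_ : t + h - t - h = 0); last by ring.
  by rewrite scale0r normr0 mulr_ge0// ltW.
by move=> t t01; apply: key; exact: seg.
Qed.

Definition segment_closed K := forall x y s, K x -> K y -> 0 <= s <= 1 ->
  K (y + s *: (x - y)).

(** Compactness bounds the derivative, which is then integrated along segments. *)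
Lemma C1_lipschitz f O K : open O -> Ck 1 O f -> compact K -> segment_closed K ->
  K `<=` O -> exists2 L, 0 < L & forall x y, K x -> K y -> `|f x - f y| <= L * `|x - y|.
Proof.
move=> oO [df Cf] cK sK KO.
have H i : exists M, 0 < M /\ forall x, K x -> `|'D_(fs_e i) f x| <= M.
  have [|M M0 HM] := @cts_bounded R V K (fun x => `|'D_(fs_e i) f x|) cK.
    move=> x Kx; apply: (@cvg_norm _ _ _ (nbhs x) _ (fun x => 'D_(fs_e i) f x)).
    exact: Cf (KO _ Kx).
  by exists M; split=> // x /HM; rewrite normr_id.
have [M HM] := choice H.
have M0 : 0 <= \sum_i M i by apply: sumr_ge0 => i _; exact/ltW/(HM i).1.
exists (\sum_i M i + 1); first by rewrite ltr_wpDl.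
move=> x y Kx Ky; pose w := x - y.
have := @mvt_le_cst _ _ fW (fun s => f (y + s *: w))
  (fun s => 'D_w f (y + s *: w)) ((\sum_i M i + 1) * `|w|) 0 1 ler01.
rewrite !scale1r !scale0r addr0 [y + w]addrC subrK subr0 mulr1; apply.
  by move=> t t01; apply: is_derive_line; apply/df/KO/sK.
move=> t t01; have Kz : K (y + t *: w) by exact: sK.
rewrite derive_fs; last exact/df/KO.
apply: le_trans (ler_norm_sum _ _ _) _.
have : (\sum_i M i) * `|w| <= (\sum_i M i + 1) * `|w| by rewrite ler_wpM2r// lerDl.
apply: le_trans; rewrite mulr_suml; apply: ler_sum => i _.
by rewrite normrZ mulrC; apply: ler_pM => //; [exact: (HM i).2|exact: fs_le].
Qed.

End Derive.

(** ** Primitives of continuous functions *)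

(** The Lebesgue integral provides primitives on bounded intervals only. *)
Lemma primitive_itv (g : R -> R) (N : R) : continuous g -> 0 < N ->
  exists G : R -> R, G 0 = 0 /\ forall t : R, - N < t < N -> is_derive t 1 G (g t).
Proof.
move=> cg N0.
pose F x := (\int[lebesgue_measure]_(t in [set` Interval (BLeft (- N)) (BRight x)]) g t)%R.
exists (fun x => F x - F 0); split; first by rewrite subrr.
move=> t /andP[Nt tN].
have [dF F'] : derivable F t 1 /\ F^`()%classic t = g t.
  apply: (@continuous_FTC1 _ g (BLeft (- N)) t N tN) => //.
    apply: continuous_compact_integrable; first exact: segment_compact.
    exact: continuous_subspaceT.
  exact: cg.
rewrite -[g t]subr0; apply: is_deriveB.
clearbody F; rewrite derive1E in F'; exact: DeriveDef.
Qed.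

Lemma primitive_scalar (g : R -> R) : continuous g ->
  exists G : R -> R, G 0 = 0 /\ forall t : R, is_derive t 1 G (g t).
Proof.
move=> cg.
have H (N : R) : exists G : R -> R, G 0 = 0 /\ (0 < N -> forall t : R, - N < t < N -> is_derive t 1 G (g t)).
  have [N0|N0] := ltP 0 N; last by exists (cst 0).
  by have [G [G0 HG]] := primitive_itv cg N0; exists G.
have [G HG] := choice H.
have E N M x : `|x| < N -> `|x| < M -> G N x = G M x.
  move=> xN xM.
  have N0 : 0 < N by exact: le_lt_trans xN.
  have M0 : 0 < M by exact: le_lt_trans xM.
  have D (t : R) : `|t| <= `|x| -> is_derive t 1 (fun t => G N t - G M t) 0.
    move=> tx; rewrite -[X in is_derive _ _ _ X](subrr (g t)); apply: is_deriveB.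
      by apply: (HG N).2 => //; rewrite -ltr_norml (le_lt_trans tx).
    by apply: (HG M).2 => //; rewrite -ltr_norml (le_lt_trans tx).
  apply/eqP; rewrite -subr_eq0 -normr_le0.
  have [x0|x0] := leP 0 x.
    have := @mvt_le_cst _ _ _ (fun t => G N t - G M t) (cst 0) 0 0 x x0.
    rewrite !(HG _).1 subrr subr0 mul0r; apply => t /andP[t0 tx]; last by rewrite normr0.
    by apply: D; rewrite !ger0_norm.
  have := @mvt_le_cst _ _ _ (fun t => G N t - G M t) (cst 0) 0 x 0 (ltW x0).
  rewrite !(HG _).1 subrr mul0r sub0r normrN; apply => t /andP[xt t0]; last by rewrite normr0.
  by apply: D; rewrite !ler0_norm ?lerN2// ltW.
exists (fun x => G (`|x| + 1) x); split; first exact: (HG _).1.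
move=> t; have D : is_derive t 1 (G (`|t| + 2)) (g t).
  have t2 : `|t| < `|t| + 2 by rewrite ltrDl.
  by apply: (HG (`|t| + 2)).2; [exact: le_lt_trans t2|rewrite -ltr_norml].
move: D => /is_deriveP D; apply/is_deriveP => e /D[d d0 B].
exists (Num.min d 1); first by rewrite lt_min d0/=.
move=> h; rewrite lt_min => /andP[/B + h1].
have th : `|t + h| < `|t| + 2 by apply: normD_lt; lra.
rewrite (E _ (`|t + h| + 1) _ th) ?ltrDl//.
by rewrite (E _ (`|t| + 1) t) ?ltrDl.
Qed.

Section FinDim.
Context {V : normedModType R} {fV : FinSup V}.

Lemma is_derive_coord (y : R -> V) (t : R) (dy : V) :
  (forall i, is_derive t 1 (fun s => fs_c i (y s)) (fs_c i dy)) -> is_derive t 1 y dy.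
Proof.
move=> H; apply/is_deriveP => e e0.
have [||d d0 B] := @fin_radius (@fs_I _ _ fV) (fun i d => forall h, `|h| < d ->
   `|fs_c i (y (t + h)) - fs_c i (y t) - h * fs_c i dy| <= e * `|h|).
- by move=> i r r' H' /andP[_ r'r] h hr; apply: H'; exact: lt_le_trans r'r.
- by move=> i; have /is_deriveP/(_ e e0)[d d0 B] := H i; exists d.
exists d => // h hd; apply: fs_norm => [|i]; first by rewrite mulr_ge0// ltW.
by rewrite !fs_cB fs_cZ; exact: B.
Qed.

Lemma fs_c_continuous i (g : R -> V) : continuous g -> continuous (fun t => fs_c i (g t)).
Proof.
move=> cg t; apply/ctsP => e e0; have /ctsP/(_ e e0)[d d0 B] := cg t.
by exists d => // s /B; apply: le_lt_trans; rewrite -fs_cB; exact: fs_le.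
Qed.

Lemma primitive (g : R -> V) : continuous g ->
  exists G : R -> V, G 0 = 0 /\ forall t : R, is_derive t 1 G (g t).
Proof.
move=> cg; have [G HG] := choice (fun i => primitive_scalar (fs_c_continuous (i := i) cg)).
exists (fun t => \sum_i G i t *: fs_e i); split.
  by rewrite big1// => i _; rewrite (HG i).1 scale0r.
move=> t; apply: is_derive_coord => i.
rewrite (_ : (fun s => _) = G i); first exact: (HG i).2.
by apply/funext => s; rewrite (fs_c_sum (fun j => G j s)).
Qed.

Lemma geometric_limit_scalar (x : nat -> R) (A : R) :
  (forall n, `|x n.+1 - x n| <= A / 2 ^+ n) ->
  exists l, forall n, `|x n - l| <= 2 * A / 2 ^+ n.
Proof.
move=> H; pose c n := 2 * A / 2 ^+ n.
have cS n : c n.+1 = c n - A / 2 ^+ n.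
  by rewrite /c exprS invfM; set z := (2 ^+ n)^-1; lra.
have A0 : 0 <= A by have := le_trans (normr_ge0 _) (H 0%N); rewrite expr0 divr1.
have c0 n : 0 <= c n by rewrite divr_ge0 ?mulr_ge0// exprn_ge0.
have up n m : (n <= m)%N -> x n - c n <= x m - c m.
  move=> /subnK <-; elim: (m - n)%N => [|k IH]; first by rewrite add0n.
  apply: le_trans IH _; rewrite addSn cS; have := H (k + n)%N.
  by rewrite ler_norml => /andP[]; lra.
have dn n m : (n <= m)%N -> x m + c m <= x n + c n.
  move=> /subnK <-; elim: (m - n)%N => [|k IH]; first by rewrite add0n.
  apply: le_trans _ IH; rewrite addSn cS; have := H (k + n)%N.
  by rewrite ler_norml => /andP[]; lra.
have ud n m : x n - c n <= x m + c m.
  case: (leqP n m) => [nm|/ltnW nm].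
    by have := up _ _ nm; have := c0 m; lra.
  by have := dn _ _ nm; have := c0 n; lra.
pose S := range (fun n => x n - c n).
have hS : has_sup S.
  split; first by exists (x 0%N - c 0%N), 0%N.
  by exists (x 0%N + c 0%N) => _ [n _ <-]; exact: ud.
exists (sup S) => n; rewrite ler_norml; apply/andP; split.
  have : sup S <= x n + c n by apply: ge_sup; [exact: hS.1|move=> _ [m _ <-]; exact: ud].
  by rewrite -/(c n); lra.
have : x n - c n <= sup S by apply: sup_upper_bound => //; exists n.
by rewrite -/(c n); lra.
Qed.

Lemma geometric_limit (x : nat -> V) (A : R) :
  (forall n, `|x n.+1 - x n| <= A / 2 ^+ n) ->
  exists l, forall n, `|x n - l| <= 2 * A / 2 ^+ n.
Proof.
move=> H.
have A0 : 0 <= A by have := le_trans (normr_ge0 _) (H 0%N); rewrite expr0 divr1.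
have Hi i : exists l, forall n, `|fs_c i (x n) - l| <= 2 * A / 2 ^+ n.
  apply: geometric_limit_scalar => n; rewrite -fs_cB.
  exact: le_trans (fs_le _ _) (H n).
have [l Hl] := choice Hi.
exists (\sum_i l i *: fs_e i) => n; apply: fs_norm => [|i].
  by rewrite divr_ge0 ?mulr_ge0// exprn_ge0.
by rewrite fs_cB fs_c_sum; exact: Hl.
Qed.

Lemma small_geometric (A e : R) : 0 <= A -> 0 < e -> exists n, A / 2 ^+ n < e.
Proof.
move=> A0 e0; have := @cvg_geometric R A (2^-1).
rewrite ger0_norm ?invr_ge0// invf_lt1// ltr1n => /(_ isT)/cvgrPdist_lt/(_ e e0)[n _ Hn].
exists n; have := Hn n (leqnn n); rewrite /= sub0r normrN exprVn.
by apply: le_lt_trans; exact: ler_norm.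
Qed.

(** Banach's fixed point theorem on a closed ball, for the ratio one half. *)
Lemma fixed_point_ball (T : V -> V) (x0 : V) (r : R) :
  (forall x y, `|x - x0| <= r -> `|y - x0| <= r -> `|T x - T y| <= 2^-1 * `|x - y|) ->
  `|T x0 - x0| <= r / 2 -> exists2 x, `|x - x0| <= r & T x = x.
Proof.
move=> HT H0; have r0 : 0 <= r by have := le_trans (normr_ge0 _) H0; lra.
pose x n := iter n T x0.
have xB n : `|x n - x0| <= r.
  elim: n => [|n IH]; first by rewrite subrr normr0.
  rewrite -(subrK (T x0) (x n.+1)) -addrA; apply: normD_le.
  have := HT (x n) x0 IH; rewrite subrr normr0 => /(_ r0).
  by rewrite -/(x n.+1) /x/= -/(x n); lra.
have [|l Hl] := @geometric_limit x (r / 2).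
  elim=> [|n IH]; first by rewrite expr0 divr1.
  apply: le_trans (HT _ _ (xB n.+1) (xB n)) _.
  by rewrite exprS invfM mulrCA ler_pM2l.
have lB : `|l - x0| <= r.
  apply/ler_addgt0Pr => e e0; have [n nS] := small_geometric (r0) e0.
  have := Hl n; have := xB n; have := ler_distD (x n) l x0.
  rewrite [`|l - x n|]distrC.
  have -> : 2 * (r / 2) = r by field.
  by move: nS; set u := r / _; lra.
exists l => //; apply/eqP; rewrite -subr_eq0 -normr_le0.
apply/ler_addgt0Pr => e e0; have [n nS] := small_geometric (r0) e0.
have := Hl n; have := Hl n.+1; have := HT l (x n) lB (xB n).
have := ler_distD (x n.+1) (T l) l.
rewrite [`|l - x n|]distrC -/(x n.+1) exprS invfM.
have -> : 2 * (r / 2) = r by field.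
rewrite [r * (_ * _)]mulrCA.
by move: nS; rewrite add0r /x/= -/(x n); set u := r / _; lra.
Qed.

End FinDim.
End Calculus.

(** * Ordinary differential equations *)

Section ScalarDerivatives.
Context {R : realType}.
Implicit Types (f g : R -> R) (t a b : R).

Lemma der_eq {V : normedModType R} (f : R -> V) t (a b : V) :
  is_derive t 1 f a -> a = b -> is_derive t 1 f b.
Proof. by move=> ? <-. Qed.

Lemma der_cst {V : normedModType R} (k : V) t : is_derive t 1 (fun=> k) 0.
Proof. exact: is_derive_cst. Qed.

Lemma der_id t : is_derive t 1 (fun s : R => s) 1.
Proof. exact: is_derive_id. Qed.

Lemma der_add {V : normedModType R} (f g : R -> V) t (a b : V) :
  is_derive t 1 f a -> is_derive t 1 g b -> is_derive t 1 (fun s => f s + g s) (a + b).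
Proof. by move=> ? ?; exact: is_deriveD. Qed.

Lemma der_sub {V : normedModType R} (f g : R -> V) t (a b : V) :
  is_derive t 1 f a -> is_derive t 1 g b -> is_derive t 1 (fun s => f s - g s) (a - b).
Proof. by move=> ? ?; exact: is_deriveB. Qed.

Lemma der_scale f t a k : is_derive t 1 f a -> is_derive t 1 (fun s => k * f s) (k * a).
Proof. by move=> ?; exact: is_deriveZ. Qed.

Lemma der_mul f g t a b : is_derive t 1 f a -> is_derive t 1 g b ->
  is_derive t 1 (fun s => f s * g s) (a * g t + f t * b).
Proof.
move=> fa gb; have H := @is_deriveM R R f g t 1 a b fa gb.
by apply: (der_eq H); rewrite addrC /GRing.scale/= mulrC.
Qed.

Lemma der_exp f t a : is_derive t 1 f a ->
  is_derive t 1 (fun s => expR (f s)) (a * expR (f t)).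
Proof.
move=> fa; have H := @is_derive1_comp R expR f t _ _ (is_derive_expR (f t)) fa.
by apply: (der_eq H); rewrite mulrC.
Qed.

Lemma der_ln f t a : 0 < f t -> is_derive t 1 f a ->
  is_derive t 1 (fun s => ln (f s)) (a / f t).
Proof.
move=> f0 fa; have H := @is_derive1_comp R (@ln R) f t _ _ (is_derive1_ln f0) fa.
by apply: (der_eq H); rewrite mulrC.
Qed.

Lemma der_expk k t : is_derive t 1 (fun s => expR (k * s)) (k * expR (k * t)).
Proof. by apply: (der_eq (der_exp (der_scale k (der_id t)))); rewrite mulr1. Qed.

End ScalarDerivatives.

Section Gronwall.
Context {R : realType} {V : normedModType R} {fV : FinSup V}.
Implicit Types (z dz : R -> V) (K e T : R).

(** Gronwall's inequality.  Instead of integrating, compare with the largest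
    value of the weighted norm |z| exp(- 2 K t): the mean value inequality
    bounds that maximum by half of itself plus the data. *)
Lemma gronwall z dz K e T : 0 < K -> 0 <= T -> 0 <= e ->
  deriv_on 0 T z dz ->
  (forall t, 0 <= t <= T -> `|dz t| <= K * `|z t| + e) ->
  forall t, 0 <= t <= T -> `|z t| <= 2 * (`|z 0| + e * T) * expR (2 * K * t).
Proof.
move=> K0 T0 e0 Hz Hdz.
pose m t := `|z t| * expR (- (2 * K) * t).
have [c cT cmax] : exists2 c, c \in `[0, T] & forall t, t \in `[0, T] -> m t <= m c.
  apply: EVT_max => //; apply: continuous_in_subspaceT => t /[!inE]/= /[!in_itv]/= tT.
  apply: (@continuousM _ _ (fun t => `|z t|) (fun t => expR (- (2 * K) * t))).
    exact/(@cvg_norm _ _ _ (nbhs t) _ z)/(is_derive_cts (Hz t tT)).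
  exact: is_derive_cts (der_expk _ _).
move: (cT); rewrite in_itv/= => /andP[c0 cT'].
have mE t : `|z t| = m t * expR (2 * K * t).
  by rewrite /m -mulrA -expRD -mulrDl addNr mul0r expR0 mulr1.
have m0 : 0 <= m c by rewrite mulr_ge0// expR_ge0.
have H : `|z c - z 0| <= (e * c + m c / 2 * expR (2 * K * c))
    - (e * 0 + m c / 2 * expR (2 * K * 0)).
  apply: (@mvt_le _ _ _ z dz (fun t => e * t + m c / 2 * expR (2 * K * t))
    (fun t => e + K * (m c * expR (2 * K * t)))) => // t /andP[t0 tc].
  - by apply: Hz; rewrite t0 (le_trans tc).
  - apply: (der_eq (der_add (der_scale e (der_id t)) (der_scale (m c / 2) (der_expk (2 * K) t)))).
    by rewrite mulr1; congr (_ + _); field.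
  - have tT : 0 <= t <= T by rewrite t0 (le_trans tc).
    apply: le_trans (Hdz t tT) _; rewrite addrC lerD2l// ler_pM2l// mE.
    by rewrite ler_pM2r ?expR_gt0//; apply: cmax; rewrite in_itv.
have Hc : m c <= 2 * (`|z 0| + e * T).
  have E1 : 1 <= expR (2 * K * c) by rewrite -expR0 ler_expR !mulr_ge0// ltW.
  have : `|z c| <= `|z 0| + `|z c - z 0| by rewrite -lerBlDl; exact: lerB_dist.
  rewrite !mulr0 expR0 mulr1 add0r in H.
  rewrite [X in X <= _ -> _]mE.
  have : e * c <= e * T by rewrite ler_wpM2l.
  have : m c <= m c * expR (2 * K * c) by rewrite ler_peMr.
  by move: H; rewrite [m c / 2 * _]mulrAC; lra.
move=> t tT; rewrite mE ler_pM2r ?expR_gt0//; apply: le_trans Hc.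
by apply: cmax; rewrite in_itv.
Qed.

Lemma gronwall_rev z dz K e T : 0 < K -> 0 <= T -> 0 <= e ->
  deriv_on (- T) 0 z dz ->
  (forall t, - T <= t <= 0 -> `|dz t| <= K * `|z t| + e) ->
  forall t, - T <= t <= 0 -> `|z t| <= 2 * (`|z 0| + e * T) * expR (2 * K * - t).
Proof.
move=> K0 T0 e0 Hz Hdz t /andP[t1 t2].
have := @gronwall (fun t => z (- t)) (fun t => - dz (- t)) K e T K0 T0 e0.
rewrite oppr0 => /(_ _ _ (- t)); rewrite opprK; apply.
- by move=> s /andP[s0 sT]; apply: is_derive_rev; apply: Hz; rewrite lerN2 sT oppr_le0.
- by move=> s /andP[s0 sT]; rewrite normrN; apply: Hdz; rewrite lerN2 sT oppr_le0.
- by rewrite oppr_ge0 t2 lerNl.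
Qed.

(** Applied to the difference of two solutions: uniqueness from either end. *)
Lemma zero_of_gronwall z dz K a b : 0 < K -> a <= b -> z a = 0 \/ z b = 0 ->
  deriv_on a b z dz ->
  (forall t, a <= t <= b -> `|dz t| <= K * `|z t|) ->
  forall t, a <= t <= b -> z t = 0.
Proof.
move=> K0 ab zab Hz Hdz t /andP[at1 tb]; apply/eqP; rewrite -normr_le0.
have ba : 0 <= b - a by rewrite subr_ge0.
case: zab => z0.
- have := @gronwall (fun t => z (t + a)) (fun t => dz (t + a)) K 0 (b - a) K0 ba (lexx 0).
  rewrite add0r z0 normr0 mul0r addr0 mulr0 => /(_ _ _ (t - a)).
  rewrite subrK mul0r; apply.
  + by move=> s /andP[s0 sT]; apply: is_derive_shiftc; apply: Hz; rewrite lerDr s0 -lerBrDr.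
  + move=> s /andP[s0 sT]; rewrite addr0; apply: Hdz; by rewrite lerDr s0 -lerBrDr.
  + by rewrite subr_ge0 at1 lerD2r.
- have := @gronwall_rev (fun t => z (t + b)) (fun t => dz (t + b)) K 0 (b - a) K0 ba (lexx 0).
  rewrite add0r z0 normr0 mul0r addr0 mulr0 => /(_ _ _ (t - b)).
  rewrite subrK mul0r; apply.
  + move=> s /andP[s0 sT]; apply: is_derive_shiftc; apply: Hz.
    by apply/andP; split; lra.
  + move=> s /andP[s0 sT]; rewrite addr0; apply: Hdz.
    by apply/andP; split; lra.
  + by rewrite opprB lerD2r at1 subr_le0.
Qed.

Lemma exp_growth z dz (C K : R) : 0 < K ->
  (forall t : R, is_derive t 1 z (dz t)) -> z 0 = 0 ->
  (forall t, `|dz t| <= C * expR (2 * K * `|t|)) ->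
  forall t, `|z t| <= C / (2 * K) * expR (2 * K * `|t|).
Proof.
move=> K0.
wlog suff wl : z dz / forall t, 0 <= t ->
    (forall t : R, is_derive t 1 z (dz t)) -> z 0 = 0 ->
    (forall t, `|dz t| <= C * expR (2 * K * `|t|)) ->
    `|z t| <= C / (2 * K) * expR (2 * K * t).
  move=> Hz z0 Hdz t; have [t0|t0] := leP 0 t.
    by rewrite [`|t|]ger0_norm//; apply: (wl z dz).
  have := wl (fun t => z (- t)) (fun t => - dz (- t)) (- t).
  rewrite opprK oppr0 ltr0_norm// => H; apply: H => //; first by rewrite oppr_ge0 ltW.
    by move=> s; apply: is_derive_rev.
  by move=> s; rewrite normrN -[`|s|]normrN.
move=> t t0 Hz z0 Hdz.
have C0 : 0 <= C.
  by have := le_trans (normr_ge0 _) (Hdz 0); rewrite normr0 mulr0 expR0 mulr1.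
have := @mvt_le _ _ fV z dz (fun t => C / (2 * K) * expR (2 * K * t))
  (fun t => C * expR (2 * K * t)) 0 t t0.
rewrite z0 subr0 => H.
have H1 s : 0 <= s <= t -> is_derive s 1 (fun t : R => C / (2 * K) * expR (2 * K * t))
    (C * expR (2 * K * s)).
  move=> _; apply: (der_eq (der_scale _ (der_expk (2 * K) s))).
  by field; rewrite gt_eqF.
have H2 s : 0 <= s <= t -> `|dz s| <= C * expR (2 * K * s).
  by move=> /andP[s0 _]; have := Hdz s; rewrite [`|s|]ger0_norm.
apply: le_trans (H (fun s _ => Hz s) H1 H2) _.
by rewrite gerBl mulr_ge0 ?expR_ge0// divr_ge0// mulr_ge0// ltW.
Qed.

(** Picard iteration for a globally Lipschitz field; the weight exp(2 K |t|)
    makes the iteration a contraction with ratio one half for all times. *)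
Lemma picard (F : V -> V) (K : R) (x0 : V) : 0 < K ->
  (forall x y, `|F x - F y| <= K * `|x - y|) ->
  exists x : R -> V, x 0 = x0 /\ forall t : R, is_derive t 1 x (F (x t)).
Proof.
move=> K0 FK.
have cF (y : R -> V) : continuous y -> continuous (F \o y).
  move=> cy t; apply/ctsP => e e0.
  have /ctsP/(_ (e / K))[|d d0 B] := cy t; first by rewrite divr_gt0.
  exists d => // s /B; rewrite ltr_pdivlMr// mulrC; apply: le_lt_trans; exact: FK.
have step (y : R -> V) : exists y' : R -> V, continuous y ->
    y' 0 = x0 /\ forall t : R, is_derive t 1 y' (F (y t)).
  have [cy|ncy] := pselect (continuous y); last by exists y.
  have [G [G0 HG]] := primitive (cF _ cy).
  exists (fun t => x0 + G t) => _; split; first by rewrite G0 addr0.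
  by move=> t; rewrite -[F (y t)]add0r; apply: der_add => //; exact: der_cst.
have [S HS] := choice step.
pose X n : R -> V := iter n S (cst x0).
have cX n : continuous (X n).
  elim: n => [|n IH]; first by move=> t; exact: cvg_cst.
  by move=> t; apply: is_derive_cts ((HS _ IH).2 t).
have X0 n : X n 0 = x0 by case: n => // n; have := (HS _ (cX n)).1.
have dX n (t : R) : is_derive t 1 (X n.+1) (F (X n t)) by exact: (HS _ (cX n)).2.
pose A := `|F x0| / (2 * K).
have A0 : 0 <= A by rewrite divr_ge0// mulr_ge0// ltW.
pose E (t : R) := expR (2 * K * `|t|).
have E0 t : 0 < E t by exact: expR_gt0.
have E1 t : 1 <= E t by rewrite -expR0 ler_expR !mulr_ge0// ltW.
have bound n t : `|X n.+1 t - X n t| <= A * E t / 2 ^+ n.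
  elim: n t => [|n IH] t.
    rewrite expr0 divr1.
    have D0 (s : R) : is_derive s 1 (fun t => X 1%N t - X 0%N t) (F x0 - 0).
      exact: der_sub (dX 0%N s) (der_cst x0 s).
    have D1 (s : R) : `|F x0 - 0| <= `|F x0| * expR (2 * K * `|s|).
      by rewrite subr0 ler_peMr//; exact: E1.
    have D2 : X 1%N 0 - X 0%N 0 = 0 by rewrite !X0 subrr.
    exact: (@exp_growth (fun t => X 1%N t - X 0%N t) (fun t => F x0 - 0) _ _ K0 D0 D2 D1).
  have := @exp_growth (fun t => X n.+2 t - X n.+1 t)
    (fun t => F (X n.+1 t) - F (X n t)) (K * A / 2 ^+ n) K K0.
  move=> H.
  have H1 s : `|F (X n.+1 s) - F (X n s)| <= K * A / 2 ^+ n * expR (2 * K * `|s|).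
    apply: le_trans (FK _ _) _; have := IH s; rewrite -(ler_pM2l K0).
    have -> : K * (A * E s / 2 ^+ n) = K * A / 2 ^+ n * E s by ring.
    by [].
  have H0 : X n.+2 0 - X n.+1 0 = 0 by rewrite !X0 subrr.
  have {H} := H (fun s => der_sub (dX n.+1 s) (dX n s)) H0 H1 t.
  have -> : K * A / 2 ^+ n / (2 * K) * expR (2 * K * `|t|) = A * E t / 2 ^+ n.+1.
    by clearbody A; rewrite exprS /E; field; do ?[apply/andP; split]; rewrite ?gt_eqF ?exprn_gt0.
  by [].
have [x Hx] := choice (fun t => geometric_limit (bound ^~ t)).
have Emon (s t : R) : `|s| <= `|t| + 1 -> E s <= E (`|t| + 1).
  move=> st; rewrite ler_expR ler_pM2l ?mulr_gt0//.
  by rewrite [`|_ + 1|]ger0_norm// addr_ge0.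
have cx : continuous x.
  move=> t; apply/ctsP => e e0.
  have [||n nS] := @small_geometric R (4 * (A * E (`|t| + 1))) (e / 2).
  - by rewrite mulr_ge0// mulr_ge0// ltW.
  - by rewrite divr_gt0.
  have /ctsP/(_ (e / 2))[|d d0 B] := cX n t; first by rewrite divr_gt0.
  exists (Num.min d 1); first by rewrite lt_min d0/=.
  move=> s; rewrite lt_min => /andP[/B Bs s1].
  have Hn u : `|u| <= `|t| + 1 -> `|X n u - x u| <= 2 * (A * E (`|t| + 1)) / 2 ^+ n.
    move=> /Emon ut; apply: le_trans (Hx u n) _.
    by rewrite ler_pM2r ?invr_gt0 ?exprn_gt0// ler_pM2l// ler_wpM2l.
  have Hs : `|s| <= `|t| + 1.
    by have := ler_normD (s - t) t; rewrite subrK; move: s1; lra.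
  have Ht : `|t| <= `|t| + 1 by rewrite lerDl.
  have {Hs} := Hn s Hs; have {Ht} := Hn t Ht; move: nS Bs.
  have -> : x s - x t = (x s - X n s) + (X n s - X n t) + (X n t - x t).
    by rewrite !subrKA.
  rewrite [`|X n s - x s|]distrC.
  have := ler_normD (x s - X n s + (X n s - X n t)) (X n t - x t).
  have := ler_normD (x s - X n s) (X n s - X n t).
  have -> : 4 * (A * E (`|t| + 1)) / 2 ^+ n = 2 * (2 * (A * E (`|t| + 1)) / 2 ^+ n).
    by ring.
  by set u := _ / 2 ^+ n; lra.
have [G [G0 HG]] := primitive (cF _ cx).
have Gx t : x0 + G t = x t.
  apply/eqP; rewrite -subr_eq0 -normr_le0; apply/ler_addgt0Pr => e e0.
  have [||n nS] := @small_geometric R (2 * (A * E t)) e => //.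
    by rewrite mulr_ge0// mulr_ge0// ltW.
  have := @exp_growth (fun t => x0 + G t - X n.+1 t)
    (fun t => 0 + F (x t) - F (X n t)) (K * (2 * A / 2 ^+ n)) K K0.
  move=> H.
  have H1 s : `|0 + F (x s) - F (X n s)| <= K * (2 * A / 2 ^+ n) * expR (2 * K * `|s|).
    rewrite add0r; apply: le_trans (FK _ _) _.
    rewrite -mulrA ler_pM2l// distrC; apply: le_trans (Hx s n) _.
    by rewrite -/(E s) mulrA mulrAC.
  have H0 : x0 + G 0 - X n.+1 0 = 0 by rewrite G0 X0 addr0 subrr.
  have {H H1 H0} := H (fun s => der_sub (der_add (der_cst x0 s) (HG s)) (dX n s)) H0 H1 t.
  have -> : K * (2 * A / 2 ^+ n) / (2 * K) * expR (2 * K * `|t|) = A * E t / 2 ^+ n.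
    by clearbody A; rewrite /E; field; do ?[apply/andP; split]; rewrite ?gt_eqF ?exprn_gt0.
  move=> H.
  have := Hx t n.+1; rewrite exprS invfM.
  have -> : 2 * (A * E t) * (2^-1 / 2 ^+ n) = A * E t / 2 ^+ n.
    by field.
  have := ler_distD (X n.+1 t) (x0 + G t) (x t).
  move: nS H; rewrite add0r (_ : 2 * (A * E t) / 2 ^+ n = 2 * (A * E t / 2 ^+ n)); last by ring.
  by set u := _ / 2 ^+ n; lra.
have xE : x = fun t => x0 + G t by apply/funext => t; rewrite Gx.
exists x; split; first by rewrite -Gx G0 addr0.
by move=> t; rewrite {1}xE; apply: (der_eq (der_add (der_cst x0 t) (HG t))); rewrite add0r.
Qed.

End Gronwall.

Section Pairs.
Context {R : realType}.

Lemma is_derive_pair {V W : normedModType R} (x : R -> V) (y : R -> W) (t : R) (a : V) (b : W) :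
  is_derive t 1 x a -> is_derive t 1 y b ->
  is_derive t 1 (fun s => (x s, y s)) (a, b).
Proof.
move=> /is_deriveP Hx /is_deriveP Hy; apply/is_deriveP => e e0.
have [d d0 Bx] := Hx e e0; have [d' d'0 By] := Hy e e0.
exists (Num.min d d'); first by rewrite lt_min d0.
move=> h; rewrite lt_min => /andP[/Bx hx /By hy].
by rewrite norm_pair/= ge_max hx.
Qed.

Lemma norm_pairB {V W : normedModType R} (a c : V) (b d : W) :
  `|((a, b) : V * W) - (c, d)| = Num.max `|a - c| `|b - d|.
Proof. by []. Qed.

Lemma der_ext {W : normedModType R} (f g : R -> W) (t : R) (a : W) :
  (forall s, f s = g s) -> is_derive t 1 f a -> is_derive t 1 g a.
Proof. by move=> /funext ->. Qed.

Lemma norm_fst {V W : normedModType R} (p : V * W) : `|p.1| <= `|p|.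
Proof. by case: p => a b; rewrite norm_pair le_max lexx. Qed.

Lemma norm_snd {V W : normedModType R} (p : V * W) : `|p.2| <= `|p|.
Proof. by case: p => a b; rewrite norm_pair le_max lexx orbT. Qed.

Lemma is_derive_fst {V W : normedModType R} (x : R -> V * W) (t : R) (a : V * W) :
  is_derive t 1 x a -> is_derive t 1 (fun s => (x s).1) a.1.
Proof.
move=> /is_deriveP H; apply/is_deriveP => e /H[d d0 B]; exists d => // h /B.
by apply: le_trans; exact: (norm_fst (x (t + h) - x t - h *: a)).
Qed.

Lemma is_derive_snd {V W : normedModType R} (x : R -> V * W) (t : R) (a : V * W) :
  is_derive t 1 x a -> is_derive t 1 (fun s => (x s).2) a.2.
Proof.
move=> /is_deriveP H; apply/is_deriveP => e /H[d d0 B]; exists d => // h /B.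
by apply: le_trans; exact: (norm_snd (x (t + h) - x t - h *: a)).
Qed.

End Pairs.

Section Clamp.
Context {R : realType}.
Implicit Types (r x y : R).

(** Composition with this projection extends a field from a cube to a globally
    Lipschitz one. *)
Definition clamp r x := Num.max (- r) (Num.min r x).

Lemma clamp_le r x : 0 <= r -> `|clamp r x| <= r.
Proof.
move=> r0; rewrite /clamp ler_norml le_max lexx/= ge_max ge_min lexx/= andbT.
by rewrite -subr_ge0 opprK addr_ge0.
Qed.

Lemma clamp_id r x : `|x| <= r -> clamp r x = x.
Proof. by rewrite ler_norml => /andP[rx xr]; rewrite /clamp (min_idPr xr) (max_idPr rx). Qed.

Lemma clamp_lip r x y : `|clamp r x - clamp r y| <= `|x - y|.
Proof.
have h1 := ler_norm (x - y); have h2 := ler_norm (y - x); rewrite distrC in h2.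
rewrite ler_norml /clamp !maxEle !minEle.
by apply/andP; split; case: (leP r x) => ?; case: (leP r y) => ?;
  case: (leP (- r) r) => ?; case: (leP (- r) x) => ?; case: (leP (- r) y) => ?; lra.
Qed.

Lemma clamp_sign r x : 0 < r -> 0 <= x * clamp r x.
Proof.
move=> r0; rewrite /clamp; have [x0|x0] := leP 0 x.
  by rewrite mulr_ge0// le_max le_min x0 (ltW r0) orbT.
by rewrite mulr_le0 ?(ltW x0)// ge_max ge_min (ltW x0) orbT oppr_le0 (ltW r0).
Qed.

End Clamp.

Section Periodic.
Context {R : realType}.

Lemma shift_period (T c : R) : 0 < T -> exists k : int, 0 <= c - T * k%:~R <= T.
Proof.
move=> T0; exists (Num.floor (c / T)).
have H1 : (Num.floor (c / T))%:~R <= c / T by exact: floor_le.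
have H2 : c / T < (Num.floor (c / T))%:~R + 1.
  by have := floorD1_gt (c / T); rewrite intrD.
move: H1 H2; rewrite ler_pdivlMr// ltr_pdivrMr// mulrDl mul1r mulrC => H1 H2.
by apply/andP; split; lra.
Qed.

Lemma periodicz {W : Type} (h : R -> W) (T : R) : (forall c, h (c + T) = h c) ->
  forall c (k : int), h (c + T * k%:~R) = h c.
Proof.
move=> hT.
have hn c (n : nat) : h (c + T * n%:R) = h c.
  elim: n c => [|n IH] c; first by rewrite mulr0 addr0.
  by rewrite -natr1 mulrDr mulr1 addrA hT IH.
move=> c [n|n]; first by rewrite -pmulrn hn.
by rewrite NegzE mulrNz -(hn _ n.+1) -pmulrn mulrN subrK.
Qed.

(** A function which is periodic in its first variable is Lipschitz as soon as
    it is so over three periods: two arguments that are more than a period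
    apart may be brought closer without changing the values. *)
Lemma periodic_lipschitz {X W : normedModType R} (h : R -> X -> W) (A : set X) (T L : R) :
  0 < T -> 0 <= L -> (forall c x, A x -> h (c + T) x = h c x) ->
  (forall c c' x x', - T <= c <= 2 * T -> - T <= c' <= 2 * T -> A x -> A x' ->
     `|h c x - h c' x'| <= L * Num.max `|c - c'| `|x - x'|) ->
  forall c c' x x', A x -> A x' ->
    `|h c x - h c' x'| <= L * Num.max `|c - c'| `|x - x'|.
Proof.
move=> T0 L0 hT HL.
have hz c x (k : int) : A x -> h (c + T * k%:~R) x = h c x.
  by move=> Ax; apply: (@periodicz _ (h ^~ x)) => c'; exact: hT.
have near c c' x x' : `|c - c'| <= T -> A x -> A x' ->
    `|h c x - h c' x'| <= L * Num.max `|c - c'| `|x - x'|.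
  move=> cc Ax Ax'; have [k /andP[k0 kT]] := shift_period c T0.
  rewrite -(hz c _ (- k))// -(hz c' _ (- k))// mulrNz mulrN.
  have -> : c - c' = c - T * k%:~R - (c' - T * k%:~R) by ring.
  move: cc; rewrite ler_norml => /andP[cc1 cc2].
  by apply: HL => //; apply/andP; split; lra.
move=> c c' x x' Ax Ax'; have [/near|cc] := leP `|c - c'| T; first exact.
have [k /andP[k0 kT]] := shift_period (c' - c) T0.
rewrite -(hz c' _ (- k))// mulrNz mulrN.
have ck : `|c - (c' - T * k%:~R)| <= T by rewrite ler_norml; apply/andP; split; lra.
apply: le_trans (near _ _ _ _ ck Ax Ax') _; rewrite ler_wpM2l//.
by rewrite ge_max !le_max lexx orbT andbT (le_trans ck)// ltW.
Qed.

End Periodic.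

Section Rectangle.
Context {R : realType}.
Implicit Types (a b : R).

Lemma itv_segment_closed a b : segment_closed (`[a, b]%classic : set R).
Proof.
move=> x y s /=; rewrite !in_itv/= => /andP[ax xb] /andP[ay yb] /andP[s0 s1].
rewrite (_ : y + s *: (x - y) = (1 - s) * y + s * x); last first.
  by rewrite /GRing.scale/=; ring.
have h1 : 0 <= 1 - s by rewrite subr_ge0.
apply/andP; split.
  have : (1 - s) * a <= (1 - s) * y by rewrite ler_wpM2l.
  have : s * a <= s * x by rewrite ler_wpM2l.
  by lra.
have : (1 - s) * y <= (1 - s) * b by rewrite ler_wpM2l.
have : s * x <= s * b by rewrite ler_wpM2l.
by lra.
Qed.

Lemma setX_segment_closed {V W : normedModType R} (A : set V) (B : set W) :
  segment_closed A -> segment_closed B -> segment_closed (A `*` B).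
Proof.
move=> sA sB [x1 x2] [y1 y2] s [/= Ax Bx] [/= Ay By] s01.
by split; [exact: sA|exact: sB].
Qed.

Definition ibox (c1 c2 r : R) : set (R * R * R) :=
  (`[c1, c2] `*` `[- r, r]) `*` `[- r, r].

Lemma ibox_compact c1 c2 r : compact (ibox c1 c2 r).
Proof. by apply: compact_setX; [apply: compact_setX|]; exact: segment_compact. Qed.

Lemma ibox_segment_closed c1 c2 r : segment_closed (ibox c1 c2 r).
Proof.
by apply: setX_segment_closed; [apply: setX_segment_closed|];
  exact: itv_segment_closed.
Qed.

Lemma iboxP c1 c2 r c s u :
  ibox c1 c2 r (c, s, u) <-> c1 <= c <= c2 /\ `|s| <= r /\ `|u| <= r.
Proof.
rewrite /ibox/= !in_itv/= !ler_norml.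
by split=> [[[? ?] ?]|[? [? ?]]].
Qed.

End Rectangle.

Section SmoothOn.
Context {R : realType} {V W : normedModType R}.
Implicit Types (f : V -> W) (A O : set V).

Lemma Ck_derive k O f v : Ck k.+1 O f -> Ck k O ('D_v f).
Proof. by case=> _; exact. Qed.

Lemma Ck_differentiable k O f x : Ck k.+1 O f -> O x -> differentiable f x.
Proof. by case=> H _; exact: H. Qed.

End SmoothOn.

(** * The flow near the periodic orbit *)

(** In both nonlinear terms a factor can be split off: with F = Fs and p = vs, or
    F = Fu and p = vu, the quotient F / p is Lipschitz.  Along the segment sc
    that scales the coordinate p to zero, F / p is an average of the derivative
    of F, which is Lipschitz as F is C^2; no quotient is evaluated at p = 0. *)
Section Ratio.
Context {R : realType}.
Local Notation coord := (R * R * R)%type.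
Variables (F : coord * (R * R) -> R) (O : set (coord * (R * R))).
Variables (K0 : set coord) (Q : set (R * R)) (e : coord) (p : coord -> R).
Variable (sc : R -> coord -> coord).
Hypotheses (oO : open O) (FC : Ck 2 O F) (KO : K0 `*` Q `<=` O).
Hypotheses (cK : compact K0) (sK : segment_closed K0).
Hypotheses (cQ : compact Q) (sQ : segment_closed Q).
Local Notation E0 := ((e, 0) : coord * (R * R)).
Hypothesis sc_line : forall (th : R) (v : coord) (lam : R * R),
  (sc th v, lam) = (sc 0 v, lam) + th *: (p v *: E0).
Hypothesis sc1 : forall v, sc 1 v = v.
Hypothesis sc_K : forall th v, 0 <= th <= 1 -> K0 v -> K0 (sc th v).
Hypothesis sc_lip : forall th v v', 0 <= th <= 1 -> `|sc th v - sc th v'| <= `|v - v'|.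
Hypothesis sc_cen : forall th v, 0 <= th <= 1 ->
  `|sc th v - (vc v, 0, 0)| <= Num.max `|vs v| `|vu v|.
Hypothesis K_cen : forall v, K0 v -> K0 (vc v, 0, 0).
Hypothesis F0 : forall v lam, K0 v -> Q lam -> F (sc 0 v, lam) = 0.
Hypothesis DF0 : forall v lam, K0 v -> Q lam -> 'D_E0 F ((vc v, 0, 0), lam) = 0.

Let D (th : R) (v : coord) (lam : R * R) (hv : K0 v) (hl : Q lam) (h : 0 <= th <= 1) :
  is_derive th 1 (fun th => F (sc th v, lam)) (p v * 'D_E0 F (sc th v, lam)).
Proof.
have Oq : O (sc th v, lam) by apply: KO; split=> //=; exact: sc_K.
have dF : differentiable F (sc th v, lam) by exact: (Ck_differentiable FC).
have H := @is_derive_line _ _ _ F (sc 0 v, lam) (p v *: E0) th.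
rewrite -sc_line in H; move: (H dF); rewrite deriveZ_dir//.
by move=> H2; apply: der_ext H2 => s; rewrite -sc_line.
Qed.

Lemma ratio_lipschitz : exists2 L, 0 < L &
  (forall v lam, K0 v -> Q lam -> `|F (v, lam)| <= L * Num.max `|vs v| `|vu v| * `|p v|) /\
  (forall v v' lam lam', K0 v -> K0 v' -> Q lam -> Q lam' -> p v != 0 -> p v' != 0 ->
     `|F (v, lam) / p v - F (v', lam') / p v'| <= L * `|(v, lam) - (v', lam')|).
Proof.
have [L L0 HL] := @C1_lipschitz R _ _ _ FinSupR ('D_E0 F) O (K0 `*` Q) oO
  (Ck_derive E0 FC) (compact_setX cK cQ) (setX_segment_closed sK sQ) KO.
exists L => //; split=> [v lam Kv Ql|v v' lam lam' Kv Kv' Ql Ql' pv pv'].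
  have := @mvt_le_cst R R FinSupR (fun th => F (sc th v, lam))
    (fun th => p v * 'D_E0 F (sc th v, lam)) (L * Num.max `|vs v| `|vu v| * `|p v|)
    0 1 ler01.
  rewrite sc1 F0// !subr0 mulr1; apply; first by move=> t; exact: D.
  move=> t t01; rewrite normrM mulrC ler_wpM2r//.
  have := HL (sc t v, lam) ((vc v, 0, 0), lam).
  rewrite DF0// subr0 => H; apply: le_trans (H _ _) _.
  - by split=> //=; exact: sc_K.
  - by split=> //=; exact: K_cen.
  - rewrite ler_wpM2l ?(ltW L0)// norm_pairB subrr normr0 ge_max.
    by rewrite (sc_cen _ t01)/= le_max normr_ge0.
have := @mvt_le_cst R R FinSupR (fun th => (p v)^-1 * F (sc th v, lam) - (p v')^-1 * F (sc th v', lam'))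
    (fun th => 'D_E0 F (sc th v, lam) - 'D_E0 F (sc th v', lam'))
    (L * `|(v, lam) - (v', lam')|) 0 1 ler01.
rewrite !sc1 !F0// !mulr0 !subr0 mulr1 [_^-1 * F (v, _)]mulrC [_^-1 * F (v', _)]mulrC.
apply.
  move=> t t01; have H1 := der_scale (p v)^-1 (D Kv Ql t01).
  have H2 := der_scale (p v')^-1 (D Kv' Ql' t01).
  by apply: (der_eq (der_sub H1 H2)); rewrite !mulrA !mulVf// !mul1r.
move=> t t01; apply: le_trans (HL _ _ _ _) _.
- by split=> //=; exact: sc_K.
- by split=> //=; exact: sc_K.
rewrite ler_wpM2l ?(ltW L0)// norm_pairB [leRHS]norm_pairB ge_max.
by apply/andP; split; rewrite le_max ?lexx ?orbT// sc_lip.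
Qed.

End Ratio.

Section FlowBox.
Context {R : realType}.
Local Notation V := 'rV[R]_3.
Local Notation coord := (R * R * R)%type.

Lemma vs_le (v w : coord) : `|vs v - vs w| <= `|v - w|.
Proof. exact: le_trans (norm_snd (v - w).1) (norm_fst (v - w)). Qed.

Lemma vc_le (v w : coord) : `|vc v - vc w| <= `|v - w|.
Proof. exact: le_trans (norm_fst (v - w).1) (norm_fst (v - w)). Qed.

Lemma vu_le (v w : coord) : `|vu v - vu w| <= `|v - w|.
Proof. exact: (norm_snd (v - w)). Qed.

(** The quantitative content of the coordinates, on a box of radius [R0] that is
    small enough for the contraction and expansion rates to dominate the
    nonlinear terms: everything that is used of them later on. *)
Record flow_box (Q : set (R * R)) (f : V -> R * R -> V) (Psi : coord -> R * R -> V)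
    (alps alpu : R * R -> R) (Fs Fu : coord -> R * R -> R) (R0 beta K : R) : Prop := {
  fb_R0 : 0 < R0;
  fb_beta : 0 < beta;
  fb_K : 0 < K;
  fb_small : K * R0 <= beta;
  fb_alps : forall lam, Q lam -> alps lam <= - (2 * beta);
  fb_alpu : forall lam, Q lam -> 2 * beta <= alpu lam;
  fb_alpsK : forall lam, Q lam -> `|alps lam| <= K;
  fb_alpuK : forall lam, Q lam -> `|alpu lam| <= K;
  fb_alps_lip : forall lam lam', Q lam -> Q lam' -> `|alps lam - alps lam'| <= K * `|lam - lam'|;
  fb_alpu_lip : forall lam lam', Q lam -> Q lam' -> `|alpu lam - alpu lam'| <= K * `|lam - lam'|;
  fb_Fs : forall lam v, Q lam -> box R0 v ->
    `|Fs v lam| <= K * Num.max `|vs v| `|vu v| * `|vs v|;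
  fb_Fu : forall lam v, Q lam -> box R0 v ->
    `|Fu v lam| <= K * Num.max `|vs v| `|vu v| * `|vu v|;
  fb_Gs : forall lam lam' v v', Q lam -> Q lam' -> box R0 v -> box R0 v' ->
    vs v != 0 -> vs v' != 0 ->
    `|Fs v lam / vs v - Fs v' lam' / vs v'| <= K * Num.max `|v - v'| `|lam - lam'|;
  fb_Gu : forall lam lam' v v', Q lam -> Q lam' -> box R0 v -> box R0 v' ->
    vu v != 0 -> vu v' != 0 ->
    `|Fu v lam / vu v - Fu v' lam' / vu v'| <= K * Num.max `|v - v'| `|lam - lam'|;
  fb_Fs_lip : forall lam lam' v v', Q lam -> Q lam' -> box R0 v -> box R0 v' ->
    `|Fs v lam - Fs v' lam'| <= K * Num.max `|v - v'| `|lam - lam'|;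
  fb_Fu_lip : forall lam lam' v v', Q lam -> Q lam' -> box R0 v -> box R0 v' ->
    `|Fu v lam - Fu v' lam'| <= K * Num.max `|v - v'| `|lam - lam'|;
  fb_Psi_lip : forall lam lam' v v', Q lam -> Q lam' -> box R0 v -> box R0 v' ->
    `|Psi v lam - Psi v' lam'| <= K * Num.max `|v - v'| `|lam - lam'|;
  fb_ode : forall lam (v : R -> coord) (t : R), Q lam -> box R0 (v t) ->
    is_derive t 1 v (nf_field alps alpu Fs Fu lam (v t)) ->
    is_derive t 1 (fun t => Psi (v t) lam) (f (Psi (v t) lam) lam);
  fb_fibres : forall lam v w, Q lam -> box R0 v -> box R0 w ->
    (Psi v lam = Psi w lam <-> exists k : int, w = deck k v);
  fb_open : forall e, 0 < e -> exists2 r, 0 < r & forall lam v y, Q lam -> box (R0 / 2) v ->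
    `|y - Psi v lam| < r -> exists2 v', `|v' - v| < e & box R0 v' /\ Psi v' lam = y;
  fb_away : exists2 d, 0 < d & forall lam v, Q lam -> box R0 v -> d <= `|Psi v lam| }.

End FlowBox.

Lemma derive_line_ext {R : realType} {V1 V2 W : normedModType R} (f : V1 -> W) (g : V2 -> W)
    (a v : V1) (b w : V2) :
  (forall h : R, f (h *: v + a) = g (h *: w + b)) -> 'D_v f a = 'D_w g b.
Proof.
move=> H; rewrite /derive.
have ab : f a = g b by have := H 0; rewrite !scale0r !add0r.
rewrite (_ : (fun h => _) = fun h : R => h^-1 *: ((g \o shift b) (h *: w) - g b))//.
by apply/funext => h /=; rewrite H ab.
Qed.

Section LocalSurjection.
Context {R : realType}.
Local Notation V := 'rV[R]_3.
Local Notation coord := (R * R * R)%type.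

Definition coord_of_row (x : V) : coord := (x 0 0, x 0 1, x 0 2%:R).

Lemma coord_of_rowD x y : coord_of_row (x + y) = coord_of_row x + coord_of_row y.
Proof. by rewrite /coord_of_row !mxE. Qed.

Lemma coord_of_rowZ (a : R) x : coord_of_row (a *: x) = a *: coord_of_row x.
Proof. by rewrite /coord_of_row !mxE. Qed.

Lemma coord_of_row_sum n (a : 'I_n -> R) (x : 'I_n -> V) :
  coord_of_row (\sum_i a i *: x i) = \sum_i a i *: coord_of_row (x i).
Proof.
elim/big_rec2 : _ => [|i y1 y2 _ <-]; first by rewrite /coord_of_row !mxE.
by rewrite coord_of_rowD coord_of_rowZ.
Qed.

Lemma coord_of_row_eq0 x : coord_of_row x = 0 -> x = 0.
Proof.
move=> [h0 h1 h2]; apply/rowP => -[[|[|[|//]]] hi]; rewrite mxE.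
- by rewrite -[RHS]h0; congr (x _ _); exact: val_inj.
- by rewrite -[RHS]h1; congr (x _ _); exact: val_inj.
- by rewrite -[RHS]h2; congr (x _ _); exact: val_inj.
Qed.

Lemma coord_of_row_surj (w : coord) : exists x, coord_of_row x = w.
Proof.
case: w => [[c s] u]; exists (\row_j (if j == 0 then c else if j == 1 then s else u)).
by rewrite /coord_of_row !mxE.
Qed.

Lemma coord_of_row_norm x : `|coord_of_row x| <= `|x|.
Proof.
by have H i := @fs_le R _ (FinSuprV 3) i x; rewrite !norm_pair !ge_max !H.
Qed.

Lemma mulmx_norm n (M : 'M[R]_n) : exists2 C, 0 < C & forall x : 'rV[R]_n, `|x *m M| <= C * `|x|.
Proof.
have S0 : 0 <= \sum_i \sum_j `|M i j| by apply: sumr_ge0 => i _; apply: sumr_ge0.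
exists (\sum_i \sum_j `|M i j| + 1); first by rewrite ltr_wpDl.
move=> x; apply: fs_norm => [|j /=]; first by rewrite mulr_ge0// addr_ge0.
rewrite mxE; apply: le_trans (ler_norm_sum _ _ _) _.
have : (\sum_i \sum_j `|M i j|) * `|x| <= (\sum_i \sum_j `|M i j| + 1) * `|x|.
  by rewrite ler_wpM2r// lerDl.
apply: le_trans; rewrite mulr_suml; apply: ler_sum => i _.
rewrite normrM mulrC; apply: ler_pM => //; last exact: (fs_le (i : 'I_n)).
by rewrite (bigD1 j)//= lerDl; apply: sumr_ge0.
Qed.

(** The inverse function theorem, in the only form needed: a map whose
    differential in the first variable is injective takes all values near its
    value at a point, uniformly in nearby points and parameters. *)
Lemma local_surjection (G : coord * (R * R) -> V) U q0 :
  open U -> Ck 1 U G -> U q0 ->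
  (forall w : coord, w != 0 -> 'D_((w, 0) : coord * (R * R)) G q0 != 0) ->
  exists C r, [/\ 0 < C, 0 < r & forall (lam : R * R) (v : coord) (e : R) (y : V),
    `|(v, lam) - q0| < r -> 0 < e <= r -> `|y - G (v, lam)| <= e / C ->
    exists2 v', `|v' - v| <= e & G (v', lam) = y].
Proof.
move=> oU CG Uq0 inj.
pose A (w : coord) := 'D_((w, 0) : coord * (R * R)) G q0.
have dG : differentiable G q0 by exact: CG.1.
have PD (w1 w2 : coord) : ((w1 + w2, 0) : coord * (R * R)) = (w1, 0) + (w2, 0).
  by transitivity ((w1 + w2, 0 + 0) : coord * (R * R)) => //; rewrite addr0.
have PZ (a : R) (w : coord) : ((a *: w, 0) : coord * (R * R)) = a *: (w, 0).
  by transitivity ((a *: w, a *: 0) : coord * (R * R)) => //; rewrite scaler0.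
have AD w1 w2 : A (w1 + w2) = A w1 + A w2 by rewrite /A PD deriveD_dir.
have AZ (a : R) w : A (a *: w) = a *: A w by rewrite /A PZ deriveZ_dir.
have A0 : A 0 = 0 by rewrite -[0]addr0 -(scale0r 0) AD AZ scale0r addr0.
pose M : 'M[R]_3 := \matrix_i A (coord_of_row (delta_mx 0 i)).
have AM x : A (coord_of_row x) = x *m M.
  rewrite {1}(row_sum_delta x) coord_of_row_sum mulmx_sum_row.
  elim/big_rec2 : _ => // i y1 y2 _ <-; rewrite AD AZ; congr (_ *: _ + _).
  by apply/rowP => j; rewrite !mxE.
have uM : M \in unitmx.
  rewrite -row_free_unit; apply: inj_row_free => x; rewrite -AM => Ax.
  apply/coord_of_row_eq0/eqP; apply: contraT => /inj.
  by rewrite -/(A _) Ax eqxx.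
pose B y := coord_of_row (y *m invmx M).
have AB y : A (B y) = y by rewrite AM mulmxKV.
have BA w : B (A w) = w.
  by have [x <-] := coord_of_row_surj w; rewrite AM /B mulmxK.
have BD x y : B (x - y) = B x - B y.
  rewrite /B mulmxBl coord_of_rowD; congr (_ + _).
  by rewrite -scaleN1r coord_of_rowZ scaleN1r.
have [C C0 HC] := mulmx_norm (invmx M).
have BC y : `|B y| <= C * `|y| by apply: le_trans (coord_of_row_norm _) (HC _).
have e0 : 0 < (2 * C)^-1 by rewrite invr_gt0 mulr_gt0.
have [r r0 Hr] := C1_strict oU CG Uq0 e0.
exists (2 * C), (r / 2); split=> [||lam v e y vr /andP[he er] hy].
- by rewrite mulr_gt0.
- by rewrite divr_gt0.
have near w : `|w - v| <= e -> `|(w, lam) - q0| < r.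
  move=> wv; have := ler_distD ((v, lam) : coord * (R * R)) (w, lam) q0.
  have -> : `|((w, lam) : coord * (R * R)) - (v, lam)| = `|w - v|.
    by rewrite norm_pairB max_normBl.
  by move: vr wv er; lra.
have [||v' v'v fv'] := @fixed_point_ball R coord _ (fun w => w - B (G (w, lam) - y)) v e.
- move=> w1 w2 w1v w2v.
  have -> : w1 - B (G (w1, lam) - y) - (w2 - B (G (w2, lam) - y)) =
     - B (G (w1, lam) - G (w2, lam) - A (w1 - w2)).
    have E (a b c d : coord) : a - b - (c - d) = (a - c) - (b - d).
      by rewrite !opprD !opprK addrACA.
    rewrite !BD BA E [RHS]opprB; congr (_ - _).
    by rewrite opprB addrA subrK.
  rewrite normrN; apply: le_trans (BC _) _.
  have := Hr (w1, lam) (w2, lam) (near _ w1v) (near _ w2v).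
  have -> : ((w1, lam) : coord * (R * R)) - (w2, lam) = (w1 - w2, 0).
    by transitivity ((w1 - w2, lam - lam) : coord * (R * R)) => //; rewrite subrr.
  rewrite norm_pair normr0 (max_idPl (normr_ge0 _)) -/(A _) => H.
  have : C * `|G (w1, lam) - G (w2, lam) - A (w1 - w2)| <= C * ((2 * C)^-1 * `|w1 - w2|).
    by rewrite ler_wpM2l// ltW.
  move/le_trans; apply; rewrite le_eqVlt; apply/orP; left; apply/eqP; field.
  by rewrite gt_eqF.
- rewrite addrAC subrr add0r normrN; apply: le_trans (BC _) _; rewrite distrC.
  have : C * `|y - G (v, lam)| <= C * (e / (2 * C)) by rewrite ler_wpM2l// ltW.
  move/le_trans; apply; rewrite le_eqVlt; apply/orP; left; apply/eqP; field.
  by rewrite gt_eqF.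
exists v' => //; have Bz : B (G (v', lam) - y) = 0.
  by apply: oppr_inj; rewrite oppr0 -[LHS](addKr v') fv' addNr.
by apply/eqP; rewrite -subr_eq0 -[X in X == _]AB Bz A0.
Qed.

End LocalSurjection.

Section FlowBoxExists.
Context {R : realType}.
Local Notation V := 'rV[R]_3.
Local Notation coord := (R * R * R)%type.

Lemma norm_shuffle (c s u c' s' u' : R) (lam lam' : R * R) :
  `|(((c, s), u), lam) - (((c', s'), u'), lam')| =
  Num.max `|c - c'| `|((s, u), lam) - ((s', u'), lam')|.
Proof. by rewrite !norm_pairB !maxA. Qed.

Lemma boxP r (c s u : R) : box r (c, s, u) <-> `|s| <= r /\ `|u| <= r.
Proof. by []. Qed.

Lemma four_pi_gt0 : 0 < 4 * pi :> R.
Proof. by rewrite mulr_gt0// pi_gt0. Qed.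

(** By periodicity in v^c a Lipschitz bound on a compact part of the box holds
    on the whole of it. *)
Lemma extend_lipschitz {W : normedModType R} (H : coord -> R * R -> W)
    (A : coord -> R * R -> Prop) (L : R) :
  0 <= L -> (forall c c' s u lam, A (c, s, u) lam -> A (c', s, u) lam) ->
  (forall c s u lam, A (c, s, u) lam -> H (c + 4 * pi, s, u) lam = H (c, s, u) lam) ->
  (forall v v' lam lam', A v lam -> A v' lam' ->
     - (4 * pi) <= vc v <= 2 * (4 * pi) -> - (4 * pi) <= vc v' <= 2 * (4 * pi) ->
     `|H v lam - H v' lam'| <= L * `|(v, lam) - (v', lam')|) ->
  forall v v' lam lam', A v lam -> A v' lam' ->
     `|H v lam - H v' lam'| <= L * Num.max `|v - v'| `|lam - lam'|.
Proof.
move=> L0 Ac Hper HL [[c s] u] [[c' s'] u'] lam lam' Av Av'.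
have := @periodic_lipschitz R ((R * R) * (R * R))%type W
  (fun c x => H (c, x.1.1, x.1.2) x.2) [set x | A (0, x.1.1, x.1.2) x.2] (4 * pi) L
  four_pi_gt0 L0 _ _ c c' ((s, u), lam) ((s', u'), lam').
rewrite -norm_shuffle norm_pairB; apply.
- by move=> d [[s1 u1] l1] /= /Ac A1; exact: Hper.
- move=> d d' [[s1 u1] l1] [[s2 u2] l2] hd hd' /= A1 A2; rewrite -norm_shuffle.
  by apply: HL => //; [exact: Ac A1|exact: Ac A2].
- exact: Ac Av.
- exact: Ac Av'.
Qed.

Variables (a1 b1 a2 b2 : R) (f : V -> R * R -> V) (P : R -> R * R -> V).
Let Q : set (R * R) := `[a1, b1] `*` `[a2, b2].
Variables (rho : R) (Psi : coord -> R * R -> V).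
Variables (alps alpu : R * R -> R) (Fs Fu : coord -> R * R -> R).
Hypothesis f0 : forall lam, Q lam -> f 0 lam = 0.
Hypothesis hPsi : floquet_coordinates Q f P rho Psi alps alpu Fs Fu.

Let cQ : compact Q.
Proof. by apply: compact_setX; exact: segment_compact. Qed.

Let sQ : segment_closed Q.
Proof. by apply: setX_segment_closed; exact: itv_segment_closed. Qed.

Let K0 : set coord := ibox (- (4 * pi)) (2 * (4 * pi)) rho.

Let K0_box v : K0 v -> box rho v.
Proof. by case: v => [[c s] u] /iboxP[_ H]; apply/boxP. Qed.

Let K0I v : box rho v -> - (4 * pi) <= vc v <= 2 * (4 * pi) -> K0 v.
Proof. by case: v => [[c s] u] /boxP H /= hc; apply/iboxP; split. Qed.

Lemma smooth_lipschitz {W : normedModType R} {fW : FinSup W} (H : coord -> R * R -> W) :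
  smooth_on (box rho `*` Q) (fun q => H q.1 q.2) ->
  (forall c s u lam, box rho (c, s, u) -> Q lam -> H (c + 4 * pi, s, u) lam = H (c, s, u) lam) ->
  exists2 L, 0 < L & forall v v' lam lam', box rho v -> box rho v' -> Q lam -> Q lam' ->
     `|H v lam - H v' lam'| <= L * Num.max `|v - v'| `|lam - lam'|.
Proof.
move=> [U [oO AO CO]] Hper.
have [L L0 HL] := @C1_lipschitz R _ W _ fW _ U (K0 `*` Q) oO (CO 1%N)
  (compact_setX (@ibox_compact _ _ _ _) cQ)
  (setX_segment_closed (@ibox_segment_closed _ _ _ _) sQ)
  (subset_trans (fun q (hq : (K0 `*` Q) q) => conj (K0_box hq.1) hq.2) AO).
exists L => // v v' lam lam' bv bv' ql ql'.
apply: (@extend_lipschitz W H (fun v lam => box rho v /\ Q lam)) => //; first exact: ltW.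
- by move=> c s u l [b q]; exact: Hper.
- move=> w w' l l' [bw qw] [bw' qw'] cw cw'.
  by apply: (HL (w, l) (w', l')); split=> //=; exact: K0I.
Qed.

Lemma smooth_lam (h : R * R -> R) : smooth_on Q h ->
  (forall lam, Q lam -> {for lam, continuous h}) /\
  exists2 L, 0 < L & forall lam lam', Q lam -> Q lam' -> `|h lam - h lam'| <= L * `|lam - lam'|.
Proof.
move=> [U [oO AO CO]]; split.
  by move=> lam /AO Ol; exact: (CO 0%N).
by have [L L0 HL] := C1_lipschitz oO (CO 1%N) cQ sQ AO; exists L.
Qed.

Lemma positive_on_compact (h : R * R -> R) :
  (forall lam, Q lam -> {for lam, continuous h}) -> (forall lam, Q lam -> 0 < h lam) ->
  exists2 m, 0 < m & forall lam, Q lam -> m <= h lam.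
Proof.
move=> ch h0; apply: (compact_unif cQ (P := fun lam r => r <= h lam)).
  by move=> lam r r' H /andP[_ r'r]; exact: le_trans r'r H.
move=> lam Ql; have hl : 0 < h lam / 2 by rewrite divr_gt0// h0.
have [d d0 B] := (ctsP h lam).1 (ch lam Ql) _ hl.
exists (Num.min d (h lam / 2)); first by rewrite lt_min d0.
move=> l _; rewrite lt_min => /andP[/B + _]; rewrite ltr_norml => /andP[H _].
by rewrite ge_min; apply/orP; right; lra.
Qed.

Let Psi_per c s u lam : box rho (c, s, u) -> Q lam -> Psi (c + 4 * pi, s, u) lam = Psi (c, s, u) lam.
Proof.
move=> b Ql; apply/esym/(fc_fibres hPsi) => //; exists 2.
rewrite /deck (_ : (-1 : R) ^ 2 = 1); last by rewrite -exprnP expr2 mulrNN mulr1.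
by rewrite /vc /vs /vu/= !mul1r; congr (_ + _, _, _); ring.
Qed.

Lemma ratio_s : exists2 L, 0 < L &
  (forall v lam, box rho v -> Q lam -> `|Fs v lam| <= L * Num.max `|vs v| `|vu v| * `|vs v|) /\
  (forall v v' lam lam', box rho v -> box rho v' -> Q lam -> Q lam' -> vs v != 0 -> vs v' != 0 ->
     `|Fs v lam / vs v - Fs v' lam' / vs v'| <= L * Num.max `|v - v'| `|lam - lam'|).
Proof.
have [U [oO AO CO]] := fc_smooth_Fs hPsi.
pose sc (th : R) (v : coord) : coord := (vc v, th * vs v, vu v).
have KO : K0 `*` Q `<=` U by move=> [v l] [kv ql]; apply: AO; split=> //; exact: K0_box.
have line (th : R) (v : coord) (lam : R * R) :
    (sc th v, lam) = (sc 0 v, lam) + th *: (vs v *: (((0, 1, 0), 0) : coord * (R * R))).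
  case: v => [[c s] u]; case: lam => l1 l2; rewrite /sc/=.
  transitivity ((c + th * (s * 0), 0 * s + th * (s * 1), u + th * (s * 0)),
    (l1 + th * (s * 0), l2 + th * (s * 0))); last by [].
  by rewrite !mulr0 !mulr1 mul0r !addr0 add0r.
have [|||||||L L0 [HL1 HL2]] := @ratio_lipschitz R (fun q => Fs q.1 q.2) U K0 Q (0, 1, 0) vs sc
  oO (CO 2%N) KO (@ibox_compact _ _ _ _) (@ibox_segment_closed _ _ _ _) cQ sQ line.
- by move=> [[c s] u]; rewrite /sc/= /vs/= mul1r.
- move=> th [[c s] u] /andP[t0 t1] /iboxP[hc [hs hu]]; apply/iboxP; split=> //; split=> //.
  by rewrite normrM ger0_norm// (le_trans _ hs)// ler_piMl.
- move=> th [[c s] u] [[c' s'] u'] /andP[t0 t1]; rewrite /sc/= /vs/= /vc/= /vu/=.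
  rewrite !norm_pairB -mulrBr normrM (ger0_norm t0) !ge_max !le_max !lexx/= ?orbT/= andbT.
  by rewrite (_ : th * `|s - s'| <= `|s - s'|) ?orbT// ler_piMl.
- move=> th [[c s] u] /andP[t0 t1]; rewrite /sc/= /vs/= /vc/= /vu/=.
  rewrite !norm_pairB subrr !subr0 normr0 normrM (ger0_norm t0) !ge_max !le_max.
  by rewrite normr_ge0 lexx orbT andbT/= ler_piMl.
- move=> [[c s] u] /iboxP[hc [hs hu]]; apply/iboxP; rewrite normr0.
  by rewrite (le_trans _ hs).
- move=> [[c s] u] lam kv ql; rewrite /sc/= mul0r (fc_Fs0 hPsi)//.
  by have /K0_box/boxP[] := kv.
- move=> [[c s] u] lam kv ql; apply: etrans (fc_DFs0 hPsi c ql).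
  have [rs _] := K0_box kv.
  have b0 : box rho (c, 0, 0) by apply/boxP; rewrite normr0 (le_trans _ rs).
  have dF : differentiable (fun q => Fs q.1 q.2) ((c, 0, 0), lam).
    by apply: (Ck_differentiable (CO 1%N)); apply: AO; split.
  have := @is_derive_line _ _ _ (fun q => Fs q.1 q.2) ((c, 0, 0), lam) ((0, 1, 0), 0) 0.
  rewrite scale0r addr0 => /(_ dF) /(der_ext (g := fun s1 => Fs (c, s1, 0) lam)) H.
  rewrite derive1E; have [t1|_ ->//] := H.
  case: (lam) => l1 l2; transitivity (Fs (c + t1 * 0, 0 + t1 * 1, 0 + t1 * 0) (l1 + t1 * 0, l2 + t1 * 0)) => //.
  by rewrite !mulr0 mulr1 !addr0 add0r.
exists L => //; split.
  move=> [[c s] u] lam b ql; have [k /andP[k0 kT]] := shift_period c four_pi_gt0.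
  have -> : Fs (c, s, u) lam = Fs (c - 4 * pi * k%:~R, s, u) lam.
    have := @periodicz R _ (fun c => Fs (c, s, u) lam) (4 * pi) _ c (- k).
    by rewrite mulrNz mulrN => ->// c'; rewrite (fc_per_Fs hPsi).
  apply: HL1 => //; apply: K0I => //=; rewrite /vc/=.
  by have h4 := four_pi_gt0; apply/andP; split; lra.
move=> v v' lam lam' bv bv' ql ql' sv sv'.
apply: (@extend_lipschitz R (fun v lam => Fs v lam / vs v)
   (fun v lam => [/\ box rho v, Q lam & vs v != 0])) => //; first exact: ltW.
- by move=> c s u l [b q _]; rewrite (fc_per_Fs hPsi).
- move=> w w' l l' [bw qw sw] [bw' qw' sw'] cw cw'.
  by apply: HL2 => //; exact: K0I.
Qed.

Lemma ratio_u : exists2 L, 0 < L &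
  (forall v lam, box rho v -> Q lam -> `|Fu v lam| <= L * Num.max `|vs v| `|vu v| * `|vu v|) /\
  (forall v v' lam lam', box rho v -> box rho v' -> Q lam -> Q lam' -> vu v != 0 -> vu v' != 0 ->
     `|Fu v lam / vu v - Fu v' lam' / vu v'| <= L * Num.max `|v - v'| `|lam - lam'|).
Proof.
have [U [oO AO CO]] := fc_smooth_Fu hPsi.
pose sc (th : R) (v : coord) : coord := (vc v, vs v, th * vu v).
have KO : K0 `*` Q `<=` U by move=> [v l] [kv ql]; apply: AO; split=> //; exact: K0_box.
have line (th : R) (v : coord) (lam : R * R) :
    (sc th v, lam) = (sc 0 v, lam) + th *: (vu v *: (((0, 0, 1), 0) : coord * (R * R))).
  case: v => [[c s] u]; case: lam => l1 l2; rewrite /sc/=.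
  transitivity ((c + th * (u * 0), s + th * (u * 0), 0 * u + th * (u * 1)),
    (l1 + th * (u * 0), l2 + th * (u * 0))); last by [].
  by rewrite !mulr0 !mulr1 mul0r !addr0 add0r.
have [|||||||L L0 [HL1 HL2]] := @ratio_lipschitz R (fun q => Fu q.1 q.2) U K0 Q (0, 0, 1) vu sc
  oO (CO 2%N) KO (@ibox_compact _ _ _ _) (@ibox_segment_closed _ _ _ _) cQ sQ line.
- by move=> [[c s] u]; rewrite /sc/= /vu/= mul1r.
- move=> th [[c s] u] /andP[t0 t1] /iboxP[hc [hs hu]]; apply/iboxP; split=> //; split=> //.
  by rewrite normrM ger0_norm// (le_trans _ hu)// ler_piMl.
- move=> th [[c s] u] [[c' s'] u'] /andP[t0 t1]; rewrite /sc/= /vs/= /vc/= /vu/=.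
  rewrite !norm_pairB -mulrBr normrM (ger0_norm t0) !ge_max !le_max !lexx/= ?orbT/=.
  by rewrite (_ : th * `|u - u'| <= `|u - u'|) ?orbT// ler_piMl.
- move=> th [[c s] u] /andP[t0 t1]; rewrite /sc/= /vs/= /vc/= /vu/=.
  rewrite !norm_pairB subrr !subr0 normr0 normrM (ger0_norm t0) !ge_max !le_max.
  by rewrite normr_ge0 lexx/= (_ : th * `|u| <= `|u|) ?orbT// ler_piMl.
- move=> [[c s] u] /iboxP[hc [hs hu]]; apply/iboxP; rewrite normr0.
  by rewrite (le_trans _ hs).
- move=> [[c s] u] lam kv ql; rewrite /sc/= mul0r (fc_Fu0 hPsi)//.
  by have /K0_box/boxP[] := kv.
- move=> [[c s] u] lam kv ql; apply: etrans (fc_DFu0 hPsi c ql).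
  have [rs _] := K0_box kv.
  have b0 : box rho (c, 0, 0) by apply/boxP; rewrite normr0 (le_trans _ rs).
  have dF : differentiable (fun q => Fu q.1 q.2) ((c, 0, 0), lam).
    by apply: (Ck_differentiable (CO 1%N)); apply: AO; split.
  have := @is_derive_line _ _ _ (fun q => Fu q.1 q.2) ((c, 0, 0), lam) ((0, 0, 1), 0) 0.
  rewrite scale0r addr0 => /(_ dF) /(der_ext (g := fun s1 => Fu (c, 0, s1) lam)) H.
  rewrite derive1E; have [t1|_ ->//] := H.
  case: (lam) => l1 l2; transitivity (Fu (c + t1 * 0, 0 + t1 * 0, 0 + t1 * 1) (l1 + t1 * 0, l2 + t1 * 0)) => //.
  by rewrite !mulr0 mulr1 !addr0 add0r.
exists L => //; split.
  move=> [[c s] u] lam b ql; have [k /andP[k0 kT]] := shift_period c four_pi_gt0.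
  have -> : Fu (c, s, u) lam = Fu (c - 4 * pi * k%:~R, s, u) lam.
    have := @periodicz R _ (fun c => Fu (c, s, u) lam) (4 * pi) _ c (- k).
    by rewrite mulrNz mulrN => ->// c'; rewrite (fc_per_Fu hPsi).
  apply: HL1 => //; apply: K0I => //=; rewrite /vc/=.
  by have h4 := four_pi_gt0; apply/andP; split; lra.
move=> v v' lam lam' bv bv' ql ql' sv sv'.
apply: (@extend_lipschitz R (fun v lam => Fu v lam / vu v)
   (fun v lam => [/\ box rho v, Q lam & vu v != 0])) => //; first exact: ltW.
- by move=> c s u l [b q _]; rewrite (fc_per_Fu hPsi).
- move=> w w' l l' [bw qw sw] [bw' qw' sw'] cw cw'.
  by apply: HL2 => //; exact: K0I.
Qed.

Lemma Psi_away r : r <= rho -> exists2 d, 0 < d & forall lam v, Q lam -> box r v ->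
  d <= `|Psi v lam|.
Proof.
move=> rrho; have [U [oO AO CO]] := fc_smooth_Psi hPsi.
have brho v : box r v -> box rho v by move=> [b1' b2']; split; apply: le_trans rrho.
have [|||d d0 H] := @compact_unif R _ (ibox 0 (4 * pi) r `*` Q) (fun q d => d <= `|Psi q.1 q.2|).
- by apply: compact_setX => //; exact: ibox_compact.
- by move=> q d d' H /andP[_ dd]; exact: le_trans dd H.
- move=> [[[c s] u] lam] [/= /iboxP[_ b] ql]; have bv : box rho (c, s, u) by exact: brho.
  have P0 : 0 < `|Psi (c, s, u) lam| / 2.
    rewrite divr_gt0// normr_gt0; apply/eqP => Pz.
    have := fc_immersion hPsi ql bv (dv := nf_field alps alpu Fs Fu lam (c, s, u)).
    rewrite (fc_ode hPsi)// Pz f0// eqxx => H; suff : false by [].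
    by apply: H; apply/eqP => -[/eqP]; rewrite oner_eq0.
  have cP : {for ((c, s, u), lam), continuous (fun q => Psi q.1 q.2)}.
    by apply: (CO 0%N); apply: AO; split.
  have [d d0 B] := (ctsP _ _).1 cP _ P0.
  exists (Num.min d (`|Psi (c, s, u) lam| / 2)); first by rewrite lt_min d0.
  move=> [v l] _; rewrite lt_min => /andP[/B/= H _].
  rewrite ge_min; apply/orP; right.
  by have := lerB_dist (Psi (c, s, u) lam) (Psi v l); rewrite distrC; move: H; rewrite distrC; lra.
exists d => // lam [[c s] u] ql bv; have [k /andP[k0 kT]] := shift_period c four_pi_gt0.
have -> : Psi (c, s, u) lam = Psi (c - 4 * pi * k%:~R, s, u) lam.
  have := @periodicz R _ (fun c => Psi (c, s, u) lam) (4 * pi) _ c (- k).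
  by rewrite mulrNz mulrN => ->// c'; rewrite Psi_per//; exact: brho.
apply: (H ((_, s, u), lam)); split=> //=; apply/iboxP; split=> //.
by apply/andP; split.
Qed.

Let derive_partial (v w : coord) (lam : R * R) :
  'D_((w, 0) : coord * (R * R)) (fun q => Psi q.1 q.2) (v, lam) = 'D_w (Psi ^~ lam) v.
Proof.
apply: derive_line_ext => h; transitivity (Psi (h *: w + v) (h *: 0 + lam)) => //.
by rewrite scaler0 add0r.
Qed.

Lemma Psi_open r e : 0 < r -> 2 * r <= rho -> 0 < e ->
  exists2 d, 0 < d & forall lam v y, Q lam -> box r v ->
    `|y - Psi v lam| < d -> exists2 v', `|v' - v| < e & box (2 * r) v' /\ Psi v' lam = y.
Proof.
move=> r0 rrho e0; have [U [oU AU CU]] := fc_smooth_Psi hPsi.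
have rr : r <= rho by lra.
have brho v : box r v -> box rho v by move=> [b1' b2']; split; apply: le_trans rr.
pose m := Num.min e r.
have m0 : 0 < m by rewrite lt_min e0.
have [|||d d0 H] := @compact_unif R _ (ibox 0 (4 * pi) r `*` Q) (fun q d => forall y,
   `|y - Psi q.1 q.2| < d -> exists2 v', `|v' - q.1| < m & Psi v' q.2 = y).
- by apply: compact_setX => //; exact: ibox_compact.
- by move=> q d d' H /andP[_ dd] y hy; apply: H; exact: lt_le_trans dd.
- move=> [[[c s] u] lam] [/= /iboxP[_ b] ql]; have bv : box rho (c, s, u) by exact: brho.
  have [||C [d [C0 d0 Hd]]] := @local_surjection R (fun q => Psi q.1 q.2) U ((c, s, u), lam) oU (CU 1%N).
  + by apply: AU; split.
  + by move=> w w0; rewrite derive_partial; exact: (fc_immersion hPsi).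
  pose e1 := Num.min (m / 2) d.
  have e10 : 0 < e1 by rewrite lt_min d0 divr_gt0.
  exists (Num.min d (e1 / C)); first by rewrite lt_min d0 divr_gt0.
  move=> [v l] _; rewrite lt_min => /andP[vd _] y; rewrite lt_min => /andP[_ hy].
  have [|v' v'v E] := Hd l v e1 y vd _ (ltW hy).
    by rewrite e10 /e1 ge_min lexx orbT.
  exists v' => //; apply: le_lt_trans v'v _.
  by rewrite /e1 gt_min; apply/orP; left; lra.
exists d => // lam [[c s] u] y ql bv.
have [k /andP[k0 kT]] := shift_period c four_pi_gt0.
have E c1 s1 u1 (k1 : int) : box rho (c1, s1, u1) ->
    Psi (c1 + 4 * pi * k1%:~R, s1, u1) lam = Psi (c1, s1, u1) lam.
  move=> b; apply: (@periodicz R _ (fun c => Psi (c, s1, u1) lam)) => c'.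
  by rewrite Psi_per.
rewrite -(E _ _ _ (- k)) ?mulrNz ?mulrN; last exact: brho.
have Iq : (ibox 0 (4 * pi) r `*` Q) ((c - 4 * pi * k%:~R, s, u), lam).
  by split=> //=; apply/iboxP; split=> //; apply/andP.
move=> /(H _ Iq)[[[c' s'] u'] /= v'v E'].
move: v'v; rewrite !norm_pairB !gt_max => /andP[/andP[hc hs] hu].
have mr : m <= r by rewrite ge_min lexx orbT.
have me : m <= e by rewrite ge_min lexx.
have bs : box (2 * r) (c' + 4 * pi * k%:~R, s', u').
  have [/= b1' b2'] := bv; split=> /=.
    by have := ler_normD (s' - s) s; rewrite subrK; move: b1'; rewrite /vs/=; lra.
  by have := ler_normD (u' - u) u; rewrite subrK; move: b2'; rewrite /vu/=; lra.
exists (c' + 4 * pi * k%:~R, s', u').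
  rewrite !norm_pairB !gt_max (lt_le_trans hs)// (lt_le_trans hu)//= !andbT.
  by apply: lt_le_trans me; rewrite (_ : _ - c = c' - (c - 4 * pi * k%:~R))//; ring.
split=> //; rewrite E//.
by case: bs => b1' b2'; split; [apply: le_trans b1' _|apply: le_trans b2' _].
Qed.

(** The radius is chosen after all constants, to make K R0 <= beta. *)
Lemma flow_box_exists : exists R0 beta K, R0 <= rho /\
  flow_box Q f Psi alps alpu Fs Fu R0 beta K.
Proof.
have rho0 := fc_rho hPsi.
have [L1 L10 [H1a H1b]] := ratio_s.
have [L2 L20 [H2a H2b]] := ratio_u.
have [L3 L30 H3] := smooth_lipschitz (fc_smooth_Fs hPsi)
  (fun c s u lam b q => fc_per_Fs hPsi q b).
have [L4 L40 H4] := smooth_lipschitz (fc_smooth_Fu hPsi)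
  (fun c s u lam b q => fc_per_Fu hPsi q b).
have [L5 L50 H5] := smooth_lipschitz (fc_smooth_Psi hPsi)
  (fun c s u lam b q => Psi_per b q).
have [c6 [L6 L60 H6]] := smooth_lam (fc_smooth_alps hPsi).
have [c7 [L7 L70 H7]] := smooth_lam (fc_smooth_alpu hPsi).
have [L8 L80 H8] := cts_bounded cQ c6.
have [L9 L90 H9] := cts_bounded cQ c7.
have [m1 m10 Hm1] : exists2 m, 0 < m & forall lam, Q lam -> m <= - alps lam.
  apply: positive_on_compact => lam ql.
    by apply: continuousN; exact: c6.
  by have /andP[] := fc_exponents hPsi ql; rewrite oppr_gt0.
have [m2 m20 Hm2] : exists2 m, 0 < m & forall lam, Q lam -> m <= alpu lam.
  by apply: positive_on_compact => // lam ql; have /andP[] := fc_exponents hPsi ql.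
pose beta := Num.min m1 m2 / 2.
have beta0 : 0 < beta by rewrite divr_gt0// lt_min m10.
pose K := L1 + L2 + L3 + L4 + L5 + L6 + L7 + L8 + L9.
have K0' : 0 < K by rewrite /K !addr_gt0.
pose R0 := Num.min rho (beta / K).
have R00 : 0 < R0 by rewrite lt_min rho0 divr_gt0.
have Rrho : R0 <= rho by rewrite ge_min lexx.
have br v : box R0 v -> box rho v.
  by move=> [b1' b2']; split; [apply: le_trans b1' _|apply: le_trans b2' _].
have up L t x : L <= K -> 0 <= t -> x <= L * t -> x <= K * t.
  by move=> LK t0 /le_trans; apply; rewrite ler_wpM2r.
have mx (a b : R) : 0 <= Num.max `|a| `|b| by rewrite le_max normr_ge0.
have mx3 (a b c : R) : 0 <= Num.max `|a| `|b| * `|c| by rewrite mulr_ge0.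
have mv (v v' : coord) (l l' : R * R) : 0 <= Num.max `|v - v'| `|l - l'|.
  by rewrite le_max normr_ge0.
exists R0, beta, K; split=> //; split=> //.
- by rewrite mulrC -ler_pdivlMr// ge_min lexx orbT.
- move=> lam ql; rewrite /beta mulrC divfK// lerNr.
  by apply: le_trans (Hm1 lam ql); rewrite ge_min lexx.
- move=> lam ql; have := Hm2 lam ql; rewrite /beta mulrC divfK//.
  by apply: le_trans; rewrite ge_min lexx orbT.
- by move=> lam ql; apply: le_trans (H8 lam ql) _; rewrite /K; lra.
- by move=> lam ql; apply: le_trans (H9 lam ql) _; rewrite /K; lra.
- by move=> l l' q q'; apply: (up L6) => //; [rewrite /K; lra|exact: H6].
- by move=> l l' q q'; apply: (up L7) => //; [rewrite /K; lra|exact: H7].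
- move=> l v q b; rewrite -mulrA; apply: (up L1) => //; first by rewrite /K; lra.
  by rewrite mulrA; apply: H1a => //; exact: br.
- move=> l v q b; rewrite -mulrA; apply: (up L2) => //; first by rewrite /K; lra.
  by rewrite mulrA; apply: H2a => //; exact: br.
- move=> l l' v v' q q' b b' n n'; apply: (up L1) => //; first by rewrite /K; lra.
  by apply: H1b => //; exact: br.
- move=> l l' v v' q q' b b' n n'; apply: (up L2) => //; first by rewrite /K; lra.
  by apply: H2b => //; exact: br.
- move=> l l' v v' q q' b b'; apply: (up L3) => //; first by rewrite /K; lra.
  by apply: H3 => //; exact: br.
- move=> l l' v v' q q' b b'; apply: (up L4) => //; first by rewrite /K; lra.
  by apply: H4 => //; exact: br.
- move=> l l' v v' q q' b b'; apply: (up L5) => //; first by rewrite /K; lra.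
  by apply: H5 => //; exact: br.
- move=> lam v t ql b Dv; have [U [oU AU CU]] := fc_smooth_Psi hPsi.
  have dG : differentiable (fun q => Psi q.1 q.2) (v t, lam).
    by apply: (Ck_differentiable (CU 1%N)); apply: AU; split=> //=; exact: br.
  have := chain_rule (is_derive_pair Dv (der_cst lam t)) dG.
  by rewrite derive_partial (fc_ode hPsi)//; exact: br.
- by move=> lam v w ql bv bw; apply: (fc_fibres hPsi) => //; exact: br.
- move=> e e0; have [|||d d0 Hd] := @Psi_open (R0 / 2) e => //.
  + by rewrite divr_gt0.
  + by rewrite mulrC divfK.
  exists d => // lam v y ql bv /(Hd _ _ _ ql bv).
  by rewrite mulrC divfK.
- exact: Psi_away.
Qed.

End FlowBoxExists.

(** * Orbits in a flow box *)

Section Monotone.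
Context {R : realType}.

Lemma nonincreasing_der (y dy : R -> R) (a b : R) : a <= b ->
  deriv_on a b y dy ->
  (forall t, a <= t <= b -> dy t <= 0) -> y b <= y a.
Proof.
move=> ab Hy Hdy; rewrite -subr_le0.
have := @mvt_le_scalar R y dy (cst 0) (cst 0) a b ab Hy (fun t _ => der_cst 0 t) Hdy.
by rewrite subrr.
Qed.

Lemma nondecreasing_der (y dy : R -> R) (a b : R) : a <= b ->
  deriv_on a b y dy ->
  (forall t, a <= t <= b -> 0 <= dy t) -> y a <= y b.
Proof.
move=> ab Hy Hdy; rewrite -subr_ge0.
have := @mvt_le_scalar R (cst 0) (cst 0) y dy a b ab (fun t _ => der_cst 0 t) Hy Hdy.
by rewrite subrr.
Qed.

Lemma ivt_le (g : R -> R) (a b m : R) : a <= b ->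
  (forall t, a <= t <= b -> {for t, continuous g}) -> g a <= m <= g b ->
  exists2 t, a <= t <= b & g t = m.
Proof.
move=> ab cg /andP[am mb].
have [||t tab E] := @IVT R g a b m ab.
- by apply: continuous_in_subspaceT => t /[!inE]/= /[!in_itv]/=; exact: cg.
- by rewrite ge_min am le_max mb orbT.
by exists t => //; move: tab; rewrite in_itv.
Qed.

Lemma ivt_ge (g : R -> R) (a b m : R) : a <= b ->
  (forall t, a <= t <= b -> {for t, continuous g}) -> g b <= m <= g a ->
  exists2 t, a <= t <= b & g t = m.
Proof.
move=> ab cg /andP[am mb].
have [||t tab E] := @IVT R g a b m ab.
- by apply: continuous_in_subspaceT => t /[!inE]/= /[!in_itv]/=; exact: cg.
- by rewrite ge_min am orbT le_max mb.
by exists t => //; move: tab; rewrite in_itv.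
Qed.

Lemma norm_continuous {W : normedModType R} (g : R -> W) (t : R) : {for t, continuous g} -> {for t, continuous (fun t => `|g t|)}.
Proof. by move=> cg; exact: (@cvg_norm _ _ _ (nbhs t) _ g). Qed.

Lemma ler_norm_sqr (x y : R) : x ^+ 2 <= y ^+ 2 -> `|x| <= `|y|.
Proof. by rewrite -real_normK ?num_real// -[y ^+ 2]real_normK ?num_real// ler_sqr ?nnegrE. Qed.

End Monotone.

Section FieldLip.
Context {R : realType}.
Local Notation V := 'rV[R]_3.

Definition field_lip (Q : set (R * R)) (f : V -> R * R -> V) : Prop :=
  forall M : R, exists2 Kf, 0 < Kf & forall (lam lam' : R * R) (x y : V), Q lam -> Q lam' ->
    `|x| <= M -> `|y| <= M -> `|f x lam - f y lam'| <= Kf * Num.max `|x - y| `|lam - lam'|.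

Lemma row_ball_compact (M : R) : compact [set x : V | `|x| <= M].
Proof.
have [M0|M0] := leP 0 M; last first.
  rewrite (_ : [set x : V | _] = set0); first exact: compact0.
  by apply/seteqP; split=> x //= /(le_trans (normr_ge0 x)); rewrite leNgt M0.
rewrite (_ : [set x : V | _] = [set x : V | forall i, (`[- M, M]%classic : set R) (x 0 i)]).
  exact: (@rV_compact R 3 (fun=> (`[- M, M]%classic : set R)) (fun=> @segment_compact R _ _)).
apply/seteqP; split=> x /= H.
  by move=> i; rewrite in_itv/= -ler_norml; apply: le_trans H; exact: (@fs_le R _ (FinSuprV 3) i x).
apply: fs_norm => [//|i].
by have := H i; rewrite in_itv/= -ler_norml.
Qed.

Lemma row_ball_segment_closed (M : R) : segment_closed [set x : V | `|x| <= M].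
Proof.
move=> x y s /= hx hy /andP[s0 s1].
have -> : y + s *: (x - y) = (1 - s) *: y + s *: x.
  by rewrite scalerBr scalerBl scale1r addrA addrAC.
apply: normD_le; rewrite !normrZ !ger0_norm ?subr_ge0//.
have : (1 - s) * `|y| <= (1 - s) * M by rewrite ler_wpM2l// subr_ge0.
have : s * `|x| <= s * M by rewrite ler_wpM2l.
by lra.
Qed.

Lemma smooth_field_lip (a1 b1 a2 b2 : R) (f : V -> R * R -> V) :
  smooth_on ([set: V] `*` (`[a1, b1] `*` `[a2, b2])) (fun q => f q.1 q.2) ->
  field_lip (`[a1, b1] `*` `[a2, b2]) f.
Proof.
move=> [U [oU AU CU]] M; pose Q : set (R * R) := `[a1, b1] `*` `[a2, b2].
have cQ : compact Q by apply: compact_setX; exact: segment_compact.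
have sQ : segment_closed Q by apply: setX_segment_closed; exact: itv_segment_closed.
have [|L L0 HL] := @C1_lipschitz R _ _ _ _ _ U ([set x | `|x| <= M] `*` Q) oU (CU 1%N)
  (compact_setX (@row_ball_compact M) cQ)
  (setX_segment_closed (@row_ball_segment_closed M) sQ).
  by apply: subset_trans AU => -[x l] [/= _ ql]; split.
exists L => // l l' x y ql ql' hx hy.
by rewrite -norm_pairB; apply: (HL (x, l) (y, l')); split.
Qed.

Lemma solution_unique (Q : set (R * R)) (f : V -> R * R -> V) lam (x y : R -> V) (a b : R) :
  field_lip Q f -> Q lam -> a <= b ->
  (forall t, a <= t <= b -> is_derive t 1 x (f (x t) lam)) ->
  (forall t, a <= t <= b -> is_derive t 1 y (f (y t) lam)) ->
  x a = y a \/ x b = y b -> forall t, a <= t <= b -> x t = y t.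
Proof.
move=> fL ql ab Hx Hy xy.
have bnd (z : R -> V) : (forall t, a <= t <= b -> is_derive t 1 z (f (z t) lam)) ->
    exists M, forall t, a <= t <= b -> `|z t| <= M.
  move=> Hz; have [|M _ HM] := @cts_bounded R _ (`[a, b]%classic : set R) (fun t => `|z t|) (@segment_compact R a b).
    move=> t /=; rewrite in_itv/= => tab.
    exact: norm_continuous (is_derive_cts (Hz t tab)).
  by exists M => t tab; have := HM t; rewrite normr_id /= in_itv/=; exact.
have [Mx HMx] := bnd x Hx; have [My HMy] := bnd y Hy.
have [Kf Kf0 HK] := fL (Num.max Mx My).
have Z := @zero_of_gronwall R _ _ (fun t => x t - y t)
  (fun t => f (x t) lam - f (y t) lam) Kf a b Kf0 ab.
move=> t tab; apply/eqP; rewrite -subr_eq0; apply/eqP; apply: Z => //.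
- by case: xy => ->; [left|right]; rewrite subrr.
- by move=> s sab; apply: der_sub; [exact: Hx|exact: Hy].
- move=> s sab; have := HK lam lam (x s) (y s) ql ql.
  rewrite max_normBl; apply.
    by rewrite le_max HMx.
  by rewrite le_max HMy// orbT.
Qed.

End FieldLip.

(** * Tools for gluing and following orbits *)

Section Limits.
Context {R : realType} {V : normedModType R}.

Lemma cvg_pinfty0 (x : R -> V) : x t @[t --> +oo] --> (0 : V) <->
  forall e, 0 < e -> exists T, forall t, T < t -> `|x t| < e.
Proof.
split=> [/cvgrPdist_lt H e e0|H].
  have [M [_ HM]] := H e e0; exists M => t Mt.
  by have := HM t Mt; rewrite /= sub0r normrN.
apply/cvgrPdist_lt => e e0; have [T HT] := H e e0.
by exists T; split; [exact: num_real|move=> t Tt; rewrite /= sub0r normrN; exact: HT].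
Qed.

Lemma cvg_ninfty0 (x : R -> V) : x t @[t --> -oo] --> (0 : V) <->
  forall e, 0 < e -> exists T, forall t, t < T -> `|x t| < e.
Proof.
split=> [/cvgrPdist_lt H e e0|H].
  have [M [_ HM]] := H e e0; exists M => t Mt.
  by have := HM t Mt; rewrite /= sub0r normrN.
apply/cvgrPdist_lt => e e0; have [T HT] := H e e0.
by exists T; split; [exact: num_real|move=> t Tt; rewrite /= sub0r normrN; exact: HT].
Qed.

End Limits.

Section Glue.
Context {R : realType} {V : normedModType R}.
Implicit Types (x y : R -> V) (a t : R).

Definition glue a x y : R -> V := fun t => if t <= a then x t else y t.

Lemma is_derive_near x y t (d : V) (r : R) : 0 < r -> (forall s, `|s - t| < r -> y s = x s) ->
  is_derive t 1 x d -> is_derive t 1 y d.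
Proof.
move=> r0 E /is_deriveP D; apply/is_deriveP => e e0; have [k k0 H] := D e e0.
exists (Num.min k r); first by rewrite lt_min k0.
move=> h; rewrite lt_min => /andP[hk hr]; rewrite !E ?subrr ?normr0//; first exact: H.
by rewrite addrAC subrr add0r.
Qed.

Lemma glue_der (G : V -> V) a x y t : x a = y a ->
  (t <= a -> is_derive t 1 x (G (x t))) -> (a <= t -> is_derive t 1 y (G (y t))) ->
  is_derive t 1 (glue a x y) (G (glue a x y t)).
Proof.
move=> xy Dx Dy; rewrite {2}/glue; case: (ltrgtP t a) => ta.
- have at0 : 0 < a - t by rewrite subr_gt0.
  apply: (is_derive_near at0 _ (Dx (ltW ta))) => s /ltr_normlP[_ h].
  by rewrite /glue ifT//; lra.
- have at0 : 0 < t - a by rewrite subr_gt0.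
  apply: (is_derive_near at0 _ (Dy (ltW ta))) => s /ltr_normlP[h _].
  by rewrite /glue ifF//; apply/negbTE; rewrite -ltNge; lra.
- subst t; have /is_deriveP D1 := Dx (lexx a); have /is_deriveP D2 := Dy (lexx a).
  apply/is_deriveP => e e0.
  have [d1 d10 H1] := D1 e e0; have [d2 d20 H2] := D2 e e0.
  exists (Num.min d1 d2); first by rewrite lt_min d10.
  move=> h; rewrite lt_min => /andP[h1 h2]; rewrite /glue lexx.
  case: ifP => _; first exact: H1.
  by rewrite xy; exact: H2.
Qed.

End Glue.

Lemma exp_small {R : realType} (A k e : R) : 0 <= A -> 0 < k -> 0 < e -> exists2 L0, 1 <= L0 &
  forall L, L0 < L -> A * (L * expR (- k * L)) <= e /\ A * expR (- k * L) <= e.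
Proof.
move=> A0 k0 e0; have ke : 0 < k ^+ 2 * e by rewrite mulr_gt0// exprn_gt0.
exists (1 + 4 * A / (k ^+ 2 * e)); first by rewrite lerDl divr_ge0 ?mulr_ge0// ltW.
move=> L hL; have L1 : 1 < L.
  by apply: le_lt_trans hL; rewrite lerDl divr_ge0 ?mulr_ge0// ltW.
have L0 : 0 < L by apply: lt_trans L1.
have kL : 0 < k * L by rewrite mulr_gt0.
have E0 : 0 < expR (- k * L) := expR_gt0 _.
have main : A * (L * expR (- k * L)) <= e.
  have h1 : (k * L / 2) ^+ 2 * expR (- k * L) <= 1.
    have -> : expR (- k * L) = expR (- (k * L / 2)) ^+ 2.
      by rewrite -expRM_natl; congr expR; rewrite mulNr -[_ *+ 2]mulr_natr; field.
    have x0 : 0 <= k * L / 2 * expR (- (k * L / 2)) by rewrite mulr_ge0 ?expR_ge0// divr_ge0// ltW.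
    rewrite -exprMn -[leRHS](expr1n _ 2%N) ler_pXn2r ?nnegrE//.
    rewrite -ler_pdivlMr ?expR_gt0// div1r -expRN opprK.
    have := expR_ge1Dx (k * L / 2) => h; apply: le_trans h; rewrite lerDr//.
  have h2 : 4 * A <= L * (k ^+ 2 * e).
    rewrite -ler_pdivrMr//; apply: le_trans (ltW hL); rewrite lerDr//.
  have h3 : (k * L / 2) ^+ 2 * expR (- k * L) * (4 * e) <= 1 * (4 * e).
    by apply: ler_wpM2r h1; rewrite mulr_ge0// ltW.
  have h4 : 4 * A * (L * expR (- k * L)) <= L * (k ^+ 2 * e) * (L * expR (- k * L)).
    by rewrite ler_wpM2r// mulr_ge0 ?expR_ge0// ltW.
  have h5 : (k * L / 2) ^+ 2 * expR (- k * L) * (4 * e) = L * (k ^+ 2 * e) * (L * expR (- k * L)) by field.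
  have h6 : L * (k ^+ 2 * e) * (L * expR (- k * L)) <= 4 * e by rewrite -h5 -[leRHS]mul1r.
  have h7 := le_trans h4 h6.
  by rewrite -(@ler_pM2l _ 4)// mulrA.
split=> //; apply: le_trans main; rewrite ler_wpM2l//.
by rewrite ler_peMl ?expR_ge0// ltW.
Qed.

Lemma expR_lip (R : realType) (a b M : R) : expR a <= M -> expR b <= M -> `|expR a - expR b| <= M * `|a - b|.
Proof.
wlog ab : a b / a <= b.
  move=> H; have [|/ltW] := leP a b; first exact: H.
  by move=> ba h1 h2; rewrite distrC [`|a - b|]distrC; exact: H.
move=> _ bM; rewrite distrC [`|a - b|]distrC [`|b - a|]ger0_norm ?subr_ge0//.
apply: (@mvt_le_cst R R FinSupR expR expR M a b ab) => t tab.
rewrite ger0_norm ?expR_ge0//; apply: le_trans bM.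
by rewrite ler_expR; case/andP: tab.
Qed.

(** * Hyperbolic equilibria *)

Section Splitting.
Context {R : realType}.

Lemma spectrum3 (A : 'M[R]_3) (s : seq R[i]) : spectrum A s ->
  [/\ size s = 3%N, \sum_(z <- s) z = real_complex R (\tr A), \prod_(z <- s) z = real_complex R (\det A),
      (forall m : R, real_complex R m \in s -> root (char_poly A) m) &
      (forall z, z \in s -> conjc z \in s)].
Proof.
rewrite /spectrum => E.
have s3 : size s = 3%N by have := size_char_poly (map_mx (real_complex R) A); rewrite E size_prod_XsubC => -[].
have E' : map_poly (real_complex R) (char_poly A) = \prod_(z <- s) ('X - z%:P) by rewrite map_char_poly.
split=> //.
- have := coefPn_prod_XsubC (ps := s); rewrite s3 => /(_ isT).
  rewrite -E char_poly_trace// => /eqP; rewrite eqr_opp => /eqP <-.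
  by rewrite /mxtrace rmorph_sum/=; apply: eq_bigr => i _; rewrite mxE.
- have := coef0_prod_XsubC s; rewrite -E char_poly_det s3.
  have h : (-1 : R[i]) ^+ 3 != 0 by rewrite expf_neq0// oppr_eq0 oner_neq0.
  by move=> /(mulfI h) <-; rewrite det_map_mx.
- move=> m ms; have : root (map_poly (real_complex R) (char_poly A)) (real_complex R m).
    by rewrite E' root_prod_XsubC.
  by rewrite fmorph_root.
- move=> z zs; rewrite -root_prod_XsubC -E'.
  have : root (map_poly (real_complex R) (char_poly A)) z by rewrite E' root_prod_XsubC.
  rewrite -complex_root_conj -map_poly_comp.
  by rewrite (@eq_map_poly _ _ (conjc \o real_complex R) (real_complex R))// => x /=; exact: conjc_real.
Qed.

(** A real matrix with one unstable and two stable eigenvalues: the unstable one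
    is real because complex conjugation permutes the spectrum. *)
Lemma unstable_real (A : 'M[R]_3) (s : seq R[i]) : spectrum A s ->
  count (fun z => 0 < complex.Re z) s = 1%N -> count (fun z => complex.Re z < 0) s = 2%N ->
  exists m tau d : R, [/\ 0 < m, 0 < tau & 0 < d] /\
    [/\ root (char_poly A) m, \tr A = m - tau & \det A = m * d].
Proof.
move=> /spectrum3[s3 str sdet sroot sconj] cu cs.
suff [z [w1 [w2 [zs z0 w10 w20 [E1 E2 E3]]]]] : exists z w1 w2 : R[i], [/\ z \in s, 0 < complex.Re z,
    complex.Re w1 < 0, complex.Re w2 < 0 &
    [/\ forall y, y \in s -> [|| y == z, y == w1 | y == w2], z + w1 + w2 = \sum_(y <- s) y &
       z * w1 * w2 = \prod_(y <- s) y]].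
  have Iz : complex.Im z = 0.
    have := E1 _ (sconj z zs); case/or3P => /eqP E; last 2 first.
    - by have := congr1 (@complex.Re R) E; case: (z) z0 => a b /= a0 Ea; move: w10; rewrite -Ea ltNge (ltW a0).
    - by have := congr1 (@complex.Re R) E; case: (z) z0 => a b /= a0 Ea; move: w20; rewrite -Ea ltNge (ltW a0).
    have := congr1 (@complex.Im R) E; case: (z) => a b /=; lra.
  case: z zs z0 E1 E2 E3 Iz => m y zs m0 _ E2 E3 /= y0; rewrite {}y0 in zs E2 E3.
  case: w1 w10 E2 E3 => p1 q1 /= p10 E2 E3; case: w2 w20 E2 E3 => p2 q2 /= p20 E2 E3.
  rewrite str in E2; rewrite sdet in E3.
  case: E2 => E2 I2; case: E3 => E3 I3.
  exists m, (- (p1 + p2)), (p1 * p2 - q1 * q2); split; split=> //; first by lra.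
  - have -> : q2 = - q1 by lra.
    have : 0 < p1 * p2 by rewrite nmulr_rgt0.
    have : 0 <= q1 * q1 by rewrite -expr2 sqr_ge0.
    by rewrite mulrN opprK; move=> h1 h2; exact: ltr_wpDr.
  - exact: sroot.
  - by rewrite -E2; ring.
  - by rewrite -E3; ring.
move: s3 cu cs; case: s {str sdet sroot sconj} => [//|z1 [//|z2 [//|z3 [|//]]]] _ /=.
rewrite !big_cons !big_nil !addr0 !mulr1.
case: (ltrgtP 0 (complex.Re z1)) => h1; case: (ltrgtP 0 (complex.Re z2)) => h2;
  case: (ltrgtP 0 (complex.Re z3)) => h3 //= _ _.
- exists z1, z2, z3; split=> //; first by rewrite !inE eqxx.
  split; [by move=> y; rewrite !inE|by ring|by ring].
- exists z2, z1, z3; split=> //; first by rewrite !inE eqxx orbT.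
  split; [by move=> y; rewrite !inE orbCA|by ring|by ring].
- exists z3, z1, z2; split=> //; first by rewrite !inE eqxx !orbT.
  split; [by move=> y; rewrite !inE orbA orbC|by ring|by ring].
Qed.

(** Block triangular form: the first column of S spans the unstable right
    eigenspace. *)
Lemma hyperbolic_splitting (A : 'M[R]_3) (s : seq R[i]) : spectrum A s ->
  count (fun z => 0 < complex.Re z) s = 1%N -> count (fun z => complex.Re z < 0) s = 2%N ->
  exists (S : 'M[R]_3) (m a b c e k1 k2 : R), [/\ S \in unitmx, 0 < m, a + e < 0, 0 < a * e - b * c &
    forall v : 'rV[R]_3, let y := v *m S in let y' := v *m A *m S in
      [/\ y' 0 0 = m * y 0 0, y' 0 1 = k1 * y 0 0 + a * y 0 1 + b * y 0 2%:R &
         y' 0 2%:R = k2 * y 0 0 + c * y 0 1 + e * y 0 2%:R]].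
Proof.
move=> sA cu cs; have [m [tau [d [[m0 t0 d0] [rm trA detA]]]]] := unstable_real sA cu cs.
have [w w0 wA] : exists2 w : 'cV[R]_3, w != 0 & A *m w = m *: w.
  have : root (char_poly A^T) m.
    by rewrite /char_poly/char_poly_mx -map_trmx -det_tr linearB/= trmxK tr_scalar_mx.
  rewrite -eigenvalue_root_char => /eigenvalueP[v vA v0].
  exists v^T; first by rewrite -(inj_eq trmx_inj) trmxK trmx0.
  by apply: trmx_inj; rewrite trmx_mul trmxK vA linearZ/= trmxK.
pose S := col_ebase w; have SU : S \in unitmx := col_ebase_unit w.
have rw : \rank w = 1%N.
  apply/eqP; rewrite eqn_leq rank_leq_col lt0n mxrank_eq0//.
pose d0' : 'cV[R]_3 := pid_mx 1.
have Sw : S *m d0' = w *m invmx (row_ebase w).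
  by apply: (canRL (mulmxK (row_ebase_unit w))); have := mulmx_ebase w; rewrite rw.
pose B := invmx S *m A *m S.
have Bd : B *m d0' = m *: d0'.
  rewrite /B -!mulmxA Sw [A *m _]mulmxA wA -scalemxAl -scalemxAr -Sw mulmxA mulVmx// mul1mx.
  by [].
have B0 i : B i 0 = if i == 0 then m else 0.
  have := congr1 (fun M : 'cV[R]_3 => M i 0) Bd.
  rewrite !mxE (bigD1 0)//= big1 ?addr0; last first.
    by case=> -[|j] hj //= _; rewrite [d0' _ _]mxE/= mulr0.
  rewrite !mxE /= mulr1 => ->.
  by case: i => -[|i] hi; rewrite /= ?mulr1// mulr0.
have trB : \tr B = m - tau by rewrite /B -mulmxA mxtrace_mulC mulmxK// trA.
have detB : \det B = m * d.
  by rewrite /B !det_mulmx det_inv mulrAC mulVr ?mul1r// -unitmxE.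
have yE v : v *m A *m S = v *m S *m B by rewrite /B !mulmxA mulmxK.
clear Bd; clearbody B.
exists S, m, (B 1 1), (B 2%:R 1), (B 1 2%:R), (B 2%:R 2%:R), (B 0 1), (B 0 2%:R); split=> //.
- move: trB; rewrite /mxtrace !big_ord_recl big_ord0 B0 eqxx addr0.
  have -> : lift ord0 (lift ord0 ord0) = 2%:R :> 'I_3 by apply/val_inj.
  have -> : lift ord0 ord0 = 1 :> 'I_3 by apply/val_inj.
  by lra.
- move: detB; rewrite (expand_det_col _ 0) !big_ord_recl big_ord0 !B0/= !mul0r !addr0.
  move=> /(mulfI (lt0r_neq0 m0)); move=> E; move: d0; rewrite -E /cofactor/= addn0 expr0 mul1r.
  rewrite (expand_det_row _ 0) !big_ord_recl big_ord0 addr0 /cofactor !det_mx11 !mxE/=.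
  have -> : lift ord0 (lift ord0 ord0) = 2%:R :> 'I_3 by apply/val_inj.
  have -> : lift 0 0 = 1 :> 'I_3 by apply/val_inj.
  rewrite (_ : lift ord0 (lift (lift ord0 ord0) 0) = 1); last by apply/val_inj.
  by rewrite /bump/= ?addn0 ?expr0 ?expr1 ?mul1r ?mulN1r ?mulrN [B 2%:R 1 * _]mulrC.
- move=> v y y'; have {yE} yE : y' = y *m B by exact: yE.
  clearbody y'.
  have sum3 (h : 'I_3 -> R) : \sum_i h i = h 0 + h 1 + h 2%:R.
    rewrite !big_ord_recl big_ord0 addr0 addrA.
    by congr (_ + _ + _); congr h; apply/val_inj.
  clearbody y; rewrite yE !mxE !sum3 !B0/=; split; ring.
Qed.

End Splitting.

(** * Cone estimates near a saddle *)

Section SaddleAlgebra.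
Context {R : realType}.

Lemma young (th x y : R) : 0 < th -> 2 * (x * y) <= th * x ^+ 2 + y ^+ 2 / th.
Proof.
move=> t0; rewrite -subr_ge0; have -> : th * x ^+ 2 + y ^+ 2 / th - 2 * (x * y) = (th * x - y) ^+ 2 / th.
  by field; rewrite gt_eqF.
by rewrite divr_ge0 ?sqr_ge0// ltW.
Qed.

Lemma sum_sqr_abs (x y : R) : (`|x| + `|y|) ^+ 2 <= 2 * (x ^+ 2 + y ^+ 2).
Proof.
rewrite -[x ^+ 2]real_normK ?num_real// -[y ^+ 2]real_normK ?num_real//.
by have := sqr_ge0 (`|x| - `|y|); rewrite sqrrB sqrrD; lra.
Qed.

Variables (m a b c e k1 k2 : R).
Hypotheses (m0 : 0 < m) (tr0 : a + e < 0) (det0 : 0 < a * e - b * c).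
Local Notation d := (a * e - b * c).

(** The Lyapunov form d |z|^2 + |z (B - tr B)|^2 of a 2 x 2 matrix B with
    negative trace and determinant d > 0: by Cayley-Hamilton its derivative
    along z' = z B is 2 d (tr B) |z|^2. *)
Definition lyap (z1 z2 : R) : R :=
  d * (z1 ^+ 2 + z2 ^+ 2) + (- e * z1 + b * z2) ^+ 2 + (c * z1 - a * z2) ^+ 2.

Definition lyap2 (z1 z2 w1 w2 : R) : R :=
  d * (z1 * w1 + z2 * w2) + (- e * z1 + b * z2) * (- e * w1 + b * w2)
  + (c * z1 - a * z2) * (c * w1 - a * w2).

Let G := d + (`|e| + `|b|) ^+ 2 + (`|c| + `|a|) ^+ 2.

Let G0 : 0 < G.
Proof. by rewrite /G -addrA ltr_wpDr ?addr_ge0 ?sqr_ge0. Qed.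

Let lin_bound (p q x y : R) : `|p * x + q * y| <= (`|p| + `|q|) * (`|x| + `|y|).
Proof.
apply: normD_le; rewrite !normrM mulrDl !mulrDr.
have h1 : 0 <= `|p| * `|y| by rewrite mulr_ge0.
have h2 : 0 <= `|q| * `|x| by rewrite mulr_ge0.
by lra.
Qed.

Lemma lyap2_bound z1 z2 w1 w2 : `|lyap2 z1 z2 w1 w2| <= G * ((`|z1| + `|z2|) * (`|w1| + `|w2|)).
Proof.
have s0 : 0 <= `|z1| + `|z2| by rewrite addr_ge0.
have t0 : 0 <= `|w1| + `|w2| by rewrite addr_ge0.
set X := _ * (`|w1| + `|w2|); have X0 : 0 <= X by rewrite mulr_ge0.
have -> : G * X = d * X + (`|e| + `|b|) ^+ 2 * X + (`|c| + `|a|) ^+ 2 * X by rewrite /G; ring.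
have dX : `|z1 * w1 + z2 * w2| <= X.
  apply: normD_le; rewrite /X !normrM mulrDl !mulrDr.
  have h1 : 0 <= `|z1| * `|w2| by rewrite mulr_ge0.
  have h2 : 0 <= `|z2| * `|w1| by rewrite mulr_ge0.
  by lra.
rewrite /lyap2; apply: normD_le; apply: lerD.
  apply: normD_le; apply: lerD.
    by rewrite normrM (gtr0_norm det0) ler_pM2l.
  rewrite normrM /X expr2 mulrACA; apply: ler_pM => //.
    by have := lin_bound (- e) b z1 z2; rewrite normrN.
  by have := lin_bound (- e) b w1 w2; rewrite normrN.
rewrite normrM /X expr2 mulrACA; apply: ler_pM => //.
  by have := lin_bound c (- a) z1 z2; rewrite normrN mulNr.
by have := lin_bound c (- a) w1 w2; rewrite normrN mulNr.
Qed.

Lemma lyap_drift z1 z2 : lyap2 z1 z2 (a * z1 + b * z2) (c * z1 + e * z2) =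
  d * (a + e) * (z1 ^+ 2 + z2 ^+ 2).
Proof. by rewrite /lyap2; ring. Qed.

Lemma lyap2D z1 z2 w1 w2 v1 v2 : lyap2 z1 z2 (w1 + v1) (w2 + v2) = lyap2 z1 z2 w1 w2 + lyap2 z1 z2 v1 v2.
Proof. by rewrite /lyap2; ring. Qed.

Lemma lyap_ge z1 z2 : d * (z1 ^+ 2 + z2 ^+ 2) <= lyap z1 z2.
Proof. by rewrite /lyap -addrA lerDl addr_ge0 ?sqr_ge0. Qed.

Lemma lyap_le z1 z2 : lyap z1 z2 <= 2 * G * (z1 ^+ 2 + z2 ^+ 2).
Proof.
have -> : lyap z1 z2 = lyap2 z1 z2 z1 z2 by rewrite /lyap /lyap2; ring.
apply: le_trans (ler_norm _) _; apply: le_trans (lyap2_bound _ _ _ _) _.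
have -> : 2 * G * (z1 ^+ 2 + z2 ^+ 2) = G * (2 * (z1 ^+ 2 + z2 ^+ 2)) by ring.
by rewrite ler_pM2l// -expr2 sum_sqr_abs.
Qed.

(** The two inequalities of [sd_ode], for any errors of relative size ep and
    absolute size E.  The weight k of the stable form makes the coupling terms
    k1 and k2 harmless. *)
Lemma saddle_inequalities : exists cc k ep C : R, [/\ 0 < cc, 0 < k, 0 < ep, 0 < C &
  forall Y z1 z2 r0 r1 r2 E : R, 0 <= E ->
    let n := `|Y| + (`|z1| + `|z2|) in
    `|r0| <= ep * n + E -> `|r1| <= ep * n + E -> `|r2| <= ep * n + E ->
    3 * cc * Y ^+ 2 - cc * (k * lyap z1 z2) - C * E ^+ 2 <= 2 * (Y * (m * Y + r0)) /\
    k * (2 * lyap2 z1 z2 (k1 * Y + a * z1 + b * z2 + r1) (k2 * Y + c * z1 + e * z2 + r2)) <=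
      - (3 * cc) * (k * lyap z1 z2) + cc * Y ^+ 2 + C * E ^+ 2].
Proof.
pose p := d * - (a + e); have p0 : 0 < p by rewrite mulr_gt0// oppr_gt0.
pose kk := `|k1| + `|k2|; have kk0 : 0 <= kk by rewrite addr_ge0.
pose G1 := 8 * G ^+ 2 * kk ^+ 2 / p + G + 1.
have G10 : 0 < G1.
  rewrite /G1 ltr_wpDl//; apply: addr_ge0 (ltW G0); apply: divr_ge0 (ltW p0).
  by apply: mulr_ge0 (sqr_ge0 _); apply: mulr_ge0 (sqr_ge0 _).
pose cc := Num.min (m / 3) (p / (6 * G)).
have cc0 : 0 < cc by rewrite lt_min !divr_gt0// mulr_gt0.
have ccm : 3 * cc <= m by have : cc <= m / 3 by [rewrite ge_min lexx]; lra.
have ccp : 3 * cc * (2 * G) <= p.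
  have : cc <= p / (6 * G) by rewrite ge_min lexx orbT.
  by rewrite ler_pdivlMr ?mulr_gt0//; lra.
pose k := cc / G1; have k0 : 0 < k by rewrite divr_gt0.
have kG : k * G1 = cc by rewrite /k divfK// gt_eqF.
pose ep := Num.min (Num.min (m / 6) (cc * k * d / 2)) (Num.min (p / (48 * G)) (1 / 4)).
have ckd : 0 < cc * k * d by apply: mulr_gt0 det0; exact: mulr_gt0.
have ep0 : 0 < ep by rewrite !lt_min !divr_gt0// mulr_gt0.
have [ep1 ep2 ep3 ep4] : [/\ 6 * ep <= m, 2 * ep <= cc * k * d, 48 * G * ep <= p & 4 * ep <= 1].
  have [h1 h2 h3 h4] : [/\ ep <= m / 6, ep <= cc * k * d / 2, ep <= p / (48 * G) & ep <= 1 / 4].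
    by split; rewrite !ge_min lexx ?orbT.
  split; [lra|lra| |lra].
  by move: h3; rewrite ler_pdivlMr ?mulr_gt0//; lra.
pose C := 2 / m + k * (32 * G ^+ 2 / p).
have C20 : 0 < k * (32 * G ^+ 2 / p) by rewrite mulr_gt0// divr_gt0// mulr_gt0// exprn_gt0.
have C0 : 0 < C by rewrite addr_gt0// divr_gt0.
exists cc, k, ep, C; split=> // Y z1 z2 r0 r1 r2 E E0 n h0 h1 h2.
pose s := `|z1| + `|z2|; pose y := `|Y|; pose Z := z1 ^+ 2 + z2 ^+ 2.
have s0 : 0 <= s by rewrite addr_ge0.
have y0 : 0 <= y := normr_ge0 Y.
have yY : Y ^+ 2 = y ^+ 2 by rewrite real_normK ?num_real.
have sZ : s ^+ 2 <= 2 * Z by exact: sum_sqr_abs.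
have Z0 : 0 <= Z by rewrite addr_ge0 ?sqr_ge0.
have sy : 2 * (s * y) <= s ^+ 2 + y ^+ 2 by have := sqr_ge0 (s - y); rewrite sqrrB; lra.
have nE : n = y + s by [].
have Wge := lyap_ge z1 z2; have Wle := lyap_le z1 z2; rewrite -/Z in Wge Wle.
set W := lyap z1 z2 in Wge Wle *.
split.
  have Yr : - (y * (ep * n + E)) <= Y * r0.
    have : `|Y * r0| <= y * (ep * n + E) by rewrite normrM ler_wpM2l.
    by move=> /ler_normlP[+ _]; lra.
  have yE : 2 * (y * E) <= m / 2 * y ^+ 2 + 2 / m * E ^+ 2.
    have m20 : 0 < m / 2 by rewrite divr_gt0.
    by have := young y E m20; rewrite invf_div [E ^+ 2 * _]mulrC.
  have e1 : 6 * ep * y ^+ 2 <= m * y ^+ 2 by rewrite ler_wpM2r// sqr_ge0.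
  have e2 : 2 * ep * Z <= cc * (k * W).
    apply: (@le_trans _ _ (cc * k * d * Z)); first by rewrite ler_wpM2r.
    have ck : 0 < cc * k by rewrite mulr_gt0.
    by rewrite -[cc * k * d * Z]mulrA [leRHS]mulrA ler_pM2l.
  have e3 : 2 * ep * (s * y) <= ep * (2 * Z + y ^+ 2).
    rewrite [2 * ep]mulrC -mulrA ler_pM2l//; lra.
  have e4 : 3 * cc * y ^+ 2 <= m * y ^+ 2 by rewrite ler_wpM2r// sqr_ge0.
  have CE : 2 / m * E ^+ 2 <= C * E ^+ 2.
    by rewrite ler_wpM2r ?sqr_ge0// lerDl ltW.
  have -> : 2 * (Y * (m * Y + r0)) = 2 * m * y ^+ 2 + 2 * (Y * r0) by rewrite -yY; ring.
  have E1 : 2 * (y * (ep * n + E)) = 2 * ep * y ^+ 2 + 2 * ep * (s * y) + 2 * (y * E) by rewrite nE; ring.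
  rewrite yY; lra.
have -> : lyap2 z1 z2 (k1 * Y + a * z1 + b * z2 + r1) (k2 * Y + c * z1 + e * z2 + r2) =
   - p * Z + lyap2 z1 z2 (k1 * Y + r1) (k2 * Y + r2).
  have -> : k1 * Y + a * z1 + b * z2 + r1 = (a * z1 + b * z2) + (k1 * Y + r1) by ring.
  have -> : k2 * Y + c * z1 + e * z2 + r2 = (c * z1 + e * z2) + (k2 * Y + r2) by ring.
  by rewrite lyap2D lyap_drift /p /Z; ring.
have B : lyap2 z1 z2 (k1 * Y + r1) (k2 * Y + r2) <= G * (s * (kk * y + 2 * (ep * n + E))).
  apply: le_trans (ler_norm _) _; apply: le_trans (lyap2_bound _ _ _ _) _.
  rewrite ler_pM2l// ler_wpM2l//.
  have t1 : `|k1 * Y + r1| <= `|k1| * y + (ep * n + E).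
    by apply: normD_le; rewrite normrM lerD2l.
  have t2 : `|k2 * Y + r2| <= `|k2| * y + (ep * n + E).
    by apply: normD_le; rewrite normrM lerD2l.
  by rewrite /kk mulrDl; lra.
have p80 : 0 < p / 8 by rewrite divr_gt0.
have b1 : 2 * (s * (G * kk * y)) <= p / 8 * s ^+ 2 + 8 * G ^+ 2 * kk ^+ 2 / p * y ^+ 2.
  have := young s (G * kk * y) p80.
  have -> : (G * kk * y) ^+ 2 / (p / 8) = 8 * G ^+ 2 * kk ^+ 2 / p * y ^+ 2 by field; rewrite gt_eqF.
  by [].
have b2 : 2 * (s * (2 * G * E)) <= p / 8 * s ^+ 2 + 32 * G ^+ 2 / p * E ^+ 2.
  have := young s (2 * G * E) p80.
  have -> : (2 * G * E) ^+ 2 / (p / 8) = 32 * G ^+ 2 / p * E ^+ 2 by field; rewrite gt_eqF.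
  by [].
have b3 : 4 * G * ep * (s * n) <= p / 8 * s ^+ 2 + G * y ^+ 2.
  have -> : s * n = s ^+ 2 + s * y by rewrite nE; ring.
  have t1 : 4 * G * ep * (s ^+ 2 + s * y) <= 4 * G * ep * (3 / 2 * s ^+ 2 + y ^+ 2 / 2).
    by rewrite ler_pM2l ?mulr_gt0//; lra.
  have t2 : 48 * G * ep * s ^+ 2 <= p * s ^+ 2 by rewrite ler_wpM2r// sqr_ge0.
  have t3 : 4 * ep * (G * y ^+ 2) <= 1 * (G * y ^+ 2) by rewrite ler_wpM2r// mulr_ge0 ?sqr_ge0// ltW.
  have t4 : 0 <= G * y ^+ 2 by rewrite mulr_ge0 ?sqr_ge0// ltW.
  lra.
have main : 2 * (- p * Z + lyap2 z1 z2 (k1 * Y + r1) (k2 * Y + r2)) <=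
    - p * Z + (8 * G ^+ 2 * kk ^+ 2 / p + G) * y ^+ 2 + 32 * G ^+ 2 / p * E ^+ 2.
  have E1 : 2 * (G * (s * (kk * y + 2 * (ep * n + E)))) =
     2 * (s * (G * kk * y)) + 4 * G * ep * (s * n) + 2 * (s * (2 * G * E)) by ring.
  have E2 : p * s ^+ 2 <= 2 * (p * Z) by rewrite [2 * (p * Z)]mulrCA; exact: ler_wpM2l (ltW p0) _ _ sZ.
  have E3 : 0 <= p * Z by rewrite mulr_ge0// ltW.
  rewrite mulrDl; lra.
have pW : 3 * cc * W <= p * Z.
  apply: (@le_trans _ _ (3 * cc * (2 * G * Z))); first by rewrite ler_pM2l// mulr_gt0.
  by rewrite mulrA; rewrite ler_wpM2r.
have y2 : 0 <= y ^+ 2 by rewrite sqr_ge0.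
have : k * (2 * (- p * Z + lyap2 z1 z2 (k1 * Y + r1) (k2 * Y + r2))) <=
    k * (- (3 * cc * W) + G1 * y ^+ 2 + 32 * G ^+ 2 / p * E ^+ 2).
  rewrite ler_pM2l//; apply: le_trans main _.
  by rewrite /G1 (mulrDl _ 1); apply: lerD => //; apply: lerD; [rewrite mulNr lerN2|rewrite lerDl mul1r].
move=> /le_trans; apply.
have -> : k * (- (3 * cc * W) + G1 * y ^+ 2 + 32 * G ^+ 2 / p * E ^+ 2) =
   - (3 * cc) * (k * W) + k * G1 * y ^+ 2 + k * (32 * G ^+ 2 / p) * E ^+ 2 by ring.
rewrite kG yY lerD2l ler_wpM2r ?sqr_ge0// /C lerDr divr_ge0//; exact: ltW.
Qed.

End SaddleAlgebra.

Section Saddle.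
Context {R : realType}.
Local Notation V := 'rV[R]_3.

(** What is used of the hyperbolicity of the equilibrium: differences of
    solutions grow in the unstable coordinate Y and decay in the quadratic form
    Qf of the stable coordinates, up to the difference of the parameters. *)
Record saddle (F : V -> R * R -> V) (D : set (R * R)) (Y Qf : V -> R) (c C KF : R) : Prop := {
  sd_c : 0 < c;
  sd_C : 0 < C;
  sd_KF : 0 < KF;
  sd_lip : forall lam lam' x y, D lam -> D lam' ->
    `|F x lam - F y lam'| <= KF * Num.max `|x - y| `|lam - lam'|;
  sd_zero : forall lam, D lam -> F 0 lam = 0;
  sd_Ylin : forall (a : R) u v, Y (a *: u + v) = a * Y u + Y v;
  sd_Y : forall v, `|Y v| <= C * `|v|;
  sd_Q0 : forall v, 0 <= Qf v;
  sd_QZ : forall (a : R) v, Qf (a *: v) = a ^+ 2 * Qf v;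
  sd_QB : forall v w, Qf (v - w) <= 2 * Qf v + 2 * Qf w;
  sd_Q : forall v, Qf v <= C * `|v| ^+ 2;
  sd_Qc : forall v w, `|Qf v - Qf w| <= C * (`|v - w| * `|v + w|);
  sd_norm : forall v, `|v| ^+ 2 <= C * (Y v ^+ 2 + Qf v);
  sd_dir : exists e, Y e = 1 /\ Qf e = 0;
  sd_ode : forall lam lam' (x y : R -> V) (t : R), D lam -> D lam' ->
    is_derive t 1 x (F (x t) lam) -> is_derive t 1 y (F (y t) lam') ->
    exists dY dQ, [/\ is_derive t 1 (fun t => Y (x t - y t)) dY,
      is_derive t 1 (fun t => Qf (x t - y t)) dQ,
      3 * c * Y (x t - y t) ^+ 2 - c * Qf (x t - y t) - C * `|lam - lam'| ^+ 2 <=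
        2 * (Y (x t - y t) * dY) &
      dQ <= - (3 * c) * Qf (x t - y t) + c * Y (x t - y t) ^+ 2 + C * `|lam - lam'| ^+ 2] }.

Lemma der_bounded_linear (l : V -> R) (C : R) (x : R -> V) (t : R) (dx : V) :
  (forall (a : R) u v, l (a *: u + v) = a * l u + l v) -> (forall v, `|l v| <= C * `|v|) ->
  is_derive t 1 x dx -> is_derive t 1 (fun t => l (x t)) (l dx).
Proof.
move=> lin lb /is_deriveP D; apply/is_deriveP => e e0.
have C10 : 0 < `|C| + 1 by rewrite ltr_wpDl.
have [d d0 H] := D (e / (`|C| + 1)) (divr_gt0 e0 C10).
exists d => // h hd; have lB u v : l u - l v = l (u - v).
  by have := lin (-1) v u; rewrite scaleN1r mulN1r addrC [_ + l u]addrC => ->.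
have lZ (a : R) u : a * l u = l (a *: u).
  have l0 : l 0 = 0 by have := lb 0; rewrite normr0 mulr0 normr_le0 => /eqP.
  by have := lin a u 0; rewrite addr0 l0 addr0.
rewrite lB /GRing.scale/= lZ lB; apply: le_trans (lb _) _.
apply: (@le_trans _ _ ((`|C| + 1) * `|x (t + h) - x t - h *: dx|)).
  by apply: ler_wpM2r => //; apply: le_trans (ler_norm C) _; rewrite lerDl.
apply: le_trans (ler_wpM2l (ltW C10) (H h hd)) _.
by rewrite mulrA mulrCA mulfV ?mulr1// gt_eqF.
Qed.

Lemma lyap_der (a b c e : R) (z1 z2 : R -> R) (t w1 w2 : R) :
  is_derive t 1 z1 w1 -> is_derive t 1 z2 w2 ->
  is_derive t 1 (fun t => lyap a b c e (z1 t) (z2 t)) (2 * lyap2 a b c e (z1 t) (z2 t) w1 w2).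
Proof.
move=> D1 D2.
have P := der_add (der_scale (- e) D1) (der_scale b D2).
have Q := der_sub (der_scale c D1) (der_scale a D2).
have D := der_add (der_add (der_scale (a * e - b * c) (der_add (der_mul D1 D1) (der_mul D2 D2)))
  (der_mul P P)) (der_mul Q Q).
apply: (der_eq (der_ext _ D)) => [s|]; first by rewrite /lyap !expr2.
by rewrite /lyap2; ring.
Qed.

Lemma le_sum4 (p q r s : R) : 0 <= p -> 0 <= q -> 0 <= r -> 0 <= s ->
  let t := p + q + r + s in [/\ p <= t, q <= t, r <= t & s <= t].
Proof. by move=> p0 q0 r0 s0 t; rewrite /t; split; lra. Qed.

Lemma sqr_sum_le (y s Z : R) : s ^+ 2 <= 2 * Z -> (y + s) ^+ 2 <= 4 * (y ^+ 2 + Z).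
Proof. by have := sqr_ge0 (y - s); have := sqr_ge0 y; rewrite sqrrB sqrrD; lra. Qed.

Definition clamp_row (r : R) (x : V) : V := \row_j clamp r (x 0 j).

Lemma clamp_row_le r x : 0 <= r -> `|clamp_row r x| <= r.
Proof.
by move=> r0; apply: (@fs_norm R V (FinSuprV 3)) => // i /=; rewrite mxE clamp_le.
Qed.

Lemma clamp_row_lip r x y : `|clamp_row r x - clamp_row r y| <= `|x - y|.
Proof.
apply: (@fs_norm R V (FinSuprV 3)) => // i /=; rewrite !mxE.
apply: le_trans (clamp_lip _ _ _) _.
by have := @fs_le R V (FinSuprV 3) i (x - y); rewrite /= !mxE.
Qed.

Lemma clamp_row_id r x : `|x| <= r -> clamp_row r x = x.
Proof.
move=> xr; apply/rowP => j; rewrite mxE clamp_id//.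
exact: le_trans (@fs_le R V (FinSuprV 3) j x) xr.
Qed.

Lemma derive_fst (f : V -> R * R -> V) (mu : R * R) (v : V) :
  'D_((v, 0) : V * (R * R)) (fun q => f q.1 q.2) (0, mu) = 'D_v (f ^~ mu) 0.
Proof.
apply: (@derive_line_ext R (V * (R * R))%type V V) => h /=.
by rewrite scaler0 add0r.
Qed.

(** Linearise, put the linear part into block form and cut the field off near
    the equilibrium, where the nonlinear part is as small as required. *)
Lemma saddle_exists (a1 b1 a2 b2 : R) (f : V -> R * R -> V) (mu : R * R) :
  let Q := (`[a1, b1] `*` `[a2, b2] : set (R * R)) in
  smooth_on ([set: V] `*` Q) (fun q => f q.1 q.2) ->
  (forall lam, Q lam -> f 0 lam = 0) -> Q mu -> hyperbolic_equilibrium (f ^~ mu) 0 1 2 ->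
  exists r F Y Qf c C KF, [/\ 0 < r,
    forall lam x, Q lam -> `|lam - mu| < r -> `|x| <= r -> F x lam = f x lam &
    saddle F [set lam | Q lam /\ `|lam - mu| < r] Y Qf c C KF].
Proof.
move=> Q fs f0 qmu [_ [s [sA _ cu cs]]].
have [Kf Kf0 fL] := smooth_field_lip fs 1.
have [W [oW AW CW]] := fs.
set A := 'J (f ^~ mu) 0 in sA.
have [S [m [a [b [c [e [k1 [k2 [SU m0 tr0 det0 HS]]]]]]]]] := hyperbolic_splitting sA cu cs.
have [CS CS0 HCS] := mulmx_norm S.
have [CI CI0 HCI] := mulmx_norm (invmx S).
have [CA CA0 HCA] := mulmx_norm A.
have [cc [k [ep [C [cc0 k0 ep0 C0 HI]]]]] := saddle_inequalities k1 k2 m0 tr0 det0.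
pose eps := ep / (CS * CI).
have CSI : 0 < CS * CI by rewrite mulr_gt0.
have eps0 : 0 < eps by rewrite divr_gt0.
have epsE : CS * (eps * CI) = ep by rewrite /eps; field; rewrite !gt_eqF.
pose f' (q : V * (R * R)) := f q.1 q.2.
have O0 : W (0, mu) by apply: AW.
have [r1 r10 Hst] := @C1_strict R _ _ _ (FinSuprV 3) f' W (0, mu) eps oW (CW 1%N) O0 eps0.
have df' : differentiable f' (0, mu) by exact: Ck_differentiable (CW 1%N) O0.
have DA v : 'D_((v, 0) : V * (R * R)) f' (0, mu) = v *m A.
  rewrite derive_fst deriveEjacobian//.
  have -> : f ^~ mu = f' \o (fun x => (x, mu)) by [].
  apply: differentiable_comp; last exact: df'.
  by apply: differentiable_pair => //; exact: differentiable_cst.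
pose r := Num.min 1 (r1 / 2).
have r0 : 0 < r by rewrite lt_min ltr01 divr_gt0.
have rr1 : r < r1 by rewrite gt_min; apply/orP; right; lra.
have rle1 : r <= 1 by rewrite ge_min lexx.
pose cl := clamp_row r.
have clr x : `|cl x| <= r by apply: clamp_row_le; exact: ltW.
pose F x lam := x *m A + (f (cl x) lam - cl x *m A).
pose D := [set lam | Q lam /\ `|lam - mu| < r].
have Frem lam lam' x y : D lam -> D lam' ->
    `|F x lam - F y lam' - (x - y) *m A| <= eps * `|x - y| + Kf * `|lam - lam'|.
  move=> [ql lr] [ql' lr'].
  have -> : F x lam - F y lam' - (x - y) *m A =
    (f (cl x) lam - f (cl y) lam - (cl x - cl y) *m A) + (f (cl y) lam - f (cl y) lam').
    by rewrite /F !mulmxBl; move: (x *m A) (y *m A) (cl x *m A) (cl y *m A) => p1 p2 p3 p4; apply/rowP => j; rewrite !mxE; ring.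
  apply: normD_le; apply: lerD.
    have in1 z : `|((cl z, lam) : V * (R * R)) - (0, mu)| < r1.
      rewrite norm_pairB subr0 gt_max (le_lt_trans (clr z) rr1)/=; exact: lt_trans lr rr1.
    have := Hst (cl x, lam) (cl y, lam) (in1 x) (in1 y).
    have -> : ((cl x, lam) : V * (R * R)) - (cl y, lam) = (cl x - cl y, 0).
      by apply/pair_equal_spec; split=> //=; rewrite subrr.
    rewrite DA => h; apply: le_trans h _; rewrite norm_pair normr0 (max_idPl (normr_ge0 _)) ler_pM2l//.
    exact: clamp_row_lip.
  have cl1 : `|cl y| <= 1 by exact: le_trans (clr y) rle1.
  have := fL lam lam' (cl y) (cl y) ql ql' cl1 cl1.
  by rewrite max_normBr.
pose Y (v : V) := (v *m S) 0 0.
pose Z1 (v : V) := (v *m S) 0 1.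
pose Z2 (v : V) := (v *m S) 0 2%:R.
pose Qf v := k * lyap a b c e (Z1 v) (Z2 v).
have lin j (h : R) (u v : V) : ((h *: u + v) *m S) 0 j = h * (u *m S) 0 j + (v *m S) 0 j.
  by rewrite mulmxDl -scalemxAl !mxE.
have bd j (v : V) : `|(v *m S) 0 j| <= CS * `|v|.
  exact: le_trans (@fs_le R V (FinSuprV 3) j (v *m S)) (HCS v).
have nrm (v : V) : `|v| <= CI * (`|Y v| + (`|Z1 v| + `|Z2 v|)).
  have -> : `|v| = `|v *m S *m invmx S| by rewrite mulmxK.
  apply: le_trans (HCI _) _; rewrite ler_pM2l//.
  have h0 : 0 <= `|Y v| := normr_ge0 _.
  have h1 : 0 <= `|Z1 v| := normr_ge0 _.
  have h2 : 0 <= `|Z2 v| := normr_ge0 _.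
  apply: (@fs_norm R V (FinSuprV 3)) => [|j /=]; first by rewrite !addr_ge0.
  case: (unliftP 0 j) => [j' ->|->]; last by rewrite -/(Y v); lra.
  case: (unliftP 0 j') => [j'' ->|->].
    have -> : lift 0 (lift 0 j'') = 2%:R by apply/val_inj; rewrite /= ord1.
    by rewrite -/(Z2 v); lra.
  have -> : lift 0 (0 : 'I_2) = 1 by apply/val_inj.
  by rewrite -/(Z1 v); lra.
pose d := a * e - b * c.
pose w := 2 * (a * e - b * c + (`|e| + `|b|) ^+ 2 + (`|c| + `|a|) ^+ 2).
have w0 : 0 < w by rewrite /w mulr_gt0// -addrA ltr_wpDr// addr_ge0 ?sqr_ge0.
have kd0 : 0 < k * d by rewrite mulr_gt0.
pose CN := 4 * CI ^+ 2 * (1 + (k * d)^-1).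
have CN0 : 0 < CN by rewrite /CN !mulr_gt0 ?exprn_gt0// addr_gt0// invr_gt0.
pose CE := C * (CS * Kf) ^+ 2.
have CE0 : 0 < CE by rewrite mulr_gt0// exprn_gt0// mulr_gt0.
pose CP := k * (w / 2 * (4 * CS ^+ 2)).
have CP0 : 0 < CP by rewrite /CP; apply: mulr_gt0 => //; apply: mulr_gt0; [exact: divr_gt0|rewrite mulr_gt0// exprn_gt0].
pose CQ0' := k * w * (2 * CS ^+ 2).
have CQ00 : 0 < CQ0' by rewrite /CQ0'; apply: mulr_gt0; [exact: mulr_gt0|rewrite mulr_gt0// exprn_gt0].
pose CQ := CQ0' + CP.
have CQ0 : 0 < CQ by rewrite addr_gt0.
pose CC := CE + CS + CQ + CN.
have [CE1 CS1 CQ1 CN1] : [/\ CE <= CC, CS <= CC, CQ <= CC & CN <= CC].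
  exact: le_sum4 (ltW CE0) (ltW CS0) (ltW CQ0) (ltW CN0).
have CC0 : 0 < CC by apply: lt_le_trans CS1.
pose KF := CA + eps + Kf.
have sq2 (x y : R) : 0 <= x -> x <= y -> x ^+ 2 <= y ^+ 2.
  by move=> x0 xy; rewrite ler_pXn2r ?nnegrE// (le_trans x0).
have Zn v : Z1 v ^+ 2 + Z2 v ^+ 2 <= 2 * CS ^+ 2 * `|v| ^+ 2.
  rewrite -mulrA -exprMn -[Z1 v ^+ 2]real_normK ?num_real// -[Z2 v ^+ 2]real_normK ?num_real//.
  have h1 := sq2 _ _ (normr_ge0 _) (bd 1 v); have h2 := sq2 _ _ (normr_ge0 _) (bd 2%:R v).
  by rewrite mulr_natl mulr2n; apply: lerD.
exists r, F, Y, Qf, cc, CC, KF; split=> //.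
  by move=> lam x ql lr xr; rewrite /F /cl clamp_row_id// addrC subrK.
split=> //.
- by rewrite /KF !addr_gt0.
- move=> lam lam' x y Dl Dl'; set mm := Num.max _ _.
  have m1 : `|x - y| <= mm by rewrite le_max lexx.
  have m2 : `|lam - lam'| <= mm by rewrite le_max lexx orbT.
  rewrite -[F x lam - _](subrK ((x - y) *m A)).
  apply: normD_le.
  have h1 := Frem lam lam' x y Dl Dl'; have h2 := HCA (x - y).
  have h3 : eps * `|x - y| <= eps * mm by rewrite ler_pM2l.
  have h4 : Kf * `|lam - lam'| <= Kf * mm by rewrite ler_pM2l.
  have h5 : CA * `|x - y| <= CA * mm by rewrite ler_pM2l.
  apply: le_trans (lerD h1 h2) _; apply: le_trans (lerD (lerD h3 h4) h5) _.
  by rewrite le_eqVlt; apply/orP; left; apply/eqP; rewrite /KF; ring.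
- move=> lam [ql lr]; rewrite /F /cl clamp_row_id ?normr0 ?(ltW r0)//.
  by rewrite f0// mul0mx subrr addr0.
- by move=> h u v; exact: lin.
- by move=> v; apply: le_trans (bd 0 v) _; rewrite ler_wpM2r.
- move=> v; rewrite /Qf mulr_ge0 ?(ltW k0)//; apply: le_trans (lyap_ge _ _ _ _ _ _).
  by rewrite mulr_ge0 ?(ltW det0)// addr_ge0 ?sqr_ge0.
- move=> h v; rewrite /Qf; have lz j : ((h *: v) *m S) 0 j = h * (v *m S) 0 j by rewrite -scalemxAl mxE.
  by rewrite /Z1 /Z2 !lz /lyap; ring.
- move=> v u; rewrite /Qf.
  have lB j : ((v - u) *m S) 0 j = (v *m S) 0 j - (u *m S) 0 j by rewrite mulmxBl !mxE.
  rewrite /Z1 /Z2 !lB; set x1 := (v *m S) 0 1; set x2 := (v *m S) 0 2%:R.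
  set y1 := (u *m S) 0 1; set y2 := (u *m S) 0 2%:R.
  have par : lyap a b c e (x1 - y1) (x2 - y2) + lyap a b c e (x1 + y1) (x2 + y2) =
    2 * lyap a b c e x1 x2 + 2 * lyap a b c e y1 y2 by rewrite /lyap; ring.
  have pos : 0 <= lyap a b c e (x1 + y1) (x2 + y2).
    by apply: le_trans (lyap_ge _ _ _ _ _ _); rewrite mulr_ge0 ?(ltW det0)// addr_ge0 ?sqr_ge0.
  have -> : 2 * (k * lyap a b c e x1 x2) + 2 * (k * lyap a b c e y1 y2) =
    k * (lyap a b c e (x1 - y1) (x2 - y2) + lyap a b c e (x1 + y1) (x2 + y2)) by rewrite par; ring.
  by rewrite ler_pM2l// lerDl.
- move=> v; apply: (@le_trans _ _ (CQ0' * `|v| ^+ 2)).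
    have -> : CQ0' * `|v| ^+ 2 = k * (w * (2 * CS ^+ 2 * `|v| ^+ 2)) by rewrite /CQ0'; ring.
    rewrite /Qf ler_pM2l//; apply: le_trans (lyap_le det0 _ _) _; rewrite -/w ler_pM2l//; exact: Zn.
  by rewrite ler_wpM2r ?sqr_ge0//; apply: le_trans CQ1; rewrite lerDl ltW.
- move=> v u; rewrite /Qf -mulrBr normrM (gtr0_norm k0).
  have lB j : ((v - u) *m S) 0 j = (v *m S) 0 j - (u *m S) 0 j by rewrite mulmxBl !mxE.
  have lD j : ((v + u) *m S) 0 j = (v *m S) 0 j + (u *m S) 0 j by rewrite mulmxDl !mxE.
  have -> : lyap a b c e (Z1 v) (Z2 v) - lyap a b c e (Z1 u) (Z2 u) =
      lyap2 a b c e (Z1 (v - u)) (Z2 (v - u)) (Z1 (v + u)) (Z2 (v + u)).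
    by rewrite /Z1 /Z2 !lB !lD /lyap /lyap2; ring.
  have s2 x : `|Z1 x| + `|Z2 x| <= 2 * (CS * `|x|).
    by rewrite mulr_natl mulr2n; apply: lerD; exact: bd.
  apply: (@le_trans _ _ (CP * (`|v - u| * `|v + u|))); last first.
    by apply: ler_wpM2r; rewrite ?mulr_ge0//; apply: le_trans CQ1; rewrite lerDr ltW.
  have -> : CP * (`|v - u| * `|v + u|) = k * (w / 2 * ((2 * (CS * `|v - u|)) * (2 * (CS * `|v + u|)))).
    by rewrite /CP; ring.
  rewrite ler_pM2l//; apply: le_trans (lyap2_bound det0 _ _ _ _) _.
  have -> : a * e - b * c + (`|e| + `|b|) ^+ 2 + (`|c| + `|a|) ^+ 2 = w / 2 by rewrite /w; field.
  by rewrite ler_pM2l ?divr_gt0//; apply: ler_pM => //; rewrite addr_ge0.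
- move=> v; apply: (@le_trans _ _ (CN * (Y v ^+ 2 + Qf v))); last first.
    rewrite ler_wpM2r// addr_ge0 ?sqr_ge0//.
    rewrite /Qf mulr_ge0 ?(ltW k0)//; apply: le_trans (lyap_ge _ _ _ _ _ _).
    by rewrite mulr_ge0 ?(ltW det0)// addr_ge0 ?sqr_ge0.
  have h1 := sq2 _ _ (normr_ge0 v) (nrm v); apply: le_trans h1 _.
  have -> : CN * (Y v ^+ 2 + Qf v) = CI ^+ 2 * (4 * ((1 + (k * d)^-1) * (Y v ^+ 2 + Qf v))) by rewrite /CN; ring.
  rewrite exprMn ler_pM2l ?exprn_gt0//.
  have h2 := sum_sqr_abs (Z1 v) (Z2 v).
  have h3 : (`|Y v| + (`|Z1 v| + `|Z2 v|)) ^+ 2 <= 4 * (Y v ^+ 2 + (Z1 v ^+ 2 + Z2 v ^+ 2)).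
    by rewrite -[Y v ^+ 2]real_normK ?num_real//; exact: sqr_sum_le.
  apply: le_trans h3 _; rewrite ler_pM2l//.
  have h4 : Z1 v ^+ 2 + Z2 v ^+ 2 <= (k * d)^-1 * Qf v.
    rewrite mulrC ler_pdivlMr// mulrC /Qf -mulrA ler_pM2l//; exact: lyap_ge.
  have h5 : 0 <= (k * d)^-1 * Y v ^+ 2 by rewrite mulr_ge0 ?sqr_ge0// invr_ge0 ltW.
  have h6 : 0 <= Qf v.
    rewrite /Qf mulr_ge0 ?(ltW k0)//; apply: le_trans (lyap_ge _ _ _ _ _ _).
    by rewrite mulr_ge0 ?(ltW det0)// addr_ge0 ?sqr_ge0.
  by move: h4 h5 h6; move: (Qf v) (Y v ^+ 2) (k * d)^-1 (_ + _) => q1 q2 q3 q4; rewrite mulrDl mul1r mulrDr; lra.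
- exists (delta_mx 0 0 *m invmx S); rewrite /Y /Qf /Z1 /Z2 !mulmxKV// !mxE/=.
  by split=> //; rewrite /lyap; ring.
- move=> lam lam' x y t Dl Dl' Dx Dy.
  have DD := der_sub Dx Dy.
  set v := x t - y t; set dv := F (x t) lam - F (y t) lam' in DD.
  pose rho := dv - v *m A.
  pose rj j := (rho *m S) 0 j.
  have dvE j : (dv *m S) 0 j = (v *m A *m S) 0 j + rj j.
    by have := lin j 1 rho (v *m A); rewrite scale1r mul1r subrK addrC.
  have [E0 E1 E2] := HS v.
  pose EE := CS * Kf * `|lam - lam'|.
  have EE0 : 0 <= EE by rewrite !mulr_ge0 ?(ltW CS0) ?(ltW Kf0).
  have rB j : `|rj j| <= ep * (`|Y v| + (`|Z1 v| + `|Z2 v|)) + EE.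
    apply: le_trans (bd j rho) _.
    apply: (@le_trans _ _ (CS * (eps * `|v| + Kf * `|lam - lam'|))).
      by rewrite ler_pM2l//; exact: Frem.
    have -> : CS * (eps * `|v| + Kf * `|lam - lam'|) = CS * (eps * `|v|) + EE by rewrite /EE; ring.
    have -> : ep * (`|Y v| + (`|Z1 v| + `|Z2 v|)) = CS * (eps * (CI * (`|Y v| + (`|Z1 v| + `|Z2 v|)))).
      by rewrite -epsE; ring.
    by rewrite lerD2r !ler_pM2l.
  have D0 : is_derive t 1 (fun t => Y (x t - y t)) ((dv *m S) 0 0).
    exact: (der_bounded_linear (lin 0) (bd 0) DD).
  have D1 : is_derive t 1 (fun t => Z1 (x t - y t)) ((dv *m S) 0 1).
    exact: (der_bounded_linear (lin 1) (bd 1) DD).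
  have D2 : is_derive t 1 (fun t => Z2 (x t - y t)) ((dv *m S) 0 2%:R).
    exact: (der_bounded_linear (lin 2%:R) (bd 2%:R) DD).
  exists ((dv *m S) 0 0), (k * (2 * lyap2 a b c e (Z1 v) (Z2 v) ((dv *m S) 0 1) ((dv *m S) 0 2%:R))).
  have [H1 H2] := HI (Y v) (Z1 v) (Z2 v) (rj 0) (rj 1) (rj 2%:R) EE EE0 (rB 0) (rB 1) (rB 2%:R).
  have CEE : C * EE ^+ 2 <= CC * `|lam - lam'| ^+ 2.
    by rewrite /EE exprMn mulrA -/CE ler_wpM2r// sqr_ge0.
  have DQ : is_derive t 1 (fun t => Qf (x t - y t))
      (k * (2 * lyap2 a b c e (Z1 v) (Z2 v) ((dv *m S) 0 1) ((dv *m S) 0 2%:R))).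
    exact: der_scale k (lyap_der a b c e D1 D2).
  split=> //.
    by rewrite dvE E0; apply: le_trans H1; rewrite lerD2l lerN2.
  by rewrite !dvE E1 E2; apply: le_trans H2 _; rewrite lerD2l.
Qed.

End Saddle.

(** * Global flows *)

Section GlobalFlow.
Context {R : realType} {V : normedModType R} {fV : FinSup V}.
Variables (F : V -> R * R -> V) (D : set (R * R)) (K : R).
Hypothesis K0 : 0 < K.
Hypothesis FL : forall lam lam' x y, D lam -> D lam' ->
  `|F x lam - F y lam'| <= K * Num.max `|x - y| `|lam - lam'|.

Definition orbits (lam : R * R) (x0 : V) : set (R -> V) :=
  [set x | x 0 = x0 /\ forall t : R, is_derive t 1 x (F (x t) lam)].

Definition gflow (lam : R * R) (x0 : V) : R -> V := xget (cst x0) (orbits lam x0).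

Lemma gflowP lam x0 : D lam -> orbits lam x0 (gflow lam x0).
Proof.
move=> dl; have [|x hx] := @picard R V fV (F ^~ lam) K x0 K0.
  by move=> x y; have := FL x y dl dl; rewrite max_normBl.
exact: (xgetPex (P := orbits lam x0) (cst x0) (ex_intro _ x hx)).
Qed.

Lemma gflow0 lam x0 : D lam -> gflow lam x0 0 = x0.
Proof. by move=> dl; case: (gflowP x0 dl). Qed.

Lemma gflow_der lam x0 (t : R) : D lam -> is_derive t 1 (gflow lam x0) (F (gflow lam x0 t) lam).
Proof. by move=> dl; case: (gflowP x0 dl). Qed.

Lemma solutions_dep lam lam' (x y : R -> V) (T t : R) : D lam -> D lam' ->
  0 <= T -> - T <= t <= T ->
  (forall s : R, - T <= s <= T -> is_derive s 1 x (F (x s) lam)) ->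
  (forall s : R, - T <= s <= T -> is_derive s 1 y (F (y s) lam')) ->
  `|x t - y t| <= 2 * (`|x 0 - y 0| + K * `|lam - lam'| * T) * expR (2 * K * `|t|).
Proof.
move=> dl dl' T0 /andP[t1 t2] Dx Dy.
pose z t := x t - y t; pose dz t := F (x t) lam - F (y t) lam'.
have Dz (s : R) : - T <= s <= T -> is_derive s 1 z (dz s).
  by move=> h; exact: der_sub (Dx s h) (Dy s h).
have Bz s : `|dz s| <= K * `|z s| + K * `|lam - lam'|.
  apply: le_trans (FL _ _ dl dl') _; rewrite -mulrDr ler_wpM2l ?(ltW K0)//.
  by rewrite ge_max lerDl lerDr !normr_ge0.
have e0 : 0 <= K * `|lam - lam'| by rewrite mulr_ge0// ltW.
rewrite -/(z 0) -/(z t); have [t0|/ltW t0] := leP 0 t.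
  rewrite [`|t|]ger0_norm//.
  have Dz' (s : R) : 0 <= s <= T -> is_derive s 1 z (dz s).
    by move=> /andP[s0 sT]; apply: Dz; rewrite sT andbT (le_trans _ s0)// oppr_le0.
  by apply: (gronwall K0 T0 e0 Dz' (fun s _ => Bz s)); rewrite t0.
rewrite [`|t|]ler0_norm//.
have Dz' (s : R) : - T <= s <= 0 -> is_derive s 1 z (dz s).
  by move=> /andP[s0 sT]; apply: Dz; rewrite s0 (le_trans sT).
by apply: (gronwall_rev K0 T0 e0 Dz' (fun s _ => Bz s)); rewrite t0 t1.
Qed.

Lemma gflow_dep lam lam' x y (T t : R) : D lam -> D lam' -> 0 <= T -> - T <= t <= T ->
  `|gflow lam x t - gflow lam' y t| <=
    2 * (`|x - y| + K * `|lam - lam'| * T) * expR (2 * K * `|t|).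
Proof.
move=> dl dl' T0 tT; have := solutions_dep dl dl' T0 tT
  (fun s _ => gflow_der x s dl) (fun s _ => gflow_der y s dl').
by rewrite !gflow0.
Qed.

Lemma gflow_uniq lam (x : R -> V) : D lam -> (forall t : R, is_derive t 1 x (F (x t) lam)) ->
  forall t, x t = gflow lam (x 0) t.
Proof.
move=> dl Dx t; have T0 : 0 <= `|t| by [].
have tT : - `|t| <= t <= `|t| by rewrite -ler_norml.
have := solutions_dep dl dl T0 tT (fun s _ => Dx s) (fun s _ => gflow_der (x 0) s dl).
rewrite gflow0// !subrr !normr0 mulr0 mul0r addr0 mulr0 mul0r normr_le0 subr_eq0.
by move/eqP.
Qed.

Lemma gflow_shift lam x0 (s t : R) : D lam ->
  gflow lam (gflow lam x0 s) t = gflow lam x0 (t + s).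
Proof.
move=> dl; have Dx (r : R) : is_derive r 1 (fun t => gflow lam x0 (t + s)) (F (gflow lam x0 (r + s)) lam).
  by apply: is_derive_shiftc; exact: gflow_der.
by have := gflow_uniq dl Dx t; rewrite add0r => ->.
Qed.

Lemma gflow_near lam x0 (T e : R) : D lam -> 0 <= T -> 0 < e ->
  exists2 r, 0 < r & forall lam' y t, D lam' -> `|lam' - lam| < r -> `|y - x0| < r ->
    - T <= t <= T -> `|gflow lam' y t - gflow lam x0 t| < e.
Proof.
move=> dl T0 e0; set E := expR (2 * K * T); have E0 : 0 < E := expR_gt0 _.
have c0 : 0 < 2 * (1 + K * T) * E by rewrite !mulr_gt0// ltr_wpDr// mulr_ge0// ltW.
exists (e / (2 * (1 + K * T) * E)); first exact: divr_gt0.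
move=> lam' y t dl' lr yr tT; apply: le_lt_trans (gflow_dep _ _ dl' dl T0 tT) _.
set r := e / _ in lr yr.
have h1 : expR (2 * K * `|t|) <= E.
  by rewrite ler_expR ler_pM2l ?mulr_gt0// ler_norml.
have h2 : `|y - x0| + K * `|lam' - lam| * T < r * (1 + K * T).
  have : K * `|lam' - lam| * T <= K * r * T by rewrite ler_wpM2r// ler_pM2l// ltW.
  by rewrite mulrDr mulr1; move: yr; lra.
have h3 : 0 <= `|y - x0| + K * `|lam' - lam| * T by rewrite addr_ge0// !mulr_ge0// ltW.
apply: le_lt_trans (ler_wpM2l _ h1) _; first by rewrite mulr_ge0.
have eE : 2 * (r * (1 + K * T)) * E = e.
  by rewrite /r; field; rewrite gt_eqF// ?gt_eqF// ltr_wpDr// mulr_ge0// ltW.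
by rewrite -[X in _ < X]eE ltr_pM2r// ltr_pM2l.
Qed.

End GlobalFlow.

Section Comparison.
Context {R : realType}.
Implicit Types (g dg : R -> R) (k a b t : R).

Lemma exp_compare g dg k a b : a <= b ->
  deriv_on a b g dg ->
  (forall t, a <= t <= b -> k * g t <= dg t) -> g a * expR (k * (b - a)) <= g b.
Proof.
move=> ab Dg H.
pose h t := g t * expR (- k * t).
pose dh t := dg t * expR (- k * t) + g t * (- k * expR (- k * t)).
have Dh (t : R) : a <= t <= b -> is_derive t 1 h (dh t).
  by move=> tab; exact: der_mul (Dg t tab) (der_expk (- k) t).
have := nondecreasing_der ab Dh.
have dh0 t : a <= t <= b -> 0 <= dh t.
  move=> tab; have -> : dh t = (dg t - k * g t) * expR (- k * t) by rewrite /dh; ring.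
  by rewrite mulr_ge0 ?expR_ge0// subr_ge0; exact: H.
move=> /(_ dh0); rewrite /h => hh.
have -> : g b = g b * expR (- k * b) * expR (k * b).
  by rewrite -mulrA -expRD mulNr addNr expR0 mulr1.
have -> : g a * expR (k * (b - a)) = g a * expR (- k * a) * expR (k * b).
  by rewrite -mulrA -expRD; congr (_ * expR _); ring.
by rewrite ler_pM2r ?expR_gt0.
Qed.

End Comparison.

(** * Cones: stable and unstable sets of a saddle *)

Section Cones.
Context {R : realType}.
Local Notation V := 'rV[R]_3.
Variables (F : V -> R * R -> V) (D : set (R * R)) (Y Qf : V -> R) (c C KF : R).
Hypothesis SD : saddle F D Y Qf c C KF.

Let c0 : 0 < c := sd_c SD.
Let C0 : 0 < C := sd_C SD.
Let KF0 : 0 < KF := sd_KF SD.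
Let FL := sd_lip SD.

Definition cone (v : V) : R := Y v ^+ 2 - Qf v.

Definition esol (lam : R * R) (x : R -> V) : Prop := forall t : R, is_derive t 1 x (F (x t) lam).

Lemma saddle_Y0 : Y 0 = 0.
Proof. by have := sd_Y SD 0; rewrite normr0 mulr0 normr_le0 => /eqP. Qed.

Lemma saddle_YB v w : Y (v - w) = Y v - Y w.
Proof. by have := sd_Ylin SD (-1) w v; rewrite scaleN1r mulN1r addrC => ->; rewrite addrC. Qed.

Lemma saddle_YZ a v : Y (a *: v) = a * Y v.
Proof. by have := sd_Ylin SD a v 0; rewrite addr0 saddle_Y0 addr0. Qed.

Lemma saddle_Qf0 : Qf 0 = 0.
Proof. by have := sd_QZ SD 0 0; rewrite scale0r expr0n/= mul0r. Qed.

Lemma esol_gflow lam x0 : D lam -> esol lam (gflow F lam x0).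
Proof. by move=> dl t; exact: (gflow_der KF0 FL). Qed.

Lemma esol0 lam : D lam -> esol lam (fun=> 0).
Proof. by move=> dl t; apply: (der_eq (der_cst 0 t)); rewrite (sd_zero SD). Qed.

Section Pair.
Variables (lam lam' : R * R) (x y : R -> V).
Hypotheses (dl : D lam) (dl' : D lam') (ex : esol lam x) (ey : esol lam' y).
Let E := C * `|lam - lam'| ^+ 2.
Let E0 : 0 <= E. Proof. by rewrite mulr_ge0 ?sqr_ge0// ltW. Qed.

Let sdd (t : R) := cid (sd_ode SD dl dl' (ex t) (ey t)).
Let dY (t : R) := sval (sdd t).
Let dQ (t : R) := sval (cid (svalP (sdd t))).

Let dP (t : R) : [/\ is_derive t 1 (fun t => Y (x t - y t)) (dY t),
      is_derive t 1 (fun t => Qf (x t - y t)) (dQ t),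
      3 * c * Y (x t - y t) ^+ 2 - c * Qf (x t - y t) - E <=
        2 * (Y (x t - y t) * dY t) &
      dQ t <= - (3 * c) * Qf (x t - y t) + c * Y (x t - y t) ^+ 2 + E].
Proof. exact: svalP (cid (svalP (sdd t))). Qed.

Lemma pair_Y_cont (t : R) : {for t, continuous (fun t => Y (x t - y t))}.
Proof. by case: (dP t) => h _ _ _; exact: is_derive_cts h. Qed.

Let dV (t : R) := dY t * Y (x t - y t) + Y (x t - y t) * dY t - dQ t.

Let DV (t : R) : is_derive t 1 (fun t => cone (x t - y t)) (dV t).
Proof.
case: (dP t) => h1 h2 _ _.
by apply: der_ext (der_sub (der_mul h1 h1) h2) => s; rewrite /cone expr2.
Qed.

Let dV_ge (t : R) : 2 * c * (Y (x t - y t) ^+ 2 + Qf (x t - y t)) - 2 * E <= dV t.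
Proof. by case: (dP t) => _ _ h3 h4; rewrite /dV [dY t * _]mulrC; lra. Qed.

Let V_le t : cone (x t - y t) <= Y (x t - y t) ^+ 2 + Qf (x t - y t).
Proof. by rewrite /cone lerD2l ge0_cp// (sd_Q0 SD). Qed.

Let V_ge t : - cone (x t - y t) <= Y (x t - y t) ^+ 2 + Qf (x t - y t).
Proof. by rewrite /cone opprB addrC lerD2r; have := sqr_ge0 (Y (x t - y t)); lra. Qed.

(** For different parameters the cone is only invariant up to E / c. *)
Lemma cone_grow a b : a <= b ->
  (cone (x a - y a) - E / c) * expR (2 * c * (b - a)) <= cone (x b - y b) - E / c.
Proof.
move=> ab; apply: (@exp_compare R (fun t => cone (x t - y t) - E / c) dV (2 * c) a b ab) => t _.
  by apply: (der_eq (der_sub (DV t) (der_cst (E / c) t))); rewrite subr0.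
apply: le_trans (dV_ge t); have h := V_le t.
have -> : 2 * c * (cone (x t - y t) - E / c) = 2 * c * cone (x t - y t) - 2 * E by field; rewrite gt_eqF.
by rewrite lerD2r ler_pM2l// mulr_gt0.
Qed.

Lemma cone_back a b : a <= b ->
  cone (x a - y a) + E / c <= (cone (x b - y b) + E / c) * expR (2 * c * (b - a)).
Proof.
move=> ab.
have := @exp_compare R (fun t => cone (x t - y t) + E / c) dV (- (2 * c)) a b ab _ _.
rewrite mulNr expRN ler_pdivrMr ?expR_gt0//; apply=> t _.
  by apply: (der_eq (der_add (DV t) (der_cst (E / c) t))); rewrite addr0.
apply: le_trans (dV_ge t); have h := V_ge t.
have -> : - (2 * c) * (cone (x t - y t) + E / c) = 2 * c * - cone (x t - y t) - 2 * E by field; rewrite gt_eqF.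
by rewrite lerD2r ler_pM2l// mulr_gt0.
Qed.

End Pair.

Section EqualParameters.
Variables (lam : R * R) (x y : R -> V).
Hypotheses (dl : D lam) (ex : esol lam x) (ey : esol lam y).

Lemma cone_grow0 a b : a <= b ->
  cone (x a - y a) * expR (2 * c * (b - a)) <= cone (x b - y b).
Proof.
by move=> ab; have := cone_grow dl dl ex ey ab; rewrite subrr normr0 expr0n/= mulr0 mul0r !subr0.
Qed.

Lemma cone_back0 a b : a <= b ->
  cone (x a - y a) <= cone (x b - y b) * expR (2 * c * (b - a)).
Proof.
by move=> ab; have := cone_back dl dl ex ey ab; rewrite subrr normr0 expr0n/= mulr0 mul0r !addr0.
Qed.

Lemma cone_pos a b : a <= b -> 0 < cone (x a - y a) -> 0 < cone (x b - y b).
Proof.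
by move=> ab h; apply: lt_le_trans (cone_grow0 ab); rewrite mulr_gt0 ?expR_gt0.
Qed.

Lemma cone_nneg a b : a <= b -> 0 <= cone (x a - y a) -> 0 <= cone (x b - y b).
Proof.
by move=> ab h; apply: le_trans (cone_grow0 ab); rewrite mulr_ge0 ?expR_ge0.
Qed.

(** Inside the positive cone the unstable coordinate cannot change sign. *)
Lemma cone_sign sg a b : a <= b -> 0 < cone (x a - y a) -> 0 < sg * Y (x a - y a) ->
  0 < sg * Y (x b - y b).
Proof.
move=> ab ca sa; rewrite ltNge; apply/negP => sb.
have [||t /andP[at_ tb] yt] := @ivt_ge R (fun t => sg * Y (x t - y t)) a b 0 ab.
- by move=> t _; apply: (@continuousM _ _ (fun=> sg)); [exact: cvg_cst|exact: (pair_Y_cont dl dl ex ey)].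
- by rewrite sb (ltW sa).
have sg0 : sg != 0 by apply/eqP => E; rewrite E mul0r ltxx in sa.
move/eqP: yt; rewrite mulf_eq0 (negbTE sg0)/= => /eqP yt.
have := cone_pos at_ ca; rewrite /cone yt expr0n/= sub0r oppr_gt0 ltNge.
by rewrite (sd_Q0 SD).
Qed.

Lemma Y_grow a b : a <= b -> 0 <= cone (x a - y a) ->
  Y (x a - y a) ^+ 2 * expR (2 * c * (b - a)) <= Y (x b - y b) ^+ 2.
Proof.
move=> ab ca.
pose sdd (t : R) := cid (sd_ode SD dl dl (ex t) (ey t)).
pose dY t := sval (sdd t).
apply: (exp_compare ab (g := fun t => Y (x t - y t) ^+ 2)
  (dg := fun t => dY t * Y (x t - y t) + Y (x t - y t) * dY t)) => t /andP[at_ tb].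
  by have [dQ [h1 _ _ _]] := svalP (sdd t); apply: der_ext (der_mul h1 h1) => s; rewrite expr2.
have [dQ [_ _ + _]] := svalP (sdd t); rewrite -/(dY t) subrr normr0 expr0n/= mulr0 subr0 => h.
have := cone_nneg at_ ca; rewrite /cone => h2.
have : c * Qf (x t - y t) <= c * Y (x t - y t) ^+ 2 by rewrite ler_pM2l//; lra.
by rewrite [dY t * _]mulrC; lra.
Qed.

Lemma Q_decay a b : a <= b -> (forall t, a <= t <= b -> cone (x t - y t) <= 0) ->
  Qf (x b - y b) * expR (2 * c * (b - a)) <= Qf (x a - y a).
Proof.
move=> ab H.
pose sdd (t : R) := cid (sd_ode SD dl dl (ex t) (ey t)).
pose dQ t := sval (cid (svalP (sdd t))).
have := @exp_compare R (fun t => - Qf (x t - y t)) (fun t => - dQ t) (- (2 * c)) a b ab _ _.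
rewrite mulNr mulNr expRN lerNl opprK ler_pdivlMr ?expR_gt0//; apply=> t tab.
  have [_ h _ _] := svalP (cid (svalP (sdd t))).
  by apply: (der_eq (der_ext _ (der_scale (-1) h))) => [s|]; rewrite mulN1r.
have [_ _ _] := svalP (cid (svalP (sdd t))); rewrite -/(dQ t) subrr normr0 expr0n/= mulr0 addr0 => h.
have : c * Y (x t - y t) ^+ 2 <= c * Qf (x t - y t).
  by rewrite ler_pM2l//; have := H t tab; rewrite /cone; lra.
lra.
Qed.

End EqualParameters.

End Cones.

Section Saddle.
Context {R : realType}.
Local Notation V := 'rV[R]_3.
Variables (F : V -> R * R -> V) (D : set (R * R)) (Y Qf : V -> R) (c C KF : R).
Hypothesis SD : saddle F D Y Qf c C KF.

Let c0 : 0 < c := sd_c SD.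
Let C0 : 0 < C := sd_C SD.
Let KF0 : 0 < KF := sd_KF SD.
Let FL := sd_lip SD.
Local Notation flow := (gflow F).
Local Notation cone := (cone Y Qf).

Let eg lam x0 (dl : D lam) : esol F lam (flow lam x0) := esol_gflow SD x0 dl.

(** The orbit enters the cone around the unstable direction, on the side sg, and
    never leaves it again. *)
Definition leaves (sg : R) (lam : R * R) (x0 : V) : Prop :=
  exists t, [/\ 0 <= t, 0 < cone (flow lam x0 t) & 0 < sg * Y (flow lam x0 t)].

Lemma cone_pos_Y v : 0 < cone v -> Y v != 0.
Proof.
by rewrite /cone; apply: contraTneq => ->; rewrite expr0n/= sub0r -leNgt oppr_le0 (sd_Q0 SD).
Qed.

Lemma leaves_later sg lam x0 (t s : R) : D lam -> t <= s -> 0 < cone (flow lam x0 t) ->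
  0 < sg * Y (flow lam x0 t) -> 0 < cone (flow lam x0 s) /\ 0 < sg * Y (flow lam x0 s).
Proof.
move=> dl ts ct st.
have := cone_pos SD dl (eg x0 dl) (esol0 SD dl) ts; have := cone_sign SD dl (eg x0 dl) (esol0 SD dl) (sg := sg) ts.
by rewrite !subr0 => h1 h2; split; [exact: h2|exact: h1].
Qed.

Lemma leaves_disjoint lam x0 : D lam -> leaves 1 lam x0 -> ~ leaves (-1) lam x0.
Proof.
move=> dl [t [t0 ct st]] [s [s0 cs ss]].
have ts : t <= Num.max t s by rewrite le_max lexx.
have ss' : s <= Num.max t s by rewrite le_max lexx orbT.
have [_ h1] := leaves_later dl ts ct st; have [_ h2] := leaves_later dl ss' cs ss.
by lra.
Qed.

Lemma norm1P (sg : R) : `|sg| = 1 -> sg = 1 \/ sg = -1.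
Proof.
move=> h; have [s0|s0] := leP 0 sg; first by left; rewrite -h ger0_norm.
by right; rewrite -h ltr0_norm// opprK.
Qed.

Lemma leaves_shift sg lam x0 (s : R) : D lam -> leaves sg lam x0 -> leaves sg lam (flow lam x0 s).
Proof.
move=> dl [t [t0 ct st]]; exists (Num.max 0 (t - s)); split; first by rewrite le_max lexx.
  rewrite (gflow_shift KF0 FL)//; apply: (leaves_later dl _ ct st).1.
  by rewrite -lerBlDr le_max lexx orbT.
rewrite (gflow_shift KF0 FL)//; apply: (leaves_later dl _ ct st).2.
by rewrite -lerBlDr le_max lexx orbT.
Qed.

Lemma cone_continuous v e : 0 < e -> exists2 r, 0 < r & forall w, `|w - v| < r ->
  `|cone w - cone v| < e /\ `|Y w - Y v| < e.
Proof.
move=> e0; pose M := 2 * `|v| + 1; have M0 : 0 < M by rewrite ltr_wpDl// mulr_ge0.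
pose A := C * C * M + C * M + C.
have A0 : 0 < A by rewrite !addr_gt0// !mulr_gt0.
exists (Num.min 1 (e / A)); first by rewrite lt_min ltr01 divr_gt0.
move=> w; rewrite lt_min => /andP[w1 wA].
have wv : `|w + v| <= M.
  rewrite (_ : w + v = (w - v) + 2 *: v); last by rewrite scaler_nat mulr2n addrA subrK.
  apply: normD_le; rewrite normrZ ger0_norm// /M addrC lerD2l; exact: ltW.
have h1 : `|Y w - Y v| <= C * `|w - v| by rewrite -(saddle_YB SD); exact: (sd_Y SD).
have h2 : `|Qf w - Qf v| <= C * (`|w - v| * M).
  by apply: le_trans (sd_Qc SD w v) _; rewrite ler_pM2l// ler_wpM2l.
have h3 : `|Y w ^+ 2 - Y v ^+ 2| <= C * C * M * `|w - v|.
  rewrite subr_sqr normrM; have := sd_Y SD (w + v).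
  have -> : Y (w + v) = Y w + Y v by have := sd_Ylin SD 1 w v; rewrite scale1r mul1r.
  move=> h; have -> : C * C * M * `|w - v| = (C * `|w - v|) * (C * M) by ring.
  apply: ler_pM => //; apply: le_trans h _; by rewrite ler_pM2l.
have wA' : A * `|w - v| < e by move: wA; rewrite ltr_pdivlMr// mulrC.
have n0 : 0 <= `|w - v| by [].
have a1 : 0 <= C * C * M * `|w - v| by rewrite !mulr_ge0// ltW.
have a2 : 0 <= C * M * `|w - v| by rewrite !mulr_ge0// ltW.
have a3 : 0 <= C * `|w - v| by rewrite mulr_ge0// ltW.
have AE : A * `|w - v| = C * C * M * `|w - v| + C * M * `|w - v| + C * `|w - v| by rewrite /A; ring.
split; last by apply: le_lt_trans h1 _; rewrite AE in wA'; lra.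
rewrite /cone (_ : _ - _ = (Y w ^+ 2 - Y v ^+ 2) - (Qf w - Qf v)); last by ring.
apply: le_lt_trans (ler_normB _ _) _; apply: le_lt_trans (lerD h3 h2) _.
by rewrite AE in wA'; lra.
Qed.

Lemma leaves_open sg lam x0 : `|sg| = 1 -> D lam -> leaves sg lam x0 -> exists2 r, 0 < r &
  forall lam' y, D lam' -> `|lam' - lam| < r -> `|y - x0| < r -> leaves sg lam' y.
Proof.
move=> sg1 dl [t [t0 ct st]].
pose e := Num.min (cone (flow lam x0 t)) (sg * Y (flow lam x0 t)).
have e0 : 0 < e by rewrite lt_min ct.
have [r1 r10 H1] := cone_continuous (flow lam x0 t) e0.
have [r r0 H] := gflow_near KF0 FL x0 dl t0 r10.
exists r => // lam' y dl' lr yr; exists t; split=> //.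
  have tt : - t <= t <= t by rewrite lexx andbT (le_trans _ t0)// oppr_le0.
  have [h _] := H1 _ (H lam' y t dl' lr yr tt).
  have : e <= cone (flow lam x0 t) by rewrite ge_min lexx.
  by move: h => /ltr_normlP[+ _]; lra.
have tt : - t <= t <= t by rewrite lexx andbT (le_trans _ t0)// oppr_le0.
have [_ h] := H1 _ (H lam' y t dl' lr yr tt).
have : e <= sg * Y (flow lam x0 t) by rewrite ge_min lexx orbT.
have : `|sg * (Y (flow lam' y t) - Y (flow lam x0 t))| < e by rewrite normrM sg1 mul1r.
by rewrite mulrBr => /ltr_normlP[+ _]; lra.
Qed.

(** Outside the positive cone Qf controls the norm and decays. *)
Lemma stays lam x0 : D lam -> ~ leaves 1 lam x0 -> ~ leaves (-1) lam x0 ->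
  forall t, 0 <= t -> `|flow lam x0 t| ^+ 2 <= 2 * C * Qf x0 * expR (- (2 * c) * t).
Proof.
move=> dl np nm.
have cn t : 0 <= t -> cone (flow lam x0 t) <= 0.
  move=> t0; rewrite leNgt; apply/negP => ct; have := cone_pos_Y ct.
  rewrite neq_lt => /orP[y|y]; [apply: nm|apply: np]; exists t; split=> //.
    by rewrite mulN1r oppr_gt0.
  by rewrite mul1r.
move=> t t0.
have := Q_decay SD dl (eg x0 dl) (esol0 SD dl) t0.
rewrite !subr0 (gflow0 KF0 FL)// => h.
have hQ : Qf (flow lam x0 t) * expR (2 * c * t) <= Qf x0.
  by apply: h => s /andP[s0 _]; rewrite subr0; exact: cn.
apply: le_trans (sd_norm SD _) _.
have hc := cn t t0; rewrite /cone in hc.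
have hQ' : Qf (flow lam x0 t) <= Qf x0 * expR (- (2 * c) * t).
  by rewrite mulNr expRN ler_pdivlMr ?expR_gt0.
have -> : 2 * C * Qf x0 * expR (- (2 * c) * t) = C * (2 * (Qf x0 * expR (- (2 * c) * t))) by ring.
by rewrite ler_pM2l//; lra.
Qed.

(** Displacing a staying orbit along the unstable direction makes it leave on
    the side of the displacement. *)
Lemma displaced_leaves sg lam x0 x1 : `|sg| = 1 -> D lam ->
  ~ leaves 1 lam x0 -> ~ leaves (-1) lam x0 ->
  0 < cone (x1 - x0) -> 0 < sg * Y (x1 - x0) -> leaves sg lam x1.
Proof.
move=> sg1 dl np nm cd sd; have st := stays dl np nm.
pose d t := flow lam x1 t - flow lam x0 t.
have d0 : d 0 = x1 - x0 by rewrite /d !(gflow0 KF0 FL).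
have ds t : 0 <= t -> 0 < sg * Y (d t).
  move=> t0; apply: (cone_sign SD dl (eg x1 dl) (eg x0 dl) t0); rewrite -/(d 0) d0//.
have dY t : 0 <= t -> Y (d 0) ^+ 2 * (1 + 2 * c * t) <= Y (d t) ^+ 2.
  move=> t0; have := Y_grow SD dl (eg x1 dl) (eg x0 dl) t0.
  rewrite -/(d 0) -/(d t) subr0 => /(_ _) h; apply: le_trans (h _); last by rewrite d0 ltW.
  by rewrite ler_wpM2l ?sqr_ge0// expR_ge1Dx.
pose B := 2 * C * Qf x0.
have B0 : 0 <= B by rewrite !mulr_ge0 ?(sd_Q0 SD)// ltW.
have Yb (M : R) (v : V) : `|v| ^+ 2 <= M -> Y v ^+ 2 <= C ^+ 2 * M.
  move=> vM; rewrite -[Y v ^+ 2]real_normK ?num_real//.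
  apply: (@le_trans _ _ ((C * `|v|) ^+ 2)); last by rewrite exprMn ler_pM2l// exprn_gt0.
  by rewrite ler_pXn2r ?nnegrE ?mulr_ge0 ?(ltW C0)//; exact: (sd_Y SD).
have x0B t : 0 <= t -> `|flow lam x0 t| ^+ 2 <= B.
  move=> t0; apply: le_trans (st t t0) _; rewrite -/B ler_piMr// -expR0 ler_expR mulNr oppr_le0.
  by rewrite !mulr_ge0// ltW.
have d00 : 0 < Y (d 0) ^+ 2 by rewrite d0 exprn_even_gt0//=; exact: cone_pos_Y.
(* a time at which the displacement has outgrown any fixed bound *)
have far M s : exists t, [/\ 0 <= t, s <= t & M < Y (d t) ^+ 2].
  have y00 : Y (d 0) ^+ 2 != 0 by rewrite gt_eqF.
  have cY : 0 < 2 * c * Y (d 0) ^+ 2 by apply: mulr_gt0 d00; exact: mulr_gt0.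
  pose t1 := `|M| / (2 * c * Y (d 0) ^+ 2); have t10 : 0 <= t1 by rewrite divr_ge0// ltW.
  exists (Num.max t1 s); have t1s : t1 <= Num.max t1 s by rewrite le_max lexx.
  split; [exact: le_trans t1s|by rewrite le_max lexx orbT|].
  apply: lt_le_trans (dY _ (le_trans t10 t1s)).
  apply: (@lt_le_trans _ _ (Y (d 0) ^+ 2 * (1 + 2 * c * t1))); last first.
    by rewrite ler_pM2l// lerD2l ler_pM2l// mulr_gt0.
  rewrite mulrDr mulr1.
  have -> : Y (d 0) ^+ 2 * (2 * c * t1) = `|M|.
    rewrite /t1; move: y00; move: (Y (d 0) ^+ 2) => y y0.
    by field; rewrite y0 gt_eqF.
  by apply: le_lt_trans (ler_norm M) _; rewrite ltrDr.
have YB a b' : Y (a - b') = Y a - Y b' := saddle_YB SD a b'.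
have split2 (p q : R) : (p - q) ^+ 2 <= 2 * p ^+ 2 + 2 * q ^+ 2.
  by have := sqr_ge0 (p + q); rewrite sqrrB sqrrD; lra.
have notboth : leaves 1 lam x1 \/ leaves (-1) lam x1.
  apply: contrapT => nb; have n1 : ~ leaves 1 lam x1 by move=> h; apply: nb; left.
  have n2 : ~ leaves (-1) lam x1 by move=> h; apply: nb; right.
  have st1 := stays dl n1 n2.
  pose B1 := 2 * C * Qf x1.
  have B10 : 0 <= B1 by rewrite !mulr_ge0 ?(sd_Q0 SD)// ltW.
  have [t [t0 _ ht]] := far (2 * (C ^+ 2 * B1) + 2 * (C ^+ 2 * B)) 0.
  move: ht; rewrite ltNge => /negP; apply; rewrite /d YB.
  apply: le_trans (split2 _ _) _; apply: lerD; rewrite ler_pM2l//; apply: Yb.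
    apply: le_trans (st1 t t0) _; rewrite -/B1 ler_piMr// -expR0 ler_expR mulNr oppr_le0.
    by rewrite !mulr_ge0// ltW.
  exact: x0B.
have key sg' : leaves sg' lam x1 -> sg' <> - sg.
  move=> [s [s0 cs ss]] E; have [t [t0 st' ht]] := far (C ^+ 2 * B) s.
  have [_] := leaves_later dl st' cs ss; rewrite E mulNr oppr_gt0 => h1.
  have := ds t t0; rewrite /d YB mulrBr => h2.
  have h3 : Y (d t) ^+ 2 <= Y (flow lam x0 t) ^+ 2.
    rewrite -[leLHS]real_normK ?num_real// -[leRHS]real_normK ?num_real//.
    rewrite ler_pXn2r ?nnegrE//.
    have -> : `|Y (d t)| = sg * Y (d t) by rewrite -[LHS]mul1r -sg1 -normrM gtr0_norm// ds.
    have -> : `|Y (flow lam x0 t)| = `|sg * Y (flow lam x0 t)| by rewrite normrM sg1 mul1r.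
    by rewrite /d YB mulrBr; have := ler_norm (- (sg * Y (flow lam x0 t))); rewrite normrN; lra.
  by have := Yb _ _ (x0B t t0); move: ht h3; rewrite ltNge => /negP a1 a2 a3; apply: a1; exact: le_trans a2 a3.
case: notboth => h; have := key _ h; case: (norm1P sg1) => E; rewrite E in h *; rewrite ?opprK => //.
Qed.

(** The unstable branch: a solution on the negative half line in the closed
    positive cone, normalised by the value of its unstable coordinate at 0. *)
Definition branch_sol (lam : R * R) (k : R) (x : R -> V) : Prop :=
  [/\ esol F lam x, Y (x 0) = k & forall t, t <= 0 -> 0 <= cone (x t)].

(** In the cone the whole norm is controlled by Y, which grows exponentially. *)
Lemma branch_sol_decay lam k x t : D lam -> branch_sol lam k x -> t <= 0 ->
  `|x t| ^+ 2 <= 2 * C * k ^+ 2 * expR (2 * c * t).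
Proof.
move=> dl [ex xk xc] t0.
have := Y_grow SD dl ex (esol0 SD dl) t0; rewrite !subr0 sub0r xk => /(_ (xc t t0)) h.
have hY : Y (x t) ^+ 2 <= k ^+ 2 * expR (2 * c * t).
  by rewrite -[2 * c * t]opprK expRN ler_pdivlMr ?expR_gt0// -mulrN.
apply: le_trans (sd_norm SD _) _.
have := xc t t0; rewrite /cone => hc.
have -> : 2 * C * k ^+ 2 * expR (2 * c * t) = C * (2 * (k ^+ 2 * expR (2 * c * t))) by ring.
by rewrite ler_pM2l//; lra.
Qed.

(** Two branches with the same normalisation differ little at time 0: the
    difference would otherwise grow without bound in negative time. *)
Lemma branch_sol_close lam lam' k x x' : D lam -> D lam' -> branch_sol lam k x ->
  branch_sol lam' k x' -> `|x 0 - x' 0| ^+ 2 <= C * (C * `|lam - lam'| ^+ 2 / c).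
Proof.
move=> dl dl' bx bx'; set E := C * _ ^+ 2 / c.
have CK : 0 <= 2 * C * k ^+ 2 by apply: mulr_ge0 (sqr_ge0 _); rewrite mulr_ge0// ltW.
have bxB y l : D l -> branch_sol l k y -> forall t, t <= 0 -> `|y t| ^+ 2 <= 2 * C * k ^+ 2.
  move=> dd bb t t0; apply: le_trans (branch_sol_decay dd bb t0) _.
  by apply: ler_piMr => //; rewrite -expR0 ler_expR mulr_ge0_le0// mulr_ge0// ltW.
have [ex xk xc] := bx; have [ex' xk' xc'] := bx'.
have YD : Y (x 0 - x' 0) = 0 by rewrite (saddle_YB SD) xk xk' subrr.
suff QE : Qf (x 0 - x' 0) <= E.
  by apply: le_trans (sd_norm SD _) _; rewrite YD expr0n/= add0r ler_pM2l.
rewrite leNgt; apply/negP => QE.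
pose W := cone (x 0 - x' 0) + E.
have W0 : W < 0 by rewrite /W /cone YD expr0n/= sub0r addrC subr_lt0.
pose M := C * (4 * (2 * C * k ^+ 2)).
have M0 : 0 <= M by apply: mulr_ge0 (ltW C0) _; exact: mulr_ge0.
have VM t : t <= 0 -> - cone (x t - x' t) <= M.
  move=> t0; apply: (@le_trans _ _ (Qf (x t - x' t))).
    by rewrite /cone opprB lerBlDr lerDl sqr_ge0.
  apply: le_trans (sd_Q SD _) _; rewrite ler_pM2l//.
  apply: (@le_trans _ _ ((`|x t| + `|x' t|) ^+ 2)).
    by rewrite ler_pXn2r ?nnegrE ?addr_ge0//; exact: ler_normB.
  have h1 := bxB x lam dl bx t t0; have h2 := bxB x' lam' dl' bx' t t0.
  by have := sqr_ge0 (`|x t| - `|x' t|); rewrite sqrrB sqrrD; lra.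
pose T := M / (- W) / (2 * c).
have cc : 0 < 2 * c by rewrite mulr_gt0.
have T0 : 0 <= T by rewrite !divr_ge0 ?(ltW cc)// oppr_ge0 ltW.
have nT : - T <= 0 by rewrite oppr_le0.
have := cone_back SD dl dl' ex ex' nT; rewrite -/E -/W sub0r opprK => h.
have h2 := VM _ nT.
have h3 : W * expR (2 * c * T) <= W * (1 + 2 * c * T) by rewrite ler_nM2l// expR_ge1Dx.
have h4 : W * (1 + 2 * c * T) = W - M.
  by rewrite /T; field; rewrite gt_eqF//= lt_eqF.
have E0 : 0 <= E by rewrite divr_ge0 ?mulr_ge0 ?sqr_ge0// ltW.
by lra.
Qed.

Lemma saddle_dist (v w : V) : Y v = Y w -> `|v - w| ^+ 2 <= C * Qf (v - w).
Proof. by move=> E; have := sd_norm SD (v - w); rewrite (saddle_YB SD) E subrr expr0n/= add0r. Qed.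

(* a solution that lies on the unstable line at time - T and is normalised at time 0 *)
Let approx lam (sg k T : R) : D lam -> `|sg| = 1 -> 0 < k -> 0 <= T ->
  exists x : R -> V, [/\ esol F lam x, Y (x 0) = sg * k &
    forall t, - T <= t <= 0 -> 0 <= cone (x t) /\ Y (x t) ^+ 2 <= k ^+ 2].
Proof.
move=> dl sg1 k0 T0; have [e [Ye Qe]] := sd_dir SD.
have ss : sg * sg = 1 by rewrite -expr2 -real_normK ?num_real// sg1 expr1n.
pose p xi : V := (sg * xi) *: e.
have Yp xi : Y (p xi) = sg * xi by rewrite (saddle_YZ SD) Ye mulr1.
have Cp xi : cone (p xi) = xi ^+ 2.
  by rewrite /cone Yp (sd_QZ SD) Qe mulr0 subr0 exprMn [sg ^+ 2]expr2 ss mul1r.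
pose h xi := sg * Y (flow lam (p xi) T).
have TT : - T <= T <= T by rewrite lexx andbT (le_trans _ T0)// oppr_le0.
have ch (xi : R) : {for xi, continuous h}.
  apply/ctsP => ep ep0; have epC : 0 < ep / C by rewrite divr_gt0.
  have [r r0 H] := gflow_near KF0 FL (p xi) dl T0 epC.
  have e1 : 0 < `|e| + 1 by rewrite ltr_wpDl.
  exists (r / (`|e| + 1)); first by rewrite divr_gt0.
  move=> y; rewrite ltr_pdivlMr// => yr.
  have := H lam (p y) T dl; rewrite subrr normr0 => /(_ r0) /(_ _ TT) hh.
  rewrite /h -mulrBr normrM sg1 mul1r -(saddle_YB SD); apply: le_lt_trans (sd_Y SD _) _.
  rewrite -ltr_pdivlMl// mulrC; apply: hh.
  rewrite /p -scalerBl -mulrBr normrZ normrM sg1 mul1r; apply: le_lt_trans yr.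
  by rewrite ler_wpM2l// lerDl.
have h0 : h 0 = 0.
  rewrite /h /p mulr0 scale0r.
  by rewrite -(gflow_uniq KF0 FL dl (esol0 SD dl) T) (saddle_Y0 SD) mulr0.
have hk : k <= h k.
  have ck : 0 < cone (p k) by rewrite Cp exprn_gt0.
  have := cone_sign SD dl (eg (p k) dl) (esol0 SD dl) (sg := sg) T0.
  rewrite !subr0 (gflow0 KF0 FL)// Yp mulrA ss mul1r => /(_ ck k0) hp.
  have := Y_grow SD dl (eg (p k) dl) (esol0 SD dl) T0.
  rewrite !subr0 (gflow0 KF0 FL)// Yp => /(_ (ltW ck)) g1.
  have g2 : k ^+ 2 <= h k ^+ 2.
    have -> : h k ^+ 2 = Y (flow lam (p k) T) ^+ 2 by rewrite /h exprMn [sg ^+ 2]expr2 ss mul1r.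
    apply: le_trans g1; rewrite exprMn [sg ^+ 2]expr2 ss mul1r ler_peMr ?sqr_ge0//.
    by rewrite -expR0 ler_expR !mulr_ge0// ltW.
  by move: g2; rewrite ler_pXn2r ?nnegrE ?(ltW k0) ?(ltW hp).
have [||xi /andP[x0 xk] hxi] := @ivt_le R h 0 k k (ltW k0).
- by move=> t _; exact: ch.
- by rewrite h0 (ltW k0).
exists (fun t => flow lam (p xi) (t + T)); split.
- by move=> t; apply: is_derive_shiftc; exact: (gflow_der KF0 FL).
- by rewrite add0r -hxi /h mulrA ss mul1r.
- move=> t /andP[tT t0]; have tT0 : 0 <= t + T by rewrite -lerBlDr sub0r.
  have ct : 0 <= cone (flow lam (p xi) (t + T)).
    have := cone_nneg SD dl (eg (p xi) dl) (esol0 SD dl) tT0.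
    by rewrite !subr0 (gflow0 KF0 FL)// Cp; apply; exact: sqr_ge0.
  split=> //; have tT2 : t + T <= T by rewrite gerDr.
  have := Y_grow SD dl (eg (p xi) dl) (esol0 SD dl) tT2; rewrite !subr0 => /(_ ct) g.
  have -> : k ^+ 2 = Y (flow lam (p xi) T) ^+ 2.
    by rewrite -hxi /h exprMn [sg ^+ 2]expr2 ss mul1r.
  apply: le_trans g; rewrite ler_peMr ?sqr_ge0// -expR0 ler_expR mulr_ge0 ?mulr_ge0 ?(ltW c0)//.
  by rewrite opprD addrCA subrr addr0 oppr_ge0.
Qed.

Lemma branch_sol_exists lam (sg k : R) : D lam -> `|sg| = 1 -> 0 < k -> exists x, branch_sol lam (sg * k) x.
Proof.
move=> dl sg1 k0; pose N := 2 / c; have N0 : 0 < N by rewrite divr_gt0.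
pose T (n : nat) := n%:R * N; have T0 n : 0 <= T n by rewrite mulr_ge0// ltW.
pose y n := sval (cid (approx dl sg1 k0 (T0 n))).
have yP n : [/\ esol F lam (y n), Y (y n 0) = sg * k &
    forall t, - T n <= t <= 0 -> 0 <= cone (y n t) /\ Y (y n t) ^+ 2 <= k ^+ 2].
  exact: svalP (cid (approx dl sg1 k0 (T0 n))).
have e4 : 4 <= expR (2 * c * N).
  have -> : 2 * c * N = 4 by rewrite /N; field; rewrite gt_eqF.
  by apply: le_trans (expR_ge1Dx 4); rewrite lerDr.
have eT n : 4 ^+ n <= expR (2 * c * T n).
  have -> : 2 * c * T n = n%:R * (2 * c * N) by rewrite /T; ring.
  by rewrite expRM_natl; apply: lerXn2r; rewrite ?nnegrE ?expR_ge0.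
pose A := 2 * k * (C + 1).
have A0 : 0 <= A by rewrite !mulr_ge0 ?addr_ge0 ?(ltW k0) ?(ltW C0).
have QB n m t : - T n <= t <= 0 -> - T m <= t <= 0 -> Qf (y n t - y m t) <= 4 * k ^+ 2.
  move=> tn tm; apply: le_trans (sd_QB SD _ _) _.
  have [_ _ /(_ t tn)[h1 h2]] := yP n; have [_ _ /(_ t tm)[h3 h4]] := yP m.
  by move: h1 h3; rewrite /cone; lra.
have cauchy n : `|y n.+1 0 - y n 0| <= A / 2 ^+ n.
  have [ex xk _] := yP n.+1; have [ey yk _] := yP n.
  have TS : T n <= T n.+1 by rewrite /T ler_pM2r// ler_nat.
  have nT : - T n <= 0 by rewrite oppr_le0.
  have := cone_back0 SD dl ex ey nT; rewrite sub0r opprK => h.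
  have YE : Y (y n.+1 0) = Y (y n 0) by rewrite xk yk.
  have c00 : cone (y n.+1 0 - y n 0) = - Qf (y n.+1 0 - y n 0).
    by rewrite /cone (saddle_YB SD) YE subrr expr0n/= sub0r.
  have q4 : Qf (y n.+1 (- T n) - y n (- T n)) <= 4 * k ^+ 2.
    by apply: QB; rewrite nT andbT ?lerN2.
  have ce : - Qf (y n.+1 (- T n) - y n (- T n)) <= cone (y n.+1 (- T n) - y n (- T n)).
    by rewrite /cone lerDr sqr_ge0.
  have q1 : Qf (y n.+1 0 - y n 0) * 4 ^+ n <= 4 * k ^+ 2.
    apply: (@le_trans _ _ (Qf (y n.+1 0 - y n 0) * expR (2 * c * T n))).
      by rewrite ler_wpM2l ?(sd_Q0 SD).
    by move: h; rewrite c00 mulNr; lra.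
  have d2 := saddle_dist YE.
  have p0 : 0 < (2 : R) ^+ n by rewrite exprn_gt0.
  rewrite ler_pdivlMr// -[leLHS]ger0_norm ?mulr_ge0 ?(ltW p0)// -[A]ger0_norm//; apply: ler_norm_sqr.
  rewrite exprMn -exprM mulnC exprM (_ : 2 ^+ 2 = 4); last by rewrite expr2; ring.
  apply: (@le_trans _ _ (C * Qf (y n.+1 0 - y n 0) * 4 ^+ n)); first by rewrite ler_wpM2r// exprn_ge0.
  rewrite -mulrA; apply: (@le_trans _ _ (C * (4 * k ^+ 2))); first by rewrite ler_pM2l.
  have -> : A ^+ 2 = (C + 1) ^+ 2 * (4 * k ^+ 2) by rewrite /A; ring.
  apply: ler_wpM2r; first by apply: mulr_ge0 (sqr_ge0 _).
  rewrite sqrrD expr1n mulr1.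
  by have := sqr_ge0 C; have := C0; lra.
have [l hl] := @geometric_limit R V (FinSuprV 3) (fun n => y n 0) A cauchy.
have A20 : 0 <= 2 * A by rewrite mulr_ge0.
have near t e : 0 <= t -> 0 < e -> exists n, t <= T n /\ `|y n (- t) - flow lam l (- t)| < e.
  move=> t0 e0; have [r r0 H] := gflow_near KF0 FL l dl t0 e0.
  have [n0 hn0] := small_geometric A20 r0.
  have [n1 hn1] : exists n1 : nat, t / N <= n1%:R.
    by exists (Num.bound (t / N)); apply: ltW; apply: archi_boundP; rewrite divr_ge0// ltW.
  exists (maxn n0 n1); split.
    by rewrite -ler_pdivrMr//; apply: le_trans hn1 _; rewrite ler_nat leq_maxr.
  have [ey _ _] := yP (maxn n0 n1).
  rewrite (gflow_uniq KF0 FL dl ey (- t)).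
  have tt : - t <= - t <= t by rewrite lexx/= (le_trans _ t0)// oppr_le0.
  apply: H => //; first by rewrite subrr normr0.
  apply: le_lt_trans (hl _) _; apply: le_lt_trans hn0.
  rewrite ler_wpM2l// lef_pV2 ?posrE ?exprn_gt0// ler_weXn2l ?leq_maxl// ler1n.
  by [].
exists (flow lam l); split; first exact: eg.
- rewrite (gflow0 KF0 FL)//; apply/eqP; rewrite -subr_eq0 -normr_le0; apply/ler_addgt0Pr => e e0.
  rewrite add0r; have eC : 0 < e / C by rewrite divr_gt0.
  have [n [_ hn]] := near 0 (e / C) (lexx 0) eC.
  have [_ yk _] := yP n.
  rewrite oppr0 (gflow0 KF0 FL)// in hn; rewrite -yk -(saddle_YB SD).
  by apply: le_trans (sd_Y SD _) _; rewrite -ler_pdivlMl// mulrC distrC ltW.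
- move=> t t0; rewrite leNgt; apply/negP => ct.
  have nc : 0 < - cone (flow lam l t) by rewrite oppr_gt0.
  have [r r0 H] := cone_continuous (flow lam l t) nc.
  have nt0 : 0 <= - t by rewrite oppr_ge0.
  have [n [tn hn]] := near (- t) r nt0 r0; rewrite opprK in hn.
  have [h _] := H _ hn; have [_ _ /(_ t)] := yP n; rewrite t0 andbT lerNl => /(_ tn)[h2 _].
  by move: h => /ltr_normlP[_]; lra.
Qed.

End Saddle.

Notation solves f lam a b x := (forall t, a <= t <= b -> is_derive t 1 x (f (x t) lam)).

(** The parts of W^s(E) and W^u(E) between the sections and E, which follow a
    connecting orbit w until they are near E. *)
Definition stable_tail {R : realType} (f : 'rV[R]_3 -> R * R -> 'rV[R]_3) Psi delta lam y0 w e x :=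
  [/\ solution (f ^~ lam) `[0, +oo[ x, x 0 = y0, x t @[t --> +oo] --> (0 : 'rV[R]_3),
    forall t : R, 0 < t -> ~ Sigma_out Psi delta lam (x t) &
    forall t : R, 0 <= t -> `|x t - w t| < e \/ `|x t| < e].
Definition unstable_tail {R : realType} (f : 'rV[R]_3 -> R * R -> 'rV[R]_3) Psi delta lam y0 w e x :=
  [/\ solution (f ^~ lam) `]-oo, 0] x, x 0 = y0, x t @[t --> -oo] --> (0 : 'rV[R]_3),
    forall t : R, t < 0 -> ~ Sigma_in Psi delta lam (x t) &
    forall t : R, t <= 0 -> `|x t - w t| < e \/ `|x t| < e].

Section BoxDynamics.
Context {R : realType}.
Local Notation V := 'rV[R]_3.
Local Notation coord := (R * R * R)%type.
Variables (Q : set (R * R)) (f : V -> R * R -> V) (Psi : coord -> R * R -> V).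
Variables (alps alpu : R * R -> R) (Fs Fu : coord -> R * R -> R) (R0 beta K : R).
Hypothesis FB : flow_box Q f Psi alps alpu Fs Fu R0 beta K.
Hypothesis fL : field_lip Q f.

Let R00 : 0 < R0 := fb_R0 FB.
Let beta0 : 0 < beta := fb_beta FB.
Let K0 : 0 < K := fb_K FB.

(** The field of the flow box, extended to all of space by freezing it outside
    the box, so that its solutions exist for all times. *)
Definition clamp_coord (v : coord) : coord := (vc v, clamp R0 (vs v), clamp R0 (vu v)).
Definition box_field (lam : R * R) (v : coord) : coord :=
  nf_field alps alpu Fs Fu lam (clamp_coord v).

Lemma clamp_coord_box v : box R0 (clamp_coord v).
Proof. by split; apply: clamp_le; exact: ltW. Qed.

Lemma clamp_coord_id v : box R0 v -> clamp_coord v = v.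
Proof. by case: v => [[c s] u] [h1 h2]; rewrite /clamp_coord !clamp_id. Qed.

Lemma clamp_coord_lip v w : `|clamp_coord v - clamp_coord w| <= `|v - w|.
Proof.
case: v => [[c s] u]; case: w => [[c' s'] u'].
by rewrite !norm_pairB !ge_max !le_max lexx/= !clamp_lip ?orbT.
Qed.

Definition field_const := 2 * K + K * R0.

Lemma field_const_gt0 : 0 < field_const.
Proof. by rewrite addr_gt0 ?mulr_gt0. Qed.

Lemma box_field_lip lam lam' v w : Q lam -> Q lam' ->
  `|box_field lam v - box_field lam' w| <= field_const * Num.max `|v - w| `|lam - lam'|.
Proof.
move=> ql ql'; set v' := clamp_coord v; set w' := clamp_coord w.
have bv := clamp_coord_box v; have bw := clamp_coord_box w.
set m := Num.max `|v - w| `|lam - lam'|.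
have m0 : 0 <= m by rewrite le_max normr_ge0.
have vwm : Num.max `|v' - w'| `|lam - lam'| <= m.
  by rewrite ge_max; apply/andP; split; rewrite le_max; apply/orP; [left; exact: clamp_coord_lip|right].
have lm : `|lam - lam'| <= m by rewrite le_max lexx orbT.
have part (al : R * R -> R) (x y F1 F2 : R) : `|al lam| <= K -> `|al lam - al lam'| <= K * `|lam - lam'| ->
    `|x - y| <= m -> `|y| <= R0 -> `|F1 - F2| <= K * m ->
    `|al lam * x + F1 - (al lam' * y + F2)| <= field_const * m.
  move=> h1 h2 h3 h4 h5.
  have -> : al lam * x + F1 - (al lam' * y + F2) =
    al lam * (x - y) + (al lam - al lam') * y + (F1 - F2) by ring.
  have e1 : `|al lam * (x - y)| <= K * m by rewrite normrM ler_pM.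
  have e2 : `|(al lam - al lam') * y| <= K * m * R0.
    rewrite normrM ler_pM//; apply: le_trans h2 _; rewrite ler_wpM2l// ltW//.
  apply: normD_le; have := ler_normD (al lam * (x - y)) ((al lam - al lam') * y).
  have -> : field_const * m = K * m + K * m * R0 + K * m by rewrite /field_const; ring.
  lra.
have cl (x y : R) : `|x - y| <= `|v' - w'| -> `|x - y| <= m.
  by move=> /le_trans; apply; apply: le_trans (clamp_coord_lip _ _) _; rewrite le_max lexx.
rewrite /box_field /nf_field !norm_pairB !ge_max subrr normr0 mulr_ge0 ?(ltW field_const_gt0)//=.
have cs : `|vs v' - vs w'| <= `|v' - w'|.
  exact: vs_le.
have cu : `|vu v' - vu w'| <= `|v' - w'| by exact: vu_le.
apply/andP; split; apply: part; rewrite ?(fb_alpsK FB) ?(fb_alpuK FB) ?(fb_alps_lip FB) ?(fb_alpu_lip FB)//.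
- exact: cl.
- by case: bw.
- by apply: le_trans (fb_Fs_lip FB ql ql' bv bw) _; rewrite ler_wpM2l// ltW.
- exact: cl.
- by case: bw.
- by apply: le_trans (fb_Fu_lip FB ql ql' bv bw) _; rewrite ler_wpM2l// ltW.
Qed.

Let bF (v : coord) (lam : R * R) : coord := box_field lam v.
Let bL lam lam' v w : Q lam -> Q lam' -> `|bF v lam - bF w lam'| <= field_const * Num.max `|v - w| `|lam - lam'|.
Proof. exact: box_field_lip. Qed.

Definition bflow : R * R -> coord -> R -> coord := gflow (fun v lam => box_field lam v).

Lemma bflow0 lam v0 : Q lam -> bflow lam v0 0 = v0.
Proof. exact: (gflow0 field_const_gt0 bL). Qed.

Lemma bflow_der lam v0 (t : R) : Q lam ->
  is_derive t 1 (bflow lam v0) (box_field lam (bflow lam v0 t)).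
Proof. exact: (gflow_der field_const_gt0 bL). Qed.

Lemma bflow_continuous_dep lam lam' v w (T t : R) : Q lam -> Q lam' -> 0 <= T -> - T <= t <= T ->
  `|bflow lam v t - bflow lam' w t| <=
    2 * (`|v - w| + field_const * `|lam - lam'| * T) * expR (2 * field_const * `|t|).
Proof. exact: (gflow_dep field_const_gt0 bL). Qed.

Lemma bflow_shift lam v (s t : R) : Q lam -> bflow lam (bflow lam v s) t = bflow lam v (t + s).
Proof. exact: (gflow_shift field_const_gt0 bL). Qed.

Section OneOrbit.
Variables (lam : R * R) (v0 : coord).
Hypothesis ql : Q lam.
Let v := bflow lam v0.
Let s t := vs (v t).
Let u t := vu (v t).
Let cv t := clamp_coord (v t).
Let ds t := alps lam * clamp R0 (s t) + Fs (cv t) lam.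
Let du t := alpu lam * clamp R0 (u t) + Fu (cv t) lam.

Lemma bflow_vs_der (t : R) : is_derive t 1 (fun t => vs (v t)) (ds t).
Proof. exact: (is_derive_snd (is_derive_fst (bflow_der v0 t ql))). Qed.

Lemma bflow_vu_der (t : R) : is_derive t 1 (fun t => vu (v t)) (du t).
Proof. exact: (is_derive_snd (bflow_der v0 t ql)). Qed.

Lemma bflow_vc t : vc (v t) = vc v0 + t.
Proof.
have D (r : R) : is_derive r 1 (fun r => vc (v r) - r) 0.
  apply: (der_eq (der_sub (is_derive_fst (is_derive_fst (bflow_der v0 r ql))) (der_id r))).
  by rewrite subrr.
have := is_derive_0_is_cst (f := fun r => vc (v r) - r) t 0 D.
by rewrite subr0 /v bflow0// => <-; rewrite subrK.
Qed.

Let mulclamp (x : R) : `|x| * `|clamp R0 x| = x * clamp R0 x.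
Proof. by rewrite -normrM ger0_norm// clamp_sign. Qed.

(* this is where the size R0 of the box is used *)
Let smallmax t : K * Num.max `|vs (cv t)| `|vu (cv t)| <= beta.
Proof.
apply: le_trans (fb_small FB); rewrite ler_pM2l// ge_max.
by have [] := clamp_coord_box (v t) => -> ->.
Qed.

Lemma s_ds_le t : s t * ds t <= - beta * (s t * clamp R0 (s t)).
Proof.
have F1 : `|Fs (cv t) lam| <= beta * `|clamp R0 (s t)|.
  by apply: le_trans (fb_Fs FB ql (clamp_coord_box (v t))) _; rewrite ler_wpM2r// smallmax.
have : s t * Fs (cv t) lam <= beta * (s t * clamp R0 (s t)).
  apply: le_trans (ler_norm _) _; rewrite normrM -mulclamp [leRHS]mulrCA.
  by rewrite ler_wpM2l.
have : alps lam * (s t * clamp R0 (s t)) <= - (2 * beta) * (s t * clamp R0 (s t)).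
  by rewrite ler_wpM2r// ?(fb_alps FB)// clamp_sign.
by rewrite /ds mulrDr mulrCA; lra.
Qed.

Lemma u_du_ge t : beta * (u t * clamp R0 (u t)) <= u t * du t.
Proof.
have F1 : `|Fu (cv t) lam| <= beta * `|clamp R0 (u t)|.
  by apply: le_trans (fb_Fu FB ql (clamp_coord_box (v t))) _; rewrite ler_wpM2r// smallmax.
have : - (beta * (u t * clamp R0 (u t))) <= u t * Fu (cv t) lam.
  rewrite lerNl; apply: le_trans (ler_norm _) _; rewrite normrN normrM -mulclamp [leRHS]mulrCA.
  by rewrite ler_wpM2l.
have : 2 * beta * (u t * clamp R0 (u t)) <= alpu lam * (u t * clamp R0 (u t)).
  by rewrite ler_wpM2r// ?(fb_alpu FB)// clamp_sign.
by rewrite /du mulrDr mulrCA; lra.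
Qed.

Let clamp_norm (x : R) : `|clamp R0 x| <= `|x|.
Proof. by have := clamp_lip R0 x 0; rewrite [clamp R0 0]clamp_id ?normr0 ?subr0// ltW. Qed.

Lemma ds_norm t : `|ds t| <= (K + beta) * `|s t|.
Proof.
have F1 : `|Fs (cv t) lam| <= beta * `|clamp R0 (s t)|.
  by apply: le_trans (fb_Fs FB ql (clamp_coord_box (v t))) _; rewrite ler_wpM2r// smallmax.
apply: normD_le; rewrite mulrDl normrM lerD//.
  by apply: ler_pM; rewrite ?(fb_alpsK FB).
by apply: le_trans F1 _; rewrite ler_wpM2l// ltW.
Qed.

Lemma du_norm t : `|du t| <= (K + beta) * `|u t|.
Proof.
have F1 : `|Fu (cv t) lam| <= beta * `|clamp R0 (u t)|.
  by apply: le_trans (fb_Fu FB ql (clamp_coord_box (v t))) _; rewrite ler_wpM2r// smallmax.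
apply: normD_le; rewrite mulrDl normrM lerD//.
  by apply: ler_pM; rewrite ?(fb_alpuK FB).
by apply: le_trans F1 _; rewrite ler_wpM2l// ltW.
Qed.

Let Kb0 : 0 < K + beta. Proof. by rewrite addr_gt0. Qed.

Lemma bflow_vs0 t : vs v0 = 0 -> vs (v t) = 0.
Proof.
move=> s0; have s00 : s 0 = 0 by rewrite /s /v bflow0.
have D (r : R) : is_derive r 1 s (ds r) by exact: bflow_vs_der.
have [t0|/ltW t0] := leP 0 t.
  apply: (@zero_of_gronwall R _ _ s ds _ 0 t Kb0 t0 (or_introl s00)) => // [r _|].
    exact: ds_norm.
  by rewrite t0 lexx.
apply: (@zero_of_gronwall R _ _ s ds _ t 0 Kb0 t0 (or_intror s00)) => // [r _|].
  exact: ds_norm.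
by rewrite t0 lexx.
Qed.

Lemma bflow_vu0 t : vu v0 = 0 -> vu (v t) = 0.
Proof.
move=> s0; have s00 : u 0 = 0 by rewrite /u /v bflow0.
have D (r : R) : is_derive r 1 u (du r) by exact: bflow_vu_der.
have [t0|/ltW t0] := leP 0 t.
  apply: (@zero_of_gronwall R _ _ u du _ 0 t Kb0 t0 (or_introl s00)) => // [r _|].
    exact: du_norm.
  by rewrite t0 lexx.
apply: (@zero_of_gronwall R _ _ u du _ t 0 Kb0 t0 (or_intror s00)) => // [r _|].
  exact: du_norm.
by rewrite t0 lexx.
Qed.

Let sqr_der (x dx : R -> R) (k t : R) : is_derive t 1 x (dx t) ->
  is_derive t 1 (fun t => x t * x t * expR (k * t))
    ((2 * (x t * dx t) + k * (x t * x t)) * expR (k * t)).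
Proof.
move=> D; apply: (der_eq (der_mul (der_mul D D) (der_expk k t))); ring.
Qed.

Lemma bflow_vs_mono a b : a <= b -> `|vs (v b)| <= `|vs (v a)|.
Proof.
move=> ab; apply: ler_norm_sqr; rewrite !expr2.
apply: (@nonincreasing_der R (fun t => s t * s t) (fun t => 2 * (s t * ds t)) a b ab) => t _.
  by apply: (der_eq (der_mul (bflow_vs_der t) (bflow_vs_der t))); rewrite /s; ring.
have : 0 <= beta * (s t * clamp R0 (s t)) by rewrite mulr_ge0 ?clamp_sign// ltW.
by have := s_ds_le t; rewrite mulNr; lra.
Qed.

Lemma bflow_vu_mono a b : a <= b -> `|vu (v a)| <= `|vu (v b)|.
Proof.
move=> ab; apply: ler_norm_sqr; rewrite !expr2.
apply: (@nondecreasing_der R (fun t => u t * u t) (fun t => 2 * (u t * du t)) a b ab) => t _.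
  by apply: (der_eq (der_mul (bflow_vu_der t) (bflow_vu_der t))); rewrite /u; ring.
have : 0 <= beta * (u t * clamp R0 (u t)) by rewrite mulr_ge0 ?clamp_sign// ltW.
by have := u_du_ge t; lra.
Qed.

Let from_sqr (x y k a b : R) : x * x * expR (2 * k * b) <= y * y * expR (2 * k * a) ->
  `|x| <= `|y| * expR (- k * (b - a)).
Proof.
have E r : expR (2 * k * r) = expR (k * r) * expR (k * r) by rewrite -expRD; congr expR; ring.
have Eb : x * x * expR (2 * k * b) = (x * expR (k * b)) ^+ 2 by rewrite E; ring.
have Ea : y * y * expR (2 * k * a) = (y * expR (k * a)) ^+ 2 by rewrite E; ring.
rewrite Ea Eb => /ler_norm_sqr.
rewrite !normrM ![`|expR _|]ger0_norm ?expR_ge0// => H.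
rewrite -(ler_pM2r (expR_gt0 (k * b))); apply: le_trans H _.
by rewrite -mulrA -expRD le_eqVlt; apply/orP; left; apply/eqP; congr (_ * expR _); ring.
Qed.

Lemma bflow_vs_decay a b : a <= b -> `|vs (v a)| <= R0 ->
  `|vs (v b)| <= `|vs (v a)| * expR (- beta * (b - a)).
Proof.
move=> ab sa; apply: from_sqr.
apply: (@nonincreasing_der R (fun t => s t * s t * expR (2 * beta * t)) _ a b ab) => t /andP[at1 tb].
  exact: sqr_der (bflow_vs_der t).
rewrite mulr_le0_ge0 ?expR_ge0//.
have := s_ds_le t; rewrite clamp_id; last by apply: le_trans sa; exact: bflow_vs_mono.
by lra.
Qed.

Lemma bflow_vu_growth a b : a <= b -> `|vu (v b)| <= R0 ->
  `|vu (v a)| <= `|vu (v b)| * expR (- beta * (b - a)).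
Proof.
move=> ab sb.
have -> : - beta * (b - a) = - - beta * (a - b) by ring.
apply: (@from_sqr _ _ (- beta) b a).
apply: (@nondecreasing_der R (fun t => u t * u t * expR (2 * - beta * t)) _ a b ab) => t /andP[at1 tb].
  exact: sqr_der (bflow_vu_der t).
rewrite mulr_ge0 ?expR_ge0//.
have := u_du_ge t; rewrite clamp_id; last by apply: le_trans sb; exact: bflow_vu_mono.
by lra.
Qed.

Lemma bflow_vu_upper a b : a <= b -> `|vu (v b)| <= `|vu (v a)| * expR ((K + beta) * (b - a)).
Proof.
move=> ab; rewrite -[K + beta]opprK; apply: from_sqr.
apply: (@nonincreasing_der R (fun t => u t * u t * expR (2 * - (K + beta) * t)) _ a b ab) => t _.
  exact: sqr_der (bflow_vu_der t).
rewrite mulr_le0_ge0 ?expR_ge0//.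
have : u t * du t <= (K + beta) * (u t * u t).
  apply: le_trans (ler_norm _) _; rewrite normrM.
  have -> : (K + beta) * (u t * u t) = `|u t| * ((K + beta) * `|u t|).
    have -> : u t * u t = `|u t| * `|u t| by rewrite -normrM ger0_norm// -expr2 sqr_ge0.
    by ring.
  by rewrite ler_wpM2l// du_norm.
by lra.
Qed.

Lemma bflow_vu_cont (t : R) : {for t, continuous (fun t => vu (v t))}.
Proof. exact: is_derive_cts (bflow_vu_der t). Qed.

Lemma bflow_nf (t : R) : box R0 (v t) ->
  is_derive t 1 v (nf_field alps alpu Fs Fu lam (v t)).
Proof. by move=> b; have := bflow_der v0 t ql; rewrite /box_field -/v clamp_coord_id. Qed.

Lemma bflow_solution (t : R) : box R0 (v t) ->
  is_derive t 1 (fun t => Psi (v t) lam) (f (Psi (v t) lam) lam).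
Proof. by move=> b; apply: (fb_ode FB) => //; exact: bflow_nf. Qed.

End OneOrbit.

(** Solutions of the given system are images of box orbits as long as these stay
    in the box; the two orbits need to agree at one end only. *)
Lemma bflow_follow lam v0 (x : R -> V) (a b r : R) : Q lam -> a <= b ->
  solves f lam a b x ->
  (forall t, a <= t <= b -> box R0 (bflow lam v0 (t - r))) ->
  x a = Psi (bflow lam v0 (a - r)) lam \/ x b = Psi (bflow lam v0 (b - r)) lam ->
  forall t, a <= t <= b -> x t = Psi (bflow lam v0 (t - r)) lam.
Proof.
move=> ql ab Hx Hb H.
apply: (solution_unique fL ql ab Hx _ H) => t tab.
exact: (@is_derive_shiftc _ _ (fun t => Psi (bflow lam v0 t) lam) (- r) t _
  (bflow_solution ql (Hb t tab))).
Qed.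

Lemma deck_norm (k : int) (v : coord) : `|vs (deck k v)| = `|vs v| /\ `|vu (deck k v)| = `|vu v|.
Proof.
have s1 : `|(-1 : R) ^ k| = 1 by case: k => n; rewrite /exprz ?normfV normrX normrN1 expr1n ?invr1.
by rewrite /deck /vs /vu /= !normrM s1 !mul1r.
Qed.

Lemma deck1 (v : coord) : deck 1 v = (vc v + 2 * pi, - vs v, - vu v).
Proof. by rewrite /deck expr1z !mulN1r mulr1. Qed.

Lemma Psi_deck lam k v : Q lam -> box R0 v -> Psi (deck k v) lam = Psi v lam.
Proof.
move=> ql bv; apply/esym/(fb_fibres FB) => //; last by exists k.
by have [h1 h2] := deck_norm k v; split; rewrite ?h1 ?h2; case: bv.
Qed.

Variable delta : R.
Hypothesis dR : 0 < delta <= R0 / 8.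

Let d0 : 0 < delta. Proof. by case/andP: dR. Qed.
Let dltR : 0 < delta < R0.
Proof. by case/andP: dR => h1 h2; apply/andP; split=> //; have := R00; lra. Qed.
Let dltR' : delta <= R0. Proof. by apply: ltW; case/andP: dltR. Qed.

Lemma box_le v : box delta v -> box R0 v.
Proof.
case/andP: dltR => _ /ltW h; case=> b1 b2.
by split; [apply: le_trans b1 _|apply: le_trans b2 _].
Qed.

Lemma Psi_box_inv lam v : Q lam -> box R0 v -> ((Psi ^~ lam) @` box delta) (Psi v lam) -> box delta v.
Proof.
move=> ql bv [w bw E]; have [k ->] := (fb_fibres FB ql (box_le bw) bv).1 E.
by have [h1 h2] := deck_norm k w; split; rewrite ?h1 ?h2; case: bw.
Qed.

Lemma Sigma_inP lam v : Q lam -> box R0 v ->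
  Sigma_in Psi delta lam (Psi v lam) <-> `|vs v| = delta /\ `|vu v| <= delta.
Proof.
move=> ql bv; split=> [[w [sw uw] E]|[hs hu]].
  have bw : box R0 w by apply: box_le; split=> //; rewrite sw gtr0_norm.
  have [k ->] := (fb_fibres FB ql bw bv).1 E.
  by have [h1 h2] := deck_norm k w; rewrite h1 h2 sw gtr0_norm.
have [s0|s0] := leP 0 (vs v).
  by exists v => //; split=> //; rewrite -hs ger0_norm.
exists (deck 1 v); last exact: Psi_deck.
by rewrite deck1; split=> /=; rewrite /vs /vu/= ?normrN// -hs ltr0_norm.
Qed.

Lemma Sigma_outP lam v : Q lam -> box R0 v ->
  Sigma_out Psi delta lam (Psi v lam) <-> `|vu v| = delta /\ `|vs v| <= delta.
Proof.
move=> ql bv; split=> [[w [sw uw] E]|[hs hu]].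
  have bw : box R0 w by apply: box_le; split=> //; rewrite sw gtr0_norm.
  have [k ->] := (fb_fibres FB ql bw bv).1 E.
  by have [h1 h2] := deck_norm k w; rewrite h1 h2 sw gtr0_norm.
have [s0|s0] := leP 0 (vu v).
  by exists v => //; split=> //; rewrite -hs ger0_norm.
exists (deck 1 v); last exact: Psi_deck.
by rewrite deck1; split=> /=; rewrite /vs /vu/= ?normrN// -hs ltr0_norm.
Qed.

(** Following an orbit forward from inside the box: the stable coordinate
    shrinks and the unstable one grows, so that the box can only be left
    through its exit face. *)
Lemma leave_box lam v1 (x : R -> V) (a b : R) : Q lam -> a <= b -> box delta v1 ->
  solves f lam a b x -> x a = Psi v1 lam ->
  let v t := bflow lam v1 (t - a) in
  (forall t, a <= t <= b -> box delta (v t) /\ x t = Psi (v t) lam) \/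
  exists t t', [/\ a <= t < t', t' <= b, `|vu (v t)| = delta, delta < `|vu (v t')| <= R0 &
    (forall r, a <= r <= t -> box delta (v r)) /\
    (forall r, a <= r <= t' -> box R0 (v r) /\ x r = Psi (v r) lam)].
Proof.
move=> ql ab bv1 Hx xa v; have va : v a = v1 by rewrite /v subrr bflow0.
have bs r : a <= r -> `|vs (v r)| <= delta.
  move=> ar; case: bv1 => h _; apply: le_trans h; rewrite -[in leRHS]va.
  by apply: bflow_vs_mono => //; rewrite lerD2r.
have mu r r' : r <= r' -> `|vu (v r)| <= `|vu (v r')|.
  by move=> rr; apply: bflow_vu_mono => //; rewrite lerD2r.
have [ub|ub] := leP `|vu (v b)| delta.
  left; have bb t : a <= t <= b -> box delta (v t).
    by move=> /andP[at1 tb]; split; [exact: bs|apply: le_trans ub; exact: mu].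
  move=> t tab; split; first exact: bb.
  apply: (bflow_follow ql ab Hx _ _ tab); last by left; rewrite -/(v a) va.
  by move=> r /bb; exact: box_le.
right; have [_ dl] := andP dltR.
pose m := Num.min R0 `|vu (v b)|.
have dm : delta < m by rewrite lt_min dl.
have cu (r : R) : {for r, continuous (fun r => `|vu (v r)|)}.
  apply: norm_continuous; apply: is_derive_cts.
  exact: (@is_derive_shiftc _ _ (fun t => vu (bflow lam v1 t)) (- a) r _ (bflow_vu_der v1 ql _)).
have ua : `|vu (v a)| <= delta by rewrite va; case: bv1.
have [||t' /andP[at' t'b] ut'] := @ivt_le R (fun r => `|vu (v r)|) a b m ab.
- by move=> r _; exact: cu.
- by rewrite (le_trans ua (ltW dm)) ge_min lexx orbT.
have [||t /andP[at1 tt'] ut] := @ivt_le R (fun r => `|vu (v r)|) a t' delta at'.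
- by move=> r _; exact: cu.
- by rewrite ua ut' ltW.
have tlt : t < t'.
  by rewrite lt_neqAle tt' andbT; apply/eqP => E; move: dm; rewrite -ut' -E ut ltxx.
have bR r : a <= r <= t' -> box R0 (v r).
  move=> /andP[ar rt']; split; first by apply: le_trans (bs r ar) _; exact: ltW.
  by apply: le_trans (mu _ _ rt') _; rewrite ut' ge_min lexx.
exists t, t'; split=> //.
- by rewrite at1.
- by rewrite ut' dm ge_min lexx.
- split=> [r /andP[ar rt]|r ar].
    by split; [exact: bs|rewrite -ut; exact: mu].
  split; first exact: bR.
  apply: (bflow_follow ql at' _ bR _ ar); last by left; rewrite -/(v a) va.
  by move=> q /andP[q1 q2]; apply: Hx; rewrite q1 (le_trans q2).
Qed.

(** The time-reversed statement: backward in time a box can only be left through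
    its entrance face. *)
Lemma enter_box lam v2 (x : R -> V) (a b : R) : Q lam -> a <= b -> box delta v2 ->
  solves f lam a b x -> x b = Psi v2 lam ->
  let v t := bflow lam v2 (t - b) in
  (forall t, a <= t <= b -> box delta (v t) /\ x t = Psi (v t) lam) \/
  exists t t', [/\ t' < t <= b, a <= t', `|vs (v t)| = delta, delta < `|vs (v t')| <= R0 &
    (forall r, t <= r <= b -> box delta (v r)) /\
    (forall r, t' <= r <= b -> box R0 (v r) /\ x r = Psi (v r) lam)].
Proof.
move=> ql ab bv2 Hx xb v; have vb : v b = v2 by rewrite /v subrr bflow0.
have bs r : r <= b -> `|vu (v r)| <= delta.
  move=> ar; case: bv2 => _ h; apply: le_trans h; rewrite -[in leRHS]vb.
  by apply: bflow_vu_mono => //; rewrite lerD2r.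
have mu r r' : r <= r' -> `|vs (v r')| <= `|vs (v r)|.
  by move=> rr; apply: bflow_vs_mono => //; rewrite lerD2r.
have [ub|ub] := leP `|vs (v a)| delta.
  left; have bb t : a <= t <= b -> box delta (v t).
    by move=> /andP[at1 tb]; split; [apply: le_trans ub; exact: mu|exact: bs].
  move=> t tab; split; first exact: bb.
  apply: (bflow_follow ql ab Hx _ _ tab); last by right; rewrite -/(v b) vb.
  by move=> r /bb; exact: box_le.
right; have [_ dl] := andP dltR.
pose m := Num.min R0 `|vs (v a)|.
have dm : delta < m by rewrite lt_min dl.
have cu (r : R) : {for r, continuous (fun r => `|vs (v r)|)}.
  apply: norm_continuous; apply: is_derive_cts.
  exact: (@is_derive_shiftc _ _ (fun t => vs (bflow lam v2 t)) (- b) r _ (bflow_vs_der v2 ql _)).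
have ua : `|vs (v b)| <= delta by rewrite vb; case: bv2.
have [||t' /andP[at' t'b] ut'] := @ivt_ge R (fun r => `|vs (v r)|) a b m ab.
- by move=> r _; exact: cu.
- by rewrite (le_trans ua (ltW dm)) ge_min lexx orbT.
have [||t /andP[tt' tb] ut] := @ivt_ge R (fun r => `|vs (v r)|) t' b delta t'b.
- by move=> r _; exact: cu.
- by rewrite ua ut' ltW.
have tlt : t' < t.
  by rewrite lt_neqAle tt' andbT; apply/eqP => E; move: dm; rewrite -ut' E ut ltxx.
have bR r : t' <= r <= b -> box R0 (v r).
  move=> /andP[ar rt']; split; last by apply: le_trans (bs r rt') _; exact: ltW.
  by apply: le_trans (mu _ _ ar) _; rewrite ut' ge_min lexx.
exists t, t'; split=> //.
- by rewrite tlt.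
- by rewrite ut' dm ge_min lexx.
- split=> [r /andP[ar rt]|r ar].
    by split; [rewrite -ut; exact: mu|exact: bs].
  split; first exact: bR.
  apply: (bflow_follow ql t'b _ bR _ ar); last by right; rewrite -/(v b) vb.
  by move=> q /andP[q1 q2]; apply: Hx; rewrite q2 (le_trans at').
Qed.

(** * The passage near the periodic orbit *)

Let Kd : 8 * K * delta <= beta.
Proof.
case/andP: dR => _ h; apply: le_trans (fb_small FB).
by rewrite mulrAC [leRHS]mulrC ler_pM2r// mulrC -ler_pdivlMr.
Qed.

Lemma bflow_vu_pos lam v0 (t : R) : Q lam -> 0 < vu v0 -> 0 < vu (bflow lam v0 t).
Proof.
move=> ql u0; rewrite ltNge; apply/negP => ut.
have cu (r : R) : {for r, continuous (fun r => vu (bflow lam v0 r))} by exact: bflow_vu_cont.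
have e0 : vu (bflow lam v0 0) = vu v0 by rewrite bflow0.
have [r ur] : exists r, vu (bflow lam v0 r) = 0.
  have [t0|/ltW t0] := leP 0 t.
    have [||r _ ur] := @ivt_ge R (fun r => vu (bflow lam v0 r)) 0 t 0 t0; last by exists r.
      by move=> s _; exact: cu.
    by rewrite ut e0 ltW.
  have [||r _ ur] := @ivt_le R (fun r => vu (bflow lam v0 r)) t 0 0 t0; last by exists r.
    by move=> s _; exact: cu.
  by rewrite ut e0 ltW.
have : vu v0 = 0.
  rewrite -e0; pose z s := vu (bflow lam v0 s).
  have zr0 : z r = 0 by [].
  have Kb : 0 < K + beta by rewrite addr_gt0.
  have [r0|/ltW r0] := leP 0 r.
    apply: (@zero_of_gronwall R _ _ z _ _ 0 r Kb r0 (or_intror zr0)); last by rewrite lexx.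
      by move=> s _; exact: bflow_vu_der.
    by move=> s _; exact: du_norm.
  apply: (@zero_of_gronwall R _ _ z _ _ r 0 Kb r0 (or_introl zr0)); last by rewrite lexx andbT.
    by move=> s _; exact: bflow_vu_der.
  by move=> s _; exact: du_norm.
by move=> E; rewrite E ltxx in u0.
Qed.

Lemma bflow_vs_pos sg lam v0 (t : R) : Q lam -> sg != 0 -> 0 < sg * vs v0 -> 0 < sg * vs (bflow lam v0 t).
Proof.
move=> ql sg0 u0; rewrite ltNge; apply/negP => ut.
have cu (r : R) : {for r, continuous (fun r => sg * vs (bflow lam v0 r))}.
  exact: is_derive_cts (der_scale sg (bflow_vs_der v0 ql r)).
have e0 : vs (bflow lam v0 0) = vs v0 by rewrite bflow0.
have [r ur] : exists r, sg * vs (bflow lam v0 r) = 0.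
  have [t0|/ltW t0] := leP 0 t.
    have [||r _ ur] := @ivt_ge R (fun r => sg * vs (bflow lam v0 r)) 0 t 0 t0; last by exists r.
      by move=> s _; exact: cu.
    by rewrite ut e0 ltW.
  have [||r _ ur] := @ivt_le R (fun r => sg * vs (bflow lam v0 r)) t 0 0 t0; last by exists r.
    by move=> s _; exact: cu.
  by rewrite ut e0 ltW.
have : vs v0 = 0.
  rewrite -e0; pose z s := vs (bflow lam v0 s).
  have zr0 : z r = 0 by move/eqP: ur; rewrite mulf_eq0 (negbTE sg0)/= => /eqP.
  have Kb : 0 < K + beta by rewrite addr_gt0.
  have [r0|/ltW r0] := leP 0 r.
    apply: (@zero_of_gronwall R _ _ z _ _ 0 r Kb r0 (or_intror zr0)); last by rewrite lexx.
      by move=> s _; exact: bflow_vs_der.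
    by move=> s _; exact: ds_norm.
  apply: (@zero_of_gronwall R _ _ z _ _ r 0 Kb r0 (or_introl zr0)); last by rewrite lexx andbT.
    by move=> s _; exact: bflow_vs_der.
  by move=> s _; exact: ds_norm.
by move=> E; rewrite E mulr0 ltxx in u0.
Qed.

(** The passage problem: the orbit enters at (c0, sg delta, u0) and has unstable
    coordinate delta exactly after time T. *)
Definition passage (lam : R * R) (c0 sg T u0 : R) : Prop :=
  0 < u0 /\ vu (bflow lam (c0, sg * delta, u0) T) = delta.

(** Intermediate values in u0: it is too small at 0 and large enough at delta,
    since v^u grows along the orbit. *)
Lemma passage_exists lam c0 sg (T : R) : Q lam -> 0 <= T -> exists u0, passage lam c0 sg T u0.
Proof.
move=> ql T0; pose g u0 := vu (bflow lam (c0, sg * delta, u0) T).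
have cg (u : R) : {for u, continuous g}.
  apply/ctsP => e e0; set E := expR (2 * field_const * `|T|).
  have E0 : 0 < E by exact: expR_gt0.
  exists (e / (2 * E)); first by rewrite divr_gt0// mulr_gt0.
  move=> u' uu.
  have hT : - T <= T <= T by rewrite lexx andbT (le_trans _ T0)// oppr_le0.
  have H := @bflow_continuous_dep lam lam
      (c0, sg * delta, u') (c0, sg * delta, u) T T ql ql T0 hT.
  have : `|g u' - g u| <= 2 * `|u' - u| * E.
    apply: le_trans (norm_snd (bflow lam (c0, sg * delta, u') T - bflow lam (c0, sg * delta, u) T)) _.
    apply: le_trans H _; rewrite !norm_pairB !subrr normr0 maxxx mulr0 mul0r addr0.
    by rewrite (max_idPr (normr_ge0 _)).
  move=> h; apply: le_lt_trans h _.
  move: uu; rewrite ltr_pdivlMr ?mulr_gt0// => uu.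
  by rewrite (_ : 2 * `|u' - u| * E = `|u' - u| * (2 * E)) //; ring.
have g0 : g 0 = 0 by rewrite /g bflow_vu0.
have gd : delta <= g delta.
  have := @bflow_vu_mono lam (c0, sg * delta, delta) ql 0 T T0.
  by rewrite bflow0// /vu/= gtr0_norm// gtr0_norm// bflow_vu_pos.
have [||u /andP[u0 ud] gu] := @ivt_le R g 0 delta delta (ltW d0).
- by move=> u _; exact: cg.
- by rewrite g0 (ltW d0).
exists u; split=> //; rewrite lt_neqAle u0 andbT; apply/eqP => E.
by move: d0; rewrite -gu -E g0 ltxx.
Qed.

Section Bounds.
Variables (lam : R * R) (c0 sg T u0 : R).
Hypotheses (ql : Q lam) (T0 : 0 <= T) (sg1 : `|sg| = 1) (pu : passage lam c0 sg T u0).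
Let v := bflow lam (c0, sg * delta, u0).
Let sd : `|sg * delta| = delta. Proof. by rewrite normrM sg1 mul1r gtr0_norm. Qed.

Lemma passage_bounds (t : R) : 0 <= t <= T ->
  `|vs (v t)| <= delta * expR (- beta * t) /\ 0 < vu (v t) <= delta * expR (- beta * (T - t)).
Proof.
move=> /andP[t0 tT]; case: pu => u00 uT; split.
  have := @bflow_vs_decay lam (c0, sg * delta, u0) ql 0 t t0.
  by rewrite bflow0// /vs/= sd subr0; apply.
have up : 0 < vu (v t) by exact: bflow_vu_pos.
rewrite up/= -[leLHS]gtr0_norm//.
have := @bflow_vu_growth lam (c0, sg * delta, u0) ql t T tT.
by rewrite uT [`|delta|]gtr0_norm//; apply.
Qed.

Lemma passage_box (t : R) : 0 <= t <= T -> box delta (v t).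
Proof.
move=> tT; have [h1 /andP[h2 h3]] := passage_bounds tT; case/andP: tT => t0 tT'.
split; [apply: le_trans h1 _|rewrite gtr0_norm//; apply: le_trans h3 _];
  by rewrite ler_piMr ?(ltW d0)// -expR0 ler_expR mulNr oppr_le0 mulr_ge0 ?(ltW beta0)// subr_ge0.
Qed.

Let vbox t : 0 <= t <= T -> box R0 (v t).
Proof. by move=> /passage_box[h1 h2]; split; apply: le_trans dltR'. Qed.

Lemma passage_s_pos (t : R) : 0 < sg * vs (v t).
Proof.
apply: bflow_vs_pos => //; first by rewrite -normr_gt0 sg1.
rewrite /vs/= mulrA -expr2 -real_normK ?num_real// sg1 expr1n mul1r//.
Qed.

Lemma passage_ln_s (t : R) : 0 <= t <= T -> is_derive t 1 (fun t => ln (sg * vs (v t)))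
  (alps lam + Fs (v t) lam / vs (v t)).
Proof.
move=> tT; have sp := passage_s_pos t.
have sg0 : sg != 0 by rewrite -normr_gt0 sg1.
have s0 : vs (v t) != 0 by apply/eqP => E; rewrite E mulr0 ltxx in sp.
have D := der_ln (f := fun t => sg * vs (v t)) sp (der_scale sg (bflow_vs_der (c0, sg * delta, u0) ql t)).
apply: (der_eq D); rewrite -/v (clamp_coord_id (vbox tT)) clamp_id; last by case: (vbox tT).
by rewrite invfM mulrACA divff// mul1r mulrDl mulfK.
Qed.

Lemma passage_ln_u (t : R) : 0 <= t <= T -> is_derive t 1 (fun t => ln (vu (v t)))
  (alpu lam + Fu (v t) lam / vu (v t)).
Proof.
move=> tT; have up : 0 < vu (v t) by case: pu => u00 _; exact: bflow_vu_pos.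
have D := der_ln (f := fun t => vu (v t)) up (bflow_vu_der (c0, sg * delta, u0) ql t).
apply: (der_eq D); rewrite -/v (clamp_coord_id (vbox tT)) clamp_id; last by case: (vbox tT).
by rewrite mulrDl mulfK// gt_eqF.
Qed.

(** A primitive of the sum of the two exponentials that bound v^s and v^u: the
    rates of growth of their logarithms differ from alps and alpu by at most a
    multiple of this sum. *)
Definition barrier (k t : R) := k * (- expR (- beta * t) + expR (- beta * (T - t))) / beta.

Lemma barrier_der k (t : R) : is_derive t 1 (barrier k)
  (k * (expR (- beta * t) + expR (- beta * (T - t)))).
Proof.
have D1 := der_expk (- beta) t.
have D2 : is_derive t 1 (fun t => expR (- beta * (T - t))) (beta * expR (- beta * (T - t))).
  apply: (der_eq (der_exp (der_scale (- beta) (der_sub (der_cst T t) (der_id t))))); ring.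
have D := der_scale (k / beta) (der_sub D2 D1).
apply: (der_eq (der_ext _ D)) => [s|]; first by rewrite /barrier; ring.
by field; rewrite gt_eqF.
Qed.

Lemma barrier_bound k a b : 0 <= k -> 0 <= a -> a <= b -> b <= T ->
  barrier k b - barrier k a <= k * 2 / beta.
Proof.
move=> k0 a0 ab bT.
have e1 r : 0 <= r -> 0 <= expR (- beta * r) <= 1.
  by move=> r0; rewrite expR_ge0 -expR0 ler_expR mulNr oppr_le0 mulr_ge0// ltW.
have aT : 0 <= T - a by rewrite subr_ge0 (le_trans ab).
have bT' : 0 <= T - b by rewrite subr_ge0.
have /andP[h1 h2] := e1 _ a0; have /andP[h3 h4] := e1 _ (le_trans a0 ab).
have /andP[h5 h6] := e1 _ aT; have /andP[h7 h8] := e1 _ bT'.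
rewrite /barrier -mulrBl -mulrBr ler_pM2r ?invr_gt0// ler_wpM2l//; lra.
Qed.

Lemma passage_u0_le : u0 <= delta * expR (1 - alpu lam * T).
Proof.
have [u00 uT] := pu.
pose k := K * delta.
have k0 : 0 <= k by rewrite mulr_ge0// ltW.
have h := @mvt_le_scalar R (fun t => alpu lam * t - ln (vu (v t)))
  (fun t => alpu lam * 1 - (alpu lam + Fu (v t) lam / vu (v t))) (barrier k) (fun t => k * (expR (- beta * t) + expR (- beta * (T - t)))) 0 T T0.
have {h} : alpu lam * T - ln (vu (v T)) - (alpu lam * 0 - ln (vu (v 0))) <= barrier k T - barrier k 0.
  apply: h => t tT.
  - exact: der_sub (der_scale (alpu lam) (der_id t)) (passage_ln_u tT).
  - exact: barrier_der.
  - rewrite mulr1 opprD addrA subrr sub0r.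
    have [hs /andP[up hu]] := passage_bounds tT.
    apply: le_trans (ler_norm _) _; rewrite normrN normrM normfV ler_pdivrMr ?normr_gt0 ?gt_eqF//.
    apply: le_trans (fb_Fu FB ql (vbox tT)) _; rewrite ler_wpM2r//.
    rewrite /k -mulrA ler_pM2l// mulrDr ge_max.
    apply/andP; split.
      by apply: le_trans hs _; rewrite lerDl mulr_ge0 ?expR_ge0// ltW.
    by rewrite gtr0_norm//; apply: le_trans hu _; rewrite lerDr mulr_ge0 ?expR_ge0// ltW.
have := barrier_bound k0 (lexx 0) T0 (lexx T).
have -> : v 0 = (c0, sg * delta, u0) by rewrite /v bflow0.
rewrite /v uT mulr0 sub0r opprK {1}/vu/= => h1 h2.
have h3 : k * 2 / beta <= 1.
  rewrite ler_pdivrMr// mul1r /k; apply: le_trans Kd.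
  by have : 0 <= K * delta by []; lra.
rewrite -[u0]lnK ?posrE// -[delta]lnK ?posrE// -expRD ler_expR.
by lra.
Qed.

End Bounds.

(** Two passages of the same duration are close if their parameters and entrance
    phases are.  In the logarithms of the stable and the unstable coordinate
    both equations are integrable along the passage up to a small multiple of
    the difference itself, which closes the estimate. *)
Lemma passage_lipschitz (lam lam' : R * R) (c0 c0' sg T u0 u0' : R) : Q lam -> Q lam' -> 0 <= T -> `|sg| = 1 ->
  passage lam c0 sg T u0 -> passage lam' c0' sg T u0' ->
  let D := Num.max `|c0 - c0'| `|lam - lam'| in
  let C := delta * expR (- beta * T) * (8 * K * T * D) in
  `|u0 - u0'| <= C /\
  `|vs (bflow lam (c0, sg * delta, u0) T) - vs (bflow lam' (c0', sg * delta, u0') T)| <= C.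
Proof.
move=> ql ql' T0 sg1 pu pu' D C.
pose v := bflow lam (c0, sg * delta, u0); pose v' := bflow lam' (c0', sg * delta, u0').
pose p (t : R) := ln (sg * vs (v t)); pose p' (t : R) := ln (sg * vs (v' t)).
pose q (t : R) := ln (vu (v t)); pose q' (t : R) := ln (vu (v' t)).
have D0 : 0 <= D by rewrite le_max normr_ge0.
have lD : `|lam - lam'| <= D by rewrite le_max lexx orbT.
have cD : `|c0 - c0'| <= D by rewrite le_max lexx.
pose dp (t : R) := alps lam + Fs (v t) lam / vs (v t) - (alps lam' + Fs (v' t) lam' / vs (v' t)).
pose dq (t : R) := alpu lam + Fu (v t) lam / vu (v t) - (alpu lam' + Fu (v' t) lam' / vu (v' t)).
have Dp (t : R) : 0 <= t <= T -> is_derive t 1 (fun t => p t - p' t) (dp t).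
  by move=> tT; exact: der_sub (passage_ln_s ql sg1 pu tT) (passage_ln_s ql' sg1 pu' tT).
have Dq (t : R) : 0 <= t <= T -> is_derive t 1 (fun t => q t - q' t) (dq t).
  by move=> tT; exact: der_sub (passage_ln_u ql sg1 pu tT) (passage_ln_u ql' sg1 pu' tT).
have [c cT cmax] : exists2 c, c \in `[0, T] & forall t, t \in `[0, T] ->
    `|p t - p' t| + `|q t - q' t| <= `|p c - p' c| + `|q c - q' c|.
  apply: (@EVT_max R (fun t => `|p t - p' t| + `|q t - q' t|)) => //.
  apply: continuous_in_subspaceT => t /[!inE]/= /[!in_itv]/= tT.
  apply: (@continuousD _ _ _ (fun t => `|p t - p' t|) (fun t => `|q t - q' t|)).
    exact: norm_continuous (is_derive_cts (Dp t tT)).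
  exact: norm_continuous (is_derive_cts (Dq t tT)).
move: (cT); rewrite in_itv/= => /andP[cpos cT'].
set m := `|p c - p' c| + `|q c - q' c| in cmax.
have m0 : 0 <= m by rewrite addr_ge0.
have pm t : 0 <= t <= T -> `|p t - p' t| <= m.
  by move=> tT; apply: le_trans (cmax t _); rewrite ?in_itv// lerDl.
have qm t : 0 <= t <= T -> `|q t - q' t| <= m.
  by move=> tT; apply: le_trans (cmax t _); rewrite ?in_itv// lerDr.
have sE w cc uu l (t : R) : `|sg| = 1 -> Q l -> passage l cc sg T uu -> w = bflow l (cc, sg * delta, uu) ->
    0 <= t <= T -> vs (w t) = sg * expR (ln (sg * vs (w t))) /\ expR (ln (sg * vs (w t))) <= delta * expR (- beta * t).
  move=> _ qq pp -> tT; have sp := @passage_s_pos l cc sg uu qq sg1 t.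
  have [hs _] := passage_bounds qq sg1 pp tT.
  rewrite lnK ?posrE//.
  split; first by rewrite mulrA -expr2 -real_normK ?num_real// sg1 expr1n mul1r.
  by apply: le_trans (ler_norm _) _; rewrite normrM sg1 mul1r.
have ds (t : R) : 0 <= t <= T -> `|vs (v t) - vs (v' t)| <= delta * expR (- beta * t) * m.
  move=> tT; have [E1 B1] := sE v c0 u0 lam t sg1 ql pu erefl tT.
  have [E2 B2] := sE v' c0' u0' lam' t sg1 ql' pu' erefl tT.
  rewrite E1 E2 -mulrBr normrM sg1 mul1r.
  apply: le_trans (expR_lip B1 B2) _; rewrite ler_wpM2l ?mulr_ge0 ?expR_ge0 ?(ltW d0)//.
  exact: pm.
have du (t : R) : 0 <= t <= T -> `|vu (v t) - vu (v' t)| <= delta * expR (- beta * (T - t)) * m.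
  move=> tT; have [_ /andP[up uB]] := passage_bounds ql sg1 pu tT.
  have [_ /andP[up' uB']] := passage_bounds ql' sg1 pu' tT.
  rewrite -[vu (v t)]lnK ?posrE// -[vu (v' t)]lnK ?posrE//.
  apply: le_trans (expR_lip (M := delta * expR (- beta * (T - t))) _ _) _.
  - by rewrite lnK ?posrE.
  - by rewrite lnK ?posrE.
  by rewrite ler_wpM2l ?mulr_ge0 ?expR_ge0 ?(ltW d0)//; exact: qm.
pose k := K * (delta * m).
have k0 : 0 <= k by rewrite !mulr_ge0 ?(ltW K0) ?(ltW d0).
pose B (t : R) := 2 * K * D * t + barrier T k t.
pose dB (t : R) := 2 * K * D * 1 + k * (expR (- beta * t) + expR (- beta * (T - t))).
have DB (t : R) : is_derive t 1 B (dB t).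
  exact: der_add (der_scale (2 * K * D) (der_id t)) (barrier_der T k t).
have vv (t : R) : 0 <= t <= T -> Num.max `|v t - v' t| `|lam - lam'| <=
    D + (delta * expR (- beta * t) * m + delta * expR (- beta * (T - t)) * m).
  move=> tT; have h1 : 0 <= delta * expR (- beta * t) * m by rewrite !mulr_ge0 ?expR_ge0 ?(ltW d0).
  have h2 : 0 <= delta * expR (- beta * (T - t)) * m by rewrite !mulr_ge0 ?expR_ge0 ?(ltW d0).
  have hs := ds t tT; have hu := du t tT.
  have hc : vc (v t) - vc (v' t) = c0 - c0'.
    by rewrite !bflow_vc// /vc/= opprD addrACA subrr addr0.
  have -> : `|v t - v' t| = Num.max (Num.max `|vc (v t) - vc (v' t)| `|vs (v t) - vs (v' t)|) `|vu (v t) - vu (v' t)|.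
    by case: (v t) => [[a1 a2] a3]; case: (v' t) => [[b1 b2] b3]; rewrite !norm_pairB.
  rewrite hc ge_max; apply/andP; split; last first.
    by apply: le_trans lD _; rewrite lerDl addr_ge0.
  rewrite ge_max; apply/andP; split; last first.
    by apply: le_trans hu _; rewrite addrA lerDr addr_ge0.
  rewrite ge_max; apply/andP; split; last by apply: le_trans hs _; rewrite addrCA lerDl addr_ge0.
  by apply: le_trans cD _; rewrite lerDl addr_ge0.
have sn0 l cc uu t : Q l -> passage l cc sg T uu -> vs (bflow l (cc, sg * delta, uu) t) != 0.
  move=> qq pp; apply/eqP => E; have := @passage_s_pos l cc sg uu qq sg1 t.
  by rewrite E mulr0 ltxx.
have bxR l cc uu t : Q l -> passage l cc sg T uu -> 0 <= t <= T -> box R0 (bflow l (cc, sg * delta, uu) t).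
  by move=> qq pp tT; have [h1 h2] := passage_box qq sg1 pp tT; split; apply: le_trans dltR'.
have H (al : R * R -> R) (x y : R) t : 0 <= t <= T -> `|al lam - al lam'| <= K * `|lam - lam'| ->
    `|x - y| <= K * Num.max `|v t - v' t| `|lam - lam'| -> `|al lam + x - (al lam' + y)| <= dB t.
  move=> tT h1 h2; have -> : al lam + x - (al lam' + y) = (al lam - al lam') + (x - y) by ring.
  apply: normD_le.
  have h3 : K * `|lam - lam'| <= K * D by rewrite ler_wpM2l// ltW.
  have h4 := vv t tT; rewrite -(ler_pM2l K0) in h4.
  have -> : dB t = K * D + K * (D + (delta * expR (- beta * t) * m + delta * expR (- beta * (T - t)) * m)).
    by rewrite /dB /k; ring.
  lra.
have Hp t : 0 <= t <= T -> `|dp t| <= dB t.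
  move=> tT; apply: H => //; first exact: (fb_alps_lip FB).
  by apply: (fb_Gs FB) => //; [exact: bxR|exact: bxR|exact: sn0|exact: sn0].
have Hq t : 0 <= t <= T -> `|dq t| <= dB t.
  move=> tT; apply: H => //; first exact: (fb_alpu_lip FB).
  have up l cc uu : Q l -> passage l cc sg T uu -> vu (bflow l (cc, sg * delta, uu) t) != 0.
    by move=> qq [u00 _]; rewrite gt_eqF// bflow_vu_pos.
  by apply: (fb_Gu FB) => //; [exact: bxR|exact: bxR|exact: up|exact: up].
have Bb a b : 0 <= a -> a <= b -> b <= T -> B b - B a <= 2 * K * D * T + k * 2 / beta.
  move=> a0 ab bT; have := barrier_bound k0 a0 ab bT.
  have : 2 * K * D * (b - a) <= 2 * K * D * T.
    by rewrite ler_wpM2l ?mulr_ge0 ?(ltW K0)//; lra.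
  by rewrite /B; lra.
have p0 : p 0 - p' 0 = 0 by rewrite /p /p' /v /v' !bflow0// /vs/= subrr.
have qT : q T - q' T = 0 by rewrite /q /q' /v /v'; case: pu => _ ->; case: pu' => _ ->; rewrite subrr.
have pc : `|p c - p' c| <= 2 * K * D * T + k * 2 / beta.
  have := @mvt_le R R FinSupR (fun t => p t - p' t) dp B dB 0 c cpos.
  rewrite p0 subr0 => h; suff : B c - B 0 <= 2 * K * D * T + k * 2 / beta.
    by apply: le_trans; apply: h => // t /andP[t0 tc]; [apply: Dp|apply: Hp]; rewrite t0 (le_trans tc).
  exact: Bb.
have qc : `|q c - q' c| <= 2 * K * D * T + k * 2 / beta.
  have := @mvt_le R R FinSupR (fun t => q t - q' t) dq B dB c T cT'.
  rewrite qT sub0r normrN => h; suff : B T - B c <= 2 * K * D * T + k * 2 / beta.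
    by apply: le_trans; apply: h => // t /andP[t0 tc]; [apply: Dq|apply: Hq]; rewrite tc (le_trans cpos).
  exact: Bb.
have km : k * 2 / beta <= m / 4.
  rewrite ler_pdivrMr// /k; have : 8 * K * delta * m <= beta * m by rewrite ler_wpM2r.
  by lra.
have mB : m <= 8 * K * T * D.
  have : m <= 2 * (2 * K * D * T + k * 2 / beta) by rewrite {1}/m; lra.
  by lra.
have fin t x : 0 <= t <= T -> x <= delta * expR (- beta * T) * m -> x <= C.
  by move=> tT /le_trans; apply; rewrite ler_wpM2l ?mulr_ge0 ?expR_ge0 ?(ltW d0).
split.
  have /du : 0 <= (0 : R) <= T by rewrite lexx.
  by rewrite /v /v' !bflow0// /vu/= subr0; apply: (fin 0); rewrite lexx.
have /ds : 0 <= T <= T by rewrite lexx andbT.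
by apply: (fin 0); rewrite lexx.
Qed.

Lemma passage_unique (lam : R * R) (c0 sg T u0 u0' : R) : Q lam -> 0 <= T -> `|sg| = 1 ->
  passage lam c0 sg T u0 -> passage lam c0 sg T u0' -> u0 = u0'.
Proof.
move=> ql T0 sg1 pu pu'; have [+ _] := passage_lipschitz ql ql T0 sg1 pu pu'.
rewrite !subrr !normr0 maxxx !mulr0 normr_le0 subr_eq0.
by move/eqP.
Qed.

(** * Sections and their crossing times *)

Lemma Psi_per4 lam (c s u : R) (k : int) : Q lam -> box R0 (c, s, u) ->
  Psi (c + 4 * pi * k%:~R, s, u) lam = Psi (c, s, u) lam.
Proof.
move=> ql hb; rewrite -(Psi_deck (k * 2) ql hb); congr (Psi _ lam).
have E : (-1 : R) ^ (k * 2) = 1.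
  by rewrite mulrC -exprz_exp -exprnP sqrrN expr1n exp1rz.
rewrite /deck /vc /vs /vu /= E !mul1r; congr (_, _, _); rewrite intrM; ring.
Qed.

(** A compact piece of orbit that misses a section stays uniformly away from it
    when the orbit and the parameter are perturbed. *)
Lemma section_far (S : set coord) mu (w : R -> V) (a b : R) : Q mu ->
  S `<=` box delta -> (forall c c' s u, S (c, s, u) -> S (c', s, u)) ->
  compact [set v | S v /\ 0 <= vc v <= 4 * pi] ->
  (forall t, a <= t <= b -> {for t, continuous w}) ->
  (forall t, a <= t <= b -> ~ ((Psi ^~ mu) @` S) (w t)) ->
  exists2 r, 0 < r & forall t lam x, a <= t <= b -> Q lam -> `|lam - mu| < r -> `|x - w t| < r ->
    ~ ((Psi ^~ lam) @` S) x.
Proof.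
move=> qmu Sb Sc cS cw miss.
have SR v : S v -> box R0 v by move=> /Sb[h1 h2]; split; apply: le_trans dltR'.
pose P (q : R * coord) (r : R) := r <= `|Psi q.2 mu - w q.1|.
have cK : compact ((`[a, b] : set R) `*` [set v | S v /\ 0 <= vc v <= 4 * pi]).
  by apply: compact_setX => //; exact: segment_compact.
have [||r r0 H] := @compact_unif R (R * coord)%type _ P cK.
- by move=> q r r' h /andP[_ rr]; exact: le_trans rr h.
- move=> [t v] [/= tab [Sv _]]; rewrite in_itv/= in tab.
  have dd : 0 < `|Psi v mu - w t|.
    by rewrite normr_gt0 subr_eq0; apply/eqP => E; apply: (miss t tab); exists v.
  set d := `|_| in dd; have d30 : 0 < d / 3 by rewrite divr_gt0.
  have [r1 r10 H1] := (ctsP w t).1 (cw t tab) (d / 3) d30.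
  exists (Num.min r1 (Num.min (d / 3) (d / 3 / K))).
    by rewrite !lt_min r10 d30 divr_gt0.
  move=> [t' v'] [/= _ [Sv' _]]; rewrite norm_pairB gt_max !lt_min => /andP[/andP[h1 _] /andP[_ /andP[_ h2]]].
  rewrite /P/=; apply: (@le_trans _ _ (d / 3)); first by rewrite !ge_min lexx !orbT.
  have h3 := H1 _ h1.
  have h4 : `|Psi v' mu - Psi v mu| <= d / 3.
    apply: le_trans (fb_Psi_lip FB qmu qmu (SR _ Sv') (SR _ Sv)) _.
    rewrite max_normBl mulrC -ler_pdivlMr//; exact: ltW.
  have h5 : d <= `|Psi v' mu - w t'| + `|Psi v' mu - Psi v mu| + `|w t' - w t|.
    rewrite /d (_ : Psi v mu - w t = (Psi v' mu - w t') - (Psi v' mu - Psi v mu) + (w t' - w t)).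
      by apply: normD_le; rewrite lerD2r; exact: ler_normB.
    by apply/rowP => j; rewrite !mxE; ring.
  by lra.
have c0 : 0 < K + 2 by rewrite addr_gt0.
exists (r / (K + 2)); first by rewrite divr_gt0.
move=> t lam x tab ql lr xr [v Sv vx].
have [k hk] := shift_period (vc v) (@four_pi_gt0 R).
pose v' : coord := (vc v - 4 * pi * k%:~R, vs v, vu v).
have Sv' : S v' by apply: (Sc (vc v)); move: Sv; case: (v) => [[? ?] ?].
have E : Psi v' lam = x.
  rewrite -vx -(Psi_per4 k ql (SR _ Sv')) subrK.
  by case: (v) => [[? ?] ?].
have : r <= `|Psi v' mu - w t| by apply: (H (t, v')); split=> //=; rewrite in_itv.
apply/negP; rewrite -ltNge.
have -> : Psi v' mu - w t = (Psi v' mu - Psi v' lam) + (x - w t) by rewrite E addrA subrK.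
apply: normD_lt.
have h1 : `|Psi v' mu - Psi v' lam| <= K * (r / (K + 2)).
  apply: le_trans (fb_Psi_lip FB qmu ql (SR _ Sv') (SR _ Sv')) _.
  by rewrite max_normBr ler_pM2l// distrC ltW.
have : r = K * (r / (K + 2)) + 2 * (r / (K + 2)) by field; rewrite gt_eqF.
have : 0 < r / (K + 2) by rewrite divr_gt0.
by move: xr; lra.
Qed.

Lemma Sigma_in_compact : compact [set v : coord | Sigma_in_plus delta v /\ 0 <= vc v <= 4 * pi].
Proof.
rewrite (_ : mkset _ = (`[0, 4 * pi] `*` [set delta]) `*` `[- delta, delta]).
  apply: compact_setX; last exact: segment_compact.
  by apply: compact_setX; [exact: segment_compact|exact: compact_set1].
apply/seteqP; split=> [[[c s] u] [[/= h1 h2] h3]|[[c s] u] [[/= h1 h2] h3]].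
  by split; [split=> //=; rewrite in_itv|rewrite /= in_itv/= -ler_norml].
by rewrite !in_itv/= in h1 h3; split=> //; split=> //; rewrite ler_norml.
Qed.

Lemma Sigma_out_compact : compact [set v : coord | Sigma_out_plus delta v /\ 0 <= vc v <= 4 * pi].
Proof.
rewrite (_ : mkset _ = (`[0, 4 * pi] `*` `[- delta, delta]) `*` [set delta]).
  apply: compact_setX; last exact: compact_set1.
  by apply: compact_setX; exact: segment_compact.
apply/seteqP; split=> [[[c s] u] [[/= h1 h2] h3]|[[c s] u] [[/= h1 h2] h3]].
  by split=> //; split; rewrite /= in_itv//= -ler_norml.
by rewrite !in_itv/= in h1 h2; split=> //; split=> //; rewrite ler_norml.
Qed.

Lemma hit_out mu v0 e : Q mu -> vu v0 = delta -> 0 < e ->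
  exists2 r, 0 < r & forall v', `|v' - v0| < r -> exists t, [/\ `|t| < e,
    vu (bflow mu v' t) = delta &
    forall s, `|s| <= `|t| -> `|bflow mu v' s - v0| < e].
Proof.
have [_ dl] := andP dltR; move=> qmu v0u e0.
have cb : {for 0, continuous (bflow mu v0)} by exact: is_derive_cts (bflow_der v0 0 qmu).
pose e1 := Num.min (e / 2) (R0 - delta).
have e10 : 0 < e1 by rewrite lt_min divr_gt0// subr_gt0.
have e1R : e1 <= R0 - delta by rewrite ge_min lexx orbT.
have e1e : e1 <= e / 2 by rewrite ge_min lexx.
have [t1 t10 H1] := (ctsP _ _).1 cb e1 e10.
pose t2 := Num.min (t1 / 2) (e / 2).
have t20 : 0 < t2 by rewrite !lt_min !divr_gt0.
have t21 : t2 < t1 by rewrite gt_min; apply/orP; left; lra.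
have t2e : t2 < e by rewrite gt_min; apply/orP; right; lra.
have near s : `|s| <= t2 -> `|bflow mu v0 s - v0| < e1.
  move=> st; have := H1 s; rewrite bflow0// subr0; apply; exact: le_lt_trans st t21.
have vuR s : `|s| <= t2 -> `|vu (bflow mu v0 s)| <= R0.
  move=> st; have h : `|vu (bflow mu v0 s) - delta| < e1.
    by rewrite -v0u; apply: le_lt_trans (near s st); exact: vu_le.
  have -> : vu (bflow mu v0 s) = delta + (vu (bflow mu v0 s) - delta) by ring.
  apply: normD_le; rewrite gtr0_norm//; have := ltW (lt_le_trans h e1R).
  by lra.
have up s : 0 < vu (bflow mu v0 s) by apply: bflow_vu_pos => //; rewrite v0u.
have ed : expR (- beta * t2) < 1 by rewrite -expR0 ltr_expR mulNr oppr_lt0 mulr_gt0.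
have hi : delta < vu (bflow mu v0 t2).
  have := @bflow_vu_growth mu v0 qmu 0 t2 (ltW t20); rewrite bflow0// subr0 v0u gtr0_norm// gtr0_norm//.
  move=> /(_ _) h; apply: le_lt_trans (h _) _.
    by have := vuR t2; rewrite !gtr0_norm//; apply.
  by rewrite -[ltRHS]mulr1 ltr_pM2l.
have nt20 : - t2 <= 0 by rewrite oppr_le0 ltW.
have lo : vu (bflow mu v0 (- t2)) < delta.
  have := @bflow_vu_growth mu v0 qmu (- t2) 0 nt20; rewrite bflow0// sub0r opprK v0u gtr0_norm// gtr0_norm//.
  by move=> /(_ dltR') h; apply: le_lt_trans h _; rewrite -[ltRHS]mulr1 ltr_pM2l.
pose gam := Num.min (Num.min (vu (bflow mu v0 t2) - delta) (delta - vu (bflow mu v0 (- t2)))) (e / 2).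
have gam0 : 0 < gam by rewrite !lt_min !subr_gt0 hi lo divr_gt0.
pose E := expR (2 * field_const * t2).
have E0 : 0 < E := expR_gt0 _.
exists (gam / (2 * E)); first by rewrite divr_gt0// mulr_gt0.
move=> v'; rewrite ltr_pdivlMr ?mulr_gt0// => v'v.
have dep s : `|s| <= t2 -> `|bflow mu v' s - bflow mu v0 s| < gam.
  move=> st; have tT : - t2 <= s <= t2 by rewrite -ler_norml.
  have := bflow_continuous_dep v' v0 qmu qmu (ltW t20) tT.
  rewrite subrr normr0 mulr0 mul0r addr0 => h; apply: le_lt_trans h _.
  apply: le_lt_trans v'v; rewrite (_ : `|v' - v0| * (2 * E) = 2 * `|v' - v0| * E); last by ring.
  rewrite ler_wpM2l ?mulr_ge0// ler_expR ler_pM2l//.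
  by rewrite mulr_gt0// field_const_gt0.
have depu s : `|s| <= t2 -> `|vu (bflow mu v' s) - vu (bflow mu v0 s)| < gam.
  by move=> st; apply: le_lt_trans (dep s st); exact: vu_le.
have t2n : `|t2| <= t2 by rewrite gtr0_norm.
have nt2n : `|- t2| <= t2 by rewrite normrN gtr0_norm.
have [g1 g2] : gam <= vu (bflow mu v0 t2) - delta /\ gam <= delta - vu (bflow mu v0 (- t2)).
  by split; rewrite !ge_min lexx ?orbT.
have t22 : - t2 <= t2 by lra.
have [||t tt ut] := @ivt_le R (fun s => vu (bflow mu v' s)) (- t2) t2 delta t22.
- by move=> s _; exact: bflow_vu_cont.
- have := depu _ t2n; have := depu _ nt2n => /ltr_normlP[_ h1] /ltr_normlP[h2 _].
  by apply/andP; split; lra.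
have tn : `|t| <= t2 by rewrite ler_norml.
exists t; split=> //; first exact: le_lt_trans tn t2e.
move=> s st; have st2 := le_trans st tn.
rewrite (_ : bflow mu v' s - v0 = (bflow mu v' s - bflow mu v0 s) + (bflow mu v0 s - v0)); last first.
  by rewrite addrA subrK.
apply: normD_lt.
have : gam <= e / 2 by rewrite !ge_min lexx !orbT.
by have := dep s st2; have := near s st2; lra.
Qed.

(** Orbits near the stable manifold of P cross the entrance section
    transversally. *)
Lemma cross_in mu c0 e : Q mu -> let v0 : coord := (c0, delta, 0) in 0 < e -> exists tau e4, [/\ 0 < tau, tau <= 1, tau <= e, 0 < e4 /\ box (R0 / 2) (bflow mu v0 tau) &
  forall lam v', Q lam -> `|lam - mu| < e4 -> `|v' - bflow mu v0 tau| < e4 ->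
  (forall t : R, - tau <= t <= tau -> 0 < vs (bflow lam v' (t - tau)) <= R0 /\ `|vu (bflow lam v' (t - tau))| <= delta) /\
  exists2 t, - tau <= t <= tau & vs (bflow lam v' (t - tau)) = delta].
Proof.
move=> qmu v0 e0; have [_ dR8] := andP dR.
(* the time needed to cross the section transversally *)
have cb : {for 0, continuous (bflow mu v0)} by exact: is_derive_cts (bflow_der v0 0 qmu).
have d40 : 0 < delta / 4 by rewrite divr_gt0.
have [t1 t10 Ht1] := (ctsP _ _).1 cb _ d40.
pose tau := Num.min (Num.min (t1 / 2) 1) e.
have tau0 : 0 < tau by rewrite !lt_min ltr01 e0 divr_gt0.
have [tau1 tau2 tau3] : [/\ tau <= t1 / 2, tau <= 1 & tau <= e] by min_le.
have nearv (s : R) : - tau <= s <= tau -> `|bflow mu v0 s - v0| < delta / 4.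
  move=> st; have := Ht1 s; rewrite bflow0// subr0; apply.
  have : `|s| <= tau by rewrite ler_norml.
  by move=> h; apply: le_lt_trans h _; apply: le_lt_trans tau1 _; frac_lt.
have vu0 s : vu (bflow mu v0 s) = 0 by exact: bflow_vu0.
have nears s : - tau <= s <= tau -> `|vs (bflow mu v0 s) - delta| < delta / 4.
  move=> st; apply: le_lt_trans (nearv s st).
  exact: (vs_le _ v0).
have spos s : - tau <= s <= tau -> delta * (3 / 4) < vs (bflow mu v0 s) < delta * (5 / 4).
  by move=> /nears /ltr_normlP[h1 h2]; apply/andP; split; lra.
have ed : expR (- beta * tau) < 1 by rewrite -expR0 ltr_expR mulNr oppr_lt0 mulr_gt0.
have ttau : - tau <= tau <= tau by rewrite lexx andbT; lra.
have ntau : - tau <= - tau <= tau by rewrite lexx/=; lra.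
have ztau : - tau <= (0 : R) <= tau by rewrite ltW ?oppr_lt0//= ltW.
have sR s : - tau <= s <= tau -> `|vs (bflow mu v0 s)| <= R0.
  by move=> /spos /andP[h1 h2]; rewrite gtr0_norm; lra.
have hi : vs (bflow mu v0 tau) < delta.
  have := bflow_vs_decay (v0 := v0) qmu (ltW tau0) (sR 0 ztau); rewrite bflow0// subr0.
  have /andP[h1 h2] := spos tau ttau; rewrite gtr0_norm; last by lra.
  by rewrite [vs v0]/= gtr0_norm// => h; apply: le_lt_trans h _; rewrite -[ltRHS]mulr1 ltr_pM2l.
have lo : delta < vs (bflow mu v0 (- tau)).
  have nt0 : - tau <= 0 by lra.
  have := bflow_vs_decay (v0 := v0) qmu nt0 (sR (- tau) ntau); rewrite bflow0// sub0r opprK.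
  have /andP[h1 h2] := spos (- tau) ntau; rewrite (gtr0_norm (x := vs (bflow _ _ _))); last by lra.
  rewrite [vs v0]/= gtr0_norm// => h; apply: le_lt_trans h _; rewrite -[ltRHS]mulr1 ltr_pM2l//; lra.
pose gam := Num.min (Num.min (delta - vs (bflow mu v0 tau)) (vs (bflow mu v0 (- tau)) - delta)) (delta / 4).
have gam0 : 0 < gam by rewrite !lt_min !subr_gt0 hi lo.
have [g1 g2 g3] : [/\ gam <= delta - vs (bflow mu v0 tau), gam <= vs (bflow mu v0 (- tau)) - delta & gam <= delta / 4].
  by min_le.
pose kf := field_const; have kf0 : 0 < kf := field_const_gt0.
pose E := expR (2 * kf * (2 * tau)); have E0 : 0 < E := expR_gt0 _.
pose e4 := gam / (4 * E * (1 + kf * (2 * tau))).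
have B0 : 0 < 1 + kf * (2 * tau) by rewrite addr_gt0// !mulr_gt0.
have e40 : 0 < e4 by rewrite divr_gt0// !mulr_gt0.
exists tau, e4; split=> //.
  split=> //; split; last by rewrite vu0 normr0 divr_ge0// ltW.
  by have /andP[h1 h2] := spos tau ttau; rewrite gtr0_norm; lra.
move=> lam v' ql lq v'v; pose b t := bflow lam v' (t - tau).
have bb t : - tau <= t <= tau -> `|b t - bflow mu v0 t| < gam.
  move=> /andP[ta tb]; have tau20 : 0 <= 2 * tau by lra.
  have tt : - (2 * tau) <= t - tau <= 2 * tau by apply/andP; split; lra.
  have := bflow_continuous_dep v' (bflow mu v0 tau) ql qmu tau20 tt.
  have -> : bflow mu (bflow mu v0 tau) (t - tau) = bflow mu v0 t.
    by rewrite bflow_shift// subrK.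
  move=> h; apply: le_lt_trans h _.
  apply: (@le_lt_trans _ _ (2 * (e4 * (1 + kf * (2 * tau))) * E)).
    have P : `|v' - bflow mu v0 tau| + kf * `|lam - mu| * (2 * tau) <= e4 * (1 + kf * (2 * tau)).
      have -> : e4 * (1 + kf * (2 * tau)) = e4 + kf * e4 * (2 * tau) by ring.
      apply: lerD; first exact: ltW.
      by apply: ler_wpM2r => //; rewrite (ler_pM2l kf0); exact: ltW lq.
    apply: ler_pM; [|exact: expR_ge0|by rewrite ler_pM2l|].
      apply: mulr_ge0 => //; apply: addr_ge0 => //; apply: mulr_ge0 => //.
      by apply: mulr_ge0 => //; exact: ltW.
    rewrite ler_expR; apply: ler_wpM2l; last by rewrite ler_norml.
    by apply: mulr_ge0 => //; exact: ltW.
  have -> : 2 * (e4 * (1 + kf * (2 * tau))) * E = gam / 2.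
    by rewrite /e4; field; rewrite !gt_eqF// addrC.
  by frac_lt.
have bs t : - tau <= t <= tau -> `|vs (b t) - vs (bflow mu v0 t)| < gam.
  move=> tt; apply: le_lt_trans (bb t tt).
  exact: vs_le.
have bu t : - tau <= t <= tau -> `|vu (b t)| <= delta.
  move=> tt; rewrite -[vu (b t)]subr0 -(vu0 t); apply: ltW.
  apply: le_lt_trans (_ : `|b t - bflow mu v0 t| < _); first exact: vu_le.
  by apply: lt_le_trans (bb t tt) _; lra.
have bs2 t : - tau <= t <= tau -> 0 < vs (b t) <= R0.
  by move=> tt; have /andP[h1 h2] := spos t tt; have /ltr_normlP[h3 h4] := bs t tt; apply/andP; split; lra.
have tautau : - tau <= tau by lra.
split; first by move=> t tt; split; [exact: bs2|exact: bu].
have [||tc tct vsc] := @ivt_ge R (fun t => vs (b t)) (- tau) tau delta tautau.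
- move=> t _; have D := bflow_vs_der v' ql (t - tau).
  exact: (is_derive_cts (@is_derive_shiftc R R (fun t => vs (bflow lam v' t)) (- tau) t _ D)).
- have /ltr_normlP[_ h1] := bs tau ttau; have /ltr_normlP[h2 _] := bs (- tau) ntau.
  by apply/andP; split; lra.
by exists tc.
Qed.

(** * Connecting orbits and their sections *)

Variable P : R -> R * R -> V.
Hypothesis PsiP : forall lam c, Q lam -> Psi (c, 0, 0) lam = P c lam.

Lemma bflow_near (T e : R) : 0 <= T -> 0 < e -> exists2 q, 0 < q & forall lam mu v v' t, Q lam -> Q mu ->
  `|lam - mu| < q -> `|v - v'| < q -> - T <= t <= T -> `|bflow lam v t - bflow mu v' t| < e.
Proof.
move=> T0 e0; pose kf := field_const; have kf0 : 0 < kf := field_const_gt0.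
pose B := 2 * (1 + kf * T) * expR (2 * kf * T).
have kT : 0 <= kf * T by rewrite mulr_ge0// ltW.
have B0 : 0 < B by rewrite mulr_gt0 ?expR_gt0// mulr_gt0// ltr_pwDl.
exists (e / B); first by rewrite divr_gt0.
move=> lam mu v v' t ql qmu lq vq tT.
have h := bflow_continuous_dep v v' ql qmu T0 tT; apply: le_lt_trans h _.
have -> : e = 2 * (e / B + kf * (e / B) * T) * expR (2 * kf * T).
  rewrite -[LHS](divfK (x := B)) ?gt_eqF// /B; ring.
apply: (@le_lt_trans _ _ (2 * (`|v - v'| + kf * `|lam - mu| * T) * expR (2 * kf * T))).
  apply: ler_wpM2l; first by rewrite mulr_ge0// addr_ge0// mulr_ge0// mulr_ge0// ltW.
  by rewrite ler_expR ler_wpM2l ?ler_norml// mulr_ge0// ltW.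
rewrite ltr_pM2r ?expR_gt0// ltr_pM2l//; apply: ltr_leD => //.
by rewrite ler_wpM2r// ler_wpM2l// ltW.
Qed.

(** An orbit in the box returns to E only through the exit section. *)
Lemma no_in_after lam (x : R -> V) : Q lam -> (forall t : R, 0 <= t -> is_derive t 1 x (f (x t) lam)) ->
  x t @[t --> +oo] --> (0 : V) -> (forall t : R, 0 < t -> ~ Sigma_out Psi delta lam (x t)) ->
  forall t : R, 0 < t -> ~ Sigma_in Psi delta lam (x t).
Proof.
move=> ql dx /cvg_pinfty0 xE xS t t0 [v Sv vx].
have [d d_gt0 Hd] := fb_away FB; have [T HT] := xE d d_gt0.
pose b := Num.max t (T + 1).
have tb : t <= b by rewrite le_max lexx.
have Tb : T < b by rewrite lt_max ltrDl ltr01 orbT.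
have bv : box delta v by case: Sv => h1 h2; split=> //; rewrite h1 gtr0_norm.
have dxt s : t <= s <= b -> is_derive s 1 x (f (x s) lam).
  by move=> /andP[s1 _]; apply: dx; apply: le_trans s1; exact: ltW.
case: (leave_box ql tb bv dxt (esym vx)) => [H|[s [s' [/andP[ts ss'] s'b vs' _ [H1 H2]]]]].
  have tbb : t <= b <= b by rewrite tb lexx.
  have [bb xb] := H b tbb.
  by have := HT b Tb; rewrite xb ltNge (Hd _ _ ql (box_le bb)).
have ss : t <= s <= s by rewrite ts lexx.
have ss2 : t <= s <= s' by rewrite ts ltW.
apply: (xS s); first exact: lt_le_trans t0 ts.
by rewrite (H2 s ss2).2; apply/(Sigma_outP ql (H2 s ss2).1); split=> //; case: (H1 s ss).
Qed.

Lemma no_out_before lam (x : R -> V) : Q lam -> (forall t : R, t <= 0 -> is_derive t 1 x (f (x t) lam)) ->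
  x t @[t --> -oo] --> (0 : V) -> (forall t : R, t < 0 -> ~ Sigma_in Psi delta lam (x t)) ->
  forall t : R, t < 0 -> ~ Sigma_out Psi delta lam (x t).
Proof.
move=> ql dx /cvg_ninfty0 xE xS t t0 [v Sv vx].
have [d d_gt0 Hd] := fb_away FB; have [T HT] := xE d d_gt0.
pose a := Num.min t (T - 1).
have ta : a <= t by rewrite ge_min lexx.
have Ta : a < T by rewrite gt_min ltrBlDr ltrDl ltr01 orbT.
have bv : box delta v by case: Sv => h1 h2; split=> //; rewrite h1 gtr0_norm.
have dxt s : a <= s <= t -> is_derive s 1 x (f (x s) lam).
  by move=> /andP[_ s1]; apply: dx; apply: le_trans s1 _; exact: ltW.
case: (enter_box ql ta bv dxt (esym vx)) => [H|[s [s' [/andP[ss' st] s'b vs' _ [H1 H2]]]]].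
  have tbb : a <= a <= t by rewrite ta lexx.
  have [bb xb] := H a tbb.
  by have := HT a Ta; rewrite xb ltNge (Hd _ _ ql (box_le bb)).
have ss : s <= s <= t by rewrite st lexx.
have ss2 : s' <= s <= t by rewrite st ltW.
apply: (xS s); first exact: le_lt_trans st t0.
by rewrite (H2 s ss2).2; apply/(Sigma_inP ql (H2 s ss2).1); split=> //; case: (H1 s ss).
Qed.

Lemma expR_lt1 (t : R) : 0 < t -> expR (- beta * t) < 1.
Proof. by move=> t0; rewrite -expR0 ltr_expR mulNr oppr_lt0 mulr_gt0. Qed.

Lemma entry_box mu c0 (t : R) : Q mu -> 0 <= t ->
  let v := bflow mu (c0, delta, 0) t in
  [/\ vc v = c0 + t, vu v = 0 & `|vs v| <= delta * expR (- beta * t)].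
Proof.
move=> qmu t0 v; split; [exact: bflow_vc|exact: bflow_vu0|].
have b0 := bflow0 (c0, delta, 0) qmu.
have := bflow_vs_decay (v0 := (c0, delta, 0)) qmu t0; rewrite b0 subr0 /vs/= gtr0_norm//; exact.
Qed.

Lemma exit_box mu c0 (t : R) : Q mu -> t <= 0 ->
  let v := bflow mu (c0, 0, delta) t in
  [/\ vc v = c0 + t, vs v = 0 & `|vu v| <= delta * expR (beta * t)].
Proof.
move=> qmu t0 v; split; [exact: bflow_vc|exact: bflow_vs0|].
have b0 := bflow0 (c0, 0, delta) qmu.
have := bflow_vu_growth (v0 := (c0, 0, delta)) qmu t0; rewrite b0 sub0r mulrNN /vu/= gtr0_norm//; exact.
Qed.

(** The point with v^u = 0 lies on W^s(P), so that its solution stays in the box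
    for all later times and is glued to the one that comes from E. *)
Lemma entry_orbit mu c0 : Q mu -> WuE_in f Psi delta mu (c0, delta, 0) ->
  exists u : R -> V, [/\ EtoP_orbit (f ^~ mu) (P ^~ mu) u,
    forall t : R, 0 <= t -> u t = Psi (bflow mu (c0, delta, 0) t) mu,
    forall t : R, t < 0 -> ~ Sigma_in Psi delta mu (u t) & exists! t, Sigma_in Psi delta mu (u t)].
Proof.
move=> qmu [_ [x [dx x0 xE xS]]]; pose v0 : coord := (c0, delta, 0); pose b t := bflow mu v0 t.
have bb t : 0 <= t -> box R0 (b t).
  move=> t0; have [_ h2 h3] := entry_box c0 qmu t0; split; last by rewrite h2 normr0 ltW.
  apply: le_trans h3 _; apply: le_trans dltR'; rewrite ler_piMr ?(ltW d0)//.
  by rewrite -expR0 ler_expR mulNr oppr_le0 mulr_ge0// ltW.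
pose y t := Psi (b t) mu.
have xy : x 0 = y 0 by rewrite x0 /y /b bflow0.
pose u := glue 0 x y.
have u1 t : t <= 0 -> u t = x t by rewrite /u /glue => ->.
have u2 t : 0 <= t -> u t = y t.
  by rewrite le_eqVlt => /orP[/eqP <-|tT]; [rewrite u1|rewrite /u /glue leNgt tT].
have du (t : R) : is_derive t 1 u (f (u t) mu).
  apply: (@glue_der R V (f ^~ mu) 0 x y t xy) => t0; first by apply: dx; rewrite /= in_itv.
  exact: (bflow_solution qmu (bb t t0)).
exists u; split.
- split; first by move=> t _.
    apply/cvg_ninfty0 => e e0; have [T HT] := (cvg_ninfty0 x).1 xE e e0.
    exists (Num.min 0 T) => t; rewrite lt_min => /andP[t0 tT]; rewrite u1 ?(ltW t0)//; exact: HT.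
  move=> e e0; have dk : 0 <= K * delta by rewrite mulr_ge0// ltW.
  have [L L1 HL] := exp_small dk beta0 (divr_gt0 e0 (ltr0n R 2)).
  exists L; split; first exact: num_real.
  move=> t Lt; exists (c0 + t); have t0 : 0 <= t by apply: le_trans (ltW Lt); apply: le_trans L1.
  have [h1 h2 h3] := entry_box c0 qmu t0.
  rewrite u2// -PsiP//; apply: le_lt_trans (_ : e / 2 < e); last by frac_lt.
  apply: le_trans (fb_Psi_lip FB qmu qmu (bb t t0) _) _.
    by split; rewrite /vs /vu/= normr0 ltW.
  rewrite max_normBl; have [_ hL] := HL t Lt.
  apply: le_trans hL; rewrite -mulrA ler_pM2l//.
  have -> : b t - (c0 + t, 0, 0) = (0, vs (b t), 0).
    transitivity ((vc (b t) - (c0 + t), vs (b t) - 0, vu (b t) - 0) : coord) => //.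
    by rewrite h1 h2 !subrr subr0.
  by rewrite !norm_pair normr0 ge_max ge_max h3 !(le_trans (normr_ge0 _) h3).
- by move=> t t0; rewrite u2.
- by move=> t t0; rewrite u1 ?ltW//; exact: xS.
- exists 0; split.
    rewrite u2// /y /b bflow0//; exists v0 => //; split=> //; rewrite /vu/= normr0; exact: ltW.
  move=> t; have [t0|t0] := ltP t 0; first by rewrite u1 ?(ltW t0)// => /(xS t t0).
  rewrite u2// => /(Sigma_inP qmu (bb t t0))[h _]; apply/eqP; rewrite eq_le t0/= leNgt.
  apply/negP => t1; have [_ _] := entry_box c0 qmu t0; rewrite -/v0 -/(b t) h leNgt => /negP; apply.
  by rewrite -[ltRHS]mulr1 ltr_pM2l// expR_lt1.
Qed.

Lemma exit_orbit mu c0 : Q mu -> WsE_out f Psi delta mu (c0, 0, delta) ->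
  exists w : R -> V, [/\ PtoE_orbit (f ^~ mu) (P ^~ mu) w,
    forall t : R, t <= 0 -> w t = Psi (bflow mu (c0, 0, delta) t) mu,
    forall t : R, 0 < t -> ~ Sigma_out Psi delta mu (w t) & exists! t, Sigma_out Psi delta mu (w t)].
Proof.
move=> qmu [_ [x [dx x0 xE xS]]]; pose v0 : coord := (c0, 0, delta); pose b t := bflow mu v0 t.
have bb t : t <= 0 -> box R0 (b t).
  move=> t0; have [_ h2 h3] := exit_box c0 qmu t0; split; first by rewrite h2 normr0 ltW.
  apply: le_trans h3 _; apply: le_trans dltR'; rewrite ler_piMr ?(ltW d0)//.
  by rewrite -expR0 ler_expR pmulr_rle0.
pose y t := Psi (b t) mu.
have yx : y 0 = x 0 by rewrite x0 /y /b bflow0.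
pose w := glue 0 y x.
have w1 t : t <= 0 -> w t = y t by rewrite /w /glue => ->.
have w2 t : 0 <= t -> w t = x t.
  by rewrite le_eqVlt => /orP[/eqP <-|tT]; [rewrite w1|rewrite /w /glue leNgt tT].
have dw (t : R) : is_derive t 1 w (f (w t) mu).
  apply: (@glue_der R V (f ^~ mu) 0 y x t yx) => t0; last by apply: dx; rewrite /= in_itv/= t0.
  exact: (bflow_solution qmu (bb t t0)).
exists w; split.
- split; first by move=> t _.
    apply/cvg_pinfty0 => e e0; have [T HT] := (cvg_pinfty0 x).1 xE e e0.
    exists (Num.max 0 T) => t; rewrite gt_max => /andP[t0 tT]; rewrite w2 ?(ltW t0)//; exact: HT.
  move=> e e0; have dk : 0 <= K * delta by rewrite mulr_ge0// ltW.
  have [L L1 HL] := exp_small dk beta0 (divr_gt0 e0 (ltr0n R 2)).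
  exists (- L); split; first exact: num_real.
  move=> t Lt; exists (c0 + t); have t0 : t <= 0.
    by apply: le_trans (ltW Lt) _; rewrite oppr_le0; apply: le_trans L1.
  have [h1 h2 h3] := exit_box c0 qmu t0.
  rewrite w1// -PsiP//; apply: le_lt_trans (_ : e / 2 < e); last by frac_lt.
  apply: le_trans (fb_Psi_lip FB qmu qmu (bb t t0) _) _.
    by split; rewrite /vs /vu/= normr0 ltW.
  have Lt' : L < - t by rewrite ltrNr.
  rewrite max_normBl; have [_] := HL (- t) Lt'.
  rewrite mulrNN => hL; apply: le_trans hL; rewrite -mulrA ler_pM2l//.
  have -> : b t - (c0 + t, 0, 0) = (0, 0, vu (b t)).
    transitivity ((vc (b t) - (c0 + t), vs (b t) - 0, vu (b t) - 0) : coord) => //.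
    by rewrite h1 h2 !subrr subr0.
  by rewrite !norm_pair normr0 ge_max ge_max h3 !(le_trans (normr_ge0 _) h3).
- by move=> t t0; rewrite w1.
- by move=> t t0; rewrite w2 ?ltW//; exact: xS.
- exists 0; split.
    rewrite w1// /y /b bflow0//; exists v0 => //; split=> //; rewrite /vs/= normr0; exact: ltW.
  move=> t; have [t0|t0] := ltP 0 t; first by rewrite w2 ?(ltW t0)// => /(xS t t0).
  rewrite w1// => /(Sigma_outP qmu (bb t t0))[h _]; apply/eqP; rewrite eq_le t0 andbT leNgt.
  apply/negP => t1; have [_ _] := exit_box c0 qmu t0; rewrite -/v0 -/(b t) h leNgt => /negP; apply.
  by rewrite -[ltRHS]mulr1 ltr_pM2l// -expR0 ltr_expR nmulr_llt0.
Qed.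

(** * Solutions of the bifurcation equation are homoclinic orbits *)

Lemma coord_lt (v v' : coord) e : `|vc v - vc v'| < e -> `|vs v - vs v'| < e -> `|vu v - vu v'| < e ->
  `|v - v'| < e.
Proof.
move=> h1 h2 h3; rewrite (_ : v - v' = (vc v - vc v', vs v - vs v', vu v - vu v')) //.
by rewrite !norm_pair !gt_max h1 h2 h3.
Qed.

Lemma Psi_close (v v' : coord) lam mu e : Q lam -> Q mu -> box R0 v -> box R0 v' -> 0 < e ->
  `|v - v'| < e / K -> `|lam - mu| < e / K -> `|Psi v lam - Psi v' mu| < e.
Proof.
move=> ql qmu bv bv' e0 h1 h2; apply: le_lt_trans (fb_Psi_lip FB ql qmu bv bv') _.
by rewrite mulrC -ltr_pdivlMr// gt_max h1.
Qed.

(** The two representatives on the double cover of an orbit near P, described by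
    the sign of their coordinates and the shift of their phase. *)
Definition lift (sg kap : R) : Prop := (sg = 1 /\ kap = 0) \/ (sg = -1 /\ kap = 2 * pi).

Lemma lift_norm sg kap : lift sg kap -> `|sg| = 1.
Proof. by case=> -[-> _]; rewrite ?normrN normr1. Qed.

Lemma Psi_lift sg kap lam (c s u : R) : lift sg kap -> Q lam -> box R0 (c, s, u) ->
  Psi (c + kap, sg * s, sg * u) lam = Psi (c, s, u) lam.
Proof.
case=> -[-> ->] ql bv; first by rewrite addr0 !mul1r.
by rewrite -(Psi_deck 1 ql bv) deck1 !mulN1r.
Qed.

Lemma small_exp (e : R) : 0 < e -> exists2 q, 0 < q & forall L, q^-1 < L -> 0 < L /\ delta * expR (- beta * L) < e.
Proof.
move=> e0; have e20 : 0 < e / 2 by rewrite divr_gt0.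
have [L0 L1 H] := exp_small (ltW d0) beta0 e20.
have L00 : 0 < L0 by apply: lt_le_trans L1.
exists L0^-1; first by rewrite invr_gt0.
move=> L; rewrite invrK => hL; split; first exact: lt_trans L00 hL.
have [_ h] := H L hL; apply: le_lt_trans h _; by frac_lt.
Qed.

Lemma exp_mono (a b : R) : a <= b -> delta * expR (- beta * b) <= delta * expR (- beta * a).
Proof. by move=> ab; rewrite ler_pM2l// ler_expR !mulNr lerN2 ler_pM2l. Qed.

Section Cycle.
Variables (mu : R * R) (phi : R) (u w : R -> V) (hc hu : R * R -> R) (g : R -> R * R -> R) (Lc : R).
Local Notation start sg kap lam := ((hc lam + kap, sg * delta, sg * hu lam) : coord).
Hypothesis qmu : Q mu.
Hypothesis Lc0 : 0 < Lc.
Hypothesis hcL : forall lam lam', Q lam -> Q lam' -> `|hc lam - hc lam'| <= Lc * `|lam - lam'|.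
Hypothesis huB : forall lam, Q lam -> `|hu lam| <= delta.
Hypothesis du : forall t : R, is_derive t 1 u (f (u t) mu).
Hypothesis uP : forall t : R, 0 <= t -> u t = Psi (bflow mu (hc mu, delta, 0) t) mu.
Hypothesis dw : forall t : R, is_derive t 1 w (f (w t) mu).
Hypothesis wP : forall t : R, t <= 0 -> w t = Psi (bflow mu (phi, 0, delta) t) mu.

Lemma near_entry e : 0 < e -> exists2 q, 0 < q & forall lam L sg kap t, Q lam -> `|lam - mu| < q ->
  q^-1 < L -> lift sg kap -> passage lam (hc lam + kap) sg (2 * L) (sg * hu lam) -> 0 <= t <= L ->
  `|Psi (bflow lam (start sg kap lam) t) lam - u t| < e.
Proof.
move=> e0; pose e1 := e / K; have e10 : 0 < e1 by rewrite divr_gt0.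
have e20 : 0 < e1 / 2 by rewrite divr_gt0.
have [q1 q10 H1] := small_exp e20.
pose T := q1^-1 + 1; have T0 : 0 <= T by rewrite addr_ge0// invr_ge0 ltW.
have [q2 q20 H2] := bflow_near T0 e10.
have q2e : 0 < Num.min q2 e1 by rewrite lt_min q20.
have [q3 q30 H3] := small_exp q2e.
have L10 : 0 < Lc + 1 by rewrite addr_gt0.
pose q := Num.min (Num.min q2 q3) (Num.min (q2 / (Lc + 1)) (e1 / (Lc + 1))).
have q0 : 0 < q by rewrite !lt_min q20 q30 !divr_gt0.
have [h1 h2 h3 h4] : [/\ q <= q2, q <= q3, q <= q2 / (Lc + 1) & q <= e1 / (Lc + 1)] by min_le.
exists q => // lam L sg kap t ql lq qL lf pu /andP[t0 tL].
have q3L : q3^-1 < L by apply: le_lt_trans qL; rewrite lef_pV2 ?posrE.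
have [L0 HL] := H3 L q3L; rewrite lt_min in HL; have /andP[HL1 HL2] := HL.
have sg1 := lift_norm lf.
have tL2 s : 0 <= s <= L -> 0 <= s <= 2 * L.
  by move=> /andP[-> sL]; apply: le_trans sL _; rewrite ler_peMl ?ltW// ltr1n.
have tt : 0 <= t <= L by rewrite t0.
have hcl x : q <= x / (Lc + 1) -> `|hc lam - hc mu| < x.
  move=> hx; apply: le_lt_trans (hcL ql qmu) _.
  have : `|lam - mu| < x / (Lc + 1) by exact: lt_le_trans lq hx.
  rewrite ltr_pdivlMr// mulrC; apply: le_lt_trans; by rewrite ler_wpM2r// lerDl.
have lame : `|lam - mu| < e1.
  apply: lt_le_trans lq (le_trans h4 _); rewrite ler_pdivrMr// ler_peMr ?ltW// ltrDr//.
have z0 : 0 <= (0 : R) <= 2 * L by rewrite lexx mulr_ge0// ltW.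
pose V0 : coord := (start sg kap lam); rewrite -/V0.
pose W0 : coord := (hc mu + kap, sg * delta, 0).
have W0E : W0 = (hc mu + kap, sg * delta, sg * 0) by rewrite mulr0.
have b00 : box R0 (hc mu, delta, 0).
  by split; rewrite /vs /vu/= ?normr0 ?gtr0_norm ?ltW//; case/andP: dltR.
have vuW s : vu (bflow mu W0 s) = 0 by exact: bflow_vu0.
have vsW s : 0 <= s -> `|vs (bflow mu W0 s)| <= delta * expR (- beta * s).
  move=> s0; have := bflow_vs_decay (v0 := W0) qmu s0; rewrite bflow0// subr0 /vs/= normrM sg1 mul1r gtr0_norm//.
  by apply; apply: ltW; case/andP: dltR.
have bW s : 0 <= s -> box R0 (bflow mu W0 s).
  move=> s0; split; last by rewrite vuW normr0 ltW.
  have dRl : delta <= R0 by apply: ltW; case/andP: dltR.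
  apply: le_trans (vsW s s0) _; apply: le_trans dRl; rewrite ler_piMr ?(ltW d0)//.
  by rewrite -expR0 ler_expR mulNr oppr_le0 mulr_ge0// ltW.
have -> : u t = Psi (bflow mu W0 t) mu.
  have := @bflow_follow mu W0 u 0 t 0 qmu t0 (fun s _ => du s).
  rewrite !subr0 => h; rewrite -[in RHS](subr0 t); apply: h; last by rewrite t0 lexx.
    by move=> s /andP[s0 _]; rewrite subr0; exact: bW.
  by left; rewrite uP// !bflow0// W0E (Psi_lift lf).
have [b1 /andP[b2 b3]] := passage_bounds ql sg1 pu (tL2 t tt).
apply: Psi_close => //.
- exact: box_le (passage_box ql sg1 pu (tL2 t tt)).
- exact: bW.
have vuV : `|vu (bflow lam V0 t)| < e1.
  rewrite gtr0_norm//; apply: le_lt_trans b3 _; apply: le_lt_trans HL2; apply: exp_mono.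
  by rewrite mulr_natl mulr2n -addrA lerDl subr_ge0.
apply: coord_lt.
- rewrite !bflow_vc// /vc/= opprD addrACA subrr addr0 opprD addrACA subrr addr0.
  exact: hcl.
- have [tT|Tt] := leP t T.
    apply: le_lt_trans (_ : `|bflow lam V0 t - bflow mu W0 t| < e1).
      exact: vs_le.
    apply: H2 => //; first exact: lt_le_trans lq h1.
      apply: coord_lt; rewrite /vc /vs /vu/=.
      + by rewrite opprD addrACA subrr addr0; exact: hcl.
      + by rewrite subrr normr0.
      + rewrite subr0; have [_] := passage_bounds ql sg1 pu z0.
        rewrite bflow0// /vu/= => /andP[p1 p2]; rewrite gtr0_norm//; apply: le_lt_trans p2 _.
        apply: le_lt_trans HL1; apply: exp_mono; rewrite subr0 ler_peMl ?ltW// ltr1n//.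
    by rewrite tT andbT (le_trans _ t0)// oppr_le0.
  have qt : q1^-1 < t by apply: lt_trans Tt; rewrite ltrDl.
  have [_ ht] := H1 t qt.
  apply: le_lt_trans (ler_normB _ _) _; rewrite [e / K]splitr; apply: ltrD.
    exact: le_lt_trans b1 ht.
  exact: le_lt_trans (vsW t t0) ht.
- by rewrite vuW subr0.
Qed.

Lemma near_exit e : 0 < e -> exists2 q, 0 < q & forall lam L sg kap c (k : int) t, Q lam -> `|lam - mu| < q ->
  `|c - phi| < q -> q^-1 < L -> lift sg kap -> hc lam + kap + 2 * L = c + 4 * pi * k%:~R ->
  passage lam (hc lam + kap) sg (2 * L) (sg * hu lam) -> L <= t <= 2 * L ->
  `|Psi (bflow lam (start sg kap lam) t) lam - w (t - 2 * L)| < e.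
Proof.
move=> e0; pose e1 := e / K; have e10 : 0 < e1 by rewrite divr_gt0.
have e20 : 0 < e1 / 2 by rewrite divr_gt0.
have [q1 q10 H1] := small_exp e20.
pose T := q1^-1 + 1; have T0 : 0 <= T by rewrite addr_ge0// invr_ge0 ltW.
have [q2 q20 H2] := bflow_near T0 e10.
have q2e : 0 < Num.min q2 e1 by rewrite lt_min q20.
have [q3 q30 H3] := small_exp q2e.
pose q := Num.min (Num.min q2 q3) e1.
have q0 : 0 < q by rewrite !lt_min q20 q30.
have [h1 h2 h3] : [/\ q <= q2, q <= q3 & q <= e1] by min_le.
exists q => // lam L sg kap c k t ql lq cq qL lf ck pu /andP[Lt tL].
have q3L : q3^-1 < L by apply: le_lt_trans qL; rewrite lef_pV2 ?posrE.
have [L0 HL] := H3 L q3L; rewrite lt_min in HL; have /andP[HL1 HL2] := HL.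
have sg1 := lift_norm lf.
have L20 : 0 <= 2 * L by rewrite mulr_ge0// ltW.
have t0 : 0 <= t by apply: le_trans Lt; exact: ltW.
have LL : L <= 2 * L by rewrite ler_peMl ?ltW// ltr1n.
have tt : 0 <= t <= 2 * L by rewrite t0.
have t2 : 0 <= 2 * L <= 2 * L by rewrite L20 lexx.
pose V0 : coord := (start sg kap lam); rewrite -/V0.
pose V1 := bflow lam V0 (2 * L).
pose s := t - 2 * L; have s0 : s <= 0 by rewrite subr_le0.
have VE : bflow lam V0 t = bflow lam V1 s by rewrite /V1 bflow_shift// subrK.
pose W0 : coord := (phi + 4 * pi * k%:~R, 0, delta).
have b00 : box R0 (phi, 0, delta).
  by split; rewrite /vs /vu/= ?normr0 ?gtr0_norm ?ltW//; case/andP: dltR.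
have bW r : r <= 0 -> [/\ vs (bflow mu W0 r) = 0, `|vu (bflow mu W0 r)| <= delta * expR (beta * r) & box R0 (bflow mu W0 r)].
  move=> r0; have [_ r1 r2] := exit_box (phi + 4 * pi * k%:~R) qmu r0; split=> //.
  rewrite -/W0 in r1 r2; split; first by rewrite r1 normr0 ltW.
  apply: le_trans r2 _; have dRl : delta <= R0 by apply: ltW; case/andP: dltR.
  apply: le_trans dRl; rewrite ler_piMr ?(ltW d0)//.
  by rewrite -expR0 ler_expR pmulr_rle0.
have [w1 w2 w3] := bW s s0.
have -> : w s = Psi (bflow mu W0 s) mu.
  have := @bflow_follow mu W0 w s 0 0 qmu s0 (fun s _ => dw s).
  rewrite !subr0 => h; rewrite -[in RHS](subr0 s); apply: h; last by rewrite s0 lexx.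
    by move=> r /andP[_ r0]; rewrite subr0; case: (bW r r0).
  by right; rewrite wP// !bflow0// Psi_per4.
have [b1 /andP[b2 b3]] := passage_bounds ql sg1 pu tt.
have [c1 _] := passage_bounds ql sg1 pu t2.
have [_ vuV1] := pu.
have lame : `|lam - mu| < e1 by exact: lt_le_trans lq h3.
have vcV1 : vc V1 = c + 4 * pi * k%:~R by rewrite /V1 bflow_vc// -ck.
apply: Psi_close => //; first exact: box_le (passage_box ql sg1 pu tt).
apply: coord_lt.
- have -> : vc (bflow lam V0 t) = c + 4 * pi * k%:~R + s.
    by rewrite bflow_vc// -ck /V0 /s /vc/=; ring.
  rewrite bflow_vc// /vc/= opprD addrACA subrr addr0 opprD addrACA subrr addr0.
  exact: lt_le_trans cq h3.
- rewrite w1 subr0; apply: le_lt_trans b1 _; apply: le_lt_trans HL2; exact: exp_mono.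
- have [sT|Ts] := leP (- T) s.
    apply: le_lt_trans (_ : `|bflow lam V0 t - bflow mu W0 s| < e1).
      exact: vu_le.
    rewrite VE; apply: H2 => //; first exact: lt_le_trans lq h1.
      apply: coord_lt.
      + by rewrite vcV1 /vc/= opprD addrACA subrr addr0; exact: lt_le_trans cq h1.
      + rewrite /W0 [vs (_, _, _)]/= subr0; apply: le_lt_trans c1 _; apply: le_lt_trans HL1; exact: exp_mono.
      + by rewrite [vu V1]vuV1 /W0 [vu (_, _, _)]/= subrr normr0.
    by rewrite sT (le_trans s0).
  have qs : q1^-1 < - s by apply: lt_trans (_ : T < - s); [rewrite ltrDl|rewrite ltrNr].
  have [_] := H1 _ qs; rewrite mulrNN => ht.
  apply: le_lt_trans (ler_normB _ _) _; rewrite [e / K]splitr; apply: ltrD.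
    rewrite gtr0_norm//; apply: le_lt_trans b3 _.
    by rewrite (_ : - beta * (2 * L - t) = beta * s)//; rewrite /s; ring.
  exact: le_lt_trans w2 ht.
Qed.

Hypothesis cyc : single_cycle f Psi delta P mu u w.
Hypothesis HU : forall e, 0 < e -> exists2 q, 0 < q & forall lam, Q lam -> `|lam - mu| < q ->
  exists x, unstable_tail f Psi delta lam (Psi (hc lam, delta, hu lam) lam) u e x.
Hypothesis HS : forall e, 0 < e -> exists2 q, 0 < q & forall lam c, Q lam -> `|lam - mu| < q -> `|c - phi| < q ->
  exists x, stable_tail f Psi delta lam (Psi (c, g c lam, delta) lam) w e x.

Let in_cycle0 : cycle_set (P ^~ mu) u w 0. Proof. by left; left; left. Qed.
Let in_cycleu t : cycle_set (P ^~ mu) u w (u t). Proof. by left; right; exists t. Qed.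
Let in_cyclew t : cycle_set (P ^~ mu) u w (w t). Proof. by right; exists t. Qed.

(** The homoclinic orbit is glued from a piece of W^u(E), the passage and a piece
    of W^s(E); it stays near u up to the middle of the passage and near w from
    then on. *)
Lemma reach_homoclinic_near (I2 : set R) (mu2 r : R) : mu = (0, mu2) -> I2 mu2 -> 0 < r ->
  exists2 q, 0 < q & forall lam L sg kap c (k : int), Q lam -> `|lam - mu| < q ->
  `|c - phi| < q -> q^-1 < L -> lift sg kap -> hc lam + kap + 2 * L = c + 4 * pi * k%:~R ->
  passage lam (hc lam + kap) sg (2 * L) (sg * hu lam) ->
  g c lam = vs (bflow lam (start sg kap lam) (2 * L)) ->
  one_homoclinic f Psi delta P I2 r L lam.
Proof.
move=> muE I2mu r0; have [q1 q10 H1] := near_entry r0; have [q2 q20 H2] := near_exit r0.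
have [q3 q30 H3] := HU r0; have [q4 q40 H4] := HS r0.
pose q := Num.min (Num.min (Num.min q1 q2) (Num.min q3 q4)) r.
have q0 : 0 < q by rewrite !lt_min q10 q20 q30 q40.
have [h1 h2 h3 h4 h5] : [/\ q <= q1, q <= q2, q <= q3, q <= q4 & q <= r] by min_le.
exists q => // lam L sg kap c k ql lq cq qL lf ck pu gE.
have inv q' : 0 < q' -> q <= q' -> q'^-1 < L.
  by move=> q'0 qq; apply: le_lt_trans qL; rewrite lef_pV2 ?posrE.
have L0 : 0 < L by apply: lt_trans (inv _ q0 (lexx q)); rewrite invr_gt0.
have sg1 := lift_norm lf.
have L20 : 0 < 2 * L by rewrite mulr_gt0.
have [xm [dm m0 mE mS mc]] := H3 lam ql (lt_le_trans lq h3).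
have [xp [dp p0 pE pS pc]] := H4 lam c ql (lt_le_trans lq h4) (lt_le_trans cq h4).
pose V0 : coord := (start sg kap lam).
pose y t := Psi (bflow lam V0 t) lam; pose xq t := xp (t - 2 * L).
have bnd t : 0 <= t <= 2 * L -> [/\ box R0 (bflow lam V0 t), box delta (bflow lam V0 t),
    `|vs (bflow lam V0 t)| <= delta * expR (- beta * t) &
    0 < vu (bflow lam V0 t) <= delta * expR (- beta * (2 * L - t))].
  move=> tt; have [b1 b2] := passage_bounds ql sg1 pu tt.
  by split=> //; [apply: box_le|]; exact: (passage_box ql sg1 pu tt).
have z2 : 0 <= (0 : R) <= 2 * L by rewrite lexx ltW.
have t2 : 0 <= 2 * L <= 2 * L by rewrite lexx ltW.
have bhd : box R0 (hc lam, delta, hu lam).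
  apply: box_le; split; first by rewrite /vs/= gtr0_norm.
  exact: huB.
have my : xm 0 = y 0 by rewrite m0 /y bflow0// /V0 (Psi_lift lf).
have yp : y (2 * L) = xq (2 * L).
  rewrite /xq subrr p0 gE /y -/V0; have [b0 _ _ _] := bnd _ t2.
  have vcE : vc (bflow lam V0 (2 * L)) = c + 4 * pi * k%:~R by rewrite bflow_vc// -ck.
  have [_ vuE] := pu; rewrite -/V0 in vuE.
  move: b0 vcE vuE; case: (bflow lam V0 (2 * L)) => [[c1 s1] u1] b0; rewrite /vc /vs /vu/= => -> ->.
  by rewrite Psi_per4//; case: b0 => b1 b2; split; rewrite// /vu/= gtr0_norm// ltW//; case/andP: dltR.
pose xr := glue (2 * L) y xq; pose x := glue 0 xm xr.
have xr0 : xm 0 = xr 0 by rewrite my /xr /glue (ltW L20).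
have x1 t : t <= 0 -> x t = xm t by rewrite /x /glue => ->.
have x2 t : 0 <= t <= 2 * L -> x t = y t.
  move=> /andP[]; rewrite le_eqVlt => /orP[/eqP <-|t0] tL; first by rewrite x1.
  by rewrite /x /glue leNgt t0/= /xr /glue tL.
have x3 t : 2 * L <= t -> x t = xq t.
  rewrite le_eqVlt => /orP[/eqP <-|t0]; first by rewrite x2.
  by rewrite /x /glue leNgt (lt_trans L20 t0)/= /xr /glue leNgt t0.
have dx (t : R) : is_derive t 1 x (f (x t) lam).
  apply: (@glue_der R V (f ^~ lam) 0 xm xr t xr0) => t0; first by apply: dm; rewrite /= in_itv.
  apply: (@glue_der R V (f ^~ lam) (2 * L) y xq t yp) => tL.
    have tt : 0 <= t <= 2 * L by rewrite t0.
    by have [b _ _ _] := bnd t tt; exact: (bflow_solution ql b).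
  apply: (@is_derive_shiftc _ _ xp (- (2 * L)) t); apply: dp.
  by rewrite /= in_itv/= andbT subr_ge0.
have dm' (t : R) : t <= 0 -> is_derive t 1 xm (f (xm t) lam) by move=> t0; apply: dm; rewrite /= in_itv.
have dp' (t : R) : 0 <= t -> is_derive t 1 xp (f (xp t) lam) by move=> t0; apply: dp; rewrite /= in_itv/= t0.
have mS' := no_out_before ql dm' mE mS.
have pS' := no_in_after ql dp' pE pS.
exists x; split.
- by move=> t _.
- split.
    apply/cvg_ninfty0 => e e0; have [T HT] := (cvg_ninfty0 xm).1 mE e e0.
    exists (Num.min 0 T) => t; rewrite lt_min => /andP[t0 tT]; rewrite x1 ?(ltW t0)//; exact: HT.
  apply/cvg_pinfty0 => e e0; have [T HT] := (cvg_pinfty0 xp).1 pE e e0.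
  exists (Num.max (2 * L) (T + 2 * L)) => t; rewrite gt_max => /andP[t0 tT].
  by rewrite x3 ?(ltW t0)// /xq; apply: HT; rewrite ltrBrDr.
- split=> t.
    split=> [|->].
      have [t0|t0] := ltP t 0; first by rewrite x1 ?(ltW t0)// => /(mS t t0).
      have [tL|tL] := leP t (2 * L); last first.
        rewrite x3 ?(ltW tL)// => h; case: (pS' (t - 2 * L) _ h); by rewrite subr_gt0.
      have tt : 0 <= t <= 2 * L by rewrite t0.
      have [b1 _ b2 _] := bnd t tt; rewrite x2// => /(Sigma_inP ql b1)[hs _].
      apply/eqP; rewrite eq_le t0 andbT leNgt; apply/negP => t0'.
      move: b2; rewrite hs leNgt => /negP; apply; rewrite -[ltRHS]mulr1 ltr_pM2l//.
      exact: expR_lt1.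
    rewrite x2//; have [b1 b2 _ _] := bnd 0 z2; apply/(Sigma_inP ql b1); rewrite bflow0//.
    rewrite /vs /vu/= !normrM sg1 !mul1r gtr0_norm//; split=> //; exact: huB.
  split=> [|->].
    have [t0|t0] := ltP t 0; first by rewrite x1 ?(ltW t0)// => /(mS' t t0).
    have [tL|tL] := leP t (2 * L); last first.
      rewrite x3 ?(ltW tL)// => h; case: (pS (t - 2 * L) _ h); by rewrite subr_gt0.
    have tt : 0 <= t <= 2 * L by rewrite t0.
    have [b1 _ _ /andP[b2 b3]] := bnd t tt; rewrite x2// => /(Sigma_outP ql b1)[hs _].
    apply/eqP; rewrite eq_le tL/= leNgt; apply/negP => t0'.
    rewrite gtr0_norm// in hs; move: b3; rewrite hs leNgt => /negP; apply; rewrite -[ltRHS]mulr1 ltr_pM2l//.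
    by apply: expR_lt1; rewrite subr_gt0.
  rewrite x2//; have [b1 [b2 _] _ _] := bnd _ t2; apply/(Sigma_outP ql b1).
  by have [_ ->] := pu; rewrite gtr0_norm.
- by move=> t tt; rewrite x2//; exists (bflow lam V0 t) => //; have [_ ? _ _] := bnd t tt.
- exists mu2, u, w; rewrite -muE; split=> //; first exact: lt_le_trans lq h5.
  move=> t; have [t0|/ltW t0] := leP t 0.
    rewrite x1//; case: (mc t t0) => h; first by exists (u t).
    by exists 0 => //; rewrite subr0.
  have [tL|/ltW tL] := leP t L.
    have tt : 0 <= t <= L by rewrite t0.
    have tt' : 0 <= t <= 2 * L by rewrite t0 (le_trans tL)// ler_peMl ?ltW// ltr1n.
    exists (u t); rewrite// x2//; apply: (H1 lam L sg kap t) => //; first exact: lt_le_trans lq h1.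
    exact: inv.
  have [tL2|/ltW tL2] := leP t (2 * L).
    have tt : L <= t <= 2 * L by rewrite tL.
    have tt' : 0 <= t <= 2 * L by rewrite t0.
    exists (w (t - 2 * L)); rewrite// x2//; apply: (H2 lam L sg kap c k t) => //.
    + exact: lt_le_trans lq h2.
    + exact: lt_le_trans cq h2.
    + exact: inv.
  rewrite x3// /xq; have s0 : 0 <= t - 2 * L by rewrite subr_ge0.
  case: (pc (t - 2 * L) s0) => h; first by exists (w (t - 2 * L)).
  by exists 0 => //; rewrite subr0.
Qed.

End Cycle.

(** * Homoclinic orbits solve the bifurcation equation *)

Lemma Psi_coord mu v v' : Q mu -> box R0 v -> box R0 v' -> Psi v mu = Psi v' mu ->
  `|vs v| = `|vs v'| /\ `|vu v| = `|vu v'|.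
Proof.
by move=> qmu bv bv' /(fb_fibres FB qmu bv bv')[k ->]; have [-> ->] := deck_norm k v.
Qed.

Lemma near_P_box mu : Q mu -> exists2 q, 0 < q & forall (y : V) s, `|y - P s mu| < q ->
  exists2 v, box delta v & Psi v mu = y.
Proof.
move=> qmu; have [q q0 H] := fb_open FB d0.
exists q => // y s ys; have [||v vv [bv vy]] := H mu (s, 0, 0) y qmu.
- by split; rewrite /vs /vu/= normr0 divr_ge0// ltW.
- by rewrite PsiP.
exists v => //; split; apply: ltW; apply: le_lt_trans vv.
  rewrite -[vs v]subr0; exact: (vs_le _ (s, 0, 0)).
rewrite -[vu v]subr0; exact: (vu_le _ (s, 0, 0)).
Qed.

Lemma zero_of_decay (a : R) : 0 <= a -> (forall b : R, 0 <= b -> a <= delta * expR (- beta * b)) -> a = 0.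
Proof.
move=> a0 H; apply/eqP; rewrite eq_le a0 andbT leNgt; apply/negP => ap.
have a20 : 0 < a / 2 by rewrite divr_gt0.
have [L L1 HL] := exp_small (ltW d0) beta0 a20.
have hL : L < L + 1 by rewrite ltrDl.
have [_ h] := HL _ hL.
have L0 : 0 <= L + 1 by rewrite addr_ge0// (le_trans _ L1).
have := le_trans (H (L + 1) L0) h.
by apply/negP; rewrite -ltNge ltr_pdivrMr// ltr_pMr// ltr1n.
Qed.

(** If the orbit left the box again, it would have to cross the entrance section
    a second time in order to approach P; in the box forever, v^u vanishes. *)
Lemma connecting_u mu (u : R -> V) t1 v1 : Q mu -> EtoP_orbit (f ^~ mu) (P ^~ mu) u ->
  (exists! t, Sigma_in Psi delta mu (u t)) -> box delta v1 -> u t1 = Psi v1 mu -> vu v1 = 0.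
Proof.
move=> qmu [du uE uP] [t0 [_ uniq]] b1 u1; apply/eqP; apply: contraT => vu1.
have [q q0 Hq] := near_P_box qmu; have [T0 [_ HT]] := uP q q0.
pose T := Num.max (T0 + 1) t1; have TT0 : T0 < T by rewrite lt_max ltrDl ltr01.
have t1T : t1 <= T by rewrite le_max lexx orbT.
have inbox t : T <= t -> ((Psi ^~ mu) @` box delta) (u t).
  move=> Tt; have [s us] := HT t (lt_le_trans TT0 Tt).
  by have [v bv vu'] := Hq _ _ us; exists v.
have [vT bT uT] := inbox T (lexx T).
have du' (a b : R) t : a <= t <= b -> is_derive t 1 u (f (u t) mu) by move=> _; exact: du.
have vuT : vu vT = 0.
  apply/eqP; rewrite -normr_eq0; apply/eqP/zero_of_decay => // b b_ge0.
  have Tb : T <= T + b by rewrite lerDl.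
  case: (leave_box qmu Tb bT (du' _ _) (esym uT)) => [H|[s [s' [/andP[Ts ss'] s'b _ /andP[vs' vsR] [_ H2]]]]].
    have [[_ h] _] : box delta (bflow mu vT (T + b - T)) /\ u (T + b) = Psi (bflow mu vT (T + b - T)) mu.
      by apply: H; rewrite Tb lexx.
    rewrite addrAC subrr add0r in h.
    have := bflow_vu_growth (v0 := vT) qmu b_ge0 (le_trans h dltR'); rewrite bflow0// subr0 => h'.
    by apply: le_trans h' _; rewrite ler_wpM2r ?expR_ge0.
  have ss : T <= s' <= s' by rewrite lexx andbT (le_trans Ts)// ltW.
  have [bs us] := H2 s' ss; have := inbox s' (le_trans Ts (ltW ss')); rewrite us.
  by move=> /(Psi_box_inv qmu bs)[_]; rewrite leNgt vs'.
have back (v2 : coord) (a b : R) : a <= b -> box delta v2 -> u b = Psi v2 mu ->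
    (u a = Psi (bflow mu v2 (a - b)) mu /\ box delta (bflow mu v2 (a - b))) \/
    exists t, [/\ a < t, t <= b & Sigma_in Psi delta mu (u t)].
  move=> ab b2 u2.
  case: (enter_box qmu ab b2 (du' _ _) u2) => [H|[s [s' [/andP[ss' sb] as' hs _ [H1 H2]]]]].
    by left; have [|h1 h2] := H a; rewrite ?lexx.
  right; exists s; split=> //; first exact: le_lt_trans ss'.
  have e1 : s <= s <= b by rewrite lexx.
  have e2 : s' <= s <= b by rewrite ltW.
  have [bs us] := H2 s e2; rewrite us; apply/(Sigma_inP qmu bs).
  by split=> //; case: (H1 s e1).
have [[ut1 bt1]|[t [t1t _ St]]] := back vT t1 T t1T bT (esym uT).
  have [_] := Psi_coord qmu (box_le b1) (box_le bt1) (etrans (esym u1) ut1).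
  by rewrite bflow_vu0// normr0 => /eqP; rewrite normr_eq0 (negbTE vu1).
have [d d_gt0 Hd] := fb_away FB; have [S HS] := (cvg_ninfty0 u).1 uE d d_gt0.
pose a := Num.min (S - 1) t1.
have aS : a < S by rewrite gt_min ltrBlDr ltrDl ltr01.
have at1 : a <= t1 by rewrite ge_min lexx orbT.
have [[ua ba]|[s [_ st1 Ss]]] := back v1 a t1 at1 b1 u1.
  by have := HS a aS; rewrite ua ltNge Hd//; exact: box_le.
by move: t1t; rewrite -(uniq _ St) (uniq _ Ss) ltNge st1.
Qed.

Lemma connecting_w mu (w : R -> V) t1 v1 : Q mu -> PtoE_orbit (f ^~ mu) (P ^~ mu) w ->
  (exists! t, Sigma_out Psi delta mu (w t)) -> box delta v1 -> w t1 = Psi v1 mu ->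
  vs v1 = 0 /\ exists s : R, [/\ 0 <= s, `|vu (bflow mu v1 s)| = delta &
    Ws_E_upto (f ^~ mu) (Sigma_out Psi delta mu) (Psi (bflow mu v1 s) mu)].
Proof.
move=> qmu [dw wE wP] [t0 [_ uniq]] b1 w1.
have [q q0 Hq] := near_P_box qmu; have [T0 [_ HT]] := wP q q0.
pose T := Num.min (T0 - 1) t1; have TT0 : T < T0 by rewrite gt_min ltrBlDr ltrDl ltr01.
have t1T : T <= t1 by rewrite ge_min lexx orbT.
have inbox t : t <= T -> ((Psi ^~ mu) @` box delta) (w t).
  move=> Tt; have [s us] := HT t (le_lt_trans Tt TT0).
  by have [v bv vu'] := Hq _ _ us; exists v.
have [vT bT wT] := inbox T (lexx T).
have dw' (a b : R) t : a <= t <= b -> is_derive t 1 w (f (w t) mu) by move=> _; exact: dw.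
have vsT : vs vT = 0.
  apply/eqP; rewrite -normr_eq0; apply/eqP/zero_of_decay => // b b_ge0.
  have Tb : T - b <= T by rewrite gerBl.
  case: (enter_box qmu Tb bT (dw' _ _) (esym wT)) => [H|[s [s' [/andP[ss' sT] s'b _ /andP[vs' vsR] [_ H2]]]]].
    have [[h _] _] : box delta (bflow mu vT (T - b - T)) /\ w (T - b) = Psi (bflow mu vT (T - b - T)) mu.
      by apply: H; rewrite Tb lexx.
    rewrite addrAC subrr add0r in h; have nb0 : - b <= 0 by rewrite oppr_le0.
    have := bflow_vs_decay (v0 := vT) qmu nb0 (le_trans h dltR'); rewrite bflow0// sub0r opprK => h'.
    by apply: le_trans h' _; rewrite ler_wpM2r ?expR_ge0.
  have ss : s' <= s' <= T by rewrite lexx/= (le_trans _ sT)// ltW.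
  have [bs ws] := H2 s' ss; have := inbox s' (le_trans (ltW ss') sT); rewrite ws.
  by move=> /(Psi_box_inv qmu bs)[]; rewrite leNgt vs'.
have fwd (v2 : coord) (a b : R) : a <= b -> box delta v2 -> w a = Psi v2 mu ->
    (w b = Psi (bflow mu v2 (b - a)) mu /\ box delta (bflow mu v2 (b - a))) \/
    exists t, [/\ a <= t, t < b, Sigma_out Psi delta mu (w t), `|vu (bflow mu v2 (t - a))| = delta &
      w t = Psi (bflow mu v2 (t - a)) mu].
  move=> ab b2 w2.
  case: (leave_box qmu ab b2 (dw' _ _) w2) => [H|[s [s' [/andP[as1 ss'] sb hs _ [H1 H2]]]]].
    by left; have [|h1 h2] := H b; rewrite ?lexx ?andbT.
  right; exists s; have e1 : a <= s <= s by rewrite lexx andbT.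
  have e2 : a <= s <= s' by rewrite as1 ltW.
  have [bs ws] := H2 s e2; split=> //; first exact: lt_le_trans sb.
  by rewrite ws; apply/(Sigma_outP qmu bs); split=> //; case: (H1 s e1).
have [d d_gt0 Hd] := fb_away FB; have [S HS] := (cvg_pinfty0 w).1 wE d d_gt0.
pose b := Num.max (S + 1) t1.
have bS : S < b by rewrite lt_max ltrDl ltr01.
have t1b : t1 <= b by rewrite le_max lexx orbT.
have [[wb bb]|[s [t1s _ Ss vus ws]]] := fwd v1 t1 b t1b b1 w1.
  by have := HS b bS; rewrite wb ltNge Hd//; exact: box_le.
split.
  have [[wt1 bt1]|[t [_ tt1 St _ _]]] := fwd vT T t1 t1T bT (esym wT).
    have [+ _] := Psi_coord qmu (box_le b1) (box_le bt1) (etrans (esym w1) wt1).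
    by rewrite bflow_vs0// normr0 => /eqP; rewrite normr_eq0 => /eqP.
  by move: tt1; rewrite -(uniq _ St) (uniq _ Ss) ltNge t1s.
exists (s - t1); split=> //; first by rewrite subr_ge0.
exists (fun t => w (t + s)); split.
- by move=> t _; apply: (@is_derive_shiftc _ _ w s t); exact: dw.
- by rewrite add0r.
- apply/cvg_pinfty0 => e e0; have [S' HS'] := (cvg_pinfty0 w).1 wE e e0.
  by exists (S' - s) => t St; apply: HS'; rewrite -ltrBlDr.
- move=> t t_gt0 /uniq; rewrite (uniq _ Ss) => /eqP; rewrite eq_sym -subr_eq0 addrK => /eqP t00.
  by rewrite t00 ltxx in t_gt0.
Qed.

(** The passage takes the prescribed time up to an error proportional to the
    error in the unstable coordinate. *)
Lemma crossing_time mu v (s e : R) : Q mu -> 0 < vu v -> 0 <= s -> vu (bflow mu v s) = delta ->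
  0 < e <= delta / 2 -> `|vu (bflow mu v 1) - delta| < e -> `|s - 1| <= 2 * e / (beta * delta).
Proof.
move=> qmu v_gt0 s0 vs_d /andP[e0 e2] /ltr_normlP[h1 h2].
have up t : 0 < vu (bflow mu v t) by exact: bflow_vu_pos.
have bd : 0 < beta * delta by exact: mulr_gt0.
have exp1 (a b x : R) : 0 < a -> 0 <= x -> a <= b * expR (- beta * x) -> a * (1 + beta * x) <= b.
  move=> a0 x0 h; apply: le_trans (_ : a * expR (beta * x) <= _).
    by rewrite ler_pM2l// expR_ge1Dx.
  by move: h; rewrite mulNr expRN ler_pdivlMr ?expR_gt0.
have u1R : `|vu (bflow mu v 1)| <= R0 by rewrite gtr0_norm//; case/andP: dR => _; lra.
rewrite ler_pdivlMr//.
have [s1|/ltW s1] := leP s 1.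
  have h := bflow_vu_growth (v0 := v) qmu s1 u1R; rewrite vs_d !gtr0_norm// in h.
  have s10 : 0 <= 1 - s by rewrite subr_ge0.
  have := exp1 _ _ _ d0 s10 h; rewrite distrC (ger0_norm s10) => h'.
  have -> : (1 - s) * (beta * delta) = delta * (1 + beta * (1 - s)) - delta by ring.
  lra.
have sR : `|vu (bflow mu v s)| <= R0 by rewrite vs_d gtr0_norm.
have h := bflow_vu_growth (v0 := v) qmu s1 sR; rewrite vs_d !gtr0_norm// in h.
have s10 : 0 <= s - 1 by rewrite subr_ge0.
have := exp1 _ _ _ (up 1) s10 h; rewrite (ger0_norm s10) => h'.
have u1 : delta / 2 <= vu (bflow mu v 1) by lra.
have h3 : delta / 2 * (beta * (s - 1)) <= vu (bflow mu v 1) * (beta * (s - 1)).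
  by rewrite ler_wpM2r// mulr_ge0// ltW.
have -> : (s - 1) * (beta * delta) = 2 * (delta / 2 * (beta * (s - 1))) by field.
rewrite mulrDr mulr1 in h'; lra.
Qed.

Variables (hc hu : R * R -> R).
Local Notation start sg kap lam := ((hc lam + kap, sg * delta, sg * hu lam) : coord).
Hypothesis huB : forall lam, Q lam -> `|hu lam| <= delta.
Hypothesis hW : forall lam v, Q lam -> WuE_in f Psi delta lam v ->
  exists k : int, v = (hc lam + 4 * pi * k%:~R, delta, hu lam).

(** An orbit homoclinic to E passes P in one of the two lifts to the double
    cover in which it leaves the box at v^u = delta. *)
Lemma homoclinic_passage lam L (x : R -> V) : Q lam -> 0 < L -> solution (f ^~ lam) setT x ->
  x t @[t --> -oo] --> (0 : V) -> x t @[t --> +oo] --> (0 : V) ->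
  (forall t, Sigma_in Psi delta lam (x t) <-> t = 0) ->
  (forall t, Sigma_out Psi delta lam (x t) <-> t = 2 * L) ->
  (forall t, 0 <= t <= 2 * L -> ((Psi ^~ lam) @` box delta) (x t)) ->
  exists sg kap, [/\ lift sg kap, passage lam (hc lam + kap) sg (2 * L) (sg * hu lam),
    forall t, 0 <= t <= 2 * L -> x t = Psi (bflow lam (start sg kap lam) t) lam &
    WsE_out f Psi delta lam (bflow lam (start sg kap lam) (2 * L))].
Proof.
move=> ql L0 dx xm xp Si So inb; have L20 : 0 <= 2 * L by rewrite mulr_ge0// ltW.
have [v Sv vx] := (Si 0).2 erefl.
have [k vE] : exists k : int, v = (hc lam + 4 * pi * k%:~R, delta, hu lam).
  apply: hW => //; split=> //; exists x; split=> //.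
  - by move=> t _; exact: dx.
  - by move=> t t0 /Si t00; rewrite t00 ltxx in t0.
have bh : box delta (hc lam, delta, hu lam).
  by split; [rewrite /vs/= gtr0_norm|exact: huB].
have x0 : x 0 = Psi (hc lam, delta, hu lam) lam.
  by rewrite -vx vE Psi_per4//; exact: box_le.
have follow sg kap t : lift sg kap -> 0 <= t <= 2 * L ->
    let v := bflow lam (start sg kap lam) t in box delta v /\ x t = Psi v lam.
  move=> lf tt; have sg1 := lift_norm lf.
  have b0 : box delta (start sg kap lam).
    by case: bh => h1 h2; split; rewrite /vs /vu/= normrM sg1 mul1r.
  have x0' : x 0 = Psi (start sg kap lam) lam.
    by rewrite Psi_lift//; exact: box_le.
  case: (leave_box ql L20 b0 (fun s _ => dx s I) x0') => [H|[s [s' [/andP[s0 ss'] sL _ /andP[vs' _] [_ H2]]]]].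
    by have := H t tt; rewrite subr0.
  have ss : 0 <= s' <= s' by rewrite lexx andbT (le_trans s0)// ltW.
  have s'L : 0 <= s' <= 2 * L by rewrite sL andbT; case/andP: ss.
  have [bs xs] := H2 s' ss; have := inb s' s'L; rewrite xs.
  by move=> /(Psi_box_inv ql bs)[_]; rewrite leNgt vs'.
have t2 : 0 <= 2 * L <= 2 * L by rewrite L20 lexx.
have vu2 sg kap : lift sg kap -> `|vu (bflow lam (start sg kap lam) (2 * L))| = delta.
  move=> lf; have [b xe] := follow sg kap _ lf t2.
  by have /(Sigma_outP ql (box_le b))[] : Sigma_out Psi delta lam (Psi (bflow lam (start sg kap lam) (2 * L)) lam)
    by rewrite -xe; apply/So.
suff [sg [kap [lf sgu]]] : exists sg kap, lift sg kap /\ 0 < sg * hu lam.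
  have up : 0 < vu (bflow lam (start sg kap lam) (2 * L)) by exact: bflow_vu_pos.
  have uE := vu2 sg kap lf; rewrite gtr0_norm// in uE.
  exists sg, kap; split=> //; first by move=> t tt; case: (follow sg kap t lf tt).
  have [b xe] := follow sg kap _ lf t2; split; first by split=> //; case: b.
  exists (fun t => x (t + 2 * L)); split.
  - by move=> t _; apply: (@is_derive_shiftc _ _ x (2 * L) t); exact: dx.
  - by rewrite add0r.
  - apply/cvg_pinfty0 => e e0; have [S HS] := (cvg_pinfty0 x).1 xp e e0.
    by exists (S - 2 * L) => t St; apply: HS; rewrite -ltrBlDr.
  - move=> t t0 /So /eqP; rewrite -subr_eq0 addrK => /eqP t00.
    by rewrite t00 ltxx in t0.
have [h|h|h] := ltgtP (hu lam) 0.
- by exists (-1), (2 * pi); split; [right|rewrite mulN1r oppr_gt0].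
- by exists 1, 0; split; [left|rewrite mul1r].
have lf : lift (1 : R) 0 by left.
have := vu2 _ _ lf; rewrite bflow_vu0// /vu/= ?h ?mulr0// normr0 => E.
by have := d0; rewrite -E ltxx.
Qed.

(** The last connecting orbit followed before the exit is that from P to E:
    its exit phase is close to that of the homoclinic orbit. *)
Lemma near_w_exit e : 0 < e -> exists2 q, 0 < q & forall lam mu L sg kap u w y,
  Q lam -> Q mu -> q^-1 < L -> lift sg kap -> passage lam (hc lam + kap) sg (2 * L) (sg * hu lam) ->
  `|lam - mu| < q -> single_cycle f Psi delta P mu u w -> cycle_set (P ^~ mu) u w y ->
  `|Psi (bflow lam (start sg kap lam) (2 * L - 1)) lam - y| < q ->
  exists2 c2, WsE_out f Psi delta mu (c2, 0, delta) & `|c2 - (hc lam + kap + 2 * L)| < e.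
Proof.
move=> e0; have bd : 0 < beta * delta by exact: mulr_gt0.
pose e1 := Num.min (delta / 2) (e / 2 * (beta * delta) / 2).
have e10 : 0 < e1 by rewrite lt_min divr_gt0// divr_gt0// mulr_gt0// divr_gt0.
have [e1d e1e] : e1 <= delta / 2 /\ e1 <= e / 2 * (beta * delta) / 2 by min_le.
have [q1 q10 H1] := bflow_near ler01 e10.
pose m := delta * expR (- (K + beta)); have m0 : 0 < m by rewrite mulr_gt0// expR_gt0.
have gap : 0 < delta * (1 - expR (- beta * 1)) by rewrite mulr_gt0// subr_gt0 expR_lt1.
pose e2 := Num.min (Num.min q1 (e / 2)) (Num.min m (Num.min (delta * (1 - expR (- beta * 1))) (delta / 2))).
have e20 : 0 < e2 by rewrite !lt_min q10 m0 gap !divr_gt0.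
have [a1 a2 a3] : [/\ e2 <= q1, e2 <= e / 2 & e2 <= m] by min_le.
have [a4 a5] : e2 <= delta * (1 - expR (- beta * 1)) /\ e2 <= delta / 2 by min_le.
have [rf rf0 Hf] := fb_open FB e20.
have d20 : 0 < delta / 2 by rewrite divr_gt0.
have [q2 q20 H2] := small_exp d20.
have [d d_gt0 Hd] := fb_away FB.
pose q := Num.min (Num.min q1 q2) (Num.min (Num.min (rf / 2) (rf / 2 / K)) 1).
have q0 : 0 < q by rewrite !lt_min q10 q20 ltr01 !divr_gt0.
have [b1 b2] : q <= q1 /\ q <= q2 by min_le.
have [b3 b4 b5] : [/\ q <= rf / 2, q <= rf / 2 / K & q <= 1] by min_le.
exists q => // lam mu L sg kap u w y ql qmu qL lf pu lq [[Ou Ow] Su Sw] cy yq.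
have sg1 := lift_norm lf.
have L1 : 1 < L by apply: le_lt_trans qL; rewrite -[leLHS]invr1 lef_pV2 ?posrE.
have q2L : q2^-1 < L by apply: le_lt_trans qL; rewrite lef_pV2 ?posrE.
have [L0 HL] := H2 L q2L.
set V := bflow lam _ (2 * L - 1) in yq.
have LL : L <= 2 * L - 1 by rewrite mulr_natl mulr2n -addrA lerDl subr_ge0 ltW.
have tt : 0 <= 2 * L - 1 <= 2 * L by rewrite gerBl ler01 andbT (le_trans _ LL)// ltW.
have [s1 /andP[u1 u2]] := passage_bounds ql sg1 pu tt; rewrite -/V in s1 u1 u2.
have bV := passage_box ql sg1 pu tt; rewrite -/V in bV.
have V1 : bflow lam V 1 = bflow lam (start sg kap lam) (2 * L).
  by rewrite /V bflow_shift// (addrC 1) subrK.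
have vuV1 : vu (bflow lam V 1) = delta by rewrite V1; case: pu.
have vcV : vc V + 1 = hc lam + kap + 2 * L by rewrite /V bflow_vc// /vc/=; ring.
have mV : m <= vu V.
  have := bflow_vu_upper V ql ler01; rewrite vuV1 bflow0// subr0 mulr1 !gtr0_norm// => h.
  by rewrite /m expRN ler_pdivrMr ?expR_gt0.
have uV : vu V <= delta * expR (- beta * 1).
  by apply: le_trans u2 _; rewrite (_ : 2 * L - (2 * L - 1) = 1)//; ring.
have sV : `|vs V| < delta / 2.
  by apply: le_lt_trans s1 _; apply: le_lt_trans HL; exact: exp_mono.
have bV2 : box (R0 / 2) V.
  have hR : delta <= R0 / 2 by case/andP: dR => _ h; apply: le_trans h _; rewrite ler_pM2l// lef_pV2 ?posrE// ler_nat.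
  by case: bV => h1 h2; split; apply: le_trans hR.
have [|v v'V [bv vy]] := Hf mu V y qmu bV2.
  rewrite distrC -[Psi V mu](subrK (Psi V lam)) -addrA.
  apply: normD_lt; rewrite [rf]splitr; apply: ltrD; last exact: lt_le_trans yq b3.
  apply: le_lt_trans (fb_Psi_lip FB qmu ql (box_le bV) (box_le bV)) _.
  rewrite max_normBr mulrC -ltr_pdivlMr// distrC.
  exact: lt_le_trans lq b4.
have vcv : `|vc v - vc V| < e2.
  by apply: le_lt_trans v'V; exact: vc_le.
have vsv : `|vs v - vs V| < e2.
  by apply: le_lt_trans v'V; exact: vs_le.
have vuv : `|vu v - vu V| < e2 by apply: le_lt_trans v'V; exact: vu_le.
have vu0 : 0 < vu v.
  by move: vuv => /ltr_normlP[h _]; rewrite opprB ltrBlDr in h; rewrite -(ltrD2l e2) addr0; apply: le_lt_trans h; apply: le_trans mV.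
have vud : vu v <= delta.
  move: vuv => /ltr_normlP[_ h]; rewrite ltrBlDr in h; apply: ltW (lt_le_trans h _).
  have -> : delta = delta * (1 - expR (- beta * 1)) + delta * expR (- beta * 1) by ring.
  exact: lerD.
have bd' : box delta v.
  split; last by rewrite gtr0_norm.
  rewrite -[vs v](subrK (vs V)); apply: normD_le.
  by rewrite [delta]splitr; apply: lerD; apply: ltW => //; exact: lt_le_trans vsv a5.
have [t1 wt] : exists t1, w t1 = y.
  case: cy => [[[/= E|[s _ sE]]|[s _ sE]]|[s _ sE]]; last by exists s.
  - have := Hd mu v qmu bv; rewrite vy E normr0 leNgt d_gt0//.
  - have b0 : box R0 (s, 0, 0) by split; rewrite /vs /vu/= normr0 ltW.
    have [_] := Psi_coord qmu bv b0 (etrans vy (esym (etrans (PsiP s qmu) sE))).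
    by rewrite /vu/= normr0 => /eqP; rewrite normr_eq0 => /eqP E; rewrite /vu E ltxx in vu0.
  - have E := connecting_u qmu Ou Su bd' (etrans sE (esym vy)).
    by rewrite E ltxx in vu0.
have [vs0 [s [s0 us ws]]] := connecting_w qmu Ow Sw bd' (etrans wt (esym vy)).
have us' : vu (bflow mu v s) = delta.
  by rewrite -us gtr0_norm//; exact: bflow_vu_pos.
have E : bflow mu v s = (vc v + s, 0, delta).
  have h1 := bflow_vc v qmu s; have h2 := bflow_vs0 qmu s vs0.
  by rewrite -h1 -us' -[in RHS]h2; case: (bflow mu v s) => [[? ?] ?].
exists (vc v + s).
  split; first by split=> //; rewrite /vs/= normr0 ltW.
  by rewrite -E.
have ct : `|s - 1| <= 2 * e1 / (beta * delta).
  apply: (crossing_time qmu vu0 s0 us'); first by rewrite e10.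
  rewrite -vuV1; apply: le_lt_trans (_ : `|bflow mu v 1 - bflow lam V 1| < _).
    exact: vu_le.
  apply: H1 => //; first by rewrite distrC; exact: lt_le_trans lq b1.
    exact: lt_le_trans v'V a1.
  by rewrite lexx andbT lerNl (le_trans _ ler01)// lerN10.
have ct' : `|s - 1| <= e / 2.
  apply: le_trans ct _; rewrite ler_pdivrMr// mulrC -ler_pdivlMr//.
rewrite -vcV (_ : vc v + s - (vc V + 1) = (vc v - vc V) + (s - 1)); last by ring.
apply: normD_lt; rewrite [e]splitr; apply: ltr_leD => //.
exact: lt_le_trans vcv a2.
Qed.

End BoxDynamics.

(** * The bifurcation equation *)

Section Newton.
Context {R : realType}.
Variables (a1 b1 a2 b2 : R).
Hypotheses (ab1 : a1 <= b1) (ab2 : a2 <= b2).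
Local Notation Q := (`[a1, b1] `*` `[a2, b2] : set (R * R)).

Definition itv_proj (a b x : R) := Num.max a (Num.min b x).
Definition proj_rect (lam : R * R) : R * R := (itv_proj a1 b1 lam.1, itv_proj a2 b2 lam.2).

Lemma itv_proj_in (a b x : R) : a <= b -> a <= itv_proj a b x <= b.
Proof. by move=> ab; rewrite /itv_proj le_max lexx ge_max ab ge_min lexx. Qed.

Lemma itv_proj_id (a b x : R) : a <= x <= b -> itv_proj a b x = x.
Proof. by move=> /andP[ax xb]; rewrite /itv_proj (min_idPr xb) (max_idPr ax). Qed.

Lemma itv_proj_lip (a b x y : R) : `|itv_proj a b x - itv_proj a b y| <= `|x - y|.
Proof.
have h1 := ler_norm (x - y); have h2 := ler_norm (y - x); rewrite distrC in h2.
rewrite ler_norml /itv_proj !maxEle !minEle.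
by apply/andP; split; case: (leP b x) => ?; case: (leP b y) => ?;
  case: (leP a b) => ?; case: (leP a x) => ?; case: (leP a y) => ?; lra.
Qed.

Lemma QP (lam : R * R) : Q lam <-> a1 <= lam.1 <= b1 /\ a2 <= lam.2 <= b2.
Proof. by split=> -[] /=; rewrite !in_itv/=. Qed.

Lemma proj_rect_in lam : Q (proj_rect lam).
Proof. by apply/QP; split; exact: itv_proj_in. Qed.

Lemma proj_rect_id lam : Q lam -> proj_rect lam = lam.
Proof. by case: lam => x y /QP[h1 h2]; rewrite /proj_rect !itv_proj_id. Qed.

Lemma proj_rect_lip lam lam' : `|proj_rect lam - proj_rect lam'| <= `|lam - lam'|.
Proof.
case: lam lam' => x y [x' y']; rewrite /proj_rect !norm_pairB ge_max/=; apply/andP; split.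
  by apply: le_trans (itv_proj_lip _ _ _ _) _; rewrite le_max lexx.
by apply: le_trans (itv_proj_lip _ _ _ _) _; rewrite le_max lexx orbT.
Qed.

(** The inverse of the lower triangular matrix with diagonal (k1, K2) and
    off-diagonal entry K1. *)
Definition tri_inv (k1 K1 K2 : R) (w : R * R) : R * R :=
  (w.1 / k1, (w.2 - K1 * (w.1 / k1)) / K2).

Lemma tri_invB k1 K1 K2 w w' :
  tri_inv k1 K1 K2 (w - w') = tri_inv k1 K1 K2 w - tri_inv k1 K1 K2 w'.
Proof. by apply/pair_equal_spec; split; rewrite /= !mulrBl ?mulrBr ?mulrBl//; ring. Qed.

Lemma tri_inv_eq0 k1 K1 K2 w : k1 != 0 -> K2 != 0 -> tri_inv k1 K1 K2 w = 0 -> w = 0.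
Proof.
move=> k0 K0; case: w => x y [/eqP]; rewrite mulf_eq0 invr_eq0 (negbTE k0) orbF => /eqP ->.
by rewrite /= mul0r mulr0 subr0 => /eqP; rewrite mulf_eq0 invr_eq0 (negbTE K0) orbF => /eqP ->.
Qed.

Lemma tri_inv_id k1 K1 K2 (d : R * R) : k1 != 0 -> K2 != 0 ->
  tri_inv k1 K1 K2 (k1 * d.1, K1 * d.1 + K2 * d.2) = d.
Proof.
by case: d => x y k0 K0; rewrite /tri_inv/=; congr pair; field; rewrite ?k0 ?K0.
Qed.

Lemma tri_inv_bound k1 K1 K2 : exists2 r, 0 < r & forall w, `|tri_inv k1 K1 K2 w| <= `|w| / r.
Proof.
set c1 := `|k1^-1|; set c2 := `|K2^-1| * (1 + `|K1| * c1).
have c10 : 0 <= c1 by exact: normr_ge0.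
have c20 : 0 <= c2 by rewrite mulr_ge0// addr_ge0// mulr_ge0.
exists (c1 + c2 + 1)^-1; first by rewrite invr_gt0 ltr_wpDl// addr_ge0.
move=> w; rewrite invrK /tri_inv.
have w1 := norm_fst w; have w2 := norm_snd w.
have w0 : 0 <= `|w| by [].
have h1 : `|w.1 / k1| <= c1 * `|w| by rewrite normrM mulrC ler_wpM2l.
have -> : `|(w.1 / k1, (w.2 - K1 * (w.1 / k1)) / K2)| =
    Num.max `|w.1 / k1| `|(w.2 - K1 * (w.1 / k1)) / K2| by rewrite norm_pair.
rewrite ge_max; apply/andP; split; first by apply: le_trans h1 _; rewrite mulrC ler_wpM2l//; lra.
rewrite normrM; apply: (@le_trans _ _ (c2 * `|w|)); last by rewrite mulrC ler_wpM2l//; lra.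
rewrite mulrC /c2 -mulrA ler_wpM2l// mulrDl mul1r.
apply: le_trans (ler_normB _ _) _; apply: lerD => //.
by rewrite normrM -mulrA ler_wpM2l.
Qed.

(** Newton's method for H = N near a zero lam0 of H, with N small: the map is
    composed with the projection onto the rectangle, so that a fixed point
    exists even when the solution leaves the rectangle; in the rectangle the
    fixed point is the only solution. *)
Lemma newton_rect (H N : R * R -> R * R) (lam0 : R * R) (k1 K1 K2 r s : R) :
  Q lam0 -> k1 != 0 -> K2 != 0 -> 0 < r -> 0 <= s <= r ->
  (forall w, `|tri_inv k1 K1 K2 w| <= `|w| / r) ->
  (forall lam lam', Q lam -> Q lam' -> `|lam - lam0| <= r -> `|lam' - lam0| <= r ->
    `|tri_inv k1 K1 K2 (H lam - H lam') - (lam - lam')| <= 4^-1 * `|lam - lam'|) ->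
  H lam0 = 0 ->
  (forall lam lam', Q lam -> Q lam' -> `|N lam - N lam'| <= r / 4 * `|lam - lam'|) ->
  `|N lam0| <= r * s / 2 ->
  exists p, [/\ `|p - lam0| <= s,
    p = proj_rect p - tri_inv k1 K1 K2 (H (proj_rect p) - N (proj_rect p)) &
    forall lam, Q lam -> `|lam - lam0| <= r -> (H lam = N lam <-> lam = p)].
Proof.
move=> ql0 k0 K0 r0 /andP[s0 sr] Ab HA H0 NL N0.
pose T lam := proj_rect lam - tri_inv k1 K1 K2 (H (proj_rect lam) - N (proj_rect lam)).
have pr0 : proj_rect lam0 = lam0 by exact: proj_rect_id.
have prr lam : `|lam - lam0| <= r -> `|proj_rect lam - lam0| <= r.
  by move=> h; apply: le_trans h; rewrite -{1}pr0; exact: proj_rect_lip.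
have TL x y : `|x - lam0| <= r -> `|y - lam0| <= r -> `|T x - T y| <= 2^-1 * `|x - y|.
  move=> xr yr; set x' := proj_rect x; set y' := proj_rect y.
  have xy : `|x' - y'| <= `|x - y| by exact: proj_rect_lip.
  have h1 := HA x' y' (proj_rect_in x) (proj_rect_in y) (prr _ xr) (prr _ yr).
  have h2 : `|tri_inv k1 K1 K2 (N x' - N y')| <= 4^-1 * `|x' - y'|.
    apply: le_trans (Ab _) _; rewrite ler_pdivrMr//.
    by apply: le_trans (NL _ _ (proj_rect_in x) (proj_rect_in y)) _; rewrite -/x' -/y'; lra.
  have -> : T x - T y = tri_inv k1 K1 K2 (N x' - N y') -
      (tri_inv k1 K1 K2 (H x' - H y') - (x' - y')).
    rewrite /T -/x' -/y' !tri_invB.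
    by apply/pair_equal_spec; split; rewrite /=; ring.
  by apply: le_trans (ler_normB _ _) _; lra.
have T0 : `|T lam0 - lam0| <= s / 2.
  rewrite /T pr0 H0 sub0r addrAC subrr sub0r normrN.
  apply: le_trans (Ab _) _; rewrite normrN ler_pdivrMr//; lra.
have [|p ps Tp] := @fixed_point_ball R _ (FinSupProd) T lam0 s _ T0.
  by move=> x y xs ys; apply: TL; apply: le_trans sr.
exists p; split=> // lam ql lr; split=> [E|E]; last first.
  move: Tp; rewrite -E /T proj_rect_id// => /eqP; rewrite -subr_eq0 addrAC subrr sub0r oppr_eq0.
  by move=> /eqP/(tri_inv_eq0 k0 K0)/eqP; rewrite subr_eq0 => /eqP.
  have Tl : T lam = lam.
    by rewrite /T proj_rect_id// E subrr -[X in tri_inv _ _ _ X](subrr (0 : R * R)) tri_invB subrr subr0.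
  have := TL lam p lr (le_trans ps sr); rewrite Tp Tl => h.
  apply/eqP; rewrite -subr_eq0 -normr_le0.
  by have : 0 <= `|lam - p| by []; lra.
Qed.

End Newton.

Section Bifurcation.
Context {R : realType}.
Local Notation V := 'rV[R]_3.
Local Notation coord := (R * R * R)%type.

Lemma derive_dir2 (h : R * R -> R) (x : R * R) (d : R * R) : differentiable h x ->
  'D_d h x = 'D_(1, 0) h x * d.1 + 'D_(0, 1) h x * d.2.
Proof.
move=> dh; have E : d = d.1 *: (1, 0) + d.2 *: (0, 1).
  by case: d => a b; apply/pair_equal_spec; split; rewrite /= /GRing.scale/=; ring.
rewrite {1}E (@deriveD_dir R)// !(@deriveZ_dir R)//.
by rewrite /GRing.scale/= [d.1 * _]mulrC [d.2 * _]mulrC.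
Qed.

Lemma derive_dir3 (h : R * (R * R) -> R) (x d : R * (R * R)) : differentiable h x ->
  'D_d h x = 'D_(1, (0, 0)) h x * d.1 + 'D_(0, (1, 0)) h x * d.2.1
    + 'D_(0, (0, 1)) h x * d.2.2.
Proof.
move=> dh; have E : d = d.1 *: (1, (0, 0)) + d.2.1 *: (0, (1, 0)) + d.2.2 *: (0, (0, 1)).
  by case: d => c [a b]; apply/pair_equal_spec; split; [|apply/pair_equal_spec; split];
    rewrite /= /GRing.scale/=; ring.
rewrite {1}E !(@deriveD_dir R)// !(@deriveZ_dir R)//.
by rewrite /GRing.scale/= [d.1 * _]mulrC [d.2.1 * _]mulrC [d.2.2 * _]mulrC.
Qed.

Lemma partial1E (h : R * R -> R) lam : partial1 h lam = 'D_(1, 0) h lam.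
Proof.
rewrite /partial1 derive1E; apply: (@derive_line_ext R R (R * R)%type R) => k /=.
by congr h; case: lam => x y; apply/pair_equal_spec; split; rewrite /= /GRing.scale/= ?mulr0 ?add0r.
Qed.

Lemma partial2E (h : R * R -> R) lam : partial2 h lam = 'D_(0, 1) h lam.
Proof.
rewrite /partial2 derive1E; apply: (@derive_line_ext R R (R * R)%type R) => k /=.
by congr h; case: lam => x y; apply/pair_equal_spec; split; rewrite /= /GRing.scale/= ?mulr0 ?add0r.
Qed.

Lemma partial2_param (g : R -> R * R -> R) phi lam :
  partial2 (g phi) lam = 'D_(0, (0, 1)) (fun q => g q.1 q.2) (phi, lam).
Proof.
rewrite partial2E; apply: (@derive_line_ext R (R * R)%type (R * (R * R))%type R) => k /=.
by rewrite /GRing.scale/= mulr0 add0r.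
Qed.

(** At an end point of the interval the one-sided difference quotients suffice. *)
Lemma der_zero_on_itv (h : R -> R) (t d a b : R) : a < b -> a <= t <= b ->
  (forall s, a <= s <= b -> h s = 0) -> is_derive t 1 h d -> d = 0.
Proof.
move=> ab tab h0 /is_deriveP D; apply/eqP; rewrite -normr_le0; apply/ler_addgt0Pr => e e0.
rewrite add0r; have [r r0 H] := D e e0.
pose k := Num.min (r / 2) ((b - a) / 2).
have k0 : 0 < k by rewrite lt_min !divr_gt0// subr_gt0.
have kr : k < r by rewrite gt_min; apply/orP; left; lra.
have kb : k <= (b - a) / 2 by rewrite ge_min lexx orbT.
have [s [s0 sk sab]] : exists s, [/\ s != 0, `|s| = k & a <= t + s <= b].
  case/andP: tab => at_ tb; have [tm|tm] := leP t ((a + b) / 2).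
    by exists k; rewrite gt_eqF// gtr0_norm//; split=> //; apply/andP; split; lra.
  by exists (- k); rewrite oppr_eq0 gt_eqF// normrN gtr0_norm//; split=> //; apply/andP; split; lra.
have := H s; rewrite sk => /(_ kr); rewrite !h0// subrr sub0r normrN normrM sk mulrC.
by rewrite ler_pM2r.
Qed.

Variables (a1 b1 a2 b2 : R).
Local Notation Q := (`[a1, b1] `*` `[a2, b2] : set (R * R)).
Hypotheses (a10b1 : a1 < 0 < b1) (a2b2 : a2 < b2).
Variables (U : set (R * (R * R))) (g : R -> R * R -> R) (z : R -> R -> R) (hu hc : R * R -> R).
Hypothesis U_open : exists2 O, open O & U = O `&` (setT `*` Q).
Hypothesis U_per : forall phi lam, U (phi + 4 * pi, lam) <-> U (phi, lam).
Hypothesis g_smooth : smooth_on U (fun q => g q.1 q.2).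
Hypothesis g_per : forall phi lam, U (phi, lam) -> g (phi + 4 * pi) lam = g phi lam.
Hypothesis zU : forall phi, U (phi, (0, z phi 0)).
Hypothesis g_z : forall phi, g phi (0, z phi 0) = 0.
Hypothesis g_lam2 : forall phi lam, U (phi, lam) -> partial2 (g phi) lam != 0.
Hypothesis z_smooth : smooth_on ([set: R] `*` `[a1, b1]) (fun q => z q.1 q.2).
Hypothesis z_per : forall phi, z (phi + 4 * pi) 0 = z phi 0.
Hypothesis zJ : forall phi, a2 <= z phi 0 <= b2.
Hypothesis hu_smooth : smooth_on Q hu.
Hypothesis hc_smooth : smooth_on Q hc.
Hypothesis hu0 : forall lam2, a2 <= lam2 <= b2 -> hu (0, lam2) = 0 /\ 0 < partial1 hu (0, lam2).
Variable q : R.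
Hypothesis q1 : q < 1.
Hypothesis hc_contr : forall phi, `|derive1 (fun phi => hc (0, z phi 0)) phi| <= q.

Local Notation lam0 phi := (0, z phi 0).

Lemma lam0Q phi : Q (lam0 phi).
Proof. by apply/QP; split=> //=; case/andP: a10b1 => /ltW -> /ltW ->. Qed.

Lemma z_derive (phi : R) : exists dz, is_derive phi 1 (z ^~ 0) dz.
Proof.
have [W [oW AW CW]] := z_smooth.
have dz : differentiable (fun q : R * R => z q.1 q.2) (phi, 0).
  by apply: (Ck_differentiable (CW 1%N)); apply: AW; split=> //=; rewrite in_itv/=; case/andP: a10b1 => /ltW -> /ltW ->.
have D := @is_derive_pair R _ _ _ _ phi _ _ (der_id phi) (der_cst (0 : R) phi).
by eexists; apply: der_ext (chain_rule D dz).
Qed.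

Lemma hcz_derive (phi dz : R) : is_derive phi 1 (z ^~ 0) dz ->
  is_derive phi 1 (fun phi => hc (lam0 phi)) (dz * 'D_(0, 1) hc (lam0 phi)).
Proof.
move=> Dz; have [W [oW AW CW]] := hc_smooth.
have dh : differentiable hc (lam0 phi) by apply: (Ck_differentiable (CW 1%N)); apply: AW; exact: lam0Q.
have D := @is_derive_pair R _ _ _ _ phi _ _ (der_cst (0 : R) phi) Dz.
apply: (der_eq (chain_rule D dh)).
by rewrite derive_dir2//= mulr0 add0r mulrC.
Qed.

Lemma hc_slope (phi dz : R) : is_derive phi 1 (z ^~ 0) dz ->
  `|dz * 'D_(0, 1) hc (lam0 phi)| <= q.
Proof. by move=> /hcz_derive D; have := hc_contr phi; rewrite derive1E (@derive_val _ _ _ _ _ _ _ D). Qed.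

Let q0 : 0 <= q := le_trans (normr_ge0 _) (hc_contr 0).

Lemma hcz_contraction phi phi' : `|hc (lam0 phi) - hc (lam0 phi')| <= q * `|phi - phi'|.
Proof.
wlog pp : phi phi' / phi' <= phi.
  move=> H; have [|/ltW h] := leP phi' phi; first exact: H.
  by rewrite distrC [`|phi - _|]distrC; exact: H.
rewrite [`|phi - _|]ger0_norm ?subr_ge0//.
have [dz Dz] : {dz : R -> R & forall t : R, is_derive t 1 (z ^~ 0) (dz t)}.
  exists (fun t => sval (cid (z_derive t))) => t; exact: svalP (cid (z_derive t)).
apply: (@mvt_le_cst R R FinSupR (fun phi => hc (lam0 phi)) (fun t => dz t * 'D_(0, 1) hc (lam0 t))) => // t _.
  exact: hcz_derive.
exact: hc_slope.
Qed.

(** The phase at which the leading order problem returns to the section. *)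
Lemma phase_exists : exists ph : R -> R, forall th phi, phi = hc (lam0 phi) + th <-> phi = ph th.
Proof.
have ex th : exists phi, phi = hc (lam0 phi) + th.
  have q1' : 0 < 1 - q by rewrite subr_gt0.
  pose N := (`|hc (lam0 0) + th|) / (1 - q).
  have N0 : 0 <= N by rewrite divr_ge0// ltW.
  have hN : (1 - q) * N = `|hc (lam0 0) + th| by rewrite /N mulrCA divff ?mulr1// gt_eqF.
  have [|||phi _ E] := @ivt_le R (fun phi => phi - hc (lam0 phi)) (- N) N th.
  - by rewrite (le_trans (y := 0))// oppr_le0.
  - move=> t _; have [dz Dz] := z_derive t.
    exact: is_derive_cts (der_sub (der_id t) (hcz_derive Dz)).
  - have h1 := hcz_contraction N 0; have h2 := hcz_contraction (- N) 0.
    move: h1 h2; rewrite !subr0 normrN [`|N|]ger0_norm// => /ler_normlP[h1 h2] /ler_normlP[h3 h4].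
    have := ler_norm (hc (lam0 0) + th); have := ler_norm (- (hc (lam0 0) + th)).
    rewrite normrN -hN => h5 h6; apply/andP; split; lra.
  - by exists phi; rewrite -E; ring.
exists (fun th => sval (cid (ex th))) => th phi; have E := svalP (cid (ex th)).
set ps := sval _ in E *; split=> [E'|->//].
have h := hcz_contraction phi ps; apply/eqP; rewrite -subr_eq0 -normr_le0.
have E2 : `|phi - ps| = `|hc (lam0 phi) - hc (lam0 ps)|.
  by rewrite {1}E' {1}E; congr `|_|; ring.
have : (1 - q) * `|phi - ps| <= 0 by rewrite mulrBl mul1r subr_le0 {1}E2.
by rewrite pmulr_rle0 ?subr_gt0.
Qed.

Lemma hc_lipschitz : exists2 Lc, 0 < Lc & forall lam lam', Q lam -> Q lam' ->
  `|hc lam - hc lam'| <= Lc * `|lam - lam'|.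
Proof.
have [W [oW AW CW]] := hc_smooth.
apply: (@C1_lipschitz R _ _ _ FinSupR _ W) => //.
  by apply: compact_setX; exact: segment_compact.
by apply: setX_segment_closed; exact: itv_segment_closed.
Qed.

Lemma z_lipschitz : exists2 Lz, 0 < Lz & forall phi phi', `|z phi 0 - z phi' 0| <= Lz * `|phi - phi'|.
Proof.
have [W [oW AW CW]] := z_smooth; have p0 := @four_pi_gt0 R.
pose T : R := 4 * pi.
have [|||L L0 HL] := @C1_lipschitz R _ _ _ FinSupR (fun q : R * R => z q.1 q.2) W
  (`[- T, 2 * T] `*` `[a1, b1]) oW (CW 1%N).
- by apply: compact_setX; exact: segment_compact.
- by apply: setX_segment_closed; exact: itv_segment_closed.
- by move=> [x y] [_ h]; apply: AW.
exists L => // phi phi'.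
have J0 : (0 : R) \in `[a1, b1] by rewrite in_itv/=; case/andP: a10b1 => /ltW -> /ltW ->.
have per (c x : R) : [set 0] x -> z (c + T) x = z c x by move=> /= ->; exact: z_per.
have lip (c c' x x' : R) : - T <= c <= 2 * T -> - T <= c' <= 2 * T -> [set 0] x -> [set 0] x' ->
    `|z c x - z c' x'| <= L * Num.max `|c - c'| `|x - x'|.
  move=> hc1 hc2 /= -> ->; rewrite max_normBl.
  apply: le_trans (HL (c, 0) (c', 0) _ _) _; [by split=> //=; rewrite in_itv|by split=> //=; rewrite in_itv|].
  by rewrite norm_pairB max_normBl.
have := @periodic_lipschitz R R R z [set 0] T L p0 (ltW L0) per lip phi phi' 0 0 erefl erefl.
by rewrite max_normBl.
Qed.

Lemma U_perz phi lam (k : int) : U (phi + 4 * pi * k%:~R, lam) <-> U (phi, lam).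
Proof.
have := @periodicz R Prop (fun c => U (c, lam)) (4 * pi) (fun c => propext (U_per c lam)) phi k.
by move=> ->.
Qed.

Lemma g_perz phi lam (k : int) : U (phi, lam) -> g (phi + 4 * pi * k%:~R) lam = g phi lam.
Proof.
move=> Up; pose h c := if `[< U (c, lam) >] then g c lam else 0.
have hper c : h (c + 4 * pi) = h c.
  by rewrite /h (propext (U_per c lam)); case: asboolP => // /g_per.
have := periodicz hper phi k.
by rewrite /h (propext (U_perz phi lam k)) asboolT.
Qed.

Lemma z_perz phi (k : int) : z (phi + 4 * pi * k%:~R) 0 = z phi 0.
Proof. exact: (periodicz z_per). Qed.

(** Uniformly along the leading order solutions, the map of the bifurcation
    equation is strictly differentiable with an invertible triangular
    derivative.  Its corner entry g_lam2 (1 - (d/dphi) hc(0, z(phi, 0))) comes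
    from differentiating g(phi, 0, z(phi, 0)) = 0. *)
Definition bif_map (phi : R) (lam : R * R) : R * R :=
  (hu lam, g (hc lam + (phi - hc (lam0 phi))) lam).

Definition newton_data (phi r : R) : Prop :=
  [/\ forall lam, Q lam -> `|lam - lam0 phi| <= r -> U (hc lam + (phi - hc (lam0 phi)), lam) &
   exists k1 K1 K2 : R, [/\ 0 < k1, K2 != 0, forall w, `|tri_inv k1 K1 K2 w| <= `|w| / r &
     forall lam lam', Q lam -> Q lam' -> `|lam - lam0 phi| <= r -> `|lam' - lam0 phi| <= r ->
      `|tri_inv k1 K1 K2 (bif_map phi lam - bif_map phi lam') - (lam - lam')| <= 4^-1 * `|lam - lam'|]].

Lemma newton_data_antitone phi r r' : newton_data phi r -> 0 < r' <= r -> newton_data phi r'.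
Proof.
move=> [HU [k1 [K1 [K2 [k0 K0 Hb HH]]]]] /andP[r0 rr]; split.
  by move=> lam ql h; apply: HU => //; exact: le_trans h rr.
exists k1, K1, K2; split=> //; last first.
  by move=> lam lam' ql ql' h h'; apply: HH => //; [exact: le_trans h rr|exact: le_trans h' rr].
move=> w; apply: le_trans (Hb w) _; rewrite ler_wpM2l// lef_pV2// ?posrE//.
exact: lt_le_trans rr.
Qed.

(** Strict differentiability of hu and g at the base point gives the estimate for
    all nearby phases with the same three derivative entries. *)
Lemma newton_data_local phi0 : exists2 r, 0 < r & forall phi, `|phi - phi0| < r -> newton_data phi r.
Proof.
Proof.
have [Lc Lc0 HLc] := hc_lipschitz; have [Lz Lz0 HLz] := z_lipschitz.
pose l0 : R * R := (0, z phi0 0); have ql0 : Q l0 by exact: lam0Q.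
have [Wu [oWu AWu CWu]] := hu_smooth; have [Wc [oWc AWc CWc]] := hc_smooth.
have [Wg [oWg AWg CWg]] := g_smooth; have [OU oOU UE] := U_open.
have du : differentiable hu l0 by apply: (Ck_differentiable (CWu 1%N)); exact: AWu.
have dc : differentiable hc l0 by apply: (Ck_differentiable (CWc 1%N)); exact: AWc.
pose G (q : R * (R * R)) := g q.1 q.2.
have dg : differentiable G (phi0, l0) by apply: (Ck_differentiable (CWg 1%N)); exact: AWg.
set k1 := 'D_(1, 0) hu l0.
set c1 := 'D_(1, 0) hc l0; set c2 := 'D_(0, 1) hc l0.
set gp := 'D_(1, (0, 0)) G (phi0, l0); set g1 := 'D_(0, (1, 0)) G (phi0, l0).
set g2 := 'D_(0, (0, 1)) G (phi0, l0).
have k10 : 0 < k1 by rewrite /k1 -partial1E; case: (hu0 (zJ phi0)).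
have hu2 : 'D_(0, 1) hu l0 = 0.
  have D := @is_derive_pair R _ _ _ _ (z phi0 0) _ _ (der_cst (0 : R) (z phi0 0)) (der_id (z phi0 0)).
  apply: (der_zero_on_itv a2b2 (zJ phi0) _ (chain_rule D du)) => s hs /=.
  by case: (hu0 hs).
have [dz Dz] := z_derive phi0.
have g0 : gp + dz * g2 = 0.
  have D := @is_derive_pair R _ _ _ _ phi0 _ _ (der_id phi0)
    (@is_derive_pair R _ _ _ _ phi0 _ _ (der_cst (0 : R) phi0) Dz).
  have D1 := der_ext (g := fun=> 0) (fun s => g_z s) (chain_rule D dg).
  have E : 'D_(1, (0, dz)) G (phi0, l0) = 0.
    by rewrite -(@derive_val _ _ _ _ _ _ _ D1) derive_cst.
  have E2 : 0 = gp * 1 + g1 * 0 + g2 * dz := etrans (esym E) (derive_dir3 _ dg).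
  by rewrite [RHS]E2; ring.
pose K1 := gp * c1 + g1; pose K2 := gp * c2 + g2.
have K20 : K2 != 0.
  have -> : K2 = g2 * (1 - dz * c2) by rewrite /K2 -[gp](addrK (dz * g2)) g0; ring.
  rewrite mulf_neq0//; first by rewrite /g2 -partial2_param; exact: g_lam2.
  have := hc_slope Dz; rewrite -/l0 -/c2 => h; rewrite subr_eq0; apply/eqP => E.
  by move: h; rewrite -E normr1 leNgt q1.
have [rA rA0 Hb] := tri_inv_bound k1 K1 K2.
pose M0 := 2 + `|c1| + `|c2| + `|gp|.
have M00 : 0 < M0 by rewrite /M0 !ltr_wpDr.
pose e := Num.min 1 (rA / (4 * M0)).
have e0 : 0 < e by rewrite lt_min ltr01 divr_gt0// mulr_gt0.
have e1 : e <= 1 by rewrite ge_min lexx.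
have eA : e * M0 <= rA / 4.
  have : e <= rA / (4 * M0) by rewrite ge_min lexx orbT.
  by rewrite ler_pdivlMr ?mulr_gt0//; lra.
have [ru ru0 Hu] := @C1_strict R _ _ _ FinSupR hu Wu l0 e oWu (CWu 1%N) (AWu _ ql0) e0.
have [rc rc0 Hc] := @C1_strict R _ _ _ FinSupR hc Wc l0 e oWc (CWc 1%N) (AWc _ ql0) e0.
have [rg rg0 Hg] := @C1_strict R _ _ _ FinSupR G Wg (phi0, l0) e oWg (CWg 1%N) (AWg _ (zU phi0)) e0.
have [rO rO0 HO] : exists2 r, 0 < r & forall y, `|y - (phi0, l0)| < r -> OU y.
  by apply: open_ball_sub => //; move: (zU phi0); rewrite UE => -[].
pose m := Num.min (Num.min ru rc) (Num.min rg rO).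
have m0 : 0 < m by rewrite !lt_min ru0 rc0 rg0 rO0.
have [mu mc] : m <= ru /\ m <= rc by split; rewrite !ge_min lexx ?orbT.
have [mg mO] : m <= rg /\ m <= rO by split; rewrite !ge_min lexx ?orbT.
pose r1 := m / (2 + Lz + Lc); have r10 : 0 < r1 by rewrite divr_gt0// !addr_gt0.
have r1m : r1 * (2 + Lz + Lc) = m by rewrite divfK// lt0r_neq0// !addr_gt0.
exists (Num.min rA r1); first by rewrite lt_min rA0.
move=> phi; rewrite lt_min => /andP[_ pr].
have close lam : Q lam -> `|lam - lam0 phi| <= Num.min rA r1 ->
    `|lam - l0| < m /\ `|(hc lam + (phi - hc (lam0 phi)), lam) - (phi0, l0)| < m.
  move=> ql; rewrite le_min => /andP[_ lr].
  have h1 : `|lam0 phi - l0| <= Lz * r1.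
    rewrite norm_pairB max_normBr.
    by apply: le_trans (HLz _ _) _; rewrite ler_pM2l// ltW.
  have h2 : `|lam - l0| < m.
    rewrite (_ : lam - l0 = (lam - lam0 phi) + (lam0 phi - l0)); last by rewrite addrA subrK.
    apply: normD_lt; rewrite -r1m.
    have : 0 < Lc * r1 by rewrite mulr_gt0.
    by lra.
  split=> //; rewrite norm_pairB gt_max h2 andbT.
  have := HLc lam (lam0 phi) ql (lam0Q phi) => h3.
  have h4 : Lc * `|lam - lam0 phi| <= Lc * r1 by rewrite ler_pM2l.
  rewrite (_ : _ - phi0 = (hc lam - hc (lam0 phi)) + (phi - phi0)); last by ring.
  apply: normD_lt; rewrite -r1m.
  have : 0 < Lz * r1 by rewrite mulr_gt0.
  by lra.
split.
  move=> lam ql /(close _ ql)[_ h]; rewrite UE; split=> //; apply: HO; exact: lt_le_trans h mO.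
exists k1, K1, K2; split=> //.
  move=> w; apply: le_trans (Hb w) _; rewrite ler_wpM2l// lef_pV2 ?posrE ?lt_min ?rA0//.
  by rewrite ge_min lexx.
move=> lam lam' ql ql' lr lr'; set H := bif_map phi.
have [n1 n2] := close lam ql lr; have [n1' n2'] := close lam' ql' lr'.
set d := lam - lam'.
have hU : `|hu lam - hu lam' - k1 * d.1| <= e * `|d|.
  have := Hu lam lam' (lt_le_trans n1 mu) (lt_le_trans n1' mu).
  by rewrite derive_dir2// hu2 mul0r addr0.
have hC : `|hc lam - hc lam' - (c1 * d.1 + c2 * d.2)| <= e * `|d|.
  have := Hc lam lam' (lt_le_trans n1 mc) (lt_le_trans n1' mc).
  by rewrite derive_dir2.
have d1 : `|d.1| <= `|d| := norm_fst d; have d2 : `|d.2| <= `|d| := norm_snd d.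
set dc' := hc lam - hc lam' in hC *.
have hD : `|dc'| <= (1 + `|c1| + `|c2|) * `|d|.
  rewrite -[dc'](subrK (c1 * d.1 + c2 * d.2)).
  apply: normD_le.
  have : `|c1 * d.1 + c2 * d.2| <= `|c1| * `|d| + `|c2| * `|d|.
    by apply: normD_le; rewrite !normrM; apply: lerD; rewrite ler_wpM2l.
  move=> h; have -> : (1 + `|c1| + `|c2|) * `|d| = 1 * `|d| + (`|c1| * `|d| + `|c2| * `|d|) by ring.
  apply: lerD; last exact: h.
  by apply: le_trans hC _; rewrite ler_wpM2r.
have hG : `|(H lam).2 - (H lam').2 - (gp * dc' + g1 * d.1 + g2 * d.2)| <= e * ((1 + `|c1| + `|c2|) * `|d|).
  have := Hg _ _ (lt_le_trans n2 mg) (lt_le_trans n2' mg).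
  have -> : (hc lam + (phi - hc (lam0 phi)), lam) - (hc lam' + (phi - hc (lam0 phi)), lam') = (dc', d).
    by apply/pair_equal_spec; split=> //=; rewrite /dc'; ring.
  rewrite derive_dir3// => /le_trans; apply.
  rewrite ler_pM2l// norm_pair ge_max hD/= ler_peMl//.
  by rewrite -addrA lerDl addr_ge0.
rewrite -[X in _ - X](tri_inv_id K1 d (lt0r_neq0 k10) K20) -tri_invB.
apply: le_trans (Hb _) _; rewrite ler_pdivrMr//.
have -> : 4^-1 * `|d| * rA = rA / 4 * `|d| by ring.
apply: (@le_trans _ _ (e * M0 * `|d|)); last by rewrite ler_wpM2r.
have -> : H lam - H lam' - (k1 * d.1, K1 * d.1 + K2 * d.2) =
    (hu lam - hu lam' - k1 * d.1, (H lam).2 - (H lam').2 - (K1 * d.1 + K2 * d.2)) by [].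
have e0' := ltW e0; have dd : 0 <= `|d| by [].
rewrite norm_pair ge_max; apply/andP; split.
  apply: le_trans hU _; rewrite -mulrA ler_wpM2l// ler_peMl//.
  by rewrite /M0 !ler_wpDr// ler1n.
have -> : (H lam).2 - (H lam').2 - (K1 * d.1 + K2 * d.2) =
   ((H lam).2 - (H lam').2 - (gp * dc' + g1 * d.1 + g2 * d.2)) + gp * (dc' - (c1 * d.1 + c2 * d.2)).
  by rewrite /K1 /K2; ring.
apply: normD_le; rewrite normrM.
have : `|gp| * `|dc' - (c1 * d.1 + c2 * d.2)| <= `|gp| * (e * `|d|) by rewrite ler_wpM2l.
have -> : e * M0 * `|d| = e * ((1 + `|c1| + `|c2|) * `|d|) + `|gp| * (e * `|d|) + e * `|d|.
  by rewrite /M0; ring.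
have : 0 <= e * `|d| by rewrite mulr_ge0.
by move=> h1 h2; apply: ler_wpDr => //; exact: lerD.
Qed.

Lemma newton_data_shift phi (k : int) r : newton_data phi r -> newton_data (phi + 4 * pi * k%:~R) r.
Proof.
move=> [HU [k1 [K1 [K2 [k0 K0 Hb HH]]]]].
have sh lam : hc lam + (phi + 4 * pi * k%:~R - hc (lam0 phi)) = hc lam + (phi - hc (lam0 phi)) + 4 * pi * k%:~R by ring.
rewrite /newton_data z_perz; split.
  by move=> lam ql h; rewrite sh U_perz; exact: HU.
exists k1, K1, K2; split=> // lam lam' ql ql' h h'.
rewrite /bif_map z_perz !sh !g_perz; [exact: HH|exact: HU|exact: HU].
Qed.

Lemma newton_data_uniform : exists2 r, 0 < r & forall phi, newton_data phi r.
Proof.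
have p0 := @four_pi_gt0 R.
have [||r r0 H] := @compact_unif R R (`[0, 4 * pi]) newton_data (@segment_compact R 0 (4 * pi)).
- by move=> x r r'; exact: newton_data_antitone.
- by move=> x _; have [r r0 H] := newton_data_local x; exists r => // y _; exact: H.
exists r => // phi; have [k hk] := shift_period phi p0.
have := H (phi - 4 * pi * k%:~R); rewrite /= in_itv/= => /(_ hk) /(newton_data_shift k).
by rewrite subrK.
Qed.

End Bifurcation.

(** * Solutions of the bifurcation equation *)

Lemma close_positive {R : realType} (x y : R) : 0 < x -> `|x - y| <= 4^-1 * `|y| -> 0 < y /\ y <= 2 * x.
Proof.
move=> x0 /ler_normlP[h1 h2]; have [h3|h3] := leP 0 y.
  rewrite ger0_norm// in h1 h2; split; last by lra.
  by rewrite lt_neqAle h3 andbT; apply/eqP => E; move: h2; rewrite -E; lra.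
by rewrite ltr0_norm// in h2; exfalso; lra.
Qed.

Section Branch.
Context {R : realType}.
Local Notation V := 'rV[R]_3.
Local Notation coord := (R * R * R)%type.
Variables (a1 b1 a2 b2 : R).
Local Notation Q := (`[a1, b1] `*` `[a2, b2] : set (R * R)).
Hypotheses (a10b1 : a1 < 0 < b1) (a2b2 : a2 < b2).
Variables (f : V -> R * R -> V) (Psi : coord -> R * R -> V).
Variables (alps alpu : R * R -> R) (Fs Fu : coord -> R * R -> R) (R0 beta K : R).
Hypothesis FB : flow_box Q f Psi alps alpu Fs Fu R0 beta K.
Variable delta : R.
Hypothesis dR : 0 < delta <= R0 / 8.
Variables (U : set (R * (R * R))) (g : R -> R * R -> R) (z : R -> R -> R) (hu hc : R * R -> R).
Local Notation lam0 phi := (0, z phi 0).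
Hypothesis g_z : forall phi, g phi (lam0 phi) = 0.
Hypothesis zJ : forall phi, a2 <= z phi 0 <= b2.
Variables (rN Lc Lz Mh q : R) (ph : R -> R).
Hypothesis rN0 : 0 < rN.
Hypothesis ND : forall phi, newton_data a1 b1 a2 b2 U g z hu hc phi rN.
Hypothesis Lc0 : 0 < Lc.
Hypothesis hcL : forall lam lam', Q lam -> Q lam' -> `|hc lam - hc lam'| <= Lc * `|lam - lam'|.
Hypothesis Lz0 : 0 < Lz.
Hypothesis zL : forall phi phi', `|z phi 0 - z phi' 0| <= Lz * `|phi - phi'|.
Hypothesis q1 : q < 1.
Hypothesis hczq : forall phi phi', `|hc (lam0 phi) - hc (lam0 phi')| <= q * `|phi - phi'|.
Hypothesis phE : forall th phi, phi = hc (lam0 phi) + th <-> phi = ph th.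
Hypothesis hu0 : forall lam2, a2 <= lam2 <= b2 -> hu (0, lam2) = 0 /\ 0 < partial1 hu (0, lam2) <= Mh.

Local Notation flow := (bflow alps alpu Fs Fu R0).
Local Notation passage := (passage alps alpu Fs Fu R0 delta).

(** The orbit of the unstable manifold enters near P at time 0 and lies on the
    stable manifold of E at the exit time 2 L.  The pair (sg, kap) is (1, 0) or
    (-1, 2 pi), according to the lift to the double cover that makes the
    unstable coordinate positive. *)
Definition reach (sg kap L : R) (lam : R * R) : Prop :=
  passage lam (hc lam + kap) sg (2 * L) (sg * hu lam) /\
  g (hc lam + kap + 2 * L) lam = vs (flow lam (hc lam + kap, sg * delta, sg * hu lam) (2 * L)).

Section Sign.
Variables (sg kap : R).
Hypothesis sg1 : `|sg| = 1.

Let sg2 : sg * sg = 1.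
Proof. by rewrite -expr2 -real_normK ?num_real// sg1 expr1n. Qed.

(** Defined for all parameters, not only for those in [reach], so that the
    bifurcation equation takes the form H = N of [newton_rect]. *)
Definition entrance (L : R) (lam : R * R) : R := xget 0 [set u | passage lam (hc lam + kap) sg (2 * L) u].

Definition rest (L : R) (lam : R * R) : R * R :=
  (sg * entrance L lam, vs (flow lam (hc lam + kap, sg * delta, entrance L lam) (2 * L))).

Lemma entranceP L lam : 0 <= L -> Q lam -> passage lam (hc lam + kap) sg (2 * L) (entrance L lam).
Proof.
move=> L0 ql; have L20 : 0 <= 2 * L by rewrite mulr_ge0.
have [u hu'] := passage_exists FB dR (hc lam + kap) sg ql L20.
exact: (xgetPex (P := [set u | passage lam (hc lam + kap) sg (2 * L) u]) 0 (ex_intro _ u hu')).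
Qed.

Lemma reachE L lam : 0 <= L -> Q lam -> (reach sg kap L lam <->
  bif_map g z hu hc (ph (kap + 2 * L)) lam = rest L lam).
Proof.
move=> L0 ql; have L20 : 0 <= 2 * L by rewrite mulr_ge0.
have Eph : ph (kap + 2 * L) - hc (lam0 (ph (kap + 2 * L))) = kap + 2 * L.
  by rewrite {1}[ph _](proj2 (phE (kap + 2 * L) _) erefl) addrAC subrr add0r.
have eP := entranceP L0 ql.
rewrite /bif_map Eph addrA /rest; split.
  move=> [pu gE]; have eE : entrance L lam = sg * hu lam by exact: (passage_unique FB dR ql L20 sg1 eP pu).
  by rewrite eE mulrA sg2 mul1r gE.
case=> E1 E2; have eE : entrance L lam = sg * hu lam by rewrite E1 mulrA sg2 mul1r.
by split; rewrite -eE.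
Qed.

Lemma rest_lip L lam lam' : 0 <= L -> Q lam -> Q lam' -> `|rest L lam - rest L lam'| <=
  delta * expR (- beta * (2 * L)) * (8 * K * (2 * L) * ((Lc + 1) * `|lam - lam'|)).
Proof.
move=> L0 ql ql'; have L20 : 0 <= 2 * L by rewrite mulr_ge0.
have [h1 h2] := passage_lipschitz FB dR ql ql' L20 sg1 (entranceP L0 ql) (entranceP L0 ql').
have d0 : 0 < delta by case/andP: dR.
have K0 := fb_K FB.
set D := Num.max _ _ in h1 h2.
have hD : D <= (Lc + 1) * `|lam - lam'|.
  rewrite /D ge_max mulrDl mul1r; apply/andP; split; last by rewrite lerDr mulr_ge0// ltW.
  by rewrite opprD addrACA subrr addr0; apply: le_trans (hcL ql ql') _; rewrite lerDl.
have mono x : x <= delta * expR (- beta * (2 * L)) * (8 * K * (2 * L) * D) ->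
    x <= delta * expR (- beta * (2 * L)) * (8 * K * (2 * L) * ((Lc + 1) * `|lam - lam'|)).
  move=> /le_trans; apply; rewrite ler_wpM2l ?mulr_ge0 ?expR_ge0 ?(ltW d0)//.
  by rewrite ler_wpM2l// !mulr_ge0// ltW.
rewrite /rest norm_pairB ge_max; apply/andP; split; apply: mono => //.
by rewrite -mulrBr normrM sg1 mul1r.
Qed.

Lemma rest_small L lam : 0 <= L -> Q lam -> `|rest L lam| <= delta * expR 1 * expR (- (2 * beta) * L).
Proof.
move=> L0 ql; have L20 : 0 <= 2 * L by rewrite mulr_ge0.
have eP := entranceP L0 ql; have d0 : 0 < delta by case/andP: dR.
rewrite -mulrA -expRD /rest norm_pair ge_max; apply/andP; split.
  have := passage_u0_le FB dR ql L20 sg1 eP; rewrite normrM sg1 mul1r => h.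
  case: eP => e0 _; rewrite gtr0_norm//; apply: le_trans h _; rewrite ler_pM2l// ler_expR.
  have := fb_alpu FB ql; have := fb_beta FB => b0 h.
  have : 2 * beta * (2 * L) <= alpu lam * (2 * L) by rewrite ler_wpM2r.
  have : 0 <= beta * L by rewrite mulr_ge0// ltW.
  by lra.
have L2 : 0 <= 2 * L <= 2 * L by rewrite L20 lexx.
have [h _] := passage_bounds FB dR ql sg1 eP L2.
apply: le_trans h _; rewrite ler_pM2l// ler_expR; lra.
Qed.

Lemma entrance_le L lam : 0 <= L -> Q lam ->
  0 < entrance L lam <= delta * expR (1 - alpu lam * (2 * L)).
Proof.
move=> L0 ql; have L20 : 0 <= 2 * L by rewrite mulr_ge0.
have eP := entranceP L0 ql; rewrite (passage_u0_le FB dR ql L20 sg1 eP) andbT.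
by case: eP.
Qed.

Let C := 2 * delta * expR 1 / rN.

(** The bounds on the first component follow from those on the entrance
    coordinate, because hu grows linearly in its first argument. *)
Lemma branch_point : exists2 L0, 1 <= L0 & forall L, L0 < L -> exists p : R * R,
  let phi := ph (kap + 2 * L) in
  [/\ `|p - lam0 phi| <= C * expR (- (2 * beta) * L),
    forall lam, Q lam -> `|lam - lam0 phi| <= rN -> (reach sg kap L lam <-> lam = p) &
    0 < sg * p.1 * partial1 hu (lam0 phi) * expR (2 * alpu (lam0 phi) * L) <=
       2 / rN * delta * expR 2 * Mh].
Proof.
have d0 : 0 < delta by case/andP: dR.
have K0 := fb_K FB; have b0 := fb_beta FB; have b20 : 0 < 2 * beta by rewrite mulr_gt0.
have C0 : 0 < C by rewrite /C divr_gt0// !mulr_gt0 ?expR_gt0.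
have A1 : 0 <= delta * (8 * K * 2 * (Lc + 1)) by rewrite !mulr_ge0 ?addr_ge0 ?(ltW Lc0) ?(ltW d0) ?(ltW K0).
have e1 : 0 < rN / 4 by rewrite divr_gt0.
have [La La1 HLa] := exp_small A1 b20 e1.
pose e2 := Num.min rN (Num.min (- a1) b1).
have e20 : 0 < e2 by rewrite !lt_min rN0 oppr_gt0.
have [Lb Lb1 HLb] := exp_small (ltW C0) b20 e20.
have A3 : 0 <= 2 * K * C by apply: mulr_ge0 (ltW C0); rewrite mulr_ge0// ltW.
have [Ld Ld1 HLd] := exp_small A3 b20 ltr01.
exists (Num.max La (Num.max Lb Ld)); first by rewrite le_max La1.
move=> L; rewrite !gt_max => /andP[LLa /andP[LLb LLd]].
have [Sa _] := HLa L LLa; have [_ Sb] := HLb L LLb; have [Sd _] := HLd L LLd.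
have L0 : 0 <= L by apply: ltW; apply: le_lt_trans LLa; apply: le_trans La1.
set phi := ph _; set l0 : R * R := lam0 phi.
have ql0 : Q l0 by exact: lam0Q.
pose s := C * expR (- (2 * beta) * L).
have s0 : 0 <= s by rewrite mulr_ge0 ?expR_ge0 ?(ltW C0).
have [sr [sa sb]] : s <= rN /\ s <= - a1 /\ s <= b1 by move: Sb; rewrite !le_min => /andP[-> /andP[-> ->]].
have [_ [k1 [K1 [K2 [k10 K20 Hb HH]]]]] := ND phi.
have H0 : bif_map g z hu hc phi l0 = 0.
  rewrite /bif_map -/l0 addrC subrK g_z.
  by have [-> _] := hu0 (zJ phi).
have ab1 : a1 <= b1 by case/andP: a10b1 => h1 h2; apply: ltW; exact: lt_trans h2.
have NL lam lam' : Q lam -> Q lam' -> `|rest L lam - rest L lam'| <= rN / 4 * `|lam - lam'|.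
  move=> ql ql'; apply: le_trans (rest_lip L0 ql ql') _.
  rewrite (_ : delta * _ * _ = delta * (8 * K * 2 * (Lc + 1)) * (L * expR (- (2 * beta) * L)) * `|lam - lam'|).
    by rewrite ler_wpM2r.
  by rewrite (_ : - beta * (2 * L) = - (2 * beta) * L); ring.
have N0 : `|rest L l0| <= rN * s / 2.
  apply: le_trans (rest_small L0 ql0) _.
  by rewrite /s /C le_eqVlt; apply/orP; left; apply/eqP; field; rewrite gt_eqF.
have ss : 0 <= s <= rN by rewrite s0.
have [p [ps pE pU]] := newton_rect ab1 (ltW a2b2) ql0 (lt0r_neq0 k10) K20 rN0 ss Hb HH H0 NL N0.
exists p => /=; split=> //.
  by move=> lam ql lr; rewrite -pU//; exact: reachE.
pose p' := proj_rect a1 b1 a2 b2 p.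
have qp' : Q p' by apply: proj_rect_in => //; exact: ltW.
have pp1 : p'.1 = p.1.
  apply: itv_proj_id; have := le_trans (norm_fst (p - l0)) ps; rewrite /= subr0 ler_norml => /andP[h1 h2].
  by apply/andP; split; [apply: le_trans h1; rewrite lerNr|apply: le_trans h2 sb].
have huE : hu p' = sg * entrance L p'.
  have : (p'.1 - p.1) = (bif_map g z hu hc phi p' - rest L p').1 / k1.
    have := congr1 fst pE; rewrite -/p' /= => E; rewrite {2}E opprB addrC -addrA.
    by rewrite [- p'.1 + _]addrC subrr addr0.
  rewrite pp1 subrr => /esym/eqP; rewrite mulf_eq0 invr_eq0 (gt_eqF k10) orbF => /eqP.
  by rewrite /= => /eqP; rewrite subr_eq0 => /eqP.
have p'l0 : `|p' - l0| <= s.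
  apply: le_trans ps; rewrite -[in leLHS](proj_rect_id ql0); exact: proj_rect_lip.
clear pE; clearbody p'.
have /andP[u0 uB] := entrance_le L0 qp'.
have ql' : Q (0, p'.2).
  by apply/QP; split=> /=; [case/andP: a10b1 => /ltW -> /ltW ->|case/QP: qp'].
have l'l0 : `|(0, p'.2) - l0| <= rN.
  rewrite norm_pairB max_normBr.
  by apply: le_trans (norm_snd (p' - l0)) _; exact: le_trans p'l0 sr.
set x := entrance L p' / k1; set y := sg * p.1.
have x0 : 0 < x by rewrite divr_gt0.
have xy : `|x - y| <= 4^-1 * `|y|.
  have := norm_fst (tri_inv k1 K1 K2 (bif_map g z hu hc phi p' - bif_map g z hu hc phi (0, p'.2)) - (p' - (0, p'.2))).
  move=> /le_trans /(_ (HH _ _ qp' ql' (le_trans p'l0 sr) l'l0)) /=.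
  have [-> _] : hu (0, p'.2) = 0 /\ 0 < partial1 hu (0, p'.2) <= Mh by apply: hu0; case/QP: qp'.
  rewrite huE !subr0 pp1 norm_pairB subr0 max_normBl.
  have -> : sg * entrance L p' / k1 - p.1 = sg * (x - y).
    by rewrite /x /y mulrBr !mulrA sg2 mul1r.
  by rewrite pp1 /y !normrM sg1 !mul1r.
have xB : x <= entrance L p' / rN.
  have := Hb (entrance L p', 0) => /(le_trans (norm_fst _)) /=.
  rewrite -/x gtr0_norm// => h; apply: le_trans h _.
  by rewrite norm_pair normr0 (max_idPl (normr_ge0 _)) gtr0_norm.
have [y0 yx] := close_positive x0 xy.
have [_ /andP[m0 mM]] := hu0 (zJ phi).
set m := partial1 hu (0, z phi 0) in m0 mM *.
set E := expR (2 * alpu (lam0 phi) * L).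
have E0 : 0 < E := expR_gt0 _.
apply/andP; split; first by apply: mulr_gt0 E0; exact: mulr_gt0.
have uE : entrance L p' * E <= delta * expR 2.
  apply: (@le_trans _ _ (delta * expR (1 - alpu p' * (2 * L)) * E)); first by rewrite ler_pM2r.
  rewrite -mulrA /E -expRD ler_pM2l// ler_expR.
  have := fb_alpu_lip FB ql0 qp'; rewrite -/l0 distrC => h.
  have : `|alpu l0 - alpu p'| * (2 * L) <= K * s * (2 * L).
    by rewrite ler_wpM2r ?mulr_ge0// distrC -[leLHS]normrN opprB distrC; apply: le_trans h _; rewrite ler_pM2l// distrC.
  have : (alpu l0 - alpu p') * (2 * L) <= `|alpu l0 - alpu p'| * (2 * L).
    by rewrite ler_wpM2r ?mulr_ge0// ler_norm.
  have : K * s * (2 * L) <= 1 by apply: le_trans Sd; rewrite /s le_eqVlt; apply/orP; left; apply/eqP; ring.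
  move=> h1 h2 h3; have -> : 1 - alpu p' * (2 * L) + 2 * alpu l0 * L = 1 + (alpu l0 - alpu p') * (2 * L) by ring.
  by apply: lerD => //; exact: le_trans h2 (le_trans h3 h1).
have Mh0 : 0 < Mh by exact: lt_le_trans mM.
apply: (@le_trans _ _ (2 * (entrance L p' / rN) * Mh * E)).
  rewrite ler_pM2r//; apply: ler_pM => //; try exact: ltW.
  by apply: le_trans yx _; rewrite ler_pM2l.
have -> : 2 * (entrance L p' / rN) * Mh * E = 2 / rN * Mh * (entrance L p' * E) by ring.
have -> : 2 / rN * delta * expR 2 * Mh = 2 / rN * Mh * (delta * expR 2) by ring.
by apply: ler_wpM2l uE; rewrite mulr_ge0 ?(ltW Mh0)// divr_ge0// ltW.
Qed.

(** A point of the parameter plane near some leading order solution whose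
    entrance phase returns near the phase of that solution is near the leading
    order solution for this flight time. *)
Lemma near_leading (th r phi : R) lam : Q lam -> 0 <= r -> `|lam - lam0 phi| <= r ->
  `|hc lam + th - phi| <= r ->
  `|lam - lam0 (ph th)| <= r * (1 + Lz * (1 + Lc) / (1 - q)).
Proof.
move=> ql r0 lr pr; have q1' : 0 < 1 - q by rewrite subr_gt0.
have ql0 : Q (lam0 phi) by exact: lam0Q.
have E := proj2 (phE th _) erefl.
have h1 : `|phi - ph th| <= r * (1 + Lc) / (1 - q).
  rewrite ler_pdivlMr// mulrBr mulr1 lerBlDr.
  have Ed : phi - ph th = (phi - (hc lam + th)) + (hc lam - hc (lam0 phi)) + (hc (lam0 phi) - hc (lam0 (ph th))).
    by rewrite {1}E; ring.
  have h2 := hcL ql ql0; have h3 := hczq phi (ph th).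
  have h4 : Lc * `|lam - lam0 phi| <= Lc * r by rewrite ler_pM2l.
  rewrite distrC in pr; rewrite [in leLHS]Ed.
  apply: normD_le; apply: lerD; last by rewrite mulrC.
  apply: normD_le; rewrite mulrDr mulr1; apply: lerD => //.
  by rewrite mulrC; apply: le_trans h2 h4.
have -> : lam - lam0 (ph th) = (lam - lam0 phi) + (lam0 phi - lam0 (ph th)) by rewrite addrA subrK.
apply: normD_le; rewrite mulrDr mulr1; apply: lerD => //.
rewrite norm_pairB max_normBr.
apply: le_trans (zL _ _) _.
have -> : r * (Lz * (1 + Lc) / (1 - q)) = Lz * (r * (1 + Lc) / (1 - q)) by ring.
by rewrite ler_pM2l.
Qed.

End Sign.
End Branch.

(** * Following a given orbit for a finite time *)

Section Track.
Context {R : realType}.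
Local Notation V := 'rV[R]_3.
Variables (Q : set (R * R)) (f : V -> R * R -> V).
Hypothesis fL : field_lip Q f.

Lemma path_bounded (x : R -> V) (a b : R) : (forall t, a <= t <= b -> {for t, continuous x}) ->
  exists2 M, 0 < M & forall t, a <= t <= b -> `|x t| <= M.
Proof.
move=> cx; have [|M M0 H] := @cts_bounded R R `[a, b]%classic (fun t => `|x t|) (@segment_compact _ _ _).
  by move=> t /=; rewrite in_itv/= => tab; exact: norm_continuous (cx t tab).
by exists M => // t tab; have := H t; rewrite /= in_itv/= normr_id; exact.
Qed.

Definition cut_field (M : R) (x : V) (lam : R * R) : V := f (clamp_row M x) lam.

Lemma cut_field_id M x lam : `|x| <= M -> cut_field M x lam = f x lam.
Proof. by move=> h; rewrite /cut_field clamp_row_id. Qed.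

Lemma cut_field_lip M : 0 <= M -> exists2 K, 0 < K & forall lam lam' x y, Q lam -> Q lam' ->
  `|cut_field M x lam - cut_field M y lam'| <= K * Num.max `|x - y| `|lam - lam'|.
Proof.
move=> M0; have [K K0 H] := fL M; exists K => // lam lam' x y ql ql'.
apply: le_trans (H _ _ _ _ ql ql' (clamp_row_le x M0) (clamp_row_le y M0)) _.
rewrite ler_pM2l// ge_max; apply/andP; split; last by rewrite le_max lexx orbT.
by apply: le_trans (clamp_row_lip M x y) _; rewrite le_max lexx.
Qed.

Local Notation cflow M := (gflow (cut_field M)).

Lemma cflow0 M lam x0 : 0 <= M -> Q lam -> cflow M lam x0 0 = x0.
Proof. by move=> M0 ql; have [K K0 H] := cut_field_lip M0; exact: (gflow0 K0 H). Qed.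

Lemma cflow_der M lam x0 (t : R) : 0 <= M -> Q lam -> `|cflow M lam x0 t| <= M ->
  is_derive t 1 (cflow M lam x0) (f (cflow M lam x0 t) lam).
Proof.
move=> M0 ql h; have [K K0 H] := cut_field_lip M0.
by rewrite -(cut_field_id lam h); exact: (gflow_der K0 H).
Qed.

Lemma cflow_shift M lam x0 (s t : R) : 0 <= M -> Q lam ->
  cflow M lam (cflow M lam x0 s) t = cflow M lam x0 (t + s).
Proof. by move=> M0 ql; have [K K0 H] := cut_field_lip M0; exact: (gflow_shift K0 H). Qed.

Lemma cflow_near M lam x0 (T e : R) : 0 <= M -> Q lam -> 0 <= T -> 0 < e ->
  exists2 r, 0 < r & forall lam' y t, Q lam' -> `|lam' - lam| < r -> `|y - x0| < r ->
    - T <= t <= T -> `|cflow M lam' y t - cflow M lam x0 t| < e.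
Proof. by move=> M0 ql; have [K K0 H] := cut_field_lip M0; exact: (gflow_near K0 H). Qed.

(** A bounded piece of a solution of the given system is a piece of the flow of
    the cut field. *)
Lemma cflow_uniq M lam (x : R -> V) (a b c : R) : 0 <= M -> Q lam -> a <= c <= b ->
  (forall t, a <= t <= b -> `|x t| <= M) ->
  solves f lam a b x ->
  forall t, a <= t <= b -> x t = cflow M lam (x c) (t - c).
Proof.
move=> M0 ql /andP[ac cb] xM dx; have [K K0 H] := cut_field_lip M0.
have fcL : field_lip Q (cut_field M) by move=> N; exists K => // *; exact: H.
have dy (t : R) : is_derive t 1 (fun t => cflow M lam (x c) (t - c)) (cut_field M (cflow M lam (x c) (t - c)) lam).
  exact: (@is_derive_shiftc _ _ (cflow M lam (x c)) (- c) t _ (gflow_der K0 H (x c) (t - c) ql)).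
have dx' t : a <= t <= b -> is_derive t 1 x (cut_field M (x t) lam).
  by move=> tab; rewrite cut_field_id ?xM//; exact: dx.
have xc : x c = cflow M lam (x c) (c - c) by rewrite subrr cflow0.
move=> t /andP[at0 tb]; have [tc|/ltW ct] := leP t c.
  apply: (@solution_unique R Q (cut_field M) lam x _ a c fcL ql ac) => //.
  - by move=> s /andP[s1 s2]; apply: dx'; rewrite s1 (le_trans s2).
  - by right.
  - by rewrite at0.
apply: (@solution_unique R Q (cut_field M) lam x _ c b fcL ql cb) => //.
- by move=> s /andP[s1 s2]; apply: dx'; rewrite s2 (le_trans ac).
- by left.
- by rewrite ct.
Qed.

(** A solution of the given system that starts near w stays below the cut-off as
    long as it follows w. *)
Lemma track mu (w : R -> V) (a b c e M : R) : Q mu -> a <= c <= b -> 0 < e ->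
  solves f mu a b w ->
  (forall t, a <= t <= b -> `|w t| + e <= M) ->
  exists2 r, 0 < r & forall lam y0, Q lam -> `|lam - mu| < r -> `|y0 - w c| < r ->
    forall t, a <= t <= b -> `|cflow M lam y0 (t - c) - w t| < e /\
      is_derive t 1 (fun t => cflow M lam y0 (t - c)) (f (cflow M lam y0 (t - c)) lam).
Proof.
move=> qmu acb e0 dw wM; have M0 : 0 <= M.
  by have := wM c acb; apply: le_trans; rewrite addr_ge0// ltW.
have ab : 0 <= b - a by case/andP: acb => ac cb; rewrite subr_ge0 (le_trans ac).
have [r r0 H] := cflow_near (w c) M0 qmu ab e0.
exists r => // lam y0 ql lr yr t tab.
have ttc : - (b - a) <= t - c <= b - a.
  by case/andP: acb => ac cb; case/andP: tab => at0 tb; apply/andP; split; lra.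
have wt : w t = cflow M mu (w c) (t - c).
  apply: (cflow_uniq M0 qmu acb _ dw) => // s sab; apply: le_trans (wM s sab).
  by rewrite lerDl ltW.
have h := H lam y0 _ ql lr yr ttc; rewrite -wt in h; split=> //.
apply: (@is_derive_shiftc _ _ (cflow M lam y0) (- c) t); apply: cflow_der => //.
apply: le_trans (wM t tab).
rewrite (_ : cflow _ _ _ _ = w t + (cflow M lam y0 (t - c) - w t)); last by rewrite [RHS]addrC subrK.
by apply: normD_le; rewrite lerD2l ltW.
Qed.

End Track.

Section Decay.
Context {R : realType} {V : normedModType R}.

Lemma decay_cvg (x : R -> V) (B k T : R) : 0 < k ->
  (forall t, T <= t -> `|x t| ^+ 2 <= B * expR (- k * (t - T))) -> x t @[t --> +oo] --> (0 : V).
Proof.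
move=> k0 H; apply/cvg_pinfty0 => e e0.
have B0 : 0 <= B by have := H T (lexx T); rewrite subrr mulr0 expR0 mulr1; exact: le_trans (sqr_ge0 _).
have e20 : 0 < e ^+ 2 by exact: exprn_gt0.
exists (T + B / (k * e ^+ 2)) => t tT.
have kp : 0 < k * e ^+ 2 by exact: mulr_gt0.
have tT0 : T <= t by apply: le_trans (ltW tT); rewrite lerDl divr_ge0// ltW.
have h1 : B < (t - T) * (k * e ^+ 2) by rewrite -ltr_pdivrMr// ltrBrDl.
have h2 : B * expR (- k * (t - T)) < e ^+ 2.
  rewrite mulNr expRN ltr_pdivrMr ?expR_gt0//.
  have : e ^+ 2 * (1 + k * (t - T)) <= e ^+ 2 * expR (k * (t - T)) by rewrite ler_pM2l// expR_ge1Dx.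
  by apply: lt_le_trans; rewrite mulrDr mulr1 (mulrC k) mulrA (mulrC (e ^+ 2)) -mulrA (mulrC _ k); lra.
by have := le_lt_trans (H t tT0) h2; rewrite ltr_pXn2r ?nnegrE// ltW.
Qed.

End Decay.

Section TwoPhases.
Context {R : realType}.

(** A segment cannot be cut into two disjoint open pieces. *)
Lemma two_phases (A B : R -> Prop) (a b : R) : a <= b ->
  (forall t, a <= t <= b -> A t \/ B t) -> (forall t, a <= t <= b -> A t -> ~ B t) ->
  (forall t, a <= t <= b -> A t -> exists2 r, 0 < r & forall s, a <= s <= b -> `|s - t| < r -> A s) ->
  (forall t, a <= t <= b -> B t -> exists2 r, 0 < r & forall s, a <= s <= b -> `|s - t| < r -> B s) ->
  A a -> A b.
Proof.
move=> ab AB dis oA oB Aa; apply: contrapT => nAb.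
pose pr (t : R) := itv_proj a b t.
have prP t : a <= pr t <= b := itv_proj_in t ab.
have prid t : a <= t <= b -> pr t = t by exact: itv_proj_id.
have prL s t : `|pr s - pr t| <= `|s - t| by exact: itv_proj_lip.
pose g (t : R) : R := if `[< A (pr t) >] then 1 else -1.
have cg (t : R) : {for t, continuous g}.
  apply/ctsP => e e0.
  have [At|nAt] := pselect (A (pr t)).
    have [r r0 H] := oA _ (prP t) At; exists r => // s sr; rewrite /g.
    have As : A (pr s) by apply: H => //; exact: le_lt_trans (prL s t) sr.
    by rewrite !asboolT// subrr normr0.
  have Bt : B (pr t) by case: (AB _ (prP t)).
  have [r r0 H] := oB _ (prP t) Bt; exists r => // s sr; rewrite /g.
  have nAs : ~ A (pr s).
    by move=> As; apply: (dis _ (prP s) As); apply: H => //; exact: le_lt_trans (prL s t) sr.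
  by rewrite !asboolF// subrr normr0.
have [||t tab] := @ivt_ge R g a b 0 ab.
- by move=> t _; exact: cg.
- have -> : g a = 1 by rewrite /g prid ?lexx// asboolT.
  have -> : g b = -1 by rewrite /g prid ?lexx ?ab// asboolF.
  by rewrite oppr_le0 ler01.
by rewrite /g; case: ifP => _ /eqP; rewrite ?oppr_eq0 oner_eq0.
Qed.

End TwoPhases.

(** * The stable manifold of the equilibrium near a connecting orbit *)

Lemma expR1_le4 {R : realType} : expR 1 <= 4 :> R.
Proof.
have h : 2^-1 <= expR (- 2^-1) :> R by apply: le_trans (expR_ge1Dx _); lra.
have h2 : expR 2^-1 <= 2 :> R.
  by rewrite -[expR _]invrK -expRN -[leRHS]invrK lef_pV2// posrE ?expR_gt0// invr_gt0.
have -> : expR 1 = expR 2^-1 * expR 2^-1 :> R by rewrite -expRD; congr expR; lra.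
have -> : 4 = 2 * 2 :> R by ring.
by apply: ler_pM => //; exact: expR_ge0.
Qed.

Section NearEquilibrium.
Context {R : realType}.
Local Notation V := 'rV[R]_3.
Local Notation coord := (R * R * R)%type.
Variables (Q : set (R * R)) (f : V -> R * R -> V) (Psi : coord -> R * R -> V).
Variables (alps alpu : R * R -> R) (Fs Fu : coord -> R * R -> R) (R0 beta K : R).
Hypothesis FB : flow_box Q f Psi alps alpu Fs Fu R0 beta K.
Hypothesis fL : field_lip Q f.
Local Notation bflow := (bflow alps alpu Fs Fu R0).
Variables (delta d : R).
Hypothesis dR : 0 < delta <= R0 / 8.
Hypothesis d_gt0 : 0 < d.
Hypothesis Hd : forall lam v, Q lam -> box R0 v -> d <= `|Psi v lam|.
Variables (mu : R * R) (F : V -> R * R -> V) (r : R) (Y Qf : V -> R) (cs C KF : R).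
Hypothesis qmu : Q mu.
Hypothesis r0 : 0 < r.
Hypothesis Fid : forall lam x, Q lam -> `|lam - mu| < r -> `|x| <= r -> F x lam = f x lam.
Hypothesis SD : saddle F [set lam | Q lam /\ `|lam - mu| < r] Y Qf cs C KF.

Let R00 : 0 < R0 := fb_R0 FB.
Let beta0 : 0 < beta := fb_beta FB.
Let d0 : 0 < delta. Proof. by case/andP: dR. Qed.
Let dltR : 0 < delta < R0.
Proof. by case/andP: dR => h1 h2; apply/andP; split=> //; lra. Qed.
Let K0 : 0 < K := fb_K FB.
Let C0 : 0 < C := sd_C SD.
Let cs0 : 0 < cs := sd_c SD.
Let dmu : Q mu /\ `|mu - mu| < r. Proof. by rewrite subrr normr0. Qed.
Local Notation cflow M := (gflow (cut_field f M)).

Section StableSide.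
Variables (phi : R) (w : R -> V).
Hypothesis dw : forall t : R, 0 <= t -> is_derive t 1 w (f (w t) mu).
Hypothesis w0 : w 0 = Psi (phi, 0, delta) mu.
Hypothesis wE : w t @[t --> +oo] --> (0 : V).
Hypothesis wS : forall t : R, 0 < t -> ~ Sigma_out Psi delta mu (w t).
Variables (g : R -> R * R -> R) (kap : R).
Hypothesis kap0 : 0 < kap.
Hypothesis gS : forall lam c s, Q lam -> `|lam - mu| < kap -> `|c - phi| < kap -> `|s| < kap ->
  WsE_out f Psi delta lam (c, s, delta) -> s = g c lam.
Hypothesis gcont : forall e : R, 0 < e -> exists2 rho, 0 < rho & forall c lam, Q lam ->
  `|c - phi| < rho -> `|lam - mu| < rho -> `|g c lam| < e.
Hypothesis gcts : forall c, `|c - phi| < kap -> {for c, continuous (fun c => g c mu)}.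

Local Notation leaves := (leaves F Y Qf).

Let boxd c s : `|s| <= delta -> box R0 (c, s, delta).
Proof.
case/andP: dltR => h1 /ltW h2 h; split; rewrite /vs /vu/=; first exact: le_trans h h2.
by rewrite gtr0_norm.
Qed.

Lemma saddle_flow lam (x : R -> V) (a b : R) : Q lam -> `|lam - mu| < r -> a <= 0 <= b ->
  (forall t : R, a <= t <= b -> `|x t| <= r) ->
  solves f lam a b x ->
  forall t : R, a <= t <= b -> x t = gflow F lam (x 0) t.
Proof.
move=> ql lr /andP[a0 b0] xr dx t /andP[at0 tb]; have dl : Q lam /\ `|lam - mu| < r by [].
have FLD : field_lip [set lam | Q lam /\ `|lam - mu| < r] F.
  by move=> N; exists KF; [exact: sd_KF SD|move=> l l' x1 x2 ? ? _ _; exact: (sd_lip SD)].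
have dy (s : R) : is_derive s 1 (gflow F lam (x 0)) (F (gflow F lam (x 0) s) lam).
  exact: (gflow_der (sd_KF SD) (sd_lip SD)).
have dxF s : a <= s <= b -> is_derive s 1 x (F (x s) lam).
  by move=> sab; rewrite (Fid ql lr (xr s sab)); exact: dx.
have E : x 0 = gflow F lam (x 0) 0 by rewrite (gflow0 (sd_KF SD) (sd_lip SD)).
have [t0|/ltW t0] := leP t 0.
  apply: (@solution_unique R _ F lam x _ t 0 FLD dl t0) => //; last by rewrite lexx.
  - by move=> s /andP[s1 s2]; apply: dxF; rewrite (le_trans at0)// (le_trans s2).
  - by right.
apply: (@solution_unique R _ F lam x _ 0 t FLD dl t0) => //; last by rewrite lexx andbT.
- by move=> s /andP[s1 s2]; apply: dxF; rewrite (le_trans a0)// (le_trans s2).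
- by left.
Qed.

Lemma orbit_to_zero_stays sg lam (x : R -> V) : Q lam -> `|lam - mu| < r ->
  (forall t : R, 0 <= t -> x t = gflow F lam (x 0) t) -> x t @[t --> +oo] --> (0 : V) ->
  ~ leaves sg lam (x 0).
Proof.
move=> ql lr E /cvg_pinfty0 xE [t [t0 ct st]]; have dl : Q lam /\ `|lam - mu| < r by [].
rewrite -E// in ct; have Yt := cone_pos_Y SD ct.
have y0 : 0 < `|Y (x t)| / C by rewrite divr_gt0// normr_gt0.
have [T HT] := xE _ y0; set s := Num.max t (T + 1).
have ts : t <= s by rewrite le_max lexx.
have Ts : T < s by rewrite lt_max ltrDl ltr01 orbT.
have s0 := le_trans t0 ts.
have := Y_grow SD dl (esol_gflow SD (x 0) dl) (esol0 SD dl) ts.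
rewrite !subr0 -!E// => /(_ (ltW ct)) h.
have h1 : Y (x t) ^+ 2 <= Y (x s) ^+ 2.
  apply: le_trans h; rewrite ler_peMr ?sqr_ge0// -expR0 ler_expR mulr_ge0 ?subr_ge0//.
  by rewrite mulr_ge0// ltW.
have h2 : `|Y (x t)| <= C * `|x s| by apply: le_trans (ler_norm_sqr h1) (sd_Y SD _).
by have := HT s Ts; rewrite ltr_pdivlMr// mulrC ltNge h2.
Qed.

Section Fixed.
Variables (e T M tau rho : R).
Let e2 := e / (8 * C + 4).
Hypothesis e0 : 0 < e.
Hypothesis er : e <= r.
Hypothesis ed : e <= d.
Hypothesis T1 : 1 <= T.
Hypothesis wT : forall t : R, T - 1 <= t -> `|w t| < e2.
Hypothesis wM : forall t : R, 0 <= t <= T + 1 -> `|w t| + 1 <= M.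
Hypothesis rM : r <= M.
Hypothesis tau0 : 0 < tau <= T.
Hypothesis tauK : (K + beta) * tau <= 1.
Hypothesis rho0 : 0 < rho.
Hypothesis rhor : rho <= r.
Hypothesis rhok : rho <= kap.
Hypothesis rhod : rho <= delta.
Hypothesis HT : forall lam c s, Q lam -> `|lam - mu| < rho -> `|c - phi| < rho -> `|s| < rho ->
  forall t : R, 0 <= t <= T -> let y := cflow M lam (Psi (c, s, delta) lam) in
    [/\ `|y t - w t| < e2, is_derive t 1 y (f (y t) lam) & tau <= t -> ~ Sigma_out Psi delta lam (y t)].
Let Phi c s lam := cflow M lam (Psi (c, s, delta) lam) T.

Let M0 : 0 <= M. Proof. exact: le_trans (ltW r0) rM. Qed.
Let e20 : 0 < e2. Proof. by rewrite divr_gt0// addr_gt0// mulr_gt0. Qed.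
Let e2E : e2 * (8 * C + 4) = e.
Proof. by rewrite /e2 divfK// gt_eqF// addr_gt0// mulr_gt0. Qed.
Let Ce2 : 0 < C * e2. Proof. exact: mulr_gt0. Qed.
(** A point that leaves the saddle on neither side converges to the equilibrium:
    first it follows w, and then the estimate for staying orbits applies. *)
Lemma stay lam c s : Q lam -> `|lam - mu| < rho -> `|c - phi| < rho -> `|s| < rho ->
  ~ leaves 1 lam (Phi c s lam) -> ~ leaves (-1) lam (Phi c s lam) ->
  exists x, stable_tail f Psi delta lam (Psi (c, s, delta) lam) w e x.
Proof.
move=> ql lr cr sr n1 n2; have H := HT ql lr cr sr.
have dl : Q lam /\ `|lam - mu| < r by split=> //; exact: lt_le_trans lr rhor.
set y := cflow M lam (Psi (c, s, delta) lam) in H; set v := gflow F lam (Phi c s lam).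
have T0 : 0 <= T := le_trans ler01 T1.
have TT : 0 <= T <= T by rewrite T0 lexx.
have yT : `|Phi c s lam| < 2 * e2.
  have [h _ _] := H T TT; have := wT (t := T); rewrite gerBl => /(_ ler01) h'.
  have -> : Phi c s lam = (y T - w T) + w T by rewrite subrK.
  by apply: normD_lt; lra.
have st := stays SD dl n1 n2; rewrite -/v in st.
have vdec t : 0 <= t -> `|v t| ^+ 2 <= (e / 2) ^+ 2 * expR (- (2 * cs) * t).
  move=> t0; apply: le_trans (st t t0) _; rewrite ler_wpM2r ?expR_ge0//.
  have h := sd_Q SD (Phi c s lam).
  apply: (@le_trans _ _ (2 * C * (C * `|Phi c s lam| ^+ 2))).
    by rewrite ler_wpM2l// mulr_ge0// ltW.
  apply: (@le_trans _ _ (2 * C * (C * (2 * e2) ^+ 2))).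
    rewrite ler_wpM2l ?mulr_ge0 ?(ltW C0)// ler_wpM2l ?(ltW C0)//.
    by rewrite lerXn2r ?nnegrE// ?ltW// mulr_gt0.
  rewrite -e2E; have -> : (e2 * (8 * C + 4) / 2) ^+ 2 = 16 * (C * e2) ^+ 2 + 16 * (C * e2 * e2) + 4 * e2 ^+ 2.
    by field.
  have -> : 2 * C * (C * (2 * e2) ^+ 2) = 8 * (C * e2) ^+ 2 by ring.
  have p1 : 0 <= (C * e2) ^+ 2 by exact: sqr_ge0.
  have p2 : 0 <= C * e2 * e2 by rewrite mulr_ge0// ltW.
  have p3 : 0 <= e2 ^+ 2 by exact: sqr_ge0.
  by lra.
have ve t : 0 <= t -> `|v t| < e.
  move=> t0; have h : `|v t| ^+ 2 <= (e / 2) ^+ 2.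
    apply: le_trans (vdec t t0) _; rewrite ler_piMr ?sqr_ge0// -expR0 ler_expR.
    by rewrite mulNr oppr_le0 mulr_ge0// mulr_ge0// ltW.
  have : `|v t| <= e / 2 by rewrite -ler_sqr ?nnegrE ?divr_ge0// ltW.
  move=> h'; apply: le_lt_trans h' _; by frac_lt.
pose z t := v (t - T); pose x := glue T y z.
have vT : y T = z T.
  by rewrite /z subrr /v (gflow0 (sd_KF SD) (sd_lip SD)).
have zd t : T <= t -> is_derive t 1 z (f (z t) lam).
  move=> Tt; have h : `|v (t - T)| < e by apply: ve; rewrite subr_ge0.
  apply: (@is_derive_shiftc _ _ v (- T) t); rewrite -(Fid ql dl.2); last exact: ltW (lt_le_trans h er).
  exact: (gflow_der (sd_KF SD) (sd_lip SD)).
have x1 t : t <= T -> x t = y t by rewrite /x /glue => ->.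
have x2 t : T <= t -> x t = z t.
  rewrite le_eqVlt => /orP[/eqP <-|tT]; first by rewrite x1.
  by rewrite /x /glue leNgt tT.
exists x; split.
- move=> t /=; rewrite in_itv/= andbT => t0.
  apply: (@glue_der R V (f ^~ lam) T y z t vT) => // tT.
  by have [|_ h _] := H t; rewrite ?t0.
- by rewrite x1// /y (cflow0 fL).
- apply: (@decay_cvg R V x ((e / 2) ^+ 2) (2 * cs) T); first by rewrite mulr_gt0.
  by move=> t Tt; rewrite x2//; apply: vdec; rewrite subr_ge0.
- move=> t t0; have [tT|Tt] := leP t T; last first.
    rewrite x2 ?(ltW Tt)// => -[u hu zu].
    have hz : `|z t| < e by apply: ve; rewrite subr_ge0 ltW.
    have : d <= `|z t|.
      rewrite -zu; apply: Hd => //; case: u hu {zu} => [[uc us] uu] [/= -> h].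
      exact: boxd.
    by move=> h; have := lt_le_trans hz (le_trans ed h); rewrite ltxx.
  rewrite x1//; have [tt|/ltW tt] := leP tau t.
    by have [|_ _ h] := H t; [rewrite ltW|exact: h].
  have [tau00 tauT] := andP tau0.
  pose b s' := bflow lam (c, s, delta) s'.
  have b0 : b 0 = (c, s, delta) by rewrite /b (bflow0 FB).
  have sd : `|s| <= delta by apply: ltW (lt_le_trans sr rhod).
  have ub (q : R) : 0 <= q <= tau -> box R0 (b q).
    move=> /andP[q0 qt]; have [_ dd] := andP dR; split.
      apply: le_trans (bflow_vs_mono FB (c, s, delta) ql q0) _; rewrite (bflow0 FB)//.
      by apply: le_trans sd _; rewrite ltW//; case/andP: dltR.
    apply: le_trans (bflow_vu_upper FB (c, s, delta) ql q0) _; rewrite (bflow0 FB)// subr0 /vu/= gtr0_norm//.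
    have h1 : expR ((K + beta) * q) <= expR 1.
      rewrite ler_expR; apply: le_trans tauK; rewrite ler_pM2l// addr_gt0//; exact: fb_beta FB.
    have h2 : expR 1 <= 8 :> R by apply: le_trans expR1_le4 _; lra.
    have : delta * expR ((K + beta) * q) <= delta * 8.
      by rewrite ler_pM2l//; exact: le_trans h1 h2.
    by lra.
  have yb : y t = Psi (b t) lam.
    have h : forall q, 0 <= q <= tau -> y q = Psi (b (q - 0)) lam.
      apply: (bflow_follow FB fL ql (ltW tau00)) => [q /andP[q0 qt]|q qt|].
      + by have [|_ h' _] := H q => //; rewrite q0 (le_trans qt).
      + by rewrite subr0; exact: ub.
      + by left; rewrite subr0 (bflow0 FB)// /y (cflow0 fL).
    by rewrite h ?subr0// (ltW t0).
  have tt' : 0 <= t <= tau by rewrite ltW.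
  rewrite yb => /(Sigma_outP FB dR ql (ub t tt'))[h _].
  have := bflow_vu_growth FB ql (ltW t0) (ub t tt').2.
  rewrite -/b h (bflow0 FB)// /vu/= gtr0_norm// subr0 -[X in X <= _]mulr1 ler_pM2l// leNgt => /negP; apply.
  by rewrite -expR0 ltr_expR mulNr oppr_lt0 mulr_gt0//; exact: fb_beta FB.
- move=> t t0; have [tT|/ltW Tt] := leP t T.
    left; rewrite x1//; have [|h _ _] := H t; first by rewrite t0.
    apply: lt_trans h _; rewrite -e2E ltr_pMr//.
    by have := C0; lra.
  by right; rewrite x2//; apply: ve; rewrite subr_ge0.
Qed.

Lemma stay_graph lam c s : Q lam -> `|lam - mu| < rho -> `|c - phi| < rho -> `|s| < rho ->
  ~ leaves 1 lam (Phi c s lam) -> ~ leaves (-1) lam (Phi c s lam) -> s = g c lam.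
Proof.
move=> ql lr cr sr n1 n2; have [x [x1 x2 x3 x4 _]] := stay ql lr cr sr n1 n2.
apply: gS => //; try by exact: lt_le_trans rhok.
split; first by split; rewrite // /vs/= ltW// (lt_le_trans sr rhod).
by exists x.
Qed.

Lemma leaves_near sg lam c s : `|sg| = 1 -> Q lam -> `|lam - mu| < rho -> `|s| < rho ->
  leaves sg lam (Phi c s lam) -> exists2 q, 0 < q & forall lam' c' s', Q lam' -> `|lam' - mu| < rho ->
    `|s'| < rho -> `|lam' - lam| < q -> `|c' - c| < q -> `|s' - s| < q -> leaves sg lam' (Phi c' s' lam').
Proof.
move=> sg1 ql lr sr lv; have dl : Q lam /\ `|lam - mu| < r by split=> //; exact: lt_le_trans lr rhor.
have [q1 q10 H1] := leaves_open SD sg1 dl lv.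
have T0 : 0 <= T := le_trans ler01 T1.
have [q2 q20 H2] := cflow_near fL (Psi (c, s, delta) lam) M0 ql T0 q10.
exists (Num.min (Num.min q1 q2) (q2 / K)); first by rewrite !lt_min q10 q20 divr_gt0.
move=> lam' c' s' ql' lr' sr'; rewrite !lt_min => /andP[/andP[l1 l3] l2] /andP[_ c2] /andP[_ s2].
apply: H1 => //; first by split=> //; exact: lt_le_trans lr' rhor.
have nT : - T <= T <= T by rewrite lexx andbT (le_trans _ T0)// oppr_le0.
apply: H2 => //.
apply: le_lt_trans (fb_Psi_lip FB ql' ql _ _) _; try by apply/boxd/ltW; apply: lt_le_trans rhod.
by rewrite [K * _]mulrC -ltr_pdivlMr// gt_max l2 andbT !norm_pairB !gt_max c2 s2 subrr normr0 divr_gt0.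
Qed.

(** Displace w T along the unstable direction, follow the flow back to time 0 and
    from there to the nearby crossing of the section. *)
Lemma displaced_point sg k : `|sg| = 1 -> 0 < k ->
  exists c1 s1, [/\ `|c1 - phi| < k, `|s1| < k & leaves sg mu (Phi c1 s1 mu)].
Proof.
move=> sg1 k0; have T0 : 0 <= T := le_trans ler01 T1.
have mur : `|mu - mu| < r by rewrite subrr normr0.
have [ed0 [Ye Qe]] := sd_dir SD.
pose v0 : coord := (phi, 0, delta).
have [_ dR8] := andP dR.
pose e5 := Num.min k (Num.min (K^-1) (R0 / 2)).
have e50 : 0 < e5 by rewrite !lt_min k0 invr_gt0 K0 divr_gt0.
have [e5k e5K e5R] : [/\ e5 <= k, e5 <= K^-1 & e5 <= R0 / 2] by min_le.
pose e6 := Num.min e5 1; have e60 : 0 < e6 by rewrite lt_min e50 ltr01.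
have [_ dltR'] := andP dltR.
have [e4 e40 H4] := hit_out FB dR qmu (v0 := v0) erefl e60.
have [rf rf0 Hf] := fb_open FB e40.
pose e3 := Num.min (Num.min e2 rf) 1.
have e30 : 0 < e3 by rewrite !lt_min e20 rf0 ltr01.
have [e32 e3f e31] : [/\ e3 <= e2, e3 <= rf & e3 <= 1] by min_le.
have TT1 : 0 <= T <= T + 1 by rewrite T0 lerDl ler01.
have [||rt rt0 Ht] := track fL (w := w) (M := M) qmu TT1 e30.
- by move=> t /andP[t0 _]; exact: dw.
- by move=> t tT; apply: le_trans (wM tT); rewrite lerD2l.
pose eta := rt / (2 * (`|ed0| + 1)).
have n1 : 0 < `|ed0| + 1 by rewrite ltr_wpDl.
have eta0 : 0 < eta by rewrite divr_gt0// mulr_gt0.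
pose x1 := w T + (sg * eta) *: ed0.
have x1w : x1 - w T = (sg * eta) *: ed0 by rewrite /x1 addrAC subrr add0r.
have sg2 : sg * sg = 1 by case: (norm1P sg1) => ->; ring.
have lx1 : leaves sg mu x1.
  have wst b : ~ leaves b mu (w T).
    have := @orbit_to_zero_stays b mu (fun t => w (t + T)) qmu mur.
    rewrite add0r; apply; last first.
      apply/cvg_pinfty0 => q q0; have [S HS] := (cvg_pinfty0 w).1 wE q q0.
      by exists S => t St; apply: HS; apply: lt_le_trans St _; rewrite lerDl.
    move=> t t0; have t00 : 0 <= (0 : R) <= t by rewrite lexx.
    have := @saddle_flow mu (fun t => w (t + T)) 0 t qmu mur t00; rewrite add0r; apply.
    - move=> s /andP[s0 _]; apply: ltW; apply: lt_le_trans (_ : e2 <= r).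
        by apply: wT; rewrite -subr_ge0; have := s0; lra.
      by apply: le_trans er; rewrite -e2E ler_peMr ?(ltW e20)//; have := C0; lra.
    - move=> s /andP[s0 _]; apply: (@is_derive_shiftc _ _ w T s); apply: dw.
      exact: addr_ge0.
    - by rewrite t0 lexx.
  apply: (displaced_leaves SD sg1 dmu (wst 1) (wst (-1))); rewrite x1w.
    rewrite /cone (saddle_YZ SD) (sd_QZ SD) Ye Qe mulr0 subr0 mulr1.
    by rewrite exprMn expr2 sg2 mul1r exprn_gt0.
  by rewrite (saddle_YZ SD) Ye mulr1 mulrA sg2 mul1r.
have x1r : `|x1 - w T| < rt.
  rewrite x1w normrZ normrM sg1 mul1r gtr0_norm// /eta.
  have := rt0; move: (normr_ge0 ed0) => n0 rtp.
  rewrite mulrAC ltr_pdivrMr ?mulr_gt0// ltr_pM2l//; lra.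
have Hy := Ht mu x1 qmu; rewrite subrr normr0 in Hy; have {}Hy := Hy rt0 x1r.
pose y t := cflow M mu x1 (t - T).
have zT : 0 <= (0 : R) <= T + 1 by rewrite lexx addr_ge0.
have [y0w _] := Hy 0 zT; rewrite -/(y 0) in y0w.
have bv0 : box (R0 / 2) v0.
  by rewrite /v0; split; rewrite /vs /vu/= ?normr0 ?gtr0_norm//; [rewrite divr_ge0// ltW|lra].
have [|v' v'v [bv' v'y]] := Hf mu v0 (y 0) qmu bv0.
  by apply: (lt_le_trans _ e3f); rewrite /v0 -w0.
have [t1 [t1e vut1 Hb]] := H4 v' v'v.
have [e65 e61] : e6 <= e5 /\ e6 <= 1 by split; rewrite ge_min lexx ?orbT.
pose b s := bflow mu v' s.
have bb s : `|s| <= `|t1| -> box R0 (b s).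
  move=> st; have h := lt_le_trans (Hb s st) e65.
  have hs : `|vs (b s)| < e5.
    apply: le_lt_trans h; rewrite -[vs (b s)]subr0.
    exact: (vs_le _ v0).
  have hu : `|vu (b s) - delta| < e5.
    by apply: le_lt_trans h; exact: (vu_le _ v0).
  split; first by lra.
  have -> : vu (b s) = delta + (vu (b s) - delta) by ring.
  by apply: normD_le; rewrite gtr0_norm//; lra.
have t1n : `|t1| <= `|t1| by [].
have b1 := Hb t1 t1n; rewrite -/(b t1) in b1.
have Pb : Psi (b t1) mu = y t1.
  have z1 : - `|t1| <= 0 <= `|t1| by rewrite oppr_le0 normr_ge0.
  have tt1 : - `|t1| <= t1 <= `|t1| by rewrite -ler_norml.
  rewrite (cflow_uniq fL M0 qmu z1 (x := fun s => Psi (b s) mu) _ _ tt1).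
  - rewrite subr0 {1}/b (bflow0 FB)// v'y /y (cflow_shift fL)//; congr (cflow M mu x1 _); ring.
  - move=> s; rewrite -ler_norml => st.
    have : `|Psi (b s) mu - w 0| <= 1.
      rewrite w0; apply: le_trans (fb_Psi_lip FB qmu qmu (bb s st) _) _.
        by apply: boxd; rewrite normr0 ltW.
      rewrite max_normBl mulrC -ler_pdivlMr// mul1r.
      by apply: le_trans e5K; apply: ltW; apply: lt_le_trans e65; exact: Hb.
    have := wM (t := 0) zT; move=> h1 h2; apply: le_trans h1.
    have -> : Psi (b s) mu = w 0 + (Psi (b s) mu - w 0) by rewrite [RHS]addrC subrK.
    by apply: normD_le; rewrite lerD2l.
  - by move=> s; rewrite -ler_norml => st; exact: (bflow_solution FB qmu (bb s st)).
exists (vc (b t1)), (vs (b t1)); split.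
- apply: lt_le_trans e5k; apply: lt_le_trans e65; apply: le_lt_trans b1.
  exact: (vc_le _ v0).
- apply: lt_le_trans e5k; apply: lt_le_trans e65; apply: le_lt_trans b1.
  rewrite -[vs (b t1)]subr0.
  exact: (vs_le _ v0).
have Eb : (vc (b t1), vs (b t1), delta) = b t1.
  by rewrite -[in X in X = _]vut1 -/(b t1); case: (b t1) => [[? ?] ?].
have -> : Phi (vc (b t1)) (vs (b t1)) mu = y (t1 + T).
  rewrite /Phi Eb Pb /y (cflow_shift fL)//; congr (cflow M mu x1 _); ring.
have t11 : `|t1| <= 1 by apply: ltW; apply: lt_le_trans t1e e61.
have z1 : - `|t1| <= 0 <= `|t1| by rewrite oppr_le0 normr_ge0.
have in1 s : - `|t1| <= s <= `|t1| -> 0 <= s + T <= T + 1 /\ T - 1 <= s + T.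
  by move=> /andP[h1 h2]; have h3 := T1; split; [apply/andP; split|]; lra.
have -> : y (t1 + T) = gflow F mu x1 t1.
  have yT : y T = x1 by rewrite /y subrr (cflow0 fL).
  have := @saddle_flow mu (fun s => y (s + T)) (- `|t1|) `|t1| qmu mur z1.
  rewrite add0r yT; apply.
  - move=> s /in1[h1 h2]; have [h3 _] := Hy _ h1; rewrite -/(y _) in h3.
    rewrite -[y _](subrK (w (s + T))); apply: normD_le.
    have := wT h2 => h4; apply: (@le_trans _ _ (2 * e2)); first by lra.
    apply: le_trans er; rewrite -e2E mulrC ler_wpM2l ?(ltW e20)//; have := C0; lra.
  - move=> s /in1[h1 h2]; have [_ h3] := Hy _ h1.
    exact: (@is_derive_shiftc _ _ y T s).
  - by rewrite -ler_norml.
exact: (leaves_shift SD).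
Qed.

(** The points of the section near the given orbit leave the equilibrium in
    opposite directions on the two sides of the stable manifold. *)
Lemma opposite_sides k : 0 < k -> exists a s1, [/\ `|a| = 1, 0 < s1 < k,
  leaves a mu (Phi phi s1 mu) & leaves (- a) mu (Phi phi (- s1) mu)].
Proof.
move=> k0; have mur : `|mu - mu| < rho by rewrite subrr normr0.
have q00 : 0 < rho / 4 by rewrite divr_gt0.
have [k1 k10 Hg] := gcont q00.
have gphi : g phi mu = 0.
  apply/eqP; rewrite -normr_le0; apply/ler_addgt0Pl => q q0; rewrite addr0.
  by have [q1 q10 H] := gcont q0; apply/ltW/H; rewrite ?subrr ?normr0.
pose k2 := Num.min k1 rho; have k20 : 0 < k2 by rewrite lt_min k10.
have [k21 k2r] : k2 <= k1 /\ k2 <= rho by min_le.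
pose s1 := Num.min (k / 2) (rho / 4).
have s10 : 0 < s1 by rewrite lt_min divr_gt0.
have [s1k s1r] : s1 <= k / 2 /\ s1 <= rho / 4 by min_le.
have gc c : `|c - phi| < k2 -> `|g c mu| < rho / 4.
  by move=> h; apply: Hg; rewrite ?subrr ?normr0//; exact: lt_le_trans h k21.
have side (b tt c s : R) : `|b| = 1 -> `|tt| = 1 -> `|c - phi| < k2 -> 0 <= s -> s < rho / 2 ->
    leaves b mu (Phi c (g c mu + tt * s) mu) -> leaves b mu (Phi phi (tt * s1) mu).
  move=> b1 tt1 ck s0 sr lv.
  pose cp (t : R) := phi + (1 - t) * (c - phi); pose sp (t : R) := s + t * (s1 - s).
  pose S t := g (cp t) mu + tt * sp t.
  have [E0 E1] : cp 0 = c /\ cp 1 = phi by rewrite /cp; split; ring.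
  have [F0 F1] : sp 0 = s /\ sp 1 = s1 by rewrite /sp; split; ring.
  have cpn t : 0 <= t <= 1 -> `|cp t - phi| < k2.
    move=> /andP[t0 t1]; rewrite /cp addrAC subrr add0r normrM ger0_norm ?subr_ge0//.
    by apply: le_lt_trans ck; rewrite ler_piMl// lerBlDr lerDl.
  have spn t : 0 <= t <= 1 -> 0 <= sp t < rho / 2.
    move=> /andP[t0 t1].
    have -> : sp t = (1 - t) * s + t * s1 by rewrite /sp; ring.
    apply/andP; split; first by rewrite addr_ge0// mulr_ge0// ?subr_ge0// ltW.
    have h1 : (1 - t) * s <= (1 - t) * Num.max s (rho / 4) by rewrite ler_wpM2l ?subr_ge0// le_max lexx.
    have h2 : t * s1 <= t * Num.max s (rho / 4) by rewrite ler_wpM2l// le_max s1r orbT.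
    have h3 : Num.max s (rho / 4) < rho / 2 by rewrite gt_max sr/=; lra.
    apply: le_lt_trans h3; have -> : Num.max s (rho / 4) = (1 - t) * Num.max s (rho / 4) + t * Num.max s (rho / 4).
      by ring.
    exact: lerD.
  have Sn t : 0 <= t <= 1 -> `|S t| < rho.
    move=> t01; apply: normD_lt; rewrite normrM tt1 mul1r.
    have := gc _ (cpn t t01); have /andP[h1 h2] := spn t t01.
    by rewrite (ger0_norm h1); lra.
  have cn t : 0 <= t <= 1 -> `|cp t - phi| < rho by move=> /cpn h; exact: lt_le_trans h k2r.
  have cpc (t : R) : {for t, continuous cp}.
    by apply: is_derive_cts; apply: (der_add (der_cst phi t) (der_mul (der_sub (der_cst 1 t) (der_id t)) (der_cst (c - phi) t))).
  have spc (t : R) : {for t, continuous sp}.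
    by apply: is_derive_cts; apply: (der_add (der_cst s t) (der_mul (der_id t) (der_cst (s1 - s) t))).
  have Sc t : 0 <= t <= 1 -> {for t, continuous S}.
    move=> t01; apply: continuousD; last by apply: continuousM => //; exact: cst_continuous.
    apply: (@continuous_comp _ _ _ cp (fun c => g c mu)); first exact: cpc.
    by apply: gcts; apply: lt_le_trans rhok; exact: cn.
  have op a t : `|a| = 1 -> 0 <= t <= 1 -> leaves a mu (Phi (cp t) (S t) mu) ->
      exists2 q, 0 < q & forall t', 0 <= t' <= 1 -> `|t' - t| < q -> leaves a mu (Phi (cp t') (S t') mu).
    move=> a1 t01 lvt; have [q q0 H] := leaves_near a1 qmu mur (Sn t t01) lvt.
    have [q1 q10 H1] := (ctsP _ _).1 (cpc t) q q0.
    have [q2 q20 H2] := (ctsP _ _).1 (Sc t t01) q q0.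
    exists (Num.min q1 q2); first by rewrite lt_min q10.
    move=> t' t01'; rewrite lt_min => /andP[h1 h2].
    by apply: H; rewrite ?subrr ?normr0//; [exact: Sn|exact: H1|exact: H2].
  have br : `|- b| = 1 by rewrite normrN.
  have dis x : leaves b mu x -> ~ leaves (- b) mu x.
    by case: (norm1P b1) => ->; [exact: (leaves_disjoint SD dmu)|rewrite opprK => h1 h2; exact: (leaves_disjoint SD dmu h2 h1)].
  have := @two_phases R (fun t => leaves b mu (Phi (cp t) (S t) mu)) (fun t => leaves (- b) mu (Phi (cp t) (S t) mu)) 0 1 ler01.
  have ES0 : S 0 = g c mu + tt * s by rewrite /S E0 F0.
  have ES1 : S 1 = tt * s1 by rewrite /S E1 F1 gphi add0r.
  rewrite ES0 ES1 E0 E1; apply => //.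
  - move=> t /[dup] t01 /andP[t0 _].
    move: t0; rewrite le_eqVlt => /orP[/eqP t0|t0].
      by left; rewrite -t0 /S E0 F0.
    have [h1|h1] := pselect (leaves b mu (Phi (cp t) (S t) mu)); first by left.
    right; apply: contrapT => h2.
    have [m1 m2] : ~ leaves 1 mu (Phi (cp t) (S t) mu) /\ ~ leaves (-1) mu (Phi (cp t) (S t) mu).
      by case: (norm1P b1) h1 h2 => ->; rewrite ?opprK.
    have := stay_graph qmu mur (cn t t01) (Sn t t01) m1 m2.
    rewrite /S => /eqP; rewrite -subr_eq0 addrAC subrr add0r mulf_eq0 => /orP[/eqP tt0|/eqP sp0].
      by move: tt1; rewrite tt0 normr0 => /esym/eqP; rewrite oner_eq0.
    have : 0 < sp t.
      case/andP: t01 => _ t1; rewrite (_ : sp t = (1 - t) * s + t * s1); last by rewrite /sp; ring.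
      by rewrite ltr_wpDl ?mulr_gt0// mulr_ge0// subr_ge0.
    by rewrite sp0 ltxx.
  - by move=> t _; exact: dis.
  - by move=> t; exact: op.
  - by move=> t; exact: op.
have q0 : 0 < Num.min k2 (rho / 4) by rewrite lt_min k20.
have both sg : `|sg| = 1 -> exists tt, `|tt| = 1 /\ leaves sg mu (Phi phi (tt * s1) mu).
  move=> sg1; have [c1 [s2 []]] := displaced_point sg1 q0.
  rewrite lt_min => /andP[c1k _]; rewrite lt_min => /andP[_ s2r] lv.
  have h := gc c1 c1k.
  have s2g : `|s2 - g c1 mu| < rho / 2 by apply: le_lt_trans (ler_normB _ _) _; lra.
  have [s0|s0] := leP 0 (s2 - g c1 mu).
    exists 1; split; first exact: normr1.
    apply: (side sg 1 c1 (s2 - g c1 mu)) => //; first exact: normr1.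
      by rewrite -(ger0_norm s0).
    by rewrite mul1r [g _ _ + _]addrC subrK.
  exists (-1); split; first by rewrite normrN normr1.
  apply: (side sg (-1) c1 (- (s2 - g c1 mu))) => //; first by rewrite normrN normr1.
  - by rewrite oppr_ge0 ltW.
  - by rewrite -(ltr0_norm s0).
  - by rewrite mulN1r opprK [g _ _ + _]addrC subrK.
have [tp [tp1 lp]] := both 1 (normr1 _).
have n1 : `|-1 : R| = 1 by rewrite normrN normr1.
have [tm [tm1 lm]] := both (-1) n1.
have s1k' : 0 < s1 < k by rewrite s10/=; lra.
have dis := leaves_disjoint SD dmu.
case: (norm1P tp1) lp => ->; case: (norm1P tm1) lm => ->; rewrite !(mul1r, mulN1r) => lm lp.
- by case: (dis _ lp lm).
- by exists 1, s1; rewrite normr1.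
- by exists (-1), s1; rewrite opprK normrN normr1.
- by case: (dis _ lp lm).
Qed.

(** By openness and [opposite_sides] the points above and below the graph keep
    leaving in opposite directions for nearby c and lam; [two_phases] provides a
    staying point between them, which is on the graph by [stay_graph]. *)
Lemma stable_graph_near : exists2 q, 0 < q & forall lam c, Q lam -> `|lam - mu| < q -> `|c - phi| < q ->
  `|g c lam| < rho /\
  ~ leaves 1 lam (Phi c (g c lam) lam) /\ ~ leaves (-1) lam (Phi c (g c lam) lam).
Proof.
have [a [s1 [a1 /andP[s10 s1r] lp lm]]] := opposite_sides rho0.
have ar : `|- a| = 1 by rewrite normrN.
have mur : `|mu - mu| < rho by rewrite subrr normr0.
have s1n : `|s1| < rho by rewrite gtr0_norm.
have s1n' : `|- s1| < rho by rewrite normrN gtr0_norm.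
have [q1 q10 H1] := leaves_near a1 qmu mur s1n lp.
have [q2 q20 H2] := leaves_near ar qmu mur s1n' lm.
exists (Num.min rho (Num.min q1 q2)); first by rewrite !lt_min rho0 q10.
move=> lam c ql; rewrite !lt_min => /and3P[l0 l1 l2] /and3P[c0 c1 c2].
have L1 : leaves a lam (Phi c s1 lam) by apply: H1; rewrite ?subrr ?normr0.
have L2 : leaves (- a) lam (Phi c (- s1) lam) by apply: H2; rewrite ?subrr ?normr0.
have dl : Q lam /\ `|lam - mu| < r by split=> //; exact: lt_le_trans l0 rhor.
have in1 s : - s1 <= s <= s1 -> `|s| < rho.
  by move=> h; apply: le_lt_trans s1r; rewrite ler_norml.
have dis x : leaves a lam x -> ~ leaves (- a) lam x.
  by case: (norm1P a1) => ->; [exact: (leaves_disjoint SD dl)|rewrite opprK => h1 h2; exact: (leaves_disjoint SD dl h2 h1)].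
have ss : - s1 <= s1 by lra.
suff [s sr [n1 n2]] : exists2 s, - s1 <= s <= s1 & ~ leaves a lam (Phi c s lam) /\ ~ leaves (- a) lam (Phi c s lam).
  have [m1 m2] : ~ leaves 1 lam (Phi c s lam) /\ ~ leaves (-1) lam (Phi c s lam).
    by case: (norm1P a1) n1 n2 => ->; rewrite ?opprK.
  have E := stay_graph ql l0 c0 (in1 s sr) m1 m2.
  by rewrite -E; split; [exact: in1|].
apply: contrapT => no.
have op b s : `|b| = 1 -> - s1 <= s <= s1 -> leaves b lam (Phi c s lam) ->
   exists2 q, 0 < q & forall s', - s1 <= s' <= s1 -> `|s' - s| < q -> leaves b lam (Phi c s' lam).
  move=> b1 sr lv; have [q q0 H] := leaves_near b1 ql l0 (in1 s sr) lv.
  by exists q => // s' sr' sq; apply: H; rewrite ?subrr ?normr0//; exact: in1.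
have := @two_phases R (fun s => leaves (- a) lam (Phi c s lam)) (fun s => leaves a lam (Phi c s lam)) (- s1) s1 ss.
move=> /(_ _ _ _ _ L2) h; apply: (dis _ L1); apply: h.
- move=> s sr; have [h1|h1] := pselect (leaves a lam (Phi c s lam)); first by right.
  by left; apply: contrapT => h2; apply: no; exists s.
- by move=> s _ h1 h2; exact: dis h2 h1.
- by move=> s; exact: op.
- by move=> s; exact: op.
Qed.

Lemma stable_close : exists2 q, 0 < q & forall lam c, Q lam -> `|lam - mu| < q -> `|c - phi| < q ->
  exists x, stable_tail f Psi delta lam (Psi (c, g c lam, delta) lam) w e x.
Proof.
have [q q0 H] := stable_graph_near.
exists (Num.min q rho); first by rewrite lt_min q0.
move=> lam c ql; rewrite !lt_min => /andP[l1 l2] /andP[c1 c2].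
by have [h1 [h2 h3]] := H lam c ql l1 c1; exact: stay.
Qed.

End Fixed.

Lemma stable_side e : 0 < e -> exists2 q, 0 < q & forall lam c, Q lam -> `|lam - mu| < q -> `|c - phi| < q ->
  exists x, stable_tail f Psi delta lam (Psi (c, g c lam, delta) lam) w e x.
Proof.
move=> e0; pose e' := Num.min e (Num.min r d).
have e'0 : 0 < e' by rewrite !lt_min e0 r0 d_gt0.
have [e'e e'r e'd] : [/\ e' <= e, e' <= r & e' <= d] by min_le.
pose e2 := e' / (8 * C + 4).
have e20 : 0 < e2 by rewrite divr_gt0// addr_gt0// mulr_gt0.
have [T' HT'] := (cvg_pinfty0 w).1 wE e2 e20.
pose T := Num.max 1 (T' + 2).
have T1 : 1 <= T by rewrite le_max lexx.
have T0 : 0 <= T := le_trans ler01 T1.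
have TT' : T' + 2 <= T by rewrite le_max lexx orbT.
have wT (t : R) : T - 1 <= t -> `|w t| < e2 by move=> h; apply: HT'; lra.
have wc t : 0 <= t -> {for t, continuous w} by move=> /dw; exact: is_derive_cts.
have [M1 M10 HM] : exists2 M1, 0 < M1 & forall t, 0 <= t <= T + 1 -> `|w t| <= M1.
  by apply: path_bounded => t /andP[t0 _]; exact: wc.
pose M := Num.max (M1 + 1) r.
have rM : r <= M by rewrite le_max lexx orbT.
have wM (t : R) : 0 <= t <= T + 1 -> `|w t| + 1 <= M.
  by move=> /HM h; rewrite le_max; apply/orP; left; rewrite lerD2r.
have Kb : 0 < K + beta by rewrite addr_gt0//; exact: fb_beta FB.
pose tau := Num.min (K + beta)^-1 1.
have tau0 : 0 < tau by rewrite lt_min invr_gt0 Kb ltr01.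
have tauT : 0 < tau <= T by rewrite tau0/=; apply: le_trans T1; rewrite ge_min lexx orbT.
have tauK : (K + beta) * tau <= 1.
  by rewrite mulrC -ler_pdivlMr// mul1r ge_min lexx.
have [_ /ltW dltR'] := andP dltR.
have [|||||rf rf0 Hf] := section_far FB dR (S := Sigma_out_plus delta) (w := w) (a := tau) (b := T) qmu.
- by move=> v [h1 h2]; split=> //; rewrite h1 gtr0_norm.
- by move=> c c' s u [h1 h2]; split.
- exact: Sigma_out_compact.
- by move=> t /andP[t0 _]; apply: wc; apply: le_trans t0; exact: ltW.
- by move=> t /andP[t0 _]; apply: wS; exact: lt_le_trans tau0 t0.
pose e3 := Num.min (Num.min e2 rf) 1.
have e30 : 0 < e3 by rewrite !lt_min e20 rf0 ltr01.
have [e32 e3f e31] : [/\ e3 <= e2, e3 <= rf & e3 <= 1] by min_le.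
have z0T : 0 <= (0 : R) <= T by rewrite lexx.
have [||rt rt0 Ht] := track fL (w := w) (M := M) qmu z0T e30.
- by move=> t /andP[t0 _]; exact: dw.
- move=> t /andP[t0 tT]; apply: le_trans (wM t _); first by rewrite lerD2l.
  by rewrite t0 (le_trans tT)// lerDl.
pose rho := Num.min (Num.min (Num.min r kap) (Num.min delta rt)) (Num.min rf (rt / K)).
have rho0 : 0 < rho by rewrite !lt_min r0 kap0 d0 rt0 rf0 divr_gt0.
have [R1 R2 R3] : [/\ rho <= r, rho <= kap & rho <= delta] by min_le.
have [R4 R5 R6] : [/\ rho <= rt, rho <= rf & rho <= rt / K] by min_le.
have HT lam c s : Q lam -> `|lam - mu| < rho -> `|c - phi| < rho -> `|s| < rho ->
    forall t : R, 0 <= t <= T -> let y := cflow M lam (Psi (c, s, delta) lam) in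
    [/\ `|y t - w t| < e2, is_derive t 1 y (f (y t) lam) & tau <= t -> ~ Sigma_out Psi delta lam (y t)].
  move=> ql lr cr sr t tT y.
  have y0 : `|Psi (c, s, delta) lam - w 0| < rt.
    rewrite w0; apply: le_lt_trans (fb_Psi_lip FB ql qmu _ _) _.
    - by apply/boxd/ltW; exact: lt_le_trans sr R3.
    - by apply: boxd; rewrite normr0 ltW.
    rewrite [K * _]mulrC -ltr_pdivlMr// gt_max (lt_le_trans lr R6) andbT.
    by rewrite !norm_pairB !gt_max subr0 subrr normr0 divr_gt0// (lt_le_trans cr R6) (lt_le_trans sr R6).
  have [h1 h2] := Ht lam _ ql (lt_le_trans lr R4) y0 t tT.
  rewrite subr0 in h1 h2; split.
  - exact: lt_le_trans h1 e32.
  - by apply: der_ext h2 => s'; rewrite subr0.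
  - move=> taut; apply: (Hf t lam (y t)) => //; first by case/andP: tT => _ ->; rewrite taut.
      exact: lt_le_trans lr R5.
    exact: lt_le_trans h1 e3f.
have [q q0 H] := stable_close e'0 e'r e'd T1 wT wM rM tauT tauK rho0 R1 R2 R3 HT.
exists q => // lam c ql lq cq; have [x [x1 x2 x3 x4 x5]] := H lam c ql lq cq.
exists x; split=> // t t0; case: (x5 t t0) => h; [left|right]; exact: lt_le_trans h e'e.
Qed.

End StableSide.

(** * The unstable manifold of the equilibrium near a connecting orbit *)

Section UnstableSide.
Hypothesis f0 : f 0 mu = 0.
Variables (c0 : R) (u : R -> V).
Let v0 : coord := (c0, delta, 0).
Hypothesis du : forall t : R, is_derive t 1 u (f (u t) mu).
Hypothesis uP : forall t : R, 0 <= t -> u t = Psi (bflow mu v0 t) mu.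
Hypothesis uE : u t @[t --> -oo] --> (0 : V).
Hypothesis uS : forall t : R, t < 0 -> ~ Sigma_in Psi delta mu (u t).
Variables (hc hu : R * R -> R).
Hypothesis hW : forall lam v, Q lam -> WuE_in f Psi delta lam v ->
  exists k : int, v = (hc lam + 4 * pi * k%:~R, delta, hu lam).

(** A solution converging to the equilibrium in backward time lies in the
    unstable cone. *)
Lemma backward_in_cone (x : R -> V) : esol F mu x -> x t @[t --> -oo] --> (0 : V) ->
  forall t : R, 0 <= cone Y Qf (x t).
Proof.
move=> ex /cvg_ninfty0 xE t; rewrite leNgt; apply/negP => ct.
pose m := - cone Y Qf (x t); have m0 : 0 < m by rewrite oppr_gt0.
have [q q0 Hq] := cone_continuous SD 0 m0.
have [T HT] := xE q q0; set s := Num.min t (T - 1).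
have st : s <= t by rewrite ge_min lexx.
have sT : s < T by rewrite gt_min ltrBlDr ltrDl ltr01 orbT.
have [|h _] := Hq (x s); first by rewrite subr0; exact: HT.
have := cone_back0 SD dmu ex (esol0 SD dmu) st; rewrite !subr0 => hb.
have : cone Y Qf (x t) * expR (2 * cs * (t - s)) <= cone Y Qf (x t).
  rewrite -[leRHS]mulr1 ler_nM2l// -expR0 ler_expR mulr_ge0 ?subr_ge0//.
  by rewrite mulr_ge0// ltW.
have c00 : cone Y Qf 0 = 0 by rewrite /cone (saddle_Y0 SD) (saddle_Qf0 SD) expr0n/= subr0.
by move: h; rewrite c00 subr0 => /ltr_normlP[h _] h'; rewrite /m in h; lra.
Qed.

(** The piece of the unstable manifold near the equilibrium that is hit by the
    given orbit persists. *)
Lemma local_unstable e T0 : 0 < e -> e <= r -> (forall t : R, t <= - T0 -> `|u t| < e / (4 * (C + 1) ^+ 2)) ->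
  (exists t, u t != 0) ->
  exists2 A, 0 < A & forall lam, Q lam -> `|lam - mu| < r -> exists X : R -> V,
    [/\ forall t : R, t <= 0 -> is_derive t 1 X (f (X t) lam), forall t : R, t <= 0 -> `|X t| < e,
        X t @[t --> -oo] --> (0 : V) & `|X 0 - u (- T0)| <= A * `|lam - mu|].
Proof.
move=> e0 er ue [t1 ut1]; set e2 := e / _ in ue.
have C1 : 1 <= (C + 1) ^+ 2 by rewrite exprn_ege1// lerDr ltW.
have C41 : 1 <= 4 * (C + 1) ^+ 2 by lra.
have C40 : 0 < 4 * (C + 1) ^+ 2 by lra.
have e20 : 0 < e2 by rewrite divr_gt0.
have e2e : e2 <= e by rewrite /e2 ler_pdivrMr// ler_peMr// ltW.
have mur : `|mu - mu| < r by rewrite subrr normr0.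
pose xu := gflow F mu (u (- T0)).
have exu : esol F mu xu by exact: (esol_gflow SD (u (- T0)) dmu).
have xuE (t : R) : t <= 0 -> xu t = u (t - T0).
  move=> t0; have tt0 : t <= (0 : R) <= 0 by rewrite t0 lexx.
  have := @saddle_flow mu (fun t => u (t - T0)) t 0 qmu mur tt0.
  rewrite sub0r => H; symmetry; apply: H.
  - move=> s /andP[_ s0]; apply/ltW; apply: lt_le_trans (ue _ _) (le_trans e2e er); lra.
  - by move=> s _; exact: (@is_derive_shiftc _ _ u (- T0) s).
  - by rewrite lexx.
have xu0 : xu 0 = u (- T0) by rewrite xuE// sub0r.
have xuZ : xu t @[t --> -oo] --> (0 : V).
  apply/cvg_ninfty0 => q q0; have [S HS] := (cvg_ninfty0 u).1 uE q q0.
  exists (Num.min 0 (S + T0)) => t; rewrite lt_min => /andP[t0 tS].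
  by rewrite xuE ?(ltW t0)//; apply: HS; rewrite ltrBlDr.
have cn := backward_in_cone exu xuZ.
set k := Y (u (- T0)).
have k0 : k != 0.
  apply/eqP => Yk; have := cn 0; rewrite xu0 /cone -/k Yk expr0n/= sub0r oppr_ge0 => Q0.
  have := sd_norm SD (u (- T0)); rewrite -/k Yk expr0n/= add0r => h.
  have h0 : u (- T0) = 0.
    apply/eqP; rewrite -normr_eq0 -sqrf_eq0 eq_le sqr_ge0 andbT.
    by apply: le_trans h _; rewrite pmulr_rle0.
  have dz (t : R) : is_derive t 1 (fun=> 0 : V) (f 0 mu) by rewrite f0; exact: der_cst.
  have uz t : u t = 0.
    have [tT|/ltW tT] := leP t (- T0).
      apply: (solution_unique (x := u) (y := fun=> 0) fL qmu tT (fun s _ => du s) (fun s _ => dz s)) => //.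
        by right.
      by rewrite lexx.
    apply: (solution_unique (x := u) (y := fun=> 0) fL qmu tT (fun s _ => du s) (fun s _ => dz s)) => //.
      by left.
    by rewrite tT lexx.
  by rewrite uz eqxx in ut1.
have kn : 0 < `|k| by rewrite normr_gt0.
pose sg := k / `|k|.
have sg1 : `|sg| = 1 by rewrite normrM normfV normr_id divff// gt_eqF.
have sgk : sg * `|k| = k by rewrite divfK// gt_eqF.
have bu : branch_sol F Y Qf mu (sg * `|k|) xu by split=> [||t _]//; rewrite xu0 sgk.
have ics : 0 < cs^-1 by rewrite invr_gt0.
exists (C * (1 + cs^-1)); first by rewrite mulr_gt0// addr_gt0.
move=> lam ql lr; have dl : Q lam /\ `|lam - mu| < r by [].
have [X bX] := branch_sol_exists SD dl sg1 kn.
have [eX X0 _] := bX.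
have kB : `|k| <= C * e2.
  by apply: le_trans (sd_Y SD _) _; rewrite ler_pM2l//; apply/ltW/ue.
have XB t : t <= 0 -> `|X t| ^+ 2 <= (e / 2) ^+ 2 * expR (2 * cs * t).
  move=> t0; apply: le_trans (branch_sol_decay SD dl bX t0) _.
  rewrite sgk ler_wpM2r ?expR_ge0//.
  have h : k ^+ 2 <= (C * e2) ^+ 2.
    by rewrite -[k ^+ 2]real_normK ?num_real// lerXn2r ?nnegrE// mulr_ge0// ltW.
  apply: (@le_trans _ _ (2 * C * (C * e2) ^+ 2)); first by rewrite ler_wpM2l// mulr_ge0// ltW.
  have Ee : e = e2 * (4 * (C + 1) ^+ 2) by rewrite /e2 divfK// gt_eqF.
  rewrite Ee; have -> : (e2 * (4 * (C + 1) ^+ 2) / 2) ^+ 2 = 4 * e2 ^+ 2 * (C + 1) ^+ 4 by field.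
  have -> : 2 * C * (C * e2) ^+ 2 = 4 * e2 ^+ 2 * (C ^+ 3 / 2) by field.
  have e22 : 0 < e2 ^+ 2 by exact: exprn_gt0.
  have e24 : 0 < 4 * e2 ^+ 2 by apply: mulr_gt0.
  rewrite (ler_pM2l e24).
  have -> : (C + 1) ^+ 4 = C ^+ 4 + 4 * C ^+ 3 + 6 * C ^+ 2 + 4 * C + 1 by ring.
  have p3 : 0 <= C ^+ 3 by rewrite exprn_ge0 ?ltW.
  have p4 : 0 <= C ^+ 4 by rewrite exprn_ge0 ?ltW.
  have p2 : 0 <= C ^+ 2 by exact: sqr_ge0.
  by have := C0; lra.
have Xe t : t <= 0 -> `|X t| < e.
  move=> t0; have h : `|X t| ^+ 2 <= (e / 2) ^+ 2.
    apply: le_trans (XB t t0) _; rewrite ler_piMr ?sqr_ge0// -expR0 ler_expR.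
    by rewrite mulr_ge0_le0// mulr_ge0// ltW.
  have : `|X t| <= e / 2 by rewrite -ler_sqr ?nnegrE ?divr_ge0// ltW.
  move=> h'; apply: le_lt_trans h' _; by frac_lt.
exists X; split=> //.
- move=> t t0; rewrite -(Fid ql lr); last by apply/ltW; apply: lt_le_trans (Xe t t0) er.
  exact: eX.
- apply/cvg_ninfty0 => q q0.
  have [|t tt|S HS] := (cvg_pinfty0 (fun t => X (- t))).1 (decay_cvg (B := (e / 2) ^+ 2) (k := 2 * cs) (T := 0) _ _) q q0.
  - by rewrite mulr_gt0.
  - by have := XB (- t); rewrite oppr_le0 subr0 mulrN mulNr; exact.
  by exists (- S) => t tS; have := HS (- t); rewrite opprK; apply; rewrite ltrNr.
- have := branch_sol_close SD dl dmu bX bu; rewrite xu0 => h.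
  rewrite -ler_sqr ?nnegrE ?mulr_ge0 ?addr_ge0 ?(ltW ics) ?(ltW C0)//.
  apply: le_trans h _.
  have -> : C * (C * `|lam - mu| ^+ 2 / cs) = (C * `|lam - mu|) ^+ 2 * cs^-1 by ring.
  have -> : (C * (1 + cs^-1) * `|lam - mu|) ^+ 2 = (C * `|lam - mu|) ^+ 2 * (1 + cs^-1) ^+ 2 by ring.
  rewrite ler_wpM2l ?sqr_ge0//.
  have -> : (1 + cs^-1) ^+ 2 = 1 + 2 * cs^-1 + cs^-1 ^+ 2 by ring.
  by have := sqr_ge0 (cs^-1); lra.
Qed.

Lemma orbit_lipschitz (a b : R) : exists2 L, 0 < L & forall s t : R, a <= s <= b -> a <= t <= b ->
  `|u t - u s| <= L * `|t - s|.
Proof.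
have [M M0 HM] : exists2 M, 0 < M & forall t, a <= t <= b -> `|u t| <= M.
  by apply: path_bounded => t _; exact: is_derive_cts (du t).
have [Kf Kf0 HK] := fL M; exists (Kf * M); first exact: mulr_gt0.
have db t : a <= t <= b -> `|f (u t) mu| <= Kf * M.
  move=> tab; have := HK mu mu (u t) 0 qmu qmu (HM t tab).
  rewrite normr0 f0 !subr0 max_normBl => /(_ (ltW M0)) h.
  by apply: le_trans h _; rewrite ler_pM2l// HM.
suff H s t : s <= t -> a <= s <= b -> a <= t <= b -> `|u t - u s| <= Kf * M * `|t - s|.
  move=> s t sab tab; have [st|/ltW st] := leP s t; first exact: H.
  by rewrite distrC [`|t - s|]distrC; exact: H.
move=> st /andP[as1 _] /andP[_ tb]; rewrite (ger0_norm (x := t - s)) ?subr_ge0//.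
apply: (@mvt_le_cst R V _ u (fun t => f (u t) mu) (Kf * M) s t st) => q /andP[sq qt].
by apply: db; rewrite (le_trans as1)//= (le_trans qt).
Qed.

(** The orbit is followed from near the equilibrium up to the section; its
    crossing point is (hc, delta, hu) because W^u(E) has no other point in the
    section up to periods. *)
Lemma unstable_side e : 0 < e -> exists2 q, 0 < q & forall lam, Q lam -> `|lam - mu| < q ->
  exists x, unstable_tail f Psi delta lam (Psi (hc lam, delta, hu lam) lam) u e x.
Proof.
move=> e0; have [_ dR8] := andP dR; have [_ dltR'] := andP dltR.
pose e' := Num.min e (Num.min r d).
have e'0 : 0 < e' by rewrite !lt_min e0 r0 d_gt0.
have [e'e e'r e'd] : [/\ e' <= e, e' <= r & e' <= d] by min_le.
have C20 : 0 < 4 * (C + 1) ^+ 2.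
  by rewrite mulr_gt0// exprn_gt0// addr_gt0.
have e20 : 0 < e' / (4 * (C + 1) ^+ 2) by rewrite divr_gt0.
have [T' HT'] := (cvg_ninfty0 u).1 uE _ e20.
pose T0 := Num.max 2 (1 - T').
have T02 : 2 <= T0 by rewrite le_max lexx.
have T0T : 1 - T' <= T0 by rewrite le_max lexx orbT.
have uT (t : R) : t <= - T0 -> `|u t| < e' / (4 * (C + 1) ^+ 2) by move=> h; apply: HT'; lra.
have bv00 : box R0 v0 by split; rewrite /vs /vu/= ?normr0 ?(ltW R00)// gtr0_norm// ltW.
have u0 : u 0 = Psi v0 mu by rewrite uP// (bflow0 FB).
have un0 : exists t, u t != 0.
  exists 0; rewrite u0 -normr_gt0; apply: lt_le_trans (Hd qmu bv00); exact: d_gt0.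
have [A A0 HA] := local_unstable e'0 e'r uT un0.
have [L L0 HL] := orbit_lipschitz (- T0 - 1) 1.
have eL : 0 < e / (2 * L) by rewrite divr_gt0// mulr_gt0.
have [tau [e4 [tau0 tau2 tau3 [e40 bt2] Hcross]]] := cross_in FB dR c0 qmu eL.
have [rf rf0 Hf] := fb_open FB e40.
have [|||||rs rs0 Hs] := section_far FB dR (S := Sigma_in_plus delta) (w := u) (a := - T0) (b := - tau) qmu.
- by move=> v [h1 h2]; split=> //; rewrite h1 gtr0_norm.
- by move=> c c' s q [h1 h2]; split.
- exact: Sigma_in_compact.
- by move=> t _; exact: is_derive_cts (du t).
- by move=> t /andP[_ tt]; apply: uS; lra.
pose e3 := Num.min (Num.min (e / 2) rs) (rf / 2).
have e30 : 0 < e3 by rewrite !lt_min rs0 !divr_gt0.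
have [e31 e32 e33] : [/\ e3 <= e / 2, e3 <= rs & e3 <= rf / 2] by min_le.
have zT : - T0 <= - T0 <= 1 by rewrite lexx/=; lra.
have [M1 M10 HM] : exists2 M, 0 < M & forall t, - T0 <= t <= 1 -> `|u t| <= M.
  by apply: path_bounded => t _; exact: is_derive_cts (du t).
pose M := M1 + e3; have M0 : 0 <= M by rewrite addr_ge0 ?ltW.
have [|rt rt0 Ht] := track fL (w := u) (M := M) qmu zT e30 (fun t _ => du t).
  by move=> t /HM h; rewrite lerD2r.
pose q := Num.min (Num.min (Num.min r rs) (Num.min rt (rt / A))) (Num.min (rf / (2 * K)) e4).
have q0 : 0 < q by rewrite !lt_min r0 rs0 rt0 e40 !divr_gt0// mulr_gt0.
have [q1 q2 q3] : [/\ q <= r, q <= rs & q <= rt] by min_le.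
have [q4 q5 q6] : [/\ q <= rt / A, q <= rf / (2 * K) & q <= e4] by min_le.
exists q => // lam ql lq.
have [X [dX Xe XE X0]] := HA lam ql (lt_le_trans lq q1).
have X0t : `|X 0 - u (- T0)| < rt.
  by apply: le_lt_trans X0 _; rewrite mulrC -ltr_pdivlMr//; exact: lt_le_trans lq q4.
have HZ := Ht lam (X 0) ql (lt_le_trans lq q3) X0t.
clear C20 e20 T0T eL e30 M10 rt0 q0 q1 q3 q4 X0t X0 A0 HM Ht HA e'0 e'r uT.
have T0n : - T0 <= - 2 by rewrite lerN2.
have T01 : - T0 <= - 1 by apply: le_trans T0n _; rewrite lerN2 ler1n.
have tauT1 : - T0 <= - tau by apply: le_trans T01 _; rewrite lerN2.
pose y t := cflow M lam (X 0) (t - - T0).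
pose xm t := X (t + T0).
pose Z := glue (- T0) xm y.
have Zm : xm (- T0) = y (- T0) by rewrite /xm /y addrC subrr subrr (cflow0 fL).
have Z1 t : t <= - T0 -> Z t = X (t + T0) by rewrite /Z /glue => ->.
have Z2 t : - T0 <= t -> Z t = y t.
  by rewrite le_eqVlt => /orP[/eqP <-|tT]; [rewrite Z1// -Zm|rewrite /Z /glue leNgt tT].
have dZ (t : R) : t <= 1 -> is_derive t 1 Z (f (Z t) lam).
  move=> t1'; apply: (@glue_der R V (f ^~ lam) (- T0) xm y t Zm) => tT.
    by apply: (@is_derive_shiftc _ _ X T0 t); apply: dX; lra.
  by have [|_ h] := HZ t; rewrite ?tT.
have Zu t : - T0 <= t <= 1 -> `|Z t - u t| < e3.
  by move=> tt; rewrite Z2; [have [h _] := HZ t tt|case/andP: tt].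
have Ze t : t <= - T0 -> `|Z t| < e' by move=> tT; rewrite Z1//; apply: Xe; lra.
(* the orbit near the section, in the flow box *)
have ntau : - tau <= tau by apply: le_trans (ltW tau0); rewrite oppr_le0 ltW.
have tauT : - T0 <= tau <= 1 by rewrite tau2 andbT (le_trans tauT1).
have utau : u tau = Psi (bflow mu v0 tau) mu by rewrite uP// ltW.
have bt : box R0 (bflow mu v0 tau).
  have hR : R0 / 2 <= R0 by rewrite ler_pdivrMr// ler_peMr ?(ltW R00)// ler1n.
  by case: bt2 => h1 h2; split; apply: le_trans hR.
have [|v' v'v [bv' v'Z]] := Hf lam (bflow mu v0 tau) (Z tau) ql bt2.
  rewrite -[Z tau](subrK (u tau)) -addrA; apply: normD_lt.
  have h1 := lt_le_trans (Zu tau tauT) e33.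
  have h2 : `|u tau - Psi (bflow mu v0 tau) lam| <= K * `|lam - mu|.
    rewrite utau; apply: le_trans (fb_Psi_lip FB qmu ql bt bt) _.
    by rewrite max_normBr [`|mu - lam|]distrC.
  have h3 : K * `|lam - mu| < rf / 2.
    rewrite mulrC -ltr_pdivlMr//; apply: lt_le_trans lq _; apply: le_trans q5 _.
    by rewrite invfM mulrA.
  by lra.
pose b t := bflow lam v' (t - tau).
have [Hb [tc tctt vsc]] := Hcross lam v' ql (lt_le_trans lq q6) v'v.
clear q5 q6 rf0 Hf e33 v'v bt2 bt utau Hcross HZ e40.
have bbox t : - tau <= t <= tau -> box R0 (b t).
  move=> tt; have [/andP[h1 h2] h3] := Hb t tt; split; first by rewrite gtr0_norm.
  by apply: le_trans h3 _; exact: ltW.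
have Zb t : - tau <= t <= tau -> Z t = Psi (b t) lam.
  apply: (bflow_follow FB fL ql ntau) => // [s /andP[_ st]|].
    by apply: dZ; exact: le_trans st tau2.
  by right; rewrite subrr (bflow0 FB).
have Sv1 : WuE_in f Psi delta lam (b tc) -> Psi (b tc) lam = Psi (hc lam, delta, hu lam) lam.
  move=> /(hW ql)[k E1]; rewrite E1 (Psi_per4 FB)//.
  have := bbox tc tctt; rewrite E1; case=> h1 h2; split; [exact: h1|exact: h2].
have [tc1 tc2] := andP tctt.
have tct (t : R) : t <= 0 -> t + tc <= tau by move=> t0; apply: le_trans tc2; rewrite gerDr.
have tct1 (t : R) : t <= 0 -> t + tc <= 1 by move=> t0; apply: le_trans (tct t t0) tau2.
pose x t := Z (t + tc).
have x0 : x 0 = Psi (b tc) lam by rewrite /x add0r Zb.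
have dx (t : R) : t <= 0 -> is_derive t 1 x (f (x t) lam).
  by move=> tt; apply: (@is_derive_shiftc _ _ Z tc t); apply: dZ; exact: tct1.
have xE : x t @[t --> -oo] --> (0 : V).
  apply/cvg_ninfty0 => q' q'0; have [S HS] := (cvg_ninfty0 X).1 XE q' q'0.
  exists (Num.min (- T0 - tc) (S - T0 - tc)) => t; rewrite lt_min => /andP[h1 h2].
  have h1' : t + tc <= - T0 by rewrite -lerBrDr ltW.
  by rewrite /x Z1//; apply: HS; rewrite -!ltrBrDr.
have xS (t : R) : t < 0 -> ~ Sigma_in Psi delta lam (x t).
  move=> tt; rewrite /x; have [h|h] := leP (- tau) (t + tc); last first.
    have [h'|h'] := leP (- T0) (t + tc).
      have := Hs (t + tc) lam (Z (t + tc)); apply => //.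
      - by rewrite h' ltW.
      - exact: lt_le_trans lq q2.
      - by apply: lt_le_trans (Zu _ _) e32; rewrite h' tct1// ltW.
    move=> [v Sv vZ]; have := Hd (v := v) ql; rewrite vZ.
    move=> /(_ _) hd; have := Ze (t + tc) (ltW h'); rewrite ltNge; apply/negP; rewrite negbK.
    apply: le_trans e'd (hd _); case: v Sv {vZ hd} => [[vc1 vs1] vu1] [h1 h2].
    split; rewrite /vs /vu /= in h1 h2 *; first by rewrite h1 gtr0_norm// ltW.
    by apply: le_trans h2 _; exact: ltW.
  have tt' : - tau <= t + tc <= tau by rewrite h tct// ltW.
  rewrite (Zb _ tt') => /(Sigma_inP FB dR ql (bbox _ tt'))[h1 _].
  have ttc : t + tc - tau <= tc - tau by rewrite lerD2r gerDr ltW.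
  have := bflow_vs_decay FB (v0 := v') ql ttc (bbox _ tt').1; rewrite -/(b tc) -/(b (t + tc)) h1 vsc gtr0_norm//.
  rewrite -[X in X <= _]mulr1 ler_pM2l// leNgt => /negP; apply.
  rewrite -expR0 ltr_expR mulNr oppr_lt0 mulr_gt0// subr_gt0.
  by rewrite ltrD2r gtrDr.
have W : WuE_in f Psi delta lam (b tc).
  split; first by split=> //; exact: (Hb tc tctt).2.
  by exists x; split=> // t /=; rewrite in_itv/= => tt; exact: dx.
exists x; split=> [t /=|||//|].
- by rewrite in_itv/= => tt; exact: dx.
- by rewrite x0 Sv1.
- exact: xE.
- move=> t tt; have [h|h] := leP (t + tc) (- T0).
    by right; apply: lt_le_trans e'e; exact: Ze.
  left; rewrite /x -[Z _](subrK (u (t + tc))) -addrA; apply: normD_lt.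
  have h1 : `|Z (t + tc) - u (t + tc)| < e3 by apply: Zu; rewrite ltW//= tct1.
  have h2 : `|u (t + tc) - u t| <= L * `|tc|.
    have -> : `|tc| = `|t + tc - t| by rewrite addrAC subrr add0r.
    have tlo : - T0 - 1 <= t.
      rewrite lerBlDr; apply: le_trans (ltW h) _; rewrite lerD2l.
      exact: le_trans tc2 tau2.
    apply: HL; first by rewrite tlo (le_trans tt)// ler01.
    by rewrite tct1// andbT (le_trans _ (ltW h))// gerBl ler01.
  have h3 : L * `|tc| <= e / 2.
    apply: (@le_trans _ _ (L * tau)); first by rewrite ler_pM2l// ler_norml.
    by rewrite mulrC -ler_pdivlMr//; apply: le_trans tau3 _; rewrite invfM mulrA.
  rewrite [e]splitr; apply: ltr_leD; first exact: lt_le_trans h1 e31.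
  exact: le_trans h2 h3.
Qed.

End UnstableSide.

End NearEquilibrium.

(** * Homoclinic orbits and solutions of the bifurcation equation *)

Section Assembly.
Context {R : realType}.
Local Notation V := 'rV[R]_3.
Local Notation coord := (R * R * R)%type.
Variables (a1 b1 a2 b2 : R).
Local Notation Q := (`[a1, b1] `*` `[a2, b2] : set (R * R)).
Hypotheses (a10b1 : a1 < 0 < b1) (a2b2 : a2 < b2).
Variables (f : V -> R * R -> V) (Psi : coord -> R * R -> V).
Hypothesis f_smooth : smooth_on ([set: V] `*` Q) (fun q => f q.1 q.2).
Hypothesis f_hyp : forall lam, Q lam -> hyperbolic_equilibrium (f ^~ lam) 0 1 2.
Variable P : R -> R * R -> V.
Hypothesis PsiP : forall lam c, Q lam -> Psi (c, 0, 0) lam = P c lam.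
Variables (alps alpu : R * R -> R) (Fs Fu : coord -> R * R -> R) (R0 beta K : R).
Hypothesis FB : flow_box Q f Psi alps alpu Fs Fu R0 beta K.
Variable delta : R.
Hypothesis dR : 0 < delta <= R0 / 8.
Variables (U : set (R * (R * R))) (g : R -> R * R -> R) (eps : R) (z : R -> R -> R) (hu hc : R * R -> R).
Local Notation lam0 phi := ((0, z phi 0) : R * R).
Hypothesis U_open : exists2 O, open O & U = O `&` (setT `*` Q).
Hypothesis U_per : forall phi lam, U (phi + 4 * pi, lam) <-> U (phi, lam).
Hypothesis Gamma_U : Gamma f Psi delta Q `<=` U.
Hypothesis g_smooth : smooth_on U (fun q => g q.1 q.2).
Hypothesis g_per : forall phi lam, U (phi, lam) -> g (phi + 4 * pi) lam = g phi lam.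
Hypothesis eps0 : 0 < eps.
Hypothesis Ws_graph : forall lam, Q lam ->
  [set v | [/\ WsE_out f Psi delta lam v, `|vs v| < eps & U (vc v, lam)]] =
  [set (phi, g phi lam, delta) | phi in [set phi | U (phi, lam)]].
Hypothesis g_lam2 : forall phi lam, U (phi, lam) -> partial2 (g phi) lam != 0.
Hypothesis z_smooth : smooth_on ([set: R] `*` `[a1, b1]) (fun q => z q.1 q.2).
Hypothesis z_per : forall phi, z (phi + 4 * pi) 0 = z phi 0.
Hypothesis zJ : forall phi, a2 <= z phi 0 <= b2.
Hypothesis Gamma_z : Gamma f Psi delta Q = [set (q.1, (q.2, z q.1 q.2)) | q in setT `*` `[a1, b1]].
Hypothesis hu_smooth : smooth_on Q hu.
Hypothesis hc_smooth : smooth_on Q hc.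
Hypothesis huB : forall lam, Q lam -> `|hu lam| <= delta.
Hypothesis Wu_point : forall lam, Q lam ->
  WuE_in f Psi delta lam = [set (hc lam + 4 * pi * k%:~R, delta, hu lam) | k in [set: int]].
Hypothesis hu0 : forall lam2, a2 <= lam2 <= b2 -> hu (0, lam2) = 0 /\ 0 < partial1 hu (0, lam2).
Variable q : R.
Hypothesis q1 : q < 1.
Hypothesis hc_contr : forall phi, `|derive1 (fun phi => hc (0, z phi 0)) phi| <= q.
Variable I2 : set R.
Hypothesis I2J : I2 `<=` `[a2, b2].
Hypothesis I2max : forall mu2, a2 <= mu2 <= b2 ->
  (exists u w, EtoP_cycle (f ^~ (0, mu2)) (P ^~ (0, mu2)) u w) -> I2 mu2.

Local Notation bflow := (bflow alps alpu Fs Fu R0).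
Local Notation passage := (passage alps alpu Fs Fu R0).
Local Notation reach := (reach alps alpu Fs Fu R0 delta g hu hc).

Let d0 : 0 < delta. Proof. by case/andP: dR. Qed.
Let fL : field_lip Q f := smooth_field_lip f_smooth.
Let f0 lam : Q lam -> f 0 lam = 0. Proof. by move=> /f_hyp[]. Qed.
Let Q0 phi : Q (lam0 phi) := lam0Q a10b1 zJ phi.
Let Q0J mu2 : a2 <= mu2 <= b2 -> Q (0, mu2).
Proof. by move=> h; apply/QP; split=> //=; case/andP: a10b1 => h1 h2; rewrite !ltW. Qed.

Lemma GammaP phi mu2 : a2 <= mu2 <= b2 -> WsE_out f Psi delta (0, mu2) (phi, 0, delta) ->
  mu2 = z phi 0.
Proof.
move=> hm W; have : Gamma f Psi delta Q (phi, (0, mu2)).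
  by split; [exact: Q0J|exists (phi, 0, delta)].
by rewrite Gamma_z => -[[p l] /= _ [<- <- <-]].
Qed.

Lemma Gamma0 phi : Gamma f Psi delta Q (phi, lam0 phi).
Proof.
rewrite Gamma_z; exists (phi, 0) => //; split=> //=; rewrite in_itv/=.
by case/andP: a10b1 => h1 h2; rewrite !ltW.
Qed.

Lemma zU phi : U (phi, lam0 phi). Proof. exact: Gamma_U (Gamma0 phi). Qed.

Lemma Ws_point phi : WsE_out f Psi delta (lam0 phi) (phi, 0, delta) /\ g phi (lam0 phi) = 0.
Proof.
have [_ [[[c s] u] [Wv [vcE vsE]]]] := Gamma0 phi; rewrite /= in vcE vsE Wv.
have [[uE _] _] := Wv; rewrite /vc /vs /vu/= in vcE vsE uE.
rewrite vcE vsE uE in Wv; split=> //.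
have : [set v | [/\ WsE_out f Psi delta (lam0 phi) v, `|vs v| < eps & U (vc v, lam0 phi)]] (phi, 0, delta).
  by split=> //; [rewrite /vs/= normr0|exact: zU].
by rewrite (Ws_graph (Q0 phi)) => -[p _ [-> ]].
Qed.

Let g_z phi : g phi (lam0 phi) = 0. Proof. by case: (Ws_point phi). Qed.

Lemma Ws_g lam c s : Q lam -> U (c, lam) -> `|s| < eps -> WsE_out f Psi delta lam (c, s, delta) -> s = g c lam.
Proof.
move=> ql Uc se W.
have : [set v | [/\ WsE_out f Psi delta lam v, `|vs v| < eps & U (vc v, lam)]] (c, s, delta) by split.
by rewrite (Ws_graph ql) => -[p _ [-> ]].
Qed.

Lemma Wu_unique lam v : Q lam -> WuE_in f Psi delta lam v ->
  exists k : int, v = (hc lam + 4 * pi * k%:~R, delta, hu lam).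
Proof. by move=> ql; rewrite (Wu_point ql) => -[k _ <-]; exists k. Qed.

Lemma Wu_self lam : Q lam -> WuE_in f Psi delta lam (hc lam, delta, hu lam).
Proof. by move=> ql; rewrite (Wu_point ql); exists 0 => //; rewrite mulr0z mulr0 addr0. Qed.

Lemma zc : exists2 Lz, 0 < Lz & forall phi phi', `|z phi 0 - z phi' 0| <= Lz * `|phi - phi'|.
Proof. by have [L L0 H] := z_lipschitz a10b1 z_smooth z_per; exists L. Qed.

Lemma lam0_dist phi phi' : `|lam0 phi - lam0 phi'| = `|z phi 0 - z phi' 0|.
Proof. by rewrite norm_pairB max_normBr. Qed.

(** Local statements are uniform, as the curve of all lam0 is closed. *)
Lemma uniform_phase (G : R -> R * R -> R -> Prop) :
  (forall phi r r', G phi (lam0 phi) r -> 0 < r' <= r -> G phi (lam0 phi) r') ->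
  (forall phi (k : int) r, G (phi + 4 * pi * k%:~R) (lam0 phi) r -> G phi (lam0 phi) r) ->
  (forall phi, exists2 r, 0 < r & forall phi', `|phi' - phi| < r -> `|lam0 phi' - lam0 phi| < r -> G phi' (lam0 phi') r) ->
  exists2 r, 0 < r & forall phi, G phi (lam0 phi) r.
Proof.
move=> anti shift loc; have p0 := @four_pi_gt0 R; have [Lz Lz0 HLz] := zc.
have [||r r0 H] := @compact_unif R R `[0, 4 * pi]%classic (fun phi r => G phi (lam0 phi) r) (@segment_compact R 0 (4 * pi)).
- exact: anti.
- move=> phi _; have [r r0 H] := loc phi; have L10 : 0 < Lz + 1 by rewrite addr_gt0.
  exists (Num.min r (r / (Lz + 1))); first by rewrite lt_min r0 divr_gt0.
  move=> phi' _; rewrite lt_min => /andP[h1 h2]; apply: (anti _ r).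
    apply: H => //; rewrite lam0_dist; apply: le_lt_trans (HLz _ _) _.
    by move: h2; rewrite ltr_pdivlMr// mulrC; apply: le_lt_trans; rewrite ler_wpM2r// lerDl.
  by rewrite lt_min r0 divr_gt0//= ge_min lexx.
exists r => // phi; have [k hk] := shift_period phi p0.
have E : phi + 4 * pi * (- k)%:~R = phi - 4 * pi * k%:~R by rewrite mulrNz mulrN.
apply: (shift _ (- k)); have := H (phi + 4 * pi * (- k)%:~R).
by rewrite (z_perz z_per); apply; rewrite /= in_itv/= E.
Qed.

Lemma tube : exists2 k, 0 < k & forall phi c lam, Q lam -> `|c - phi| < k -> `|lam - lam0 phi| < k -> U (c, lam).
Proof.
have [W oW UE] := U_open.
have [|||k k0 H] := @uniform_phase (fun phi mu k => forall c lam, Q lam -> `|c - phi| < k -> `|lam - mu| < k -> U (c, lam)).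
- move=> phi r r' H /andP[r'0 rr] c lam ql h1 h2.
  by apply: H => //; [exact: lt_le_trans h1 rr|exact: lt_le_trans h2 rr].
- move=> phi k r H c lam ql h1 h2; apply/(U_perz U_per c lam k); apply: H => //.
  by rewrite opprD addrACA subrr addr0.
- move=> phi; have : U (phi, lam0 phi) by exact: zU.
  rewrite UE => -[Op _]; have [r r0 Hr] := open_ball_sub oW Op.
  exists (r / 2); first by rewrite divr_gt0.
  move=> phi' h1 h2 c lam ql h3 h4; split=> //; apply: Hr.
  rewrite norm_pairB gt_max [r]splitr.
  apply/andP; split.
    exact: le_lt_trans (ler_distD _ _ _) (ltrD h3 h1).
  exact: le_lt_trans (ler_distD _ _ _) (ltrD h4 h2).
by exists k => // phi c lam; exact: H.
Qed.

Lemma g_cont c lam : U (c, lam) -> {for (c, lam), continuous (fun q => g q.1 q.2)}.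
Proof. by have [W [oW AW CW]] := g_smooth => /AW Wc; exact: (CW 0%N). Qed.

(** At lam0 the points of W^u(E) and W^s(E) in the sections lie on W^s(P) and
    W^u(P): there is a cycle, and I2 is maximal. *)
Lemma z_I2 phi : I2 (z phi 0).
Proof.
have [W0 _] := Ws_point phi.
have [w [Ow _ _ _]] := exit_orbit FB dR PsiP (Q0 phi) W0.
have W1 : WuE_in f Psi delta (lam0 phi) (hc (lam0 phi), delta, 0).
  by have := Wu_self (Q0 phi); have [-> _] := hu0 (zJ phi).
have [u [Ou _ _ _]] := entry_orbit FB dR PsiP (Q0 phi) W1.
by apply: I2max => //; exists u, w.
Qed.

Lemma converse_local r phi : 0 < r -> exists2 rho, 0 < rho & forall lam L sg kap c (k : int), Q lam ->
  `|lam - lam0 phi| < rho -> `|c - phi| < rho -> rho^-1 < L -> lift sg kap ->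
  hc lam + kap + 2 * L = c + 4 * pi * k%:~R -> reach sg kap L lam ->
  one_homoclinic f Psi delta P I2 r L lam.
Proof.
move=> r0; set mu : R * R := lam0 phi; have qmu : Q mu by exact: Q0.
have [W0 _] := Ws_point phi; rewrite -/mu in W0.
have [w [Ow wP wS Sw]] := exit_orbit FB dR PsiP qmu W0.
have W1 : WuE_in f Psi delta mu (hc mu, delta, 0).
  by have := Wu_self qmu; have [-> _] := hu0 (zJ phi).
have [u [Ou uP uS Su]] := entry_orbit FB dR PsiP qmu W1.
have [du uE _] := Ou; have [dw wE _] := Ow.
have du' (t : R) : is_derive t 1 u (f (u t) mu) by exact: du.
have dw' (t : R) : is_derive t 1 w (f (w t) mu) by exact: dw.
have [d d_gt0 Hd] := fb_away FB.
have [rs [F [Y [Qf [cs [C [KF [rs0 Fid SD]]]]]]]] := saddle_exists f_smooth f0 qmu (f_hyp qmu).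
have HU := unstable_side FB fL dR d_gt0 Hd qmu rs0 Fid SD (f0 qmu) du' uP uE uS Wu_unique.
have [kt kt0 Ht] := tube.
pose kap := Num.min kt eps; have kap0 : 0 < kap by rewrite lt_min kt0.
have [kk1 kk2] : kap <= kt /\ kap <= eps by min_le.
have gS lam c s : Q lam -> `|lam - mu| < kap -> `|c - phi| < kap -> `|s| < kap ->
    WsE_out f Psi delta lam (c, s, delta) -> s = g c lam.
  move=> ql h1 h2 h3; apply: Ws_g => //; last exact: lt_le_trans h3 kk2.
  by apply: (Ht phi) => //; [exact: lt_le_trans h2 kk1|exact: lt_le_trans h1 kk1].
have gcont e : 0 < e -> exists2 rho, 0 < rho & forall c lam, Q lam -> `|c - phi| < rho -> `|lam - mu| < rho -> `|g c lam| < e.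
  move=> e0; have [rho rho0 H] := (ctsP _ _).1 (g_cont (zU phi)) e e0.
  exists rho => // c lam ql h1 h2; have := H (c, lam); rewrite /= g_z subr0; apply.
  by rewrite norm_pairB gt_max h1.
have gcts c : `|c - phi| < kap -> {for c, continuous (fun c => g c mu)}.
  move=> h; have Uc : U (c, mu).
    by apply: (Ht phi) => //; [exact: lt_le_trans h kk1|rewrite subrr normr0].
  apply/ctsP => e e0; have [rho rho0 H] := (ctsP _ _).1 (g_cont Uc) e e0.
  exists rho => // c' hc'; apply: (H (c', mu)); by rewrite norm_pairB max_normBl.
have w0 : w 0 = Psi (phi, 0, delta) mu by rewrite wP// (bflow0 FB).
have HS := stable_side FB fL dR d_gt0 Hd qmu rs0 Fid SD (fun t _ => dw' t) w0 wE wS kap0 gS gcont gcts.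
have I2mu := z_I2 phi.
have [Lc Lc0 hcL] := hc_lipschitz hc_smooth.
have cyc : single_cycle f Psi delta P mu u w by [].
have [rho rho0 H] := reach_homoclinic_near FB fL dR qmu Lc0 hcL huB du' uP dw' wP cyc HU HS erefl I2mu r0.
exists (Num.min rho kt); first by rewrite lt_min rho0.
move=> lam L sg kp c k ql; rewrite !lt_min => /andP[l1 l2] /andP[c1 c2] rL lf ck [pu gE].
apply: (H lam L sg kp c k) => //.
  by apply: le_lt_trans rL; rewrite lef_pV2 ?posrE ?lt_min ?rho0// ge_min lexx.
by rewrite -gE ck (g_perz U_per g_per)//; exact: Ht c2 l2.
Qed.

Lemma converse_uniform r : 0 < r -> exists2 rho, 0 < rho & forall phi lam L sg kap, Q lam ->
  `|lam - lam0 phi| < rho -> `|hc lam + kap + 2 * L - phi| < rho -> rho^-1 < L -> lift sg kap ->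
  reach sg kap L lam -> one_homoclinic f Psi delta P I2 r L lam.
Proof.
move=> r0.
have [|||k k0 H] := @uniform_phase (fun phi mu rho => forall lam L sg kap c (k : int), Q lam ->
  `|lam - mu| < rho -> `|c - phi| < rho -> rho^-1 < L -> lift sg kap ->
  hc lam + kap + 2 * L = c + 4 * pi * k%:~R -> reach sg kap L lam ->
  one_homoclinic f Psi delta P I2 r L lam).
- move=> phi s s' H /andP[s'0 ss] lam L sg kap c k ql h1 h2 h3; apply: H => //.
  + exact: lt_le_trans h1 ss.
  + exact: lt_le_trans h2 ss.
  + by apply: le_lt_trans h3; rewrite lef_pV2 ?posrE// (lt_le_trans s'0).
- move=> phi k s H lam L sg kap c k' ql h1 h2 h3 lf ck.
  apply: (H lam L sg kap (c + 4 * pi * k%:~R) (k' - k)) => //.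
    by rewrite opprD addrACA subrr addr0.
  by rewrite ck mulrzBr mulrBr; ring.
- move=> phi; have [s s0 H] := converse_local phi r0.
  exists (s / 2); first by rewrite divr_gt0.
  move=> phi' h1 h2 lam L sg kap c k ql h3 h4 h5; apply: H => //.
  + by rewrite [s]splitr; apply: le_lt_trans (ler_distD _ _ _) (ltrD h3 h2).
  + by rewrite [s]splitr; apply: le_lt_trans (ler_distD _ _ _) (ltrD h4 h1).
  + apply: le_lt_trans h5; rewrite lef_pV2 ?posrE ?divr_gt0// ler_pdivrMr// ler_peMr ?ltW// ltr1n//.
exists k => // phi lam L sg kap ql h1 h2 h3 lf.
by apply: (H phi lam L sg kap (hc lam + kap + 2 * L) 0); rewrite // mulr0z mulr0 addr0.
Qed.

Variable ph : R -> R.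
Hypothesis phE : forall th phi, phi = hc (lam0 phi) + th <-> phi = ph th.

Lemma forward_uniform e : 0 < e -> exists2 rho, 0 < rho & forall r L lam, r <= rho -> rho^-1 < L ->
  Q lam -> one_homoclinic f Psi delta P I2 r L lam ->
  exists sg kap, [/\ lift sg kap, reach sg kap L lam & `|lam - lam0 (ph (kap + 2 * L))| < e].
Proof.
move=> e0; have [kt kt0 Ht] := tube.
have [Lc Lc0 hcL] := hc_lipschitz hc_smooth; have [Lz Lz0 zL] := zc.
pose B := 1 + Lz * (1 + Lc) / (1 - q).
have B0 : 0 < B.
  by rewrite addr_gt0// divr_gt0 ?subr_gt0// mulr_gt0// addr_gt0.
pose e1 := Num.min kt (e / 2 / B); have e10 : 0 < e1 by rewrite lt_min kt0 !divr_gt0.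
have [e1k e1B] : e1 <= kt /\ e1 <= e / 2 / B by min_le.
have [r1 r10 H1] := near_w_exit FB fL dR PsiP hc hu e10.
have [r2 r20 H2] := small_exp FB dR eps0.
pose rho := Num.min (Num.min r1 r2) (Num.min e1 1).
have e1m : 0 < Num.min e1 1 by rewrite lt_min e10 ltr01.
have rho0 : 0 < rho by rewrite lt_min e1m andbT lt_min r10.
have [m1 m2] : rho <= r1 /\ rho <= r2 by split; rewrite ge_min ge_min lexx ?orbT.
have [m3 m4] : rho <= e1 /\ rho <= 1 by split; rewrite ge_min; apply/orP; right; rewrite ge_min lexx ?orbT.
exists rho => // r L lam rr rL ql [x [dx [xm xp] [Si So] inb [mu2 [u [w [I2mu cyc lr close]]]]]].
have L1 : 1 < L by apply: le_lt_trans rL; rewrite -[leLHS]invr1 lef_pV2 ?posrE.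
have L0 : 0 < L by apply: lt_trans L1.
have r1L : r1^-1 < L by apply: le_lt_trans rL; rewrite lef_pV2 ?posrE.
have r2L : r2^-1 < L by apply: le_lt_trans rL; rewrite lef_pV2 ?posrE.
have hm : a2 <= mu2 <= b2 by have := I2J I2mu; rewrite /= in_itv.
have qmu := Q0J hm.
have [sg [kap [lf pu xV WV]]] := homoclinic_passage FB fL dR huB Wu_unique ql L0 dx xm xp Si So inb.
have tt : 0 <= 2 * L - 1 <= 2 * L.
  by rewrite gerBl ler01 andbT subr_ge0 (le_trans (ltW L1))// ler_peMl ?ltW// ltr1n.
have [y cy xy] := close (2 * L - 1); rewrite (xV _ tt) in xy.
have [c2 Wc c2E] := H1 lam (0, mu2) L sg kap u w y ql qmu r1L lf pu
  (lt_le_trans lr (le_trans rr m1)) cyc cy (lt_le_trans xy (le_trans rr m1)).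
have muE := GammaP hm Wc; rewrite muE in lr.
set V2 := bflow lam _ (2 * L) in WV.
have vcV : vc V2 = hc lam + kap + 2 * L by rewrite /V2 (bflow_vc FB).
have [_ vuV] := pu; rewrite -/V2 in vuV.
have sg1 := lift_norm lf.
have t2 : 0 <= 2 * L <= 2 * L by rewrite lexx andbT mulr_ge0// ltW.
have [sV _] := passage_bounds FB dR ql sg1 pu t2; rewrite -/V2 in sV.
have [_ sL] := H2 L r2L.
have sV' : `|vs V2| < eps.
  apply: le_lt_trans sV _; apply: le_lt_trans sL; apply: (exp_mono FB dR).
  by rewrite ler_peMl ?ltW// ltr1n.
have lr1 : `|lam - lam0 c2| < e1 by apply: lt_le_trans lr (le_trans rr m3).
have Uc : U (hc lam + kap + 2 * L, lam).
  apply: (Ht c2) => //; first by rewrite distrC; exact: lt_le_trans c2E e1k.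
  exact: lt_le_trans lr1 e1k.
have V2E : V2 = (hc lam + kap + 2 * L, vs V2, delta) by rewrite -vcV -vuV; case: (V2) => [[? ?] ?].
exists sg, kap; split=> //.
  by split=> //; rewrite -/V2; apply/esym/Ws_g => //; rewrite -V2E.
apply: le_lt_trans (_ : e1 * B < e).
  apply: (near_leading a10b1 zJ Lc0 hcL Lz0 zL q1 (hcz_contraction a10b1 z_smooth zJ hc_smooth hc_contr) phE (phi := c2)) => //.
  - exact: ltW.
  - exact: ltW.
  - by rewrite addrA distrC ltW.
apply: le_lt_trans (_ : e / 2 < e); first by rewrite -ler_pdivlMr.
by frac_lt.
Qed.

Lemma hu_slope_bounded : exists2 Mh, 0 < Mh & forall lam2, a2 <= lam2 <= b2 ->
  hu (0, lam2) = 0 /\ 0 < partial1 hu (0, lam2) <= Mh.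
Proof.
have [W [oW AW CW]] := hu_smooth.
have [|Mh Mh0 H] := @cts_bounded R R `[a2, b2]%classic (fun l => 'D_(1, 0) hu (0, l)) (@segment_compact _ _ _).
  move=> l; rewrite /= in_itv/= => hl.
  have cD : {for (0, l), continuous (fun x : R * R => 'D_(1, 0) hu x)}.
    by apply: ((CW 1%N).2 (1, 0)); apply: AW; exact: Q0J.
  apply/ctsP => e e0; have [r r0 Hr] := (ctsP _ _).1 cD e e0.
  by exists r => // l' ll; apply: (Hr (0, l')); rewrite norm_pairB max_normBr.
exists Mh => // l hl; have [h1 h2] := hu0 hl; split=> //; rewrite h2/= -[leLHS]gtr0_norm//.
by rewrite partial1E; apply: H; rewrite /= in_itv.
Qed.

Lemma ph_periodic th : ph (th + 4 * pi) = ph th + 4 * pi.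
Proof.
apply/esym/phE; have := z_perz z_per (ph th) 1; rewrite mulr1 => ->.
by have /phE E := erefl (ph th); rewrite {1}E; ring.
Qed.

(** With a(L) defined by the expansion of the first component, the error term of
    that expansion vanishes. *)
Lemma branch sg kap : lift sg kap -> exists rN L0 (p : R -> R * R),
  [/\ 0 < rN, 1 <= L0,
    forall L lam, L0 < L -> Q lam -> `|lam - lam0 (ph (kap + 2 * L))| <= rN ->
      (reach sg kap L lam <-> lam = p L),
    forall e, 0 < e -> exists L1, forall L, L1 < L -> `|p L - lam0 (ph (kap + 2 * L))| < e &
    forall L1, L0 <= L1 -> branch_expansion z hu alpu L1 (2 * beta) sg p].
Proof.
move=> lf; have sg1 := lift_norm lf.
have [rN rN0 ND] := newton_data_uniform a10b1 a2b2 U_open U_per g_smooth g_per zU g_z g_lam2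
  z_smooth z_per zJ hu_smooth hc_smooth hu0 q1 hc_contr.
have [Lc Lc0 hcL] := hc_lipschitz hc_smooth.
have [Mh Mh0 hu0'] := hu_slope_bounded.
have [L0 L01 H] := branch_point a10b1 a2b2 FB dR g_z zJ rN0 ND Lc0 hcL phE hu0' kap sg1.
pose C := 2 * delta * expR 1 / rN; rewrite -/C in H.
have C0 : 0 < C by rewrite divr_gt0// mulr_gt0 ?expR_gt0// mulr_gt0.
have [p Hp] : exists p : R -> R * R, forall L, L0 < L -> let phi := ph (kap + 2 * L) in
  [/\ `|p L - lam0 phi| <= C * expR (- (2 * beta) * L),
    forall lam, Q lam -> `|lam - lam0 phi| <= rN -> (reach sg kap L lam <-> lam = p L) &
    0 < sg * (p L).1 * partial1 hu (lam0 phi) * expR (2 * alpu (lam0 phi) * L) <=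
       2 / rN * delta * expR 2 * Mh].
  have h L : exists p, L0 < L -> let phi := ph (kap + 2 * L) in
  [/\ `|p - lam0 phi| <= C * expR (- (2 * beta) * L),
    forall lam, Q lam -> `|lam - lam0 phi| <= rN -> (reach sg kap L lam <-> lam = p) &
    0 < sg * p.1 * partial1 hu (lam0 phi) * expR (2 * alpu (lam0 phi) * L) <=
       2 / rN * delta * expR 2 * Mh].
    have [hL|hL] := ltP L0 L; first by have [p hp] := H L hL; exists p.
    by exists 0 => hL'; move: hL; rewrite leNgt hL'.
  by exists (fun L => sval (cid (h L))) => L; exact: svalP (cid (h L)).
have b20 : 0 < 2 * beta by rewrite mulr_gt0//; exact: fb_beta FB.
exists rN, L0, p; split=> //.
- by move=> L lam hL ql h; have [_ h1 _] := Hp L hL; exact: h1.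
- move=> e e0; have e20 : 0 < e / 2 by rewrite divr_gt0.
  have [L1 L11 HL] := exp_small (ltW C0) b20 e20.
  exists (Num.max L0 L1) => L; rewrite gt_max => /andP[h1 h2].
  have [h3 _ _] := Hp L h1; have [_ h4] := HL L h2.
  apply: le_lt_trans h3 _; apply: le_lt_trans h4 _; by frac_lt.
move=> L1 L0L1; pose phi L := ph (kap + 2 * L).
exists (fun L => phi L - 2 * L), (fun L => sg * (p L).1 * partial1 hu (lam0 (phi L)) * expR (2 * alpu (lam0 (phi L)) * L)),
  (fun=> 0), (fun L => (p L).2 - z (phi L) 0); split.
- move=> L; rewrite /phi (_ : kap + 2 * (L + 4 * pi) = kap + 2 * L + 4 * pi + 4 * pi); last by ring.
  by rewrite !ph_periodic; ring.
- exists (2 / rN * delta * expR 2 * Mh) => L hL.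
  by have [_ _ h] := Hp L (le_lt_trans L0L1 hL).
- split.
    exists 0; exists 0; split; first exact: num_real.
    by move=> L _; rewrite normr0 mul0r.
  exists C; exists L0; split; first exact: num_real.
  move=> L hL; have [h _ _] := Hp L hL; apply: le_trans h; exact: (norm_snd (p L - lam0 (phi L))).
- move=> L hL z0; have z0E : z0 = z (phi L) 0 by rewrite /z0 subrK.
  rewrite z0E; split; last by rewrite addrC subrK.
  have [_ hpos] := hu0 (zJ (phi L)).
  rewrite addr0 mulr1 (_ : -2 * alpu (0, z (phi L) 0) * L = - (2 * alpu (0, z (phi L) 0) * L)); last by ring.
  rewrite expRN; have sg2 : sg * sg = 1 by case: lf => -[-> _]; ring.
  have E0 := expR_gt0 (2 * alpu (0, z (phi L) 0) * L).
  set E := expR _ in E0 *; set h := partial1 _ _ in hpos *.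
  rewrite (_ : sg * _ = sg * sg * ((p L).1 * h * E)); last by ring.
  by rewrite sg2 mul1r; field; rewrite !gt_eqF.
Qed.

End Assembly.

(** * The two branches of homoclinic orbits *)

Theorem theorem4p1 (R : realType)
  (a1 b1 a2 b2 l2 u2 : R) (J1 J2 I2 : set R) (Q : set (R * R))
  (hJ1 : J1 = `[a1, b1]%classic) (hJ2 : J2 = `[a2, b2]%classic) (hQ : Q = J1 `*` J2)
  (h0Q : Q^° (0, 0))
  (f : 'rV[R]_3 -> R * R -> 'rV[R]_3)
  (hf : smooth_on ([set: 'rV[R]_3] `*` Q) (fun q => f q.1 q.2))
  (* (1) *)
  (hE : forall lam, Q lam -> hyperbolic_equilibrium (f ^~ lam) 0 1 2)
  (P : R -> R * R -> 'rV[R]_3)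
  (hP : forall lam, Q lam ->
     hyperbolic_periodic_orbit (f ^~ lam) (P ^~ lam) (2 * pi) 2 2)
  (hI2 : I2 = `[l2, u2]%classic) (hlu : l2 < u2) (hI2J2 : I2 `<` J2)
  (hcycle : forall lam2, I2 lam2 ->
     exists u w, EtoP_cycle (f ^~ (0, lam2)) (P ^~ (0, lam2)) u w)
  (hmax : forall lam2, (J2 `\` I2) lam2 ->
     ~ exists u w, EtoP_cycle (f ^~ (0, lam2)) (P ^~ (0, lam2)) u w)
  (* (2) *)
  (hneg : forall lam s, Q lam ->
     nontrivial_multipliers (f ^~ lam) (P ^~ lam) (2 * pi) s ->
     all (fun mu => mu < 0) s)
  (* the fixed coordinates near P *)
  (rho : R) (Psi : R * R * R -> R * R -> 'rV[R]_3)
  (alps alpu : R * R -> R) (Fs Fu : R * R * R -> R * R -> R)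
  (hPsi : floquet_coordinates Q f P rho Psi alps alpu Fs Fu) :
  exists2 delta0 : R, 0 < delta0 <= rho &
  forall delta : R, 0 < delta <= delta0 ->
  (* (3) *)
  forall (U : set (R * (R * R))) (g : R -> R * R -> R) (eps : R),
  (exists2 O, open O & U = O `&` (setT `*` Q)) ->
  (forall phi lam, U (phi + 4 * pi, lam) <-> U (phi, lam)) ->
  Gamma f Psi delta Q `<=` U ->
  smooth_on U (fun q => g q.1 q.2) ->
  (forall phi lam, U (phi, lam) ->
     `|g phi lam| <= delta /\ g (phi + 4 * pi) lam = g phi lam) ->
  0 < eps ->
  (forall lam, Q lam ->
     [set v | [/\ WsE_out f Psi delta lam v, `|vs v| < eps & U (vc v, lam)]] =
     [set (phi, g phi lam, delta) | phi in [set phi | U (phi, lam)]]) ->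
  (* (4) *)
  forall (b : R) (z : R -> R -> R),
  0 < b ->
  (forall phi lam, U (phi, lam) -> b <= `|partial2 (g phi) lam|) ->
  smooth_on ([set: R] `*` J1) (fun q => z q.1 q.2) ->
  (forall phi lam1, J1 lam1 ->
     J2 (z phi lam1) /\ z (phi + 4 * pi) lam1 = z phi lam1) ->
  Gamma f Psi delta Q =
    [set (q.1, (q.2, z q.1 q.2)) | q in setT `*` J1] ->
  (* (5) *)
  (forall phi, derive1 (z ^~ 0) phi = 0 -> derive1n 2 (z ^~ 0) phi != 0) ->
  (* (6) *)
  forall (hu hc : R * R -> R) (q : R),
  smooth_on Q hu ->
  smooth_on Q hc ->
  (forall lam, Q lam -> `|hu lam| <= delta) ->
  (forall lam, Q lam ->
     WuE_in f Psi delta lam =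
     [set (hc lam + 4 * pi * k%:~R, delta, hu lam) | k in [set: int]]) ->
  (forall lam2, J2 lam2 -> hu (0, lam2) = 0 /\ 0 < partial1 hu (0, lam2)) ->
  q < 1 ->
  (forall phi, `|derive1 (fun phi => hc (0, z phi 0)) phi| <= q) ->
  (* conclusion *)
  exists2 r0 : R, 0 < r0 & forall r : R, 0 < r <= r0 ->
  exists (L0 : R) (lamp lamm : R -> R * R),
    [/\ 0 < L0,
        forall L, L0 < L -> forall lam, Q lam ->
          (one_homoclinic f Psi delta P I2 r L lam <->
             lam = lamp L \/ lam = lamm L),
        (I2 `<=` `]a2, b2[%classic ->
           forall L, L0 < L -> Q (lamp L) /\ Q (lamm L)) &
        exists2 eta : R, 0 < eta &
          branch_expansion z hu alpu L0 eta 1 lamp /\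
          branch_expansion z hu alpu L0 eta (-1) lamm].

Proof.
subst J1 J2 Q I2.
have f0 lam : (`[a1, b1] `*` `[a2, b2] : set (R * R)) lam -> f 0 lam = 0 by move=> /hE[].
have [a10b1 a20b2] : a1 < 0 < b1 /\ a2 < 0 < b2.
  have /nbhs_ballP[e /= e0 B] := h0Q.
  have in_Q (x y : R) : `|x| < e -> `|y| < e -> (`[a1, b1] `*` `[a2, b2] : set (R * R)) (x, y).
    move=> hx hy; apply: B; rewrite -ball_normE/= distrC norm_pairB !subr0.
    by rewrite gt_max hx.
  have e2 : `|e / 2| < e by rewrite gtr0_norm ?divr_gt0// ltr_pdivrMr// ltr_pMr// ltr1n.
  have e2n : `|- (e / 2)| < e by rewrite normrN.
  have [/andP[_ h1] /andP[_ h2]] := (QP _ _ _ _ _).1 (in_Q _ _ e2 e2).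
  have [/andP[h3 _] /andP[h4 _]] := (QP _ _ _ _ _).1 (in_Q _ _ e2n e2n).
  rewrite /= in h1 h2 h3 h4; have e20 : 0 < e / 2 by rewrite divr_gt0.
  have ne20 : - (e / 2) < 0 by rewrite oppr_lt0.
  by rewrite !(le_lt_trans _ ne20)// !(lt_le_trans e20).
have a2b2 : a2 < b2 by case/andP: a20b2; exact: lt_trans.
have [R0 [beta [K [R0rho FB]]]] := flow_box_exists f0 hPsi.
have R00 := fb_R0 FB; have beta0 := fb_beta FB.
have PsiP lam c : (`[a1, b1] `*` `[a2, b2] : set (R * R)) lam -> Psi (c, 0, 0) lam = P c lam.
  by move=> ql; exact: (fc_P hPsi c ql).
exists (R0 / 8).
  by rewrite divr_gt0//=; apply: le_trans R0rho; rewrite ler_pdivrMr// ler_peMr ?ltW// ltr1n.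
move=> delta dR U g eps U_open U_per Gamma_U g_smooth gU eps0 Ws_graph b z b0 g_lam2 z_smooth zJ Gamma_z _.
move=> hu hc q hu_smooth hc_smooth huB Wu_point hu0 q1 hc_contr.
have g_per phi lam : U (phi, lam) -> g (phi + 4 * pi) lam = g phi lam by move=> /gU[].
have z0 : (`[a1, b1]%classic : set R) 0 by rewrite /= in_itv/=; case/andP: a10b1 => h1 h2; rewrite !ltW.
have z_per phi : z (phi + 4 * pi) 0 = z phi 0 by case: (zJ phi 0 z0).
have zJ2 phi : a2 <= z phi 0 <= b2 by have [h _] := zJ phi 0 z0; rewrite /= in_itv in h.
have g_lam2' phi lam : U (phi, lam) -> partial2 (g phi) lam != 0.
  by move=> /g_lam2 h; rewrite -normr_gt0; exact: lt_le_trans h.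
have hu0' lam2 : a2 <= lam2 <= b2 -> hu (0, lam2) = 0 /\ 0 < partial1 hu (0, lam2).
  by move=> h; apply: hu0; rewrite /= in_itv.
have I2J : (`[l2, u2]%classic : set R) `<=` `[a2, b2] by case: hI2J2.
have I2max mu2 : a2 <= mu2 <= b2 ->
    (exists u w, EtoP_cycle (f ^~ (0, mu2)) (P ^~ (0, mu2)) u w) -> (`[l2, u2]%classic : set R) mu2.
  by move=> h c; apply: contrapT => n; apply: (hmax mu2) => //; split.
have [ph phE] := phase_exists a10b1 z_smooth zJ2 hc_smooth q1 hc_contr.
have lfp : lift (1 : R) 0 by left.
have lfm : lift (-1 : R) (2 * pi) by right.
have Br := branch a10b1 a2b2 FB dR U_open U_per Gamma_U g_smooth g_per eps0 Ws_graph g_lam2' z_smooth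
  z_per zJ2 Gamma_z hu_smooth hc_smooth hu0' q1 hc_contr phE.
have [rp [Lp [lamp [rp0 Lp1 lampP lampC lampE]]]] := Br _ _ lfp.
have [rm [Lm [lamm [rm0 Lm1 lammP lammC lammE]]]] := Br _ _ lfm.
pose rN := Num.min rp rm; have rN0 : 0 < rN by rewrite lt_min rp0.
have [rNp rNm] : rN <= rp /\ rN <= rm by split; rewrite ge_min lexx ?orbT.
have [rf rf0 Hf] := forward_uniform a10b1 hf PsiP FB dR U_open U_per Gamma_U eps0 Ws_graph z_smooth
  z_per zJ2 Gamma_z hc_smooth huB Wu_point q1 hc_contr I2J phE rN0.
exists rf => // r /andP[r0 rrf].
have [rc rc0 Hc] := converse_uniform a10b1 hf hE PsiP FB dR U_open U_per Gamma_U g_smooth g_per eps0 Ws_graph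
  z_smooth z_per zJ2 Gamma_z hc_smooth huB Wu_point hu0' I2max r0.
have zI phi : l2 <= z phi 0 <= u2.
  by have := z_I2 a10b1 PsiP FB dR Gamma_U eps0 Ws_graph zJ2 Gamma_z Wu_point hu0' I2max phi; rewrite /= in_itv.
have [Lc Lc0 hcL] := hc_lipschitz hc_smooth.
have Lc10 : 0 < Lc + 1 by rewrite addr_gt0.
(* m1, and m2 if I2 is inside J2, bound the distances of all lam0 to the sides of Q *)
pose m2 := Num.min (if a2 < l2 then l2 - a2 else 1) (if u2 < b2 then b2 - u2 else 1).
have m20 : 0 < m2.
  by rewrite /m2 lt_min; apply/andP; split; case: ifP => // h; rewrite subr_gt0.
pose m1 := Num.min (- a1) b1.
have m10 : 0 < m1 by rewrite lt_min oppr_gt0.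
pose e1 := Num.min (Num.min rN (rc / (Lc + 1))) (Num.min m1 m2).
have ra : 0 < Num.min rN (rc / (Lc + 1)) by rewrite lt_min rN0 divr_gt0.
have e10 : 0 < e1 by rewrite lt_min ra lt_min m10.
have e1a : e1 <= Num.min rN (rc / (Lc + 1)) by rewrite ge_min lexx.
have e1m : e1 <= Num.min m1 m2 by rewrite ge_min lexx orbT.
have e1N : e1 <= rN by apply: le_trans e1a _; rewrite ge_min lexx.
have e1c : e1 <= rc / (Lc + 1) by apply: le_trans e1a _; rewrite ge_min lexx orbT.
have e1m1 : e1 <= m1 by apply: le_trans e1m _; rewrite ge_min lexx.
have e1m2 : e1 <= m2 by apply: le_trans e1m _; rewrite ge_min lexx orbT.
have [L1 HL1] := lampC e1 e10; have [L2 HL2] := lammC e1 e10.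
pose L0 := Num.max (Num.max (Num.max Lp Lm) (Num.max L1 L2)) (Num.max rf^-1 rc^-1).
have LL L : L0 < L -> [/\ Lp < L, Lm < L & L1 < L] /\ [/\ L2 < L, rf^-1 < L & rc^-1 < L].
  by rewrite !gt_max => /andP[/andP[/andP[-> ->] /andP[-> ->]] /andP[-> ->]].
have L0p : Lp <= L0 by rewrite !le_max lexx.
have L0m : Lm <= L0 by rewrite !le_max lexx !orbT.
have conv sg kap L lam : lift sg kap -> (`[a1, b1] `*` `[a2, b2] : set (R * R)) lam -> rc^-1 < L ->
    `|lam - (0, z (ph (kap + 2 * L)) 0)| < e1 ->
    reach alps alpu Fs Fu R0 delta g hu hc sg kap L lam ->
    one_homoclinic f Psi delta P `[l2, u2]%classic r L lam.
  move=> lf ql rL near; apply: (Hc (ph (kap + 2 * L))) => //.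
    apply: lt_le_trans near (le_trans e1c _).
    by rewrite ler_pdivrMr// ler_peMr ?ltW// ltrDr.
  have E := (phE (kap + 2 * L) (ph (kap + 2 * L))).2 erefl.
  set x := hc (0, _) in E; have -> : hc lam + kap + 2 * L - ph (kap + 2 * L) = hc lam - x by rewrite E; ring.
  apply: le_lt_trans (hcL _ _ ql (lam0Q a10b1 zJ2 _)) _.
  have : `|lam - (0, z (ph (kap + 2 * L)) 0)| < rc / (Lc + 1) by exact: lt_le_trans near e1c.
  by rewrite ltr_pdivlMr// mulrC; apply: le_lt_trans; rewrite ler_wpM2r// lerDl.
have inQ (p : R * R) phi : `[l2, u2]%classic `<=` `]a2, b2[%classic -> `|p - (0, z phi 0)| < e1 ->
    (`[a1, b1] `*` `[a2, b2] : set (R * R)) p.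
  move=> I2i pz; have [a2l u2b] : a2 < l2 /\ u2 < b2.
    have := I2i l2; have := I2i u2; rewrite /= !in_itv/= !lexx (ltW hlu).
    by move=> /(_ isT)/andP[_ h1] /(_ isT)/andP[h2 _].
  have p1 : `|p.1 - 0| < e1 by apply: le_lt_trans pz; exact: (norm_fst (p - (0, z phi 0))).
  have p2 : `|p.2 - z phi 0| < e1 by apply: le_lt_trans pz; exact: (norm_snd (p - (0, z phi 0))).
  have [n1 n2] : m1 <= - a1 /\ m1 <= b1 by rewrite !ge_min !lexx ?orbT.
  have [n3 n4] : m2 <= l2 - a2 /\ m2 <= b2 - u2.
    by rewrite /m2 a2l u2b !ge_min !lexx ?orbT.
  have /andP[z1 z2] := zI phi.
  move: p1 p2 => /ltr_normlP[p1 p1'] /ltr_normlP[p2 p2'].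
  clear - p1 p1' p2 p2' n1 n2 n3 n4 z1 z2 e1m1 e1m2.
  by apply/QP; split; apply/andP; split; lra.
exists L0, lamp, lamm; split.
- by apply: lt_le_trans L0p; apply: lt_le_trans Lp1.
- move=> L /LL[[h1 h2 h3] [h4 h5 h6]] lam ql; split.
    move=> /(Hf r L lam rrf h5 ql)[sg [kap [[[-> ->]|[-> ->]] hr hn]]].
      by left; apply/(lampP L lam h1 ql) => //; apply: le_trans (ltW hn) rNp.
    by right; apply/(lammP L lam h2 ql) => //; apply: le_trans (ltW hn) rNm.
  case=> E; subst lam.
    have near := HL1 L h3; apply: (conv 1 0) => //.
    by apply/(lampP L _ h1 ql) => //; exact: ltW (lt_le_trans near (le_trans e1N rNp)).
  have near := HL2 L h4; apply: (conv (-1) (2 * pi)) => //.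
  by apply/(lammP L _ h2 ql) => //; exact: ltW (lt_le_trans near (le_trans e1N rNm)).
- move=> I2i L /LL[[h1 h2 h3] [h4 h5 h6]]; split.
    exact: inQ I2i (HL1 L h3).
  exact: inQ I2i (HL2 L h4).
- exists (2 * beta); first by rewrite mulr_gt0.
  by split; [exact: lampE|exact: lammE].
Qed.
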